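(* Let $1\le q<\infty$, $r\ge1$, let $(\Omega,\mu)$ be a measure space, $n\ge1$, and let $X_1,\dots,X_n,Y_1,\dots,Y_n$ be independent random variables, each with density $g(x)=C(r)\exp(-|x|^r)$, where $C(r)$ is the normalizing constant. Let $(a_{ij})_{i,j\le n}$ be an $L_q(\Omega,\mu)$-valued matrix. Then for every $p\ge1$, \begin{align*} \Big\|\sum_{i,j}a_{ij}X_iY_j\Big\|_p\sim^{q}\ &\mathbb{E}\Big\|\sum_{i,j}a_{ij}X_iY_j\Big\|_{L_q}+\sup_{x\in B^X_p}\mathbb{E}\Big\|\sum_{i,j}a_{ij}x_iY_j\Big\|_{L_q}+\sup_{y\in B^Y_p}\mathbb{E}\Big\|\sum_{i,j}a_{ij}X_iy_j\Big\|_{L_q}\\ &+\sup_{f\in B^*(L_q)}\Big\|\Big(\sqrt{\textstyle\sum_jf(a_{ij})^2}\Big)_i\Big\|_{X,p}+\sup_{f\in B^*(L_q)}\big\|(f(a_{ij}))_{ij}\big\|_{X,Y,p}, \end{align*} where $a\sim^q b$ means $C(q)^{-1}a\le b\le C(q)a$ with $C(q)$ depending only on $q$ (in particular not on $r$), and $\|Z\|_p=(\mathbb{E}\|Z\|_{L_q}^p)^{1/p}$.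
   Context: Set $N^X_i(t)=-\ln\mathbb{P}(|X_i|\ge t)$, $M^Y_j(t)=-\ln\mathbb{P}(|Y_j|\ge t)$, $\hat N^X_i(t)=t^2$ for $|t|\le1$ and $\hat N^X_i(t)=N^X_i(|t|)$ for $|t|>1$, and $\hat M^Y_j$ analogously. $B^X_p=\{x\in\mathbb{R}^n:\sum_i\hat N^X_i(x_i)\le p\}$, $B^Y_p=\{y\in\mathbb{R}^n:\sum_j\hat M^Y_j(y_j)\le p\}$. For real $(b_i)$, $\|(b_i)\|_{X,p}=\sup_{x\in B^X_p}\sum_ib_ix_i$; for a real matrix, $\|(b_{ij})\|_{X,Y,p}=\sup\{\sum_{ij}b_{ij}x_iy_j:x\in B^X_p,y\in B^Y_p\}$. $B^*(L_q)$ is the unit ball of the dual of $L_q(\Omega,\mu)$. *)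

(* Defs.v *)
From HB Require Import structures.
From mathcomp Require Import all_boot all_order all_algebra.
From mathcomp Require Import all_classical all_reals all_analysis.
Set Implicit Arguments. Unset Strict Implicit. Unset Printing Implicit Defensive.
Import Order.TTheory GRing.Theory Num.Theory.
Import numFieldNormedType.Exports.
Local Open Scope classical_set_scope.
Local Open Scope ring_scope.

Section Defs.
Context {R : realType}.

Definition mutually_independent {d} {W : measurableType d} (P : probability W R)
  (I : finType) (Z : I -> W -> R) : Prop :=
  forall A : I -> set R, (forall i, measurable (A i)) ->
    P (\bigcap_(i in [set: I]) (Z i @^-1` A i)) = (\prod_(i : I) P (Z i @^-1` A i))%E.

Definition tailN {d} {W : measurableType d} (P : probability W R) (Z : W -> R) (t : R) : R :=
  - ln (fine (P [set w | t <= `|Z w|])).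

Definition hatN {d} {W : measurableType d} (P : probability W R) (Z : W -> R) (t : R) : R :=
  if `|t| <= 1 then t ^+ 2 else tailN P Z `|t|.

Definition Bp {d} {W : measurableType d} (P : probability W R) (n : nat)
  (Z : 'I_n -> W -> R) (p : R) : set ('I_n -> R) :=
  [set x | \sum_(i < n) hatN P (Z i) (x i) <= p].

Definition vnorm {d} {W : measurableType d} (P : probability W R) (n : nat)
  (Z : 'I_n -> W -> R) (p : R) (b : 'I_n -> R) : \bar R :=
  ereal_sup [set (\sum_(i < n) b i * x i)%:E | x in Bp P Z p].

Definition mnorm {d} {W : measurableType d} (P : probability W R) (n : nat)
  (X Y : 'I_n -> W -> R) (p : R) (b : 'I_n -> 'I_n -> R) : \bar R :=
  ereal_sup [set (\sum_(i < n) \sum_(j < n) b i j * xy.1 i * xy.2 j)%:E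
            | xy in [set xy : ('I_n -> R) * ('I_n -> R) | Bp P X p xy.1 /\ Bp P Y p xy.2]].

Definition inLq {d} {T : measurableType d} (mu : {measure set T -> \bar R}) (q : R)
  (g : T -> R) : Prop :=
  measurable_fun setT g /\ (Lnorm mu q%:E (fun t => (g t)%:E) < +oo)%E.

Definition dual_ball {d} {T : measurableType d} (mu : {measure set T -> \bar R}) (q : R)
  : set ((T -> R) -> R) :=
  [set f | (forall g h, inLq mu q g -> inLq mu q h -> f (g \+ h) = f g + f h)
        /\ (forall (c : R) g, inLq mu q g -> f (fun t => c * g t) = c * f g)
        /\ (forall g, inLq mu q g -> (`|f g|%:E <= Lnorm mu q%:E (fun t => (g t)%:E))%E)].
End Defs.

(* Main.v *)
Require Import Defs.
From HB Require Import structures.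
From mathcomp Require Import all_boot all_order all_algebra.
From mathcomp Require Import all_classical all_reals all_analysis.
From mathcomp Require Import measurable_realfun ring lra.
Set Implicit Arguments. Unset Strict Implicit. Unset Printing Implicit Defensive.
Import Order.TTheory GRing.Theory Num.Theory.
Import numFieldNormedType.Exports.
Local Open Scope classical_set_scope.
Local Open Scope ring_scope.

(* Write M(x,y) for the L_q norm of sum a_ij x_i y_j.  By duality M(x,y) is the
   maximum of the bilinear forms with matrices (f(a_ij)), f in the dual ball; L_q
   enters only through this fact and through a comparison of the means of
   M(x,.) under the Laplace law and under the given law, both being of the order
   of the norm of the square function.

   Upper bound.  The density satisfies a Prekopa-Leindler inequality whose cost is
   a function of the logits of the distribution functions.  It tensorizes, and
   gives E exp(h/128) <= exp(p + E h/128) for a sublinear h that is at most p on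
   the ball of the cost equal to t^2 for |t| <= 1 and to |t|^r beyond.  Given X, this reduces the
   p-th moment of M(X,Y) to those of E_Y M(X,Y), to which the same inequality
   applies, and of the supremum of M(X,y) over the ball.  The latter is handled by
   a smoothing argument: the point y is replaced by y + Z for a Laplace vector Z
   conditioned to a symmetric set where everything is of the typical size, at the
   price of a factor exp(Cp), and the supremum over y becomes an integral over Z.

   Lower bound.  The law can be tilted coordinatewise by a density with mean
   proportional to x and with second moment at most exp(2p) when x is in the ball;
   by convexity N(x) is at most C times the mean of N under the tilted law, hence
   at most C ||N||_p, for the sublinear N at hand. *)

(** * Product laws *)

(** Two obstacles shape the argument. The constants may not depend on [r]: every tail estimate is
    reduced to the superadditivity of [t^r] and to the bounds 1/4 and 2 for the normalizing
    constant, and every moment is compared with the Laplace law, whose density dominates all the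
    others up to a factor. And the supremum over y sits inside the p-th moment in X. The Laplace law
    is the smoothing law because a translation by y changes its density by the factor exp(|z| - |z +
    y|), whose exponent, averaged over z and - z, costs only the part of |y| exceeding |z|; the mean
    of this part is at most the cost of y, for all [r] at once. The price is that the mean of sup_x
    f(x,Z), with Z a Laplace vector, has to be bounded, and it is not one of the five terms. It is
    recovered from the two terms containing f, with a threshold at r = 4/3: above it, the conjugate
    of the cost grows at most like a fourth power, and fourth moments suffice; below it, testing the
    last term on a single row shows that all rows are short. One third of the ball of the cost lies
    in the ball of the theorem. *)

Section density.
Context {R : realType}.
Notation leb := (@lebesgue_measure R).
Notation RR := (measurableTypeR R).
Local Open Scope ereal_scope.

(** [m] is absolutely continuous, and its Radon-Nikodym derivative has the same integrals as [g]
    over all measurable sets. The two agree almost everywhere, so [g] may replace it in the change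
    of variables. *)
Lemma ge0_integral_density (m : probability RR R) (g : R -> R) :
  measurable_fun setT g -> (forall x, 0 <= g x)%R ->
  (forall A, measurable A -> m A = \int[leb]_(x in A) (g x)%:E) ->
  forall F : RR -> \bar R, measurable_fun setT F -> (forall x, 0 <= F x) ->
  \int[m]_x F x = \int[leb]_x (F x * (g x)%:E).
Proof.
move=> mg g0 mE F mF F0.
have ac : m `<< leb.
  apply/null_content_dominatesP => A mA A0.
  by rewrite mE//; apply: null_set_integral => //; exact/measurable_EFinP/measurable_funTS.
rewrite -(Radon_Nikodym_SigmaFinite.change_of_variables ac F0 measurableT mF).
have mf : measurable_fun setT (Radon_Nikodym_SigmaFinite.f m leb).
  exact: measurable_int (Radon_Nikodym_SigmaFinite.f_integrable ac).
have mEg : measurable_fun setT (EFin \o g) by exact/measurable_EFinP.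
have E : ae_eq leb setT (Radon_Nikodym_SigmaFinite.f m leb) (EFin \o g).
  apply: integral_ae_eq => //.
    exact: Radon_Nikodym_SigmaFinite.f_integrable.
  move=> A _ mA; exact: etrans (esym (Radon_Nikodym_SigmaFinite.f_integral ac mA)) (mE _ mA).
apply: ge0_ae_eq_integral => //.
- exact: emeasurable_funM.
- exact: emeasurable_funM.
- by move=> x _; rewrite mule_ge0// Radon_Nikodym_SigmaFinite.f_ge0.
- by move=> x _; rewrite mule_ge0// lee_fin.
- by apply: filterS E => x /= H _; rewrite H.
Qed.

Definition density_measure (g : R -> R) (A : set RR) : \bar R :=
  \int[leb]_(x in A) (g x)%:E.

Section density_probability.
Variable g : R -> R.
Hypotheses (mg : measurable_fun setT g) (g0 : forall x, (0 <= g x)%R).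
Hypothesis g1 : \int[leb]_x (g x)%:E = 1.
Local Notation nu := (density_measure g).

Let nu0 : nu set0 = 0.
Proof. by rewrite /density_measure integral_set0. Qed.

Let nu_ge0 A : 0 <= nu A.
Proof. by apply: integral_ge0 => x _; rewrite lee_fin. Qed.

Let nu_sigma_additive : semi_sigma_additive nu.
Proof.
move=> /= F mF tF mUF; rewrite /density_measure; apply: cvg_toP.
  apply: ereal_nondecreasing_is_cvgn => k n kn.
  by apply: lee_sum_nneg_natr => // ? _ _; exact: nu_ge0.
rewrite ge0_integral_bigcup//=.
- by apply/measurable_EFinP/measurable_funTS.
- by move=> x _; rewrite lee_fin.
Qed.

HB.instance Definition _ := isMeasure.Build _ _ _ nu nu0 nu_ge0 nu_sigma_additive.
HB.instance Definition _ := Measure_isProbability.Build _ _ _ nu g1.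

Definition density_probability : probability RR R := nu.

End density_probability.
End density.

Section product_law.
Context {R : realType} {d} {T : measurableType d}.
Local Open Scope ereal_scope.

Definition tcons n (t : T) (x : n.-tuple T) : n.+1.-tuple T := [tuple of t :: x].

Lemma tnth_tcons0 n t (x : n.-tuple T) : tnth (tcons t x) ord0 = t.
Proof. by []. Qed.

Lemma tnth_tconsS n t (x : n.-tuple T) i : tnth (tcons t x) (lift ord0 i) = tnth x i.
Proof. by rewrite tnthS. Qed.

Definition tconsp n (tx : T * n.-tuple T) : n.+1.-tuple T := tcons tx.1 tx.2.

Lemma measurable_tcons n : measurable_fun setT (@tconsp n).
Proof. exact: measurable_cons. Qed.

HB.instance Definition _ n := isMeasurableFun.Build _ _ _ _ _ (@measurable_tcons n).

(** Built by adjoining one coordinate at the head, so that a statement about [n] variables follows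
    by induction through [integral_prodPS]; the empty product is the point mass at the empty
    tuple. *)
Fixpoint prodP (mu : probability T R) n : probability (n.-tuple T) R :=
  match n with
  | 0 => \d_[tuple]
  | k.+1 => distribution (mu \x prodP mu k) (@tconsp k)
  end.

Lemma integral_prodP0 (mu : probability T R) (F : 0.-tuple T -> \bar R) :
  \int[prodP mu 0]_x F x = F [tuple].
Proof.
rewrite integral_dirac//; first by rewrite diracT mul1e.
move=> _ Y mY; rewrite setTI.
have [H|H] := pselect (Y (F [tuple])).
  by rewrite (_ : _ @^-1` _ = setT)//; apply/seteqP; split=> // x _ /=; rewrite tuple0.
by rewrite (_ : _ @^-1` _ = set0)//; apply/seteqP; split=> // x /=; rewrite tuple0.
Qed.

Lemma integral_prodPS (mu : probability T R) n (F : n.+1.-tuple T -> \bar R) :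
  measurable_fun setT F -> (forall x, 0 <= F x) ->
  \int[prodP mu n.+1]_x F x = \int[mu]_t \int[prodP mu n]_x F (tcons t x).
Proof.
move=> mF F0; rewrite /= ge0_integral_distribution//.
rewrite fubini_tonelli1//=.
by apply: measurableT_comp => //; exact: measurable_tcons.
Qed.

Lemma measurable_tcons_l n (F : n.+1.-tuple T -> \bar R) t :
  measurable_fun setT F -> measurable_fun setT (fun x => F (tcons t x)).
Proof. by move=> mF; apply: measurableT_comp => //; exact: measurable_cons. Qed.

Lemma measurable_integral_tcons (mu : probability T R) n (F : n.+1.-tuple T -> \bar R) :
  measurable_fun setT F -> (forall x, 0 <= F x) ->
  measurable_fun setT (fun t => \int[prodP mu n]_x F (tcons t x)).
Proof.
move=> mF F0.
apply: (@measurable_fun_fubini_tonelli_F _ _ _ _ _ (prodP mu n)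
  (fun tx : T * n.-tuple T => F (tcons tx.1 tx.2))) => //.
by apply: measurableT_comp => //; exact: measurable_tcons.
Qed.

Definition tbox n (A : 'I_n -> set T) : set (n.-tuple T) :=
  [set x | forall i, A i (tnth x i)].

Lemma measurable_tbox n (A : 'I_n -> set T) :
  (forall i, measurable (A i)) -> measurable (tbox A).
Proof.
move=> mA; rewrite (_ : tbox A = \bigcap_(i in [set: 'I_n]) ((@tnth n T)^~ i @^-1` A i)); last first.
  by apply/seteqP; split=> x /= H i; [move=> _; exact: H|exact: H].
apply: fin_bigcap_measurable => [|i _]; first exact: finite_finset.
by rewrite -[X in measurable X]setTI; exact: measurable_tnth.
Qed.

Lemma prodP_tbox (mu : probability T R) n (A : 'I_n -> set T) :
  (forall i, measurable (A i)) -> prodP mu n (tbox A) = \prod_(i < n) mu (A i).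
Proof.
elim: n A => [|n IH] A mA.
  rewrite big_ord0 (_ : tbox A = setT) ?probability_setT//.
  by apply/seteqP; split=> // x _ [].
rewrite big_ord_recl -IH; last by [].
rewrite /= /distribution /pushforward /=.
rewrite (_ : _ @^-1` _ = A ord0 `*` tbox (fun i => A (lift ord0 i))).
  by rewrite [LHS]product_measure1E //; exact: measurable_tbox.
apply/seteqP; split => -[t x]/= => [H|[H1 H2] i].
  split; first exact: (H ord0).
  by move=> i; have := H (lift ord0 i); rewrite tnth_tconsS.
by case: (unliftP ord0 i) => [j ->|->//]; rewrite tnth_tconsS; exact: H2.
Qed.

(** Boxes are stable under intersection and generate the sigma-algebra of tuples, so the uniqueness
    of finite measures on a pi-system applies. *)
Lemma measure_tbox_unique n (m1 m2 : {measure set (n.-tuple T) -> \bar R}) :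
  m1 setT < +oo ->
  (forall A : 'I_n -> set T, (forall i, measurable (A i)) -> m1 (tbox A) = m2 (tbox A)) ->
  forall A, measurable A -> m1 A = m2 A.
Proof.
move=> m1oo m12 A mA.
pose G := [set B : set (n.-tuple T) | exists2 A : 'I_n -> set T, (forall i, measurable (A i)) & B = tbox A].
have tboxT : tbox (fun=> setT) = [set: n.-tuple T] by apply/seteqP; split.
apply: (measure_unique G (fun=> setT)) => //.
- apply/seteqP; split.
    apply: smallest_sub; first exact: smallest_sigma_algebra.
    (* [inord] needs a nonempty ordinal type, so the case of no coordinate is separated: the union
       of the generators is then empty. *)
    move=> B; case: n {m1 m2 m1oo m12 A mA tboxT} @G B => [|n] G B.
      by rewrite big_ord0.
    rewrite -bigcup_mkord_ord => -[i Ii [C mC <-]].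
    apply: sub_sigma_algebra.
    exists (fun j => if j == inord i then C else setT).
      by move=> j; case: ifP.
    rewrite setTI; apply/seteqP; split=> x /= H.
      by move=> j; case: ifP => // /eqP ->.
    by have := H (inord i); rewrite eqxx.
  apply: smallest_sub; first exact: sigma_algebra_measurable.
  by move=> B [C mC ->]; exact: measurable_tbox.
- move=> B C [D mD ->] [E mE ->]; exists (fun i => D i `&` E i).
    by move=> i; exact: measurableI.
  apply/seteqP; split => x /=; first by move=> [H1 H2] i; split; [exact: H1|exact: H2].
  by move=> H; split=> i; have [] := H i.
- by move=> _; exists (fun=> setT).
- by rewrite bigcup_const.
- by move=> B [C mC ->]; exact: m12.
Qed.

End product_law.

(** * Joint law of the two independent families *)

Section joint_law.
Context {R : realType} {d'} {W : measurableType d'}.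
Notation RR := (measurableTypeR R).
Local Open Scope ereal_scope.

Definition rvtuple n (X : 'I_n -> W -> R) (w : W) : n.-tuple RR := [tuple X i w | i < n].

Lemma measurable_rvtuple n (X : 'I_n -> W -> R) :
  (forall i, measurable_fun setT (X i)) -> measurable_fun setT (rvtuple X).
Proof.
move=> mX; apply/measurable_fun_tnthP => i.
apply: (eq_measurable_fun (X i)); last exact: mX.
by move=> w _ /=; rewrite tnth_mktuple.
Qed.

(** Independence gives the product formula on pairs of boxes only. It is extended one factor at a
    time: with a box frozen for [X], both sides are finite measures in the set for [Y] that agree on
    boxes; then any measurable set is frozen for [Y] and the set for [X] varies. *)
Lemma integral_joint_law (P : probability W R) n (X Y : 'I_n -> W -> R) (m : probability RR R) :
  (forall i, measurable_fun setT (X i)) -> (forall i, measurable_fun setT (Y i)) ->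
  mutually_independent P (fun k : 'I_n + 'I_n => match k with inl i => X i | inr j => Y j end) ->
  (forall i A, measurable A -> P (X i @^-1` A) = m A) ->
  (forall i A, measurable A -> P (Y i @^-1` A) = m A) ->
  forall F : n.-tuple RR * n.-tuple RR -> \bar R,
  measurable_fun setT F -> (forall x, 0 <= F x) ->
  \int[P]_w F (rvtuple X w, rvtuple Y w) =
  \int[prodP m n]_x \int[prodP m n]_y F (x, y).
Proof.
move=> mX mY ind PX PY F mF F0.
have mXT := measurable_rvtuple mX; have mYT := measurable_rvtuple mY.
pose phi w := (rvtuple X w, rvtuple Y w).
have mphi : measurable_fun setT phi by exact: measurable_fun_pair.
have boxes (A B : 'I_n -> set R) : (forall i, measurable (A i)) -> (forall i, measurable (B i)) ->
    P (rvtuple X @^-1` tbox A `&` rvtuple Y @^-1` tbox B) =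
    (\prod_(i < n) m (A i)) * (\prod_(i < n) m (B i)).
  move=> mA mB.
  have := ind (fun k => match k with inl i => A i | inr i => B i end).
  rewrite big_sumType/=.
  have -> : \prod_(i < n) P (X i @^-1` A i) = \prod_(i < n) m (A i).
    by apply: eq_bigr => i _; exact: PX.
  have -> : \prod_(i < n) P (Y i @^-1` B i) = \prod_(i < n) m (B i).
    by apply: eq_bigr => i _; exact: PY.
  move=> <-; last by case.
  congr (P _); apply/seteqP; split=> w /=.
    by move=> [H1 H2] [i|i] _ /=; [have := H1 i|have := H2 i]; rewrite tnth_mktuple.
  by move=> H; split=> i /=; rewrite tnth_mktuple; [exact: (H (inl i))|exact: (H (inr i))].
have prodfin (A : 'I_n -> set R) : (forall i, measurable (A i)) ->
    \prod_(i < n) m (A i) \is a fin_num.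
  move=> mA; rewrite -prodP_tbox//; apply: fin_num_measure; exact: measurable_tbox.
have step1 (A : 'I_n -> set R) B : (forall i, measurable (A i)) -> measurable B ->
    P (rvtuple X @^-1` tbox A `&` rvtuple Y @^-1` B) = prodP m n (tbox A) * prodP m n B.
  move=> mA mB.
  have mC : measurable (rvtuple X @^-1` tbox A).
    by rewrite -[X in measurable X]setTI; apply: mXT => //; exact: measurable_tbox.
  have c0 : (0 <= fine (prodP m n (tbox A)))%R by exact: fine_ge0.
  (* The image by [rvtuple Y] of [P] restricted to the event on [X], to be compared with a multiple
     of the product law. *)
  pose m1 : {measure set _ -> \bar R} := measure_function_pushforward__canonical__measure_function_Measure (mrestr P mC) mYT.
  have E := @measure_tbox_unique _ _ _ _ m1 (mscale (NngNum c0) (prodP m n)) _ _ B mB.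
  rewrite setIC [LHS]E.
  - transitivity ((fine (prodP m n (tbox A)))%:E * prodP m n B) => //.
    by rewrite fineK// prodP_tbox// prodfin.
  - by rewrite /m1 /= /pushforward /mrestr preimage_setT setTI (le_lt_trans (probability_le1 _ _))// ltry.
  - move=> D mD; rewrite /m1/= /pushforward /mrestr setIC boxes//.
    transitivity ((fine (prodP m n (tbox A)))%:E * prodP m n (tbox D)) => //.
    by rewrite fineK !prodP_tbox ?prodfin.
have step2 A B : measurable A -> measurable B ->
    P (rvtuple X @^-1` A `&` rvtuple Y @^-1` B) = prodP m n A * prodP m n B.
  move=> mA mB.
  have mC : measurable (rvtuple Y @^-1` B).
    by rewrite -[X in measurable X]setTI; exact: mYT.
  have c0 : (0 <= fine (prodP m n B))%R by exact: fine_ge0.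
  pose m1 : {measure set _ -> \bar R} := measure_function_pushforward__canonical__measure_function_Measure (mrestr P mC) mXT.
  have E := @measure_tbox_unique _ _ _ _ m1 (mscale (NngNum c0) (prodP m n)) _ _ A mA.
  rewrite [LHS]E.
  - transitivity ((fine (prodP m n B))%:E * prodP m n A) => //.
    by rewrite fineK 1?muleC// fin_num_measure.
  - by rewrite /m1 /= /pushforward /mrestr preimage_setT setTI (le_lt_trans (probability_le1 _ _))// ltry.
  - move=> D mD; rewrite /m1/= /pushforward /mrestr step1//.
    transitivity ((fine (prodP m n B))%:E * prodP m n (tbox D)) => //.
    by rewrite fineK 1?muleC// fin_num_measure.
pose phi' : {mfun W >-> (n.-tuple RR * n.-tuple RR)%type} := HB.pack phi (isMeasurableFun.Build _ _ _ _ _ mphi).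
rewrite -(@fubini_tonelli1 _ _ _ _ _ (prodP m n) (prodP m n) F mF F0).
have -> : \int[P]_w F (rvtuple X w, rvtuple Y w) = \int[distribution P phi']_z F z.
  by rewrite ge0_integral_distribution.
apply: eq_measure_integral => A mA _; apply/esym.
by apply: product_measure_unique => // B C mB mC; exact: step2.
Qed.

End joint_law.

(** * Measurability of continuous functions of finitely many variables *)

Section continuous_family.
Context {R : realType} {I : finType}.

(** Continuity for the sup distance, on plain functions over a finite type, so that it serves ['I_n]
    as well as ['I_n + 'I_n]. *)
Definition fam_continuous (F : (I -> R) -> R) :=
  forall x e, 0 < e -> exists2 dl, 0 < dl &
    forall y, (forall i, `|x i - y i| <= dl) -> `|F x - F y| <= e.

(** Each coordinate is rounded down to the grid of mesh [1 / k.+1]. The rounded vector takes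
    countably many values, each on a measurable event, so [F] of it is measurable; by continuity
    these functions converge pointwise as [k] grows. *)
Lemma measurable_fam_continuous {d} {W : measurableType d} (Z : I -> W -> R) (F : (I -> R) -> R) :
  (forall i, measurable_fun setT (Z i)) -> fam_continuous F ->
  measurable_fun setT (fun w => F (Z ^~ w)).
Proof.
move=> mZ cF.
pose c k w : {ffun I -> int} := [ffun i => Num.floor (Z i w * k.+1%:R)].
pose h k (f : {ffun I -> int}) : R := F (fun i => (f i)%:~R / k.+1%:R).
have mc k (f : {ffun I -> int}) : measurable [set w | c k w = f].
  rewrite (_ : mkset _ = \bigcap_(i in [set: I])
     ((fun w => Z i w * k.+1%:R) @^-1` `[(f i)%:~R, (f i + 1)%:~R[)); last first.
    apply/seteqP; split=> w /=.
      by move=> <- i _ /=; rewrite in_itv/= ffunE floor_itv.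
    move=> H; apply/ffunP => i; rewrite ffunE; apply: floor_def.
    by have := H i Logic.I; rewrite /= in_itv.
  apply: fin_bigcap_measurable => [|i _]; first exact: finite_finset.
  rewrite -[X in measurable X]setTI.
  have mZi : measurable_fun setT (fun w => Z i w * k.+1%:R).
    by apply: measurable_funM.
  by apply: mZi => //; exact: measurable_itv.
have mh k : measurable_fun setT (fun w => h k (c k w)).
  move=> _ Y mY; rewrite setTI.
  (* The grid points [{ffun I -> int}] are countable: the preimage is a union over their codes
     [j]. *)
  rewrite (_ : _ @^-1` Y = \bigcup_(j in [set j | if unpickle j is Some f then Y (h k f) else False])
     (if unpickle j is Some f then [set w | c k w = f] else set0)); last first.
    apply/seteqP; split=> w /=.
      by move=> H; exists (pickle (c k w)) => /=; rewrite pickleK.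
    by move=> [j /=]; case: (unpickle j) => //= f Yf ->.
  apply: bigcup_measurable => j _; case: (unpickle j) => [f|//].
  exact: mc.
apply: (@measurable_fun_cvg _ _ _ _ (fun k w => h k (c k w))) => //.
move=> w _; apply/cvgrPdist_le => e e0.
have [dl dl0 H] := cF (Z ^~ w) e e0.
near=> k; apply: H => i; rewrite ffunE.
set x := Z i w.
have k0 : (0 : R) < k.+1%:R by rewrite ltr0n.
have /andP[H1 H2] := floor_itv (x * k.+1%:R).
have -> : x - (Num.floor (x * k.+1%:R))%:~R / k.+1%:R =
   (x * k.+1%:R - (Num.floor (x * k.+1%:R))%:~R) / k.+1%:R.
  by rewrite mulrBl mulfK// gt_eqF.
rewrite ger0_norm ?divr_ge0 ?subr_ge0 ?(ltW k0)//.
rewrite ler_pdivrMr//.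
have : 1 <= dl * k.+1%:R.
  rewrite mulrC -ler_pdivrMr// mul1r.
  rewrite (@le_trans _ _ k%:R)// ?ler_nat//.
  by near: k; exact: nbhs_infty_ger.
apply: le_trans; rewrite lerBlDr; apply: ltW; move: H2; rewrite intrD.
by rewrite addrC.
Unshelve. all: by end_near. Qed.

End continuous_family.

(** * A Prekopa-Leindler inequality with logit cost *)

Section cumulative_integral.
Context {R : realType}.
Notation leb := (@lebesgue_measure R).
Variable a : R -> R.
Hypotheses (ca : continuous a) (a0 : forall x, 0 < a x).
Hypothesis ia : leb.-integrable setT (EFin \o a).

Definition cum (f : R -> R) x := \int[leb]_(t in `]-oo, x]) f t.
Definition tot (f : R -> R) := \int[leb]_t f t.

Let iaS (A : set R) : measurable A -> leb.-integrable A (EFin \o a).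
Proof. by move=> mA; exact: integrableS ia. Qed.

Let fin (A : set R) : measurable A -> (\int[leb]_(t in A) (a t)%:E)%E \is a fin_num.
Proof. by move=> mA; apply: integrable_fin_num => //; exact: iaS. Qed.

Lemma cum_derive (x : R) : is_derive x 1 (cum a) (a x).
Proof.
have xx1 : x < x + 1 by rewrite ltrDl.
have [|||d1 d2] := @continuous_FTC1 R a (BInfty _ true) x (x + 1) xx1.
- exact: iaS.
- by rewrite ltNyr.
- exact: ca.
- by apply: DeriveDef; [exact: d1|rewrite -derive1E; exact: d2].
Qed.

Lemma cum_lt x y : x < y -> cum a x < cum a y.
Proof.
move=> xy; have [||c _ E] := @MVT _ (cum a) a x y xy.
- by move=> z _; exact: cum_derive.
- apply: continuous_subspaceT => z.
  by apply/differentiable_continuous/derivable1_diffP; have [] := cum_derive z.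
- by rewrite -subr_gt0 E mulr_gt0// subr_gt0.
Qed.

Lemma cum_ge0 x : 0 <= cum a x.
Proof. by apply: Rintegral_ge0 => z _; exact: ltW. Qed.

Lemma cum_le_tot x : cum a x <= tot a.
Proof.
rewrite /cum /tot /Rintegral fine_le ?fin//.
apply: ge0_subset_integral => //.
- by apply/measurable_EFinP; exact: continuous_measurable_fun.
- by move=> z _; rewrite lee_fin ltW.
Qed.

Lemma cum_gt0 x : 0 < cum a x.
Proof. by rewrite (le_lt_trans (cum_ge0 (x - 1)))// cum_lt// ltrBlDr ltrDl. Qed.

Lemma cum_lt_tot x : cum a x < tot a.
Proof. by rewrite (lt_le_trans _ (cum_le_tot (x + 1)))// cum_lt// ltrDl. Qed.

Let int_cvg (F : (set (measurableTypeR R))^nat) (e : R) : nondecreasing_seq F -> (forall i, measurable (F i)) ->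
  \bigcup_i F i = setT -> 0 < e ->
  exists n, tot a - e < \int[leb]_(t in F n) a t.
Proof.
move=> ndF mF FT e0.
have := @ge0_nondecreasing_set_cvg_integral _ _ R F (EFin \o a) leb ndF mF.
rewrite FT => /(_ _ _)/= H.
have {}H : (\int[leb]_(x in F i) (a x)%:E)%E @[i --> \oo] --> (\int[leb]_x (a x)%:E)%E.
  apply: H => i.
    by apply/measurable_EFinP/measurable_funTS; exact: continuous_measurable_fun.
  by move=> x _; rewrite lee_fin ltW.
have {}H : \int[leb]_(x in F i) a x @[i --> \oo] --> tot a.
  by apply: fine_cvg; rewrite /tot /Rintegral fineK// fin.
have /cvgrPdist_lt/(_ e e0)[N _ HN] := H.
exists N; have := HN N (leqnn N); rewrite /= => /ltr_normlP[_].
by rewrite ltrBlDr -ltrBlDl.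
Qed.

Lemma cum_near_tot (e : R) : 0 < e -> exists x, tot a - e < cum a x.
Proof.
move=> e0.
have [|||n Hn] := @int_cvg (fun n : nat => `]-oo, n%:R]%classic) e _ _ _ e0.
- move=> m n mn; apply/subsetPset => x /=; rewrite !in_itv/= => /le_trans; apply.
  by rewrite ler_nat.
- by move=> i; exact: measurable_itv.
- apply/seteqP; split=> // x _; exists (Num.truncn `|x|).+1 => //=.
  rewrite in_itv/=; apply/ltW/(le_lt_trans (ler_norm _)).
  by rewrite truncnS_gt.
- by exists n%:R.
Qed.

Lemma cum_near0 (e : R) : 0 < e -> exists x, cum a x < e.
Proof.
move=> e0.
have [|||n Hn] := @int_cvg (fun n : nat => `]- n%:R, +oo[%classic) e _ _ _ e0.
- move=> m n mn; apply/subsetPset => x /=; rewrite !in_itv/= !andbT; apply: le_lt_trans.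
  by rewrite lerN2 ler_nat.
- by move=> i; exact: measurable_itv.
- apply/seteqP; split=> // x _; exists (Num.truncn `|x|).+1 => //=.
  rewrite in_itv/= andbT ltrNl (le_lt_trans (ler_norm _))// normrN.
  by rewrite truncnS_gt.
- exists (- n%:R).
  suff E : tot a = cum a (- n%:R) + \int[leb]_(t in `]- n%:R, +oo[) a t.
    by move: Hn; rewrite E ltrBlDr addrC ltrD2l.
  rewrite /tot /cum -Rintegral_setU//.
  + congr (Rintegral _ _ _); apply/seteqP; split => // x _ /=.
    by rewrite !in_itv/= andbT; case: (leP x (- n%:R)); [left|right].
  + by apply: iaS; exact: measurableU.
  + rewrite disj_set2E; apply/eqP/seteqP; split => // x [] /=.
    by rewrite !in_itv/= andbT leNgt => /negP.
Qed.

Lemma cum_surj v : 0 < v < tot a -> exists x, cum a x = v.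
Proof.
move=> /andP[v0 vA].
have [x Hx] := cum_near0 v0.
have [y Hy] := cum_near_tot (e := tot a - v) ltac:(by rewrite subr_gt0).
have {}Hy : v < cum a y by lra.
have xy : x <= y.
  rewrite leNgt; apply/negP => /cum_lt; lra.
have [||c _ <-] := @IVT R (cum a) x y v xy; last by exists c.
- apply: continuous_subspaceT => z.
  by apply/differentiable_continuous/derivable1_diffP; have [] := cum_derive z.
- by rewrite ge_min le_max (ltW Hx) (ltW Hy) orbT.
Qed.

End cumulative_integral.

Lemma is_derive_cmul {R : realType} (f : R -> R) (c x df : R) :
  is_derive x 1 f df -> is_derive x 1 (fun y => c * f y) (c * df).
Proof.
move=> H; have := is_deriveM (is_derive_cst c x 1) H.
by rewrite /GRing.scale/= mulr0 addr0.
Qed.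

Lemma derive_nondecreasing {R : realType} (f df : R -> R) :
  (forall x : R, is_derive x 1 f (df x)) -> (forall x, 0 <= df x) ->
  forall x y, x <= y -> f x <= f y.
Proof.
move=> H H0 x y xy; have [|c _ E] := @MVT_segment _ f df x y xy.
- apply: continuous_subspaceT => z.
  by apply/differentiable_continuous/derivable1_diffP; have [] := H z.
- by rewrite -subr_ge0 E mulr_ge0// subr_ge0.
Qed.

Lemma oscillation_lt {R : realType} (dx dy cx cy : R) : 2 < cy - cx ->
  -1 <= dy -> dy <= 1 -> -1 <= dx -> dx <= 1 -> dx - cx <= dy - cy -> False.
Proof. lra. Qed.

Section prekopa_leindler.
Context {R : realType}.
Notation leb := (@lebesgue_measure R).

(* [kap u v] is cosh^2 (delta / 4), delta being the difference of the logits of u and v. *)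
Definition kap (u v : R) : R :=
  (Num.sqrt (u * (1 - v)) + Num.sqrt ((1 - u) * v)) ^+ 2 /
  (4 * Num.sqrt (u * (1 - v)) * Num.sqrt ((1 - u) * v)).

Variables (g a b : R -> R).
Hypotheses (cg : continuous g) (g0 : forall x, 0 < g x).
Hypotheses (ca : continuous a) (a0 : forall x, 0 < a x).
Hypotheses (cb : continuous b) (b0 : forall x, 0 < b x).
Hypothesis ig : leb.-integrable setT (EFin \o g).
Hypothesis ia : leb.-integrable setT (EFin \o a).
Hypothesis ib : leb.-integrable setT (EFin \o b).
Hypothesis g1 : tot g = 1.
Hypothesis abk : forall x y, a x * b y <= kap (cum g x) (cum g y) * (g x * g y).

Let A := tot a.
Let B := tot b.
Let A0 : 0 < A. Proof. exact: le_lt_trans (cum_ge0 a0 0) (cum_lt_tot ca a0 ia 0). Qed.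
Let B0 : 0 < B. Proof. exact: le_lt_trans (cum_ge0 b0 0) (cum_lt_tot cb b0 ib 0). Qed.

(** [th] transports the normalized density [a / A] to [b / B]: the masses to the left of [x] and of
    [th x] are in the ratio of the total masses. *)
Let th_ex x : exists y, cum b y = B / A * cum a x.
Proof.
apply: cum_surj => //; rewrite mulr_gt0 ?divr_gt0 ?cum_gt0//=.
rewrite mulrAC ltr_pdivrMr// ltr_pM2l//; exact: cum_lt_tot.
Qed.

Let th x := sval (cid (th_ex x)).
Let thE x : cum b (th x) = B / A * cum a x. Proof. exact: svalP (cid (th_ex x)). Qed.

Let cum_inj : injective (cum b).
Proof.
move=> x y E; apply/eqP; rewrite eq_le !leNgt; apply/andP; split; apply/negP => /(cum_lt cb b0 ib); rewrite E ltxx//.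
Qed.

(** A left inverse of [cum b], made total by a default value; it presents [th] as a composite, to
    which the rule for inverse functions applies. *)
Let inv v := xget 0 [set y | cum b y = v].
Let invK : cancel (cum b) inv.
Proof.
move=> y; apply: cum_inj; rewrite /inv; case: xgetP => [z _ ->//|].
by move=> /(_ y)/(_ erefl).
Qed.

Let thI x : th x = inv (B / A * cum a x).
Proof. by rewrite -thE invK. Qed.

Let dth (x : R) : is_derive x 1 th (B / A * a x / b (th x)).
Proof.
have -> : th = inv \o (fun x => B / A * cum a x) by apply/funext => y; exact: thI.
have H1 : is_derive x 1 (fun x => B / A * cum a x) (B / A * a x).
  exact: is_derive_cmul (cum_derive ca ia x).
have H2 : is_derive (B / A * cum a x) 1 inv (b (th x))^-1.
  rewrite -thE; apply: (@is_derive_inverse _ (cum b) inv (b (th x)) (th x)).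
  - by near=> z; exact: invK.
  - near=> z; apply/differentiable_continuous/derivable1_diffP.
    by have [] := cum_derive cb ib z.
  - exact: cum_derive.
  - by rewrite gt_eqF.
rewrite [X in is_derive _ _ _ X](_ : _ = (b (th x))^-1 * (B / A * a x)).
  exact: (@is_derive1_comp _ inv (fun x => B / A * cum a x) x _ _ H2 H1).
by rewrite /= -thI mulrC.
Unshelve. all: by end_near. Qed.

Let Fl (x : R) : 0 < cum g x. Proof. exact: cum_gt0. Qed.
Let Fu x : 0 < 1 - cum g x. Proof. by rewrite subr_gt0 -g1; exact: cum_lt_tot. Qed.

Let dsqrt (f : R -> R) (x df : R) : 0 < f x -> is_derive x 1 f df ->
  is_derive x 1 (fun y => Num.sqrt (f y)) (df / (2 * Num.sqrt (f x))).
Proof.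
move=> fx H; have := @is_derive1_comp _ Num.sqrt f x _ _ (is_derive1_sqrt fx) H.
by rewrite mulrC.
Qed.

(** With [cum g x = sin^2 s] and [cum g (th x) = sin^2 t], this is [- cos (s + t)]. *)
Let D x := Num.sqrt (cum g x) * Num.sqrt (cum g (th x)) -
  Num.sqrt (1 - cum g x) * Num.sqrt (1 - cum g (th x)).

(** In the angles [s] and [t] the derivative is [sin (s + t) * (s' + t')], and
    [s' + t' >= 2 * sqrt (s' * t')]. After squaring, [sin^2 (s + t)] over four times the product of
    the sines and cosines is exactly [kap], and [abk] at the point [th x] turns the whole into
    [B / A * a x ^+ 2] up to the factor 4. *)
Let dD (x : R) : exists2 d, is_derive x 1 D d & 2 * Num.sqrt (B / A) * a x <= d.
Proof.
pose u' := g x; pose v' := g (th x) * (B / A * a x / b (th x)).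
have du : is_derive x 1 (cum g) u' by exact: cum_derive.
have dv : is_derive x 1 (cum g \o th) v'.
  exact: (is_derive1_comp (cum_derive cg ig (th x)) (dth x)).
have dunit (f : R -> R) (df : R) : is_derive x 1 f df -> is_derive x 1 (fun y => 1 - f y) (- df).
  by move=> H; have := is_deriveB (is_derive_cst (1 : R) x (1 : R)) H; rewrite sub0r.
have s1 := dsqrt (Fl x) du.
have s2 := @dsqrt (cum g \o th) x _ (Fl (th x)) dv.
have s3 := @dsqrt (fun y => 1 - cum g y) x _ (Fu x) (dunit _ _ du).
have s4 := @dsqrt (fun y => 1 - cum g (th y)) x _ (Fu (th x)) (dunit _ _ dv).
have dE := is_deriveB (is_deriveM s1 s2) (is_deriveM s3 s4).
move: dE; set d := (X in is_derive _ _ _ X) => dE.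
exists d; first exact: dE.
rewrite /d /= /GRing.scale/=.
set a1 := Num.sqrt (cum g x); set b1 := Num.sqrt (cum g (th x)).
set c1 := Num.sqrt (1 - cum g x); set d1 := Num.sqrt (1 - cum g (th x)).
have a10 : 0 < a1 by rewrite sqrtr_gt0.
have b10 : 0 < b1 by rewrite sqrtr_gt0.
have c10 : 0 < c1 by rewrite sqrtr_gt0.
have d10 : 0 < d1 by rewrite sqrtr_gt0.
have u'0 : 0 < u' by exact: g0.
have BA0 : 0 < B / A by rewrite divr_gt0.
have v'0 : 0 < v' by rewrite /v' mulr_gt0// divr_gt0// mulr_gt0.
pose S := a1 * d1 + b1 * c1.
have S0 : 0 < S by rewrite addr_gt0// mulr_gt0.
have kE : kap (cum g x) (cum g (th x)) = S ^+ 2 / (4 * (a1 * d1) * (b1 * c1)).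
  rewrite /kap !sqrtrM; [|exact: ltW..].
  by rewrite -/a1 -/b1 -/c1 -/d1 (mulrC c1 b1).
have key : B / A * a x ^+ 2 <= S ^+ 2 / (4 * (a1 * d1) * (b1 * c1)) * (u' * v').
  rewrite -kE.
  have := abk x (th x); set K := kap _ _ => H.
  have -> : K * (u' * v') = B / A * (a x / b (th x)) * (K * (g x * g (th x))).
    by rewrite /u' /v'; ring.
  have -> : B / A * a x ^+ 2 = B / A * (a x / b (th x)) * (a x * b (th x)).
    by field; rewrite !gt_eqF.
  by rewrite ler_pM2l// mulr_gt0// divr_gt0.
set dd := (X in _ <= X).
have -> : dd = S / 2 * (u' / (a1 * c1) + v' / (b1 * d1)).
  by rewrite /dd /S; field; rewrite !gt_eqF.
rewrite -(@ler_pXn2r _ 2)// ?nnegrE; last 2 first.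
- by rewrite !mulr_ge0 ?sqrtr_ge0// ltW.
- by apply/ltW/mulr_gt0; [exact: divr_gt0|apply: addr_gt0; apply: divr_gt0 => //; exact: mulr_gt0].
rewrite !exprMn sqr_sqrtr ?(ltW BA0)//.
have amgm : 4 * (u' / (a1 * c1) * (v' / (b1 * d1))) <= (u' / (a1 * c1) + v' / (b1 * d1)) ^+ 2.
  set X := u' / _; set Y := v' / _.
  rewrite -subr_ge0 (_ : _ - _ = (X - Y) ^+ 2) ?sqr_ge0//; ring.
apply: (@le_trans _ _ (S ^+ 2 / 4 * (4 * (u' / (a1 * c1) * (v' / (b1 * d1)))))); last first.
  rewrite (_ : (2^-1) ^+ 2 = 4^-1); last by rewrite exprVn -natrX.
  by rewrite ler_pM2l// divr_gt0// exprn_gt0.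
have -> : S ^+ 2 / 4 * (4 * (u' / (a1 * c1) * (v' / (b1 * d1)))) =
  4 * (S ^+ 2 / (4 * (a1 * d1) * (b1 * c1)) * (u' * v')).
  by field; rewrite !gt_eqF.
rewrite -natrX -mulrA ler_pM2l//.
Qed.

(** [D] stays in [[-1, 1]] while its derivative is at least [2 * sqrt (B / A) * a]. Integrating over
    the line gives [2 * sqrt (B / A) * A <= 2], that is [sqrt (A * B) <= 1]. Instead of limits at
    infinity, two points are used between which [cum a] gains almost all of [A]. *)
Lemma prekopa_leindler_logit : A * B <= 1.
Proof.
pose dD' x := sval (cid2 (dD x)).
have H1 (x : R) : is_derive x 1 D (dD' x) by rewrite /dD'; case: cid2.
have H2 x : 2 * Num.sqrt (B / A) * a x <= dD' x by rewrite /dD'; case: cid2.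
pose c := 2 * Num.sqrt (B / A).
have BA0 : 0 < Num.sqrt (B / A) by rewrite sqrtr_gt0 divr_gt0.
have Hm x y : x <= y -> D x - c * cum a x <= D y - c * cum a y.
  apply: (@derive_nondecreasing _ (fun x => D x - c * cum a x) (fun x => dD' x - c * a x)) => z.
    exact: is_deriveB (H1 z) (is_derive_cmul _ (cum_derive ca ia z)).
  by rewrite subr_ge0; exact: H2.
have D1 x : -1 <= D x <= 1.
  have sle1 z : 0 <= Num.sqrt (cum g z) * Num.sqrt (cum g (th z)) <= 1.
    rewrite mulr_ge0 ?sqrtr_ge0//= mulr_ile1 ?sqrtr_ge0//;
      by rewrite -sqrtr1 ler_wsqrtr// -g1; exact: cum_le_tot.
  have sle2 z : 0 <= Num.sqrt (1 - cum g z) * Num.sqrt (1 - cum g (th z)) <= 1.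
    rewrite mulr_ge0 ?sqrtr_ge0//= mulr_ile1 ?sqrtr_ge0//;
      by rewrite -{2}sqrtr1 ler_wsqrtr// lerBlDr lerDl cum_ge0.
  rewrite /D; move: (sle1 x) (sle2 x); lra.
have sA : Num.sqrt (B / A) * A <= 1.
  rewrite leNgt; apply/negP => gt1.
  (* [e] solves [c * (A - 2 * e) = 2]: between the levels [e] and [A - e] of [cum a] the guaranteed
     increase of [D] is exactly 2, and the strict choice of [x] and [y] exceeds it. *)
  pose e := (Num.sqrt (B / A) * A - 1) / (2 * Num.sqrt (B / A)).
  have e0 : 0 < e by rewrite divr_gt0 ?mulr_gt0// subr_gt0.
  have [x Hx] := cum_near0 ca a0 ia e0.
  have [y Hy] := cum_near_tot ca a0 ia e0.
  have ce : c * (A - 2 * e) = 2.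
    by rewrite /c /e; field; rewrite gt_eqF.
  have xy : x <= y.
    rewrite leNgt; apply/negP => /(cum_lt ca a0 ia) H.
    have A2e : 0 < A - 2 * e.
      by rewrite -(pmulr_rgt0 _ (_ : 0 < c)) ?ce// mulr_gt0.
    move: Hx Hy H A2e; rewrite -/A; lra.
  have := Hm _ _ xy; have /andP[] := D1 x; have /andP[] := D1 y.
  have : 2 < c * (cum a y - cum a x).
    by rewrite -ce ltr_pM2l ?mulr_gt0//; move: Hx Hy; rewrite -/A; lra.
  by rewrite mulrBr; exact: oscillation_lt.
have : (Num.sqrt (B / A) * A) ^+ 2 <= 1 by rewrite expr_le1// mulr_ge0// ltW.
rewrite exprMn sqr_sqrtr; last by apply: divr_ge0; exact: ltW.
by rewrite (_ : B / A * A ^+ 2 = A * B)//; field; rewrite gt_eqF.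
Qed.

End prekopa_leindler.

(** * Tensorization of the inequality *)

Section tensorization.
Context {R : realType}.
Notation leb := (@lebesgue_measure R).
Notation RR := (measurableTypeR R).

Definition l1dist n (x y : n.-tuple RR) : R := \sum_(i < n) `|tnth x i - tnth y i|.

Lemma l1dist_tcons n (t s : RR) (x y : n.-tuple RR) :
  l1dist (tcons t x) (tcons s y) = `|t - s| + l1dist x y.
Proof.
rewrite /l1dist big_ord_recl; congr (_ + _).
by apply: eq_bigr => i _; rewrite !tnth_tconsS.
Qed.

Lemma l1distxx n (x : n.-tuple RR) : l1dist x x = 0.
Proof. by rewrite /l1dist big1// => i _; rewrite subrr normr0. Qed.

(* Positive bounded functions whose logarithm is Lipschitz: a class which is
   stable under integration of one variable. *)
Definition loglip n (a : n.-tuple RR -> R) := [/\ measurable_fun setT a,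
  exists M, forall x, 0 < a x <= M &
  exists2 L, 0 <= L & forall x y, a x <= expR (L * l1dist x y) * a y].

Definition loglip1 (a : RR -> R) := [/\ continuous (a : R -> R),
  exists M, forall x, 0 < a x <= M &
  exists2 L, 0 <= L & forall x y, a x <= expR (L * `|x - y|) * a y].

(** The constant [c] is quantified because the induction freezes the first coordinates [t] and [s]:
    the remaining ones satisfy the pointwise bound with [c * k t s], and their inequality is the
    one-dimensional hypothesis for the integrated functions. *)
Definition PL1 (m : probability RR R) (k : R -> R -> R) :=
  forall a b c, loglip1 a -> loglip1 b -> (forall x y, a x * b y <= c * k x y) ->
  ((\int[m]_x (a x)%:E) * (\int[m]_x (b x)%:E) <= c%:E)%E.

Lemma continuous_loglip (a : R -> R) L : 0 <= L -> (forall x, 0 < a x) ->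
  (forall x y, a x <= expR (L * `|x - y|) * a y) -> continuous a.
Proof.
move=> L0 a0 H x.
have cn (c : R) : expR (c * `|x - y|) * a x @[y --> x] --> a x.
  rewrite -[X in _ --> X]mul1r -expR0 -[X in expR X](mulr0 c) -(@normr0 _ R^o) -[X in `|X|](subrr x).
  apply: cvgM; last exact: cvg_cst.
  apply: (cvg_comp (fun y => c * `|x - y|) expR); last exact: continuous_expR.
  apply: cvgM; first exact: cvg_cst.
  apply: cvg_norm; apply: cvgB; [exact: cvg_cst|exact: cvg_id].
apply: (@squeeze_cvgr _ _ _ _ (fun y => expR (- L * `|x - y|) * a x) (fun y => expR (L * `|x - y|) * a x)) => //.
near=> y; apply/andP; split; last by rewrite distrC; exact: H.
rewrite mulNr expRN mulrC ler_pdivrMr ?expR_gt0// mulrC; exact: H.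
Unshelve. all: by end_near. Qed.

Lemma probability_integral_fin d (T : measurableType d) (P : probability T R) (a : T -> R) M :
  measurable_fun setT a -> (forall x, 0 < a x <= M) ->
  ((\int[P]_x (a x)%:E)%E \is a fin_num) /\ 0 < fine (\int[P]_x (a x)%:E)%E <= M.
Proof.
move=> ma H.
have ge0 x : (0 <= (a x)%:E)%E by rewrite lee_fin; case/andP: (H x) => /ltW.
have le : (\int[P]_x (a x)%:E <= M%:E)%E.
  apply: (@le_trans _ _ (\int[P]_x (cst M%:E) x)%E).
    apply: ge0_le_integral => //.
    - exact/measurable_EFinP.
    - by move=> x _; rewrite lee_fin; case/andP: (H x).
  by rewrite integral_cst// [X in (_ * X <= _)%E](probability_setT P) mule1.
have i0 : (0 <= \int[P]_x (a x)%:E)%E by apply: integral_ge0 => x _.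
have fin : (\int[P]_x (a x)%:E)%E \is a fin_num.
  by rewrite ge0_fin_numE// (le_lt_trans le)// ltry.
split=> //; apply/andP; split; last by rewrite -lee_fin fineK.
rewrite lt_neqAle fine_ge0// andbT; apply/negP => /eqP E.
have E0 : (\int[P]_x `|(a x)%:E| = 0)%E.
  rewrite (eq_integral (fun x => (a x)%:E)); last by move=> x _; rewrite gee0_abs.
  by rewrite -[LHS]fineK// -E.
have /(ae_eq_integral_abs P measurableT) : measurable_fun setT (EFin \o a).
  exact/measurable_EFinP.
move=> [H1 _]; have [N [mN N0 sub]] := H1 E0.
have : (P setT <= P N)%E.
  apply: le_measure; rewrite ?inE// => x _; apply: sub => /= /(_ Logic.I) /eqP.
  by rewrite /cst eqe gt_eqF//; case/andP: (H x).
by rewrite N0 probability_setT lee_fin ler10.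
Qed.

Lemma measurable_tcons_r n (a : n.+1.-tuple RR -> R) (t : RR) :
  measurable_fun setT a -> measurable_fun setT (fun x : n.-tuple RR => a (tcons t x)).
Proof. by move=> ma; apply: measurableT_comp => //; exact: measurable_cons. Qed.

Lemma loglip_integral (m : probability RR R) n (a : n.+1.-tuple RR -> R) : loglip a ->
  loglip1 (fun t => fine (\int[prodP m n]_x (a (tcons t x))%:E)%E).
Proof.
move=> [ma [M aM] [L L0 aL]].
have pf t := probability_integral_fin (prodP m n) (measurable_tcons_r t ma) (fun x => aM (tcons t x)).
have lip t s : fine (\int[prodP m n]_x (a (tcons t x))%:E)%E <=
    expR (L * `|t - s|) * fine (\int[prodP m n]_x (a (tcons s x))%:E)%E.
  rewrite -lee_fin EFinM !fineK//; [|exact: (pf s).1|exact: (pf t).1].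
  rewrite -ge0_integralZl//; last 2 first.
  - by apply/measurable_EFinP; exact: measurable_tcons_r.
  - by move=> x _; rewrite lee_fin; case/andP: (aM (tcons s x)) => /ltW.
  apply: ge0_le_integral => //.
  - by move=> x _; rewrite lee_fin; case/andP: (aM (tcons t x)) => /ltW.
  - by apply/measurable_EFinP; exact: measurable_tcons_r.
  - apply: emeasurable_funM => //; apply/measurable_EFinP; exact: measurable_tcons_r.
  - move=> x _; rewrite -EFinM lee_fin.
    by have := aL (tcons t x) (tcons s x); rewrite l1dist_tcons l1distxx addr0.
split; last by exists L.
- apply: (continuous_loglip L0) => //.
  by move=> x; have [_ /andP[]] := pf x.
- by exists M => t; have [] := pf t.
Qed.

Lemma PL_tensor (m : probability RR R) (k : R -> R -> R) : PL1 m k ->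
  forall n (a b : n.-tuple RR -> R) c, loglip a -> loglip b ->
  (forall x y, a x * b y <= c * \prod_(i < n) k (tnth x i) (tnth y i)) ->
  ((\int[prodP m n]_x (a x)%:E) * (\int[prodP m n]_x (b x)%:E) <= c%:E)%E.
Proof.
move=> PL; elim=> [|n IH] a b c na nb H.
  rewrite !integral_prodP0 -EFinM lee_fin.
  by have := H [tuple] [tuple]; rewrite big_ord0 mulr1.
have [ma [Ma aM] _] := na; have [mb [Mb bM] _] := nb.
have pfa t := probability_integral_fin (prodP m n) (measurable_tcons_r t ma) (fun x => aM (tcons t x)).
have pfb t := probability_integral_fin (prodP m n) (measurable_tcons_r t mb) (fun x => bM (tcons t x)).
have sec (f : n.+1.-tuple RR -> R) t : loglip f -> loglip (fun x => f (tcons t x)).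
  move=> [mf [M fM] [L L0 fL]]; split.
  - exact: measurable_tcons_r.
  - by exists M => x.
  - by exists L => // x y; have := fL (tcons t x) (tcons t y);
      rewrite l1dist_tcons subrr normr0 add0r.
rewrite !integral_prodPS//; last 4 first.
- exact/measurable_EFinP.
- by move=> x; rewrite lee_fin; case/andP: (bM x) => /ltW.
- exact/measurable_EFinP.
- by move=> x; rewrite lee_fin; case/andP: (aM x) => /ltW.
under eq_integral do rewrite -(fineK (pfa _).1).
under [X in (_ * X)%E]eq_integral do rewrite -(fineK (pfb _).1).
apply: PL; [exact: loglip_integral|exact: loglip_integral|].
move=> t s; rewrite -lee_fin EFinM !fineK; [|exact: (pfb s).1|exact: (pfa t).1].
apply: IH; [exact: sec|exact: sec|].
move=> x y; have := H (tcons t x) (tcons s y).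
rewrite big_ord_recl/= mulrA.
by under eq_bigr do rewrite !tnth_tconsS.
Qed.

(** The logit inequality is applied to [c^-1 * a * g] and [b * g], whose total masses are the
    integrals under [m], the first one divided by [c]. *)
Lemma PL1_density (m : probability RR R) (g : R -> R) :
  continuous g -> (forall x, 0 < g x) ->
  (forall A, measurable A -> m A = \int[leb]_(x in A) (g x)%:E)%E ->
  PL1 m (fun x y => kap (fine (m `]-oo, x]%classic)) (fine (m `]-oo, y]%classic))).
Proof.
move=> cg g0 mE a b c [ca [Ma aM] _] [cb [Mb bM] _] H.
have mg : measurable_fun setT g by exact: continuous_measurable_fun.
have ma : measurable_fun setT a by exact: continuous_measurable_fun.
have mb : measurable_fun setT b by exact: continuous_measurable_fun.
have a0 x : 0 < a x by case/andP: (aM x).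
have b0 x : 0 < b x by case/andP: (bM x).
have g1 : (\int[leb]_x (g x)%:E = 1)%E by rewrite -mE// probability_setT.
have ge0 (f : R -> R) : (forall x, 0 < f x) -> forall x : RR, (0 <= (f x)%:E)%E.
  by move=> f0 x; rewrite lee_fin ltW.
have intE (f : R -> R) : (forall x, 0 < f x) -> measurable_fun setT f ->
    (\int[m]_x (f x)%:E = \int[leb]_x (f x * g x)%:E)%E.
  move=> f0 mf; rewrite (ge0_integral_density mg (fun x => ltW (g0 x)) mE)//.
  - exact/measurable_EFinP.
  - exact: ge0.
have int (f : R -> R) M : (forall x, 0 < f x <= M) -> measurable_fun setT f ->
   leb.-integrable setT (EFin \o (fun x => f x * g x)).
  move=> fM mf; apply/integrableP; split.
    by apply/measurable_EFinP; exact: measurable_funM.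
  have f0 x : 0 < f x by case/andP: (fM x).
  under eq_integral do rewrite /= ger0_norm ?mulr_ge0 ?(ltW (f0 _)) ?(ltW (g0 _))//.
  rewrite -intE//.
  have [fin _] := probability_integral_fin m mf fM.
  by rewrite -ge0_fin_numE//; apply: integral_ge0 => x _; exact: ge0.
have c0 : 0 < c.
  have := H 0 0; rewrite ltNge; apply: contraL => c0.
  rewrite -ltNge (@le_lt_trans _ _ 0) ?mulr_gt0//.
  by rewrite mulr_le0_ge0// /kap divr_ge0 ?sqr_ge0// mulr_ge0 ?mulr_ge0 ?sqrtr_ge0.
have FE x : fine (m `]-oo, x]%classic) = cum g x by rewrite mE.
have cgm (f : R -> R) : continuous f -> continuous (fun x => f x * g x).
  by move=> cf x; apply: cvgM; [exact: cf|exact: cg].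
have c'0 : 0 < c^-1 by rewrite invr_gt0.
pose a' x := c^-1 * a x.
have ia' := @int a' (c^-1 * Ma) _ _.
have ib := int _ _ bM mb.
have := @prekopa_leindler_logit R g (fun x => a' x * g x) (fun x => b x * g x) cg g0.
move=> /(_ _ _ (cgm b cb) _ _ _ ib _ _) PLL.
have {PLL} : tot (fun x => a' x * g x) * tot (fun x => b x * g x) <= 1.
  have ca' : continuous a' by move=> x; apply: cvgM; [exact: cvg_cst|exact: ca].
  apply: PLL.
  - exact: cgm.
  - by move=> x; rewrite !mulr_gt0.
  - by move=> x; rewrite mulr_gt0.
  - apply/integrableP; split; first exact/measurable_EFinP.
    under eq_integral do rewrite /= ger0_norm ?(ltW (g0 _))//.
    by rewrite g1 ltry.
  - apply: ia'; last exact: continuous_measurable_fun.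
    by move=> x; rewrite mulr_gt0//= ler_pM2l//; case/andP: (aM x).
  - by rewrite /tot /Rintegral g1.
  - move=> x y; rewrite mulrACA ler_wpM2r ?mulr_ge0 ?(ltW (g0 _))//.
    by rewrite /a' -mulrA ler_pdivrMl// -!FE; exact: H.
have [fa _] := probability_integral_fin m ma aM.
have [fb _] := probability_integral_fin m mb bM.
rewrite /tot /Rintegral.
have -> : (\int[leb]_x (a' x * g x)%:E = c^-1%:E * \int[m]_x (a x)%:E)%E.
  rewrite -intE; [|by move=> x; rewrite mulr_gt0|exact: measurable_funM].
  under eq_integral do rewrite /a' EFinM.
  rewrite ge0_integralZl//; first exact/measurable_EFinP.
  - by move=> x _; exact: ge0.
  - by rewrite lee_fin ltW.
rewrite -intE// fineM//= -mulrA ler_pdivrMl// mulr1.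
by rewrite -lee_fin EFinM !fineK.
Qed.

End tensorization.

(** * Densities proportional to exp(-|x|^r) *)

Section power_cost.
Context {R : realType}.
Implicit Types (r t x y b : R).

Lemma expR_le_1D2x x : 0 <= x -> x <= 2^-1 -> expR x <= 1 + 2 * x.
Proof.
move=> x0 x2.
have H : 1 - x <= expR (- x) by exact: expR_ge1Dx.
have : expR x * (1 - x) <= 1.
  by rewrite -[leRHS](expRxMexpNx_1 x) ler_wpM2l// expR_ge0.
have := expR_gt0 x; nra.
Qed.

Lemma expR1_le4 : expR 1 <= 4 :> R.
Proof.
have := @expR_le_1D2x 2^-1; rewrite lexx => /(_ ltac:(lra) isT).
have -> : expR 1 = expR 2^-1 * expR 2^-1 :> R by rewrite -expRD; congr expR; lra.
by have := expR_gt0 (2^-1 : R); nra.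
Qed.

Lemma powR_superadd r x b : 1 <= r -> 0 <= x -> 0 <= b -> x `^ r + b `^ r <= (x + b) `^ r.
Proof.
move=> r1 x0 b0.
have [s0|s0] := eqVneq (x + b) 0.
  have /eqP := s0; rewrite paddr_eq0// => /andP[/eqP-> /eqP->].
  by rewrite addr0 powR0 ?addr0//; apply: contraTneq r1 => ->; rewrite -ltNge.
have sp : 0 < x + b by rewrite lt_neqAle eq_sym s0 addr_ge0.
have H z : 0 <= z -> z <= x + b -> z `^ r <= z / (x + b) * (x + b) `^ r.
  move=> z0 zs.
  have [->|zn] := eqVneq z 0.
    by rewrite powR0 ?mul0r//; apply: contraTneq r1 => ->; rewrite -ltNge.
  have zp : 0 < z by rewrite lt_neqAle eq_sym zn.
  rewrite -{1}(divfK s0 z); apply: ge1r_powRZ => //; last exact: ltW.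
  by rewrite divr_gt0//= ler_pdivrMr// mul1r.
apply: (le_trans (lerD (H x x0 _) (H b b0 _))); rewrite ?lerDl ?lerDr//.
by rewrite -mulrDl -mulrDl divff// mul1r.
Qed.

Lemma continuous_absp r : 1 <= r -> continuous (fun x : R => `|x| `^ r).
Proof.
move=> r1 x; have r0 : r != 0 by apply: contraTneq r1 => ->; rewrite -ltNge.
have [->|x0] := eqVneq x 0.
  apply/cvgrPdist_le => e e0; rewrite normr0 powR0//.
  exists (Num.min 1 e) => /=; first by rewrite lt_min ltr01.
  move=> y /=; rewrite !sub0r !normrN (ger0_norm (powR_ge0 _ _)) lt_min => /andP[y1 ye].
  have [->|y0] := eqVneq y 0; first by rewrite normr0 powR0// ltW.
  apply: (@le_trans _ _ `|y|); last exact: ltW.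
  by apply: ge1r_powR => //; rewrite normr_gt0 y0/= ltW.
apply: (cvg_comp (fun x : R => `|x|) (fun x => x `^ r)).
  by apply: cvg_norm; exact: cvg_id.
suff C : {for `|x|, continuous (fun z : R => z `^ r)} by exact: C.
apply/differentiable_continuous/derivable1_diffP.
by apply: derivable_powR; rewrite in_itv/= andbT normr_gt0.
Qed.

(* The cost of a coordinate in the set D_p replacing B_p: t^2 for small t, |t|^r for large t. *)
Definition phi r t := if `|t| <= 1 then t ^+ 2 else `|t| `^ r.

Lemma phi_ge0 r t : 0 <= phi r t.
Proof. by rewrite /phi; case: ifP => _; rewrite ?sqr_ge0 ?powR_ge0. Qed.

Lemma phiN r t : phi r (- t) = phi r t.
Proof. by rewrite /phi normrN sqrrN. Qed.

(** Replaces convexity, which fails for [r < 2]: the slope of [phi] drops from 2 to [r] at 1. It is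
    what lets a point outside a ball be shrunk into it at the expected rate. *)
Lemma phi_scale r t K : 1 <= r -> 1 <= K -> phi r (t / K) <= phi r t / K.
Proof.
move=> r1 K1; have K0 : 0 < K by exact: lt_le_trans K1.
have KV : 0 < K^-1 <= 1 by rewrite invr_gt0 K0 invf_le1.
rewrite /phi normrM (gtr0_norm (_ : 0 < K^-1)) ?invr_gt0//.
have [/ltW K'0 K'1] := andP KV.
have [t1|t1] := leP `|t| 1.
  rewrite mulr_ile1// exprMn ler_wpM2l ?sqr_ge0// expr2 ler_piMl//.
have tr : `|t| <= `|t| `^ r by apply: le1r_powR => //; exact: ltW.
case: ifPn => [tK|tK].
  rewrite -real_normK ?num_real// normrM (gtr0_norm (_ : 0 < K^-1)) ?invr_gt0//.
  rewrite expr2 (le_trans (_ : _ <= `|t| / K))//.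
    by rewrite ler_piMl// divr_ge0// ltW.
  by rewrite ler_wpM2r// invr_ge0 ltW.
by rewrite mulrC [leRHS]mulrC ge1r_powRZ.
Qed.

Lemma phi_ge_lin r t : 1 <= r -> 1 <= `|t| -> `|t| <= phi r t.
Proof.
move=> r1 t1; rewrite /phi; case: ifPn => [t1'|_]; last exact: le1r_powR.
have -> : `|t| = 1 by apply/eqP; rewrite eq_le t1 t1'.
by rewrite -real_normK ?num_real// (_ : `|t| = 1) ?expr1n//; apply/eqP; rewrite eq_le t1 t1'.
Qed.

Lemma kapC (u v : R) : kap u v = kap v u.
Proof.
rewrite /kap (mulrC (1 - u) v) (mulrC u (1 - v)); congr (_ / _).
  by congr (_ ^+ 2); rewrite addrC.
by rewrite mulrAC.
Qed.

End power_cost.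
(** [(s + t)^2 / (4 * s * t)] depends only on [s / t] and increases on the ratios above 1. *)
Lemma kap_arith {R : realType} (s t Q : R) : 0 < s -> 0 < t -> 1 <= Q -> Q * t <= s ->
  (1 + Q) ^+ 2 / (4 * Q) <= (s + t) ^+ 2 / (4 * s * t).
Proof.
move=> s0 t0 Q1 H; have Q0 : 0 < Q by lra.
rewrite ler_pdivrMr ?mulr_gt0// mulrAC ler_pdivlMr ?mulr_gt0//.
have : 0 <= (s - Q * t) * (Q * s - t).
  by apply: mulr_ge0; nra.
nra.
Qed.

Lemma kap_ge {R : realType} (u v Q : R) : 0 < u < 1 -> 0 < v < 1 -> 1 <= Q ->
  Q ^+ 2 * ((1 - u) * v) <= u * (1 - v) -> (1 + Q) ^+ 2 / (4 * Q) <= kap u v.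
Proof.
move=> /andP[u0 u1] /andP[v0 v1] Q1 H.
have p0 : 0 < u * (1 - v) by rewrite mulr_gt0// subr_gt0.
have q0 : 0 < (1 - u) * v by rewrite mulr_gt0// subr_gt0.
apply: kap_arith; rewrite ?sqrtr_gt0//.
have -> : Q = Num.sqrt (Q ^+ 2) by rewrite sqrtr_sqr ger0_norm//; lra.
by rewrite -sqrtrM ?sqr_ge0// ler_wsqrtr.
Qed.

(* The three regimes of the displacement b: quadratic, intermediate, power. *)
Lemma kap_ge_phi {R : realType} (u v b r : R) : 1 <= r -> 0 <= b -> 0 < u < 1 -> 0 < v < 1 ->
  (forall l, 1 <= l -> (l <= expR ((b / 2) `^ r)) \/ (b <= 2 /\ l <= 1 + b / 4) ->
    l * ((1 - u) * v) <= u * (1 - v)) ->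
  expR (phi r (b / 128)) <= kap u v.
Proof.
move=> r1 b0 u01 v01 H.
have nb : `|b / 128| = b / 128 by rewrite ger0_norm// divr_ge0.
have quad Q : 1 <= Q -> b <= 64 -> 1 + b ^+ 2 / (64 * 128) <= (1 + Q) ^+ 2 / (4 * Q) ->
    expR (phi r (b / 128)) <= (1 + Q) ^+ 2 / (4 * Q).
  move=> Q1 b64; apply: le_trans.
  rewrite /phi nb ifT; last by lra.
  apply: (le_trans (expR_le_1D2x _ _)); [by rewrite sqr_ge0|nra|nra].
have [b2|b2] := leP b 2.
  have Q1 : 1 <= 1 + b / 10 by lra.
  apply: (le_trans (quad (1 + b / 10) Q1 _ _)); first lra.
    by rewrite ler_pdivlMr; nra.
  (* [(1 + b / 10)^2 <= 1 + b / 4] for [b <= 2], so this [Q] falls under the second alternative on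
     [l]. *)
  apply: kap_ge => //; apply: H; first by nra.
  by right; split=> //; nra.
have B2 : b / 2 <= (b / 2) `^ r by apply: le1r_powR => //; lra.
pose Q2 := (b / 2) `^ r.
have QE : expR (Q2 / 2) ^+ 2 = expR Q2.
  by rewrite expr2 -expRD; congr expR; rewrite -splitr.
have Q21 : 1 <= expR (Q2 / 2) by rewrite -[leLHS]expR0 ler_expR; move: B2; rewrite -/Q2; lra.
have kQ : (1 + expR (Q2 / 2)) ^+ 2 / (4 * expR (Q2 / 2)) <= kap u v.
  apply: kap_ge => //; apply: H; last by left; rewrite QE.
  by rewrite QE -[leLHS]expR0 ler_expR; move: B2; rewrite -/Q2; lra.
apply: le_trans kQ.
have [b64|b64] := leP b 64.
  apply: quad => //.
  have Qb : 1 + b / 4 <= expR (Q2 / 2).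
    by rewrite (le_trans _ (expR_ge1Dx _))//; move: B2; rewrite -/Q2; lra.
  move: (expR (Q2 / 2)) Qb => Q Qb.
  have h1 : b ^+ 2 <= 16 * (Q - 1) ^+ 2 by nra.
  have h2 : b * (Q - 1) <= 4 * (Q - 1) ^+ 2 by nra.
  have h3 : 0 <= (64 - b) * (b * (Q - 1)) by apply: mulr_ge0; nra.
  by rewrite ler_pdivlMr; nra.
(* Beyond 64 the rough bound [(1 + Q)^2 / (4 * Q) >= Q / 4] suffices: the factor 64 between [b / 2]
   and [b / 128] leaves ample room in the exponent to absorb the 4. *)
apply: (@le_trans _ _ (expR (Q2 / 2) / 4)); last first.
  move: (expR (Q2 / 2)) Q21 => Q Q1.
  by rewrite ler_pdivlMr; nra.
have Q32 : 32 <= Q2 by move: B2; rewrite -/Q2; lra.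
apply: (@le_trans _ _ (expR (Q2 / 32))).
  rewrite ler_expR /phi nb; case: ifPn => [b1|b1]; first by nra.
  have -> : b / 128 = 64^-1 * (b / 2) by lra.
  apply: (le_trans (ge1r_powRZ _ _ r1)); [by rewrite invr_gt0 ltr0n invf_le1 ?ler1n|lra|].
  by rewrite -/Q2; lra.
have -> : Q2 / 2 = Q2 / 32 + Q2 * (15 / 32) by lra.
rewrite expRD -mulrA ler_peMr ?expR_ge0// ler_pdivlMr// mul1r.
by apply: le_trans (expR_ge1Dx _); lra.
Qed.

Section shift.
Context {R : realType}.
Notation leb := (@lebesgue_measure R).
Notation RR := (measurableTypeR R).
Local Open Scope ereal_scope.

Lemma lebesgue_measure_shift (b : R) (A : set RR) : measurable A ->
  leb ((fun x : RR => (x + b)%R : RR) @^-1` A) = leb A.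
Proof.
move=> mA.
have mb : measurable_fun setT (fun x : RR => (x + b)%R : RR).
  by apply: continuous_measurable_fun => x; apply: cvgD; [exact: cvg_id|exact: cvg_cst].
apply/esym.
apply: (@lebesgue_measure_unique R (measure_function_pushforward__canonical__measure_function_Measure leb mb)) => // _ [[u v]] _ <-.
rewrite /= /pushforward.
have -> : (fun x : RR => (x + b)%R : RR) @^-1` `]u, v] = `](u - b)%R, (v - b)%R]%classic.
  by apply/seteqP; split => x /=; rewrite !in_itv/= ltrBlDr lerBrDr.
rewrite !lebesgue_measure_itv/= !lte_fin ltrD2r; case: ifP => // _.
by rewrite -!EFinB; congr EFin; rewrite opprB addrA subrK.
Qed.

Lemma ge0_integral_shift (f : RR -> \bar R) (b : R) :
  measurable_fun setT f -> (forall x, 0 <= f x) ->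
  \int[leb]_x f (x + b)%R = \int[leb]_x f x.
Proof.
move=> mf f0.
have mb : measurable_fun setT (fun x : RR => (x + b)%R : RR).
  by apply: continuous_measurable_fun => x; apply: cvgD; [exact: cvg_id|exact: cvg_cst].
have H := @ge0_integral_pushforward _ _ _ _ _ _ mb leb setT f measurableT mf (fun x _ => f0 x).
rewrite preimage_setT in H; rewrite -[LHS]H.
apply: eq_measure_integral => A mA _; exact: lebesgue_measure_shift.
Qed.

Lemma ge0_integral_opp (f : RR -> \bar R) :
  measurable_fun setT f -> (forall x, 0 <= f x) ->
  \int[leb]_x f (- x)%R = \int[leb]_x f x.
Proof.
move=> mf f0.
have mb : measurable_fun setT (fun x : RR => (- x)%R : RR).
  by apply: continuous_measurable_fun => x; apply: cvgN; exact: cvg_id.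
have H := @ge0_integral_pushforward _ _ _ _ _ _ mb leb setT f measurableT mf (fun x _ => f0 x).
rewrite preimage_setT in H; rewrite -[LHS]H.
apply: eq_measure_integral => A mA _; exact: lebesgue_measureN.
Qed.

End shift.

(** [cr] is left free: total mass one forces its sign and the bounds [4^-1 <= cr <= 2], which are
    uniform in [r]. *)
Definition explaw {R : realType} (m : probability (measurableTypeR R) R) (r cr : R) :=
  1 <= r /\ forall A : set (measurableTypeR R), measurable A ->
   m A = (\int[lebesgue_measure]_(x in A) (cr * expR (- (`|x| `^ r)))%:E)%E.

(** * Tails of the laws and lower bound for the logit cost *)

Section explaw_theory.
Context {R : realType}.
Notation leb := (@lebesgue_measure R).
Notation RR := (measurableTypeR R).
Variables (m : probability RR R) (r cr : R).
Hypothesis law : explaw m r cr.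

Let r1 : 1 <= r. Proof. by case: law. Qed.
Let mE := law.2.
Let g (x : R) := cr * expR (- (`|x| `^ r)).

Lemma continuous_explaw : continuous g.
Proof.
move=> x; apply: cvgM; first exact: cvg_cst.
apply: (cvg_comp (fun x : R => - (`|x| `^ r)) expR); last exact: continuous_expR.
by apply: cvgN; exact: continuous_absp.
Qed.

Let mg : measurable_fun setT g.
Proof. by apply: continuous_measurable_fun; exact: continuous_explaw. Qed.

Lemma explaw_cr_gt0 : 0 < cr.
Proof.
rewrite ltNge; apply/negP => cr0.
have := probability_setT m; rewrite mE// => H.
have g0 x : 0 <= - g x by rewrite oppr_ge0 mulr_le0_ge0// expR_ge0.
have : (\int[leb]_x (g x)%:E <= 0)%E.
  have -> : (\int[leb]_x (g x)%:E = - \int[leb]_x (- g x)%:E)%E.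
    rewrite -integral_ge0N => [|x _]; last by rewrite lee_fin.
    by apply: eq_integral => x _; rewrite EFinN oppeK.
  by rewrite oppe_le0; apply: integral_ge0 => x _; rewrite lee_fin.
by rewrite H lee_fin ler10.
Qed.

Let g0 x : 0 < g x.
Proof. by rewrite mulr_gt0 ?expR_gt0// explaw_cr_gt0. Qed.

Let mEi (D : set RR) : measurable D ->
  m D = (\int[leb]_x ((g x)%:E * (\1_D x)%:E))%E.
Proof. by move=> mD; rewrite mE// integral_mkcond epatch_indic. Qed.

Let mgi (D : set RR) : measurable D ->
  measurable_fun setT (fun x : RR => (g x)%:E * (\1_D x)%:E)%E.
Proof.
move=> mD; apply: emeasurable_funM; first exact/measurable_EFinP.
by apply/measurable_EFinP; exact: measurable_indic.
Qed.

Let gi0 (D : set RR) x : (0 <= (g x)%:E * (\1_D x)%:E)%E.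
Proof. by rewrite mule_ge0// lee_fin// ltW. Qed.

Let g_shift (b x : R) : 0 <= b -> 0 <= x ->
  ((g (x + b))%:E <= (expR (- (b `^ r)))%:E * (g x)%:E)%E.
Proof.
move=> b0 x0; rewrite -EFinM lee_fin /g mulrCA ler_wpM2l ?(ltW explaw_cr_gt0)//.
rewrite -expRD ler_expR -opprD lerN2 addrC !ger0_norm ?addr_ge0//.
exact: powR_superadd.
Qed.

(** By superadditivity of the power, the density at [x + b] is at most [expR (- b^r)] times the
    density at [x >= 0]. *)
Lemma explaw_shift (a b : R) : 0 <= a -> 0 <= b ->
  (m `](a + b)%R, +oo[%classic <= (expR (- (b `^ r)))%:E * m `]a, +oo[%classic)%E.
Proof.
move=> a0 b0; rewrite !mEi// -(ge0_integral_shift b (mgi _) (gi0 _))//.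
rewrite -ge0_integralZl//; last exact: mgi.
apply: ge0_le_integral => //.
- apply: (measurableT_comp (f := fun x => (g x)%:E * (\1_`](a + b)%R, +oo[ x)%:E)%E) => //.
    exact: mgi.
  by apply: continuous_measurable_fun => x; apply: cvgD; [exact: cvg_id|exact: cvg_cst].
- by apply: emeasurable_funM => //; exact: mgi.
move=> x _; rewrite !indicE !mem_setE !in_itv/= !andbT ltrD2r.
have := @g_shift b x b0; move: (g (x + b)) (g x) (expR (- (b `^ r))) => u v w H.
have [ax|_] := ltP a x; last by rewrite !mule0.
by rewrite !mule1; apply: H; exact: le_trans (ltW ax).
Qed.

Definition cdfm (x : R) : R := fine (m `]-oo, x]%classic).

Let mfin (A : set RR) : measurable A -> m A \is a fin_num.
Proof. by move=> mA; exact: fin_num_measure. Qed.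

Lemma explaw_tail a : (m `]a, +oo[%classic = (cdfm (- a))%:E)%E.
Proof.
have E : (m `]-oo, (- a)%R]%classic = m `]-oo, (- a)%R[%classic)%E.
  rewrite mE// [RHS]mE// integral_itv_bndo_bndc//.
  by apply/measurable_EFinP/measurable_funTS.
rewrite /cdfm fineK ?mfin// E !mEi// -(ge0_integral_opp (mgi _) (gi0 _))//.
apply: eq_integral => x _; rewrite /g normrN !indicE !mem_setE !in_itv/= andbT.
by rewrite ltrNr.
Qed.

Lemma cdfmN a : cdfm (- a) = 1 - cdfm a.
Proof.
apply: EFin_inj; rewrite -explaw_tail -setCitvl probability_setC// EFinB.
by rewrite /cdfm fineK ?mfin.
Qed.

Lemma cdfm0 : cdfm 0 = 2^-1.
Proof. by have := cdfmN 0; rewrite oppr0; lra. Qed.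

Lemma cdfm_lt01 x : 0 < cdfm x < 1.
Proof.
have ig : leb.-integrable setT (EFin \o g).
  apply/integrableP; split; first exact/measurable_EFinP.
  under eq_integral do rewrite /= ger0_norm ?(ltW (g0 _))//.
  by rewrite -mE// probability_setT ltry.
have FE y : cdfm y = cum g y by rewrite /cdfm mE.
rewrite !FE (cum_gt0 continuous_explaw g0 ig)//=.
have -> : 1 = tot g by rewrite /tot /Rintegral -mE// probability_setT.
exact: cum_lt_tot continuous_explaw g0 ig x.
Qed.

Lemma cdfm_le x y : x <= y -> cdfm x <= cdfm y.
Proof.
move=> xy; rewrite fine_le ?mfin//; apply: le_measure; rewrite ?inE//.
by move=> z /=; rewrite !in_itv/= => /le_trans; exact.
Qed.

Lemma cdfm_shift a b : 0 <= a -> 0 <= b ->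
  expR (b `^ r) * cdfm (- (a + b)) <= cdfm (- a).
Proof.
move=> a0 b0; have := explaw_shift a0 b0; rewrite !explaw_tail -EFinM lee_fin expRN.
by rewrite mulrC ler_pdivlMr ?expR_gt0// mulrC.
Qed.

Lemma cdfm_increment (a b : R) : 0 <= a -> 0 <= b ->
  b * (cr * expR (- ((a + b) `^ r))) <= cdfm (- a) - cdfm (- (a + b)) <= b * cr.
Proof.
move=> a0 b0.
have E : (m `]a, +oo[%classic = m `]a, (a + b)%R]%classic + m `](a + b)%R, +oo[%classic)%E.
  rewrite -measureU//.
    congr (m _); apply/seteqP; split=> x /=; rewrite !in_itv/= !andbT.
      by move=> ax; case: (leP x (a + b)) => H; [left; rewrite ax|right].
    by case=> [/andP[]//|]; apply: le_lt_trans; rewrite lerDl.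
  apply/seteqP; split=> // x [] /=; rewrite !in_itv/= andbT => /andP[_ H1] H2.
  by move: (le_lt_trans H1 H2); rewrite ltxx.
have {E} -> : cdfm (- a) - cdfm (- (a + b)) = fine (m `]a, (a + b)%R]%classic).
  move: E; rewrite !explaw_tail -(fineK (mfin (measurable_itv `]a, (a + b)%R]))) -EFinD => -[->].
  by rewrite addrK.
have mab : measurable (`]a, (a + b)%R]%classic : set RR) by exact: measurable_itv.
have cstE (c : R) : (\int[leb]_(x in `]a, (a + b)%R]) (cst c%:E) x = (b * c)%:E)%E.
  rewrite integral_cst//= lebesgue_measure_itv/= lte_fin ltrDl.
  have [->|bn] := eqVneq b 0; first by rewrite mul0r ltxx mule0.
  rewrite lt_neqAle eq_sym bn b0/= -EFinB -EFinM addrAC subrr add0r mulrC.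
  by [].
have c0 := ltW explaw_cr_gt0.
rewrite -!lee_fin fineK ?mfin// mE// -!cstE; apply/andP; split.
- apply: ge0_le_integral; first exact: mab.
  + by move=> x _; rewrite lee_fin mulr_ge0 ?expR_ge0.
  + exact: measurable_cst.
  + by apply/measurable_EFinP/measurable_funTS.
  + move=> x /=; rewrite in_itv/= => /andP[ax xab].
    rewrite lee_fin ler_wpM2l// ler_expR lerN2.
    have x0 : 0 <= x by exact: le_trans (ltW ax).
    rewrite ger0_norm//; apply: ge0_ler_powR => //; rewrite ?nnegrE ?addr_ge0//.
    by rewrite (le_trans _ r1).
- apply: ge0_le_integral; first exact: mab.
  + by move=> x _; rewrite lee_fin mulr_ge0 ?expR_ge0.
  + by apply/measurable_EFinP/measurable_funTS.
  + exact: measurable_cst.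
  + move=> x _; rewrite lee_fin ler_piMr// -[leRHS]expR0 ler_expR oppr_le0.
Qed.

(** A shift by 1 divides the tail by at least [expR 1 >= 2], so []0, 1]] has mass at least 1/4, and
    the density is at most [cr]. *)
Lemma explaw_cr_ge : 4^-1 <= cr.
Proof.
have /andP[_] := @cdfm_increment 0 1 (lexx _) ler01.
have := @cdfm_shift 0 1 (lexx _) ler01.
rewrite !add0r !powR1 oppr0 cdfm0 mul1r.
have := expR_ge1Dx (1 : R).
have /andP[] := cdfm_lt01 (- 1).
move: (cdfm (- 1)) (expR 1) => c e c0 c1 e2 H1 H2.
have H3 : 2 * c <= e * c by rewrite ler_pM2r//; lra.
lra.
Qed.

Lemma cdfm_tail_le a : 0 <= a -> cdfm (- a) <= 2^-1 * expR (- (a `^ r)).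
Proof.
move=> a0; have := @cdfm_shift 0 a (lexx _) a0.
rewrite add0r oppr0 cdfm0 expRN ler_pdivlMr ?expR_gt0//.
by rewrite mulrC.
Qed.

(** For a small shift and a large [r] the gain [expR (b^r)] degenerates; this linear gain does not.
    It compares the mass of []a, a + b]], at least [b] times the density at the right end, with the
    tail beyond, at most half of [expR (- (a + b)^r)]. *)
Lemma cdfm_shift_lin a b : 0 <= a -> 0 <= b ->
  (1 + b / 2) * cdfm (- (a + b)) <= cdfm (- a).
Proof.
move=> a0 b0; have /andP[+ _] := cdfm_increment a0 b0.
have := cdfm_tail_le (addr_ge0 a0 b0); have := explaw_cr_ge.
have := expR_gt0 (- ((a + b) `^ r)).
move: (cdfm _) (cdfm _) (expR _) => c1 c2 e e0 crge H1 H2.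
have H3 : 4^-1 * e <= cr * e by rewrite ler_pM2r.
have H4 : c2 <= 2 * (cr * e) by lra.
have H5 : b * c2 <= b * (2 * (cr * e)) by rewrite ler_wpM2l.
lra.
Qed.

(** The odds ratio of [s] and [t] is a product of two ratios of tails. If both points lie on one
    side of 0, one ratio is the drop of a tail over the whole displacement; otherwise one of [s] and
    [- t] is at least half of it. Always a shift by half the displacement is available in one tail,
    while the other ratio is at least 1. *)
Lemma explaw_kap s t : expR (phi r ((s - t) / 128)) <= kap (cdfm s) (cdfm t).
Proof.
wlog ts : s t / t <= s.
  move=> H; have [|/ltW] := leP t s; first exact: H.
  by move=> /H; rewrite kapC -opprB mulNr phiN.
have b0 : 0 <= s - t by rewrite subr_ge0.
apply: kap_ge_phi => //; [exact: cdfm_lt01|exact: cdfm_lt01|].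
move=> l l1 lH.
set b := s - t in b0 lH *.
have shift a : 0 <= a -> l * cdfm (- (a + b / 2)) <= cdfm (- a).
  move=> a0; have b20 : 0 <= b / 2 by rewrite divr_ge0.
  have /andP[c0 _] := cdfm_lt01 (- (a + b / 2)).
  case: lH => [H|[_ H]].
    apply: le_trans (cdfm_shift a0 b20); by rewrite ler_pM2r.
  apply: le_trans (cdfm_shift_lin a0 b20); rewrite ler_pM2r//; lra.
have shift0 : l * cdfm (- (b / 2)) <= 2^-1.
  by have := shift 0 (lexx _); rewrite add0r oppr0 cdfm0.
have lo z : 0 < cdfm z < 1 by exact: cdfm_lt01.
have prod (p q p' q' : R) : 0 <= p' -> 0 <= q -> l * p' <= p -> q' <= q -> 0 <= q' -> l * (p' * q') <= p * q.
  move=> *; rewrite mulrA; apply: ler_pM => //; apply: mulr_ge0 => //; lra.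
have bE : b = s - t by [].
have [t0|t0] := leP 0 t.
  have H1 := shift t t0.
  have H2 : cdfm (- s) <= cdfm (- (t + b / 2)) by apply: cdfm_le; rewrite /b; lra.
  have H3 : cdfm t <= cdfm s by exact: cdfm_le.
  rewrite -!cdfmN [leRHS]mulrC.
  have /andP[? _] := lo (- s). have /andP[? _] := lo t. have /andP[? _] := lo s.
  apply: prod; [exact: ltW|exact: ltW| |by []|exact: ltW].
  apply: le_trans H1; rewrite ler_wpM2l//; lra.
have [s0|s0] := leP s 0.
  have s0' : 0 <= - s by lra.
  have H1 := shift (- s) s0'; rewrite opprK in H1.
  have H2 : cdfm t <= cdfm (- (- s + b / 2)) by apply: cdfm_le; rewrite /b; lra.
  have H3 : cdfm (- s) <= cdfm (- t) by apply: cdfm_le; lra.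
  rewrite -!cdfmN [X in l * X]mulrC.
  have /andP[? _] := lo (- s). have /andP[? _] := lo t. have /andP[? _] := lo (- t).
  apply: prod; [exact: ltW|exact: ltW| |by []|exact: ltW].
  apply: le_trans H1; rewrite ler_wpM2l//; lra.
have c0 := cdfm0.
(* Here 0 lies between [t] and [s]: one of [s] and [- t] is at least [b / 2], and its tail is
   compared with the mass 1/2 of a half-line. *)
have [sb|sb] := leP (b / 2) s.
  have H1 : cdfm (- s) <= cdfm (- (b / 2)) by apply: cdfm_le; lra.
  have H2 : cdfm 0 <= cdfm s by apply: cdfm_le; lra.
  have H3 : cdfm t <= cdfm (- t) by apply: cdfm_le; lra.
  rewrite -!cdfmN.
  have /andP[? _] := lo (- s). have /andP[? _] := lo t. have /andP[? _] := lo (- t).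
  apply: prod; [exact: ltW|exact: ltW| |by []|exact: ltW].
  by rewrite (le_trans (_ : _ <= l * cdfm (- (b / 2))))//; [rewrite ler_wpM2l//; lra|lra].
have H1 : cdfm t <= cdfm (- (b / 2)) by apply: cdfm_le; rewrite bE; move: sb; rewrite bE; lra.
have H2 : cdfm 0 <= cdfm (- t) by apply: cdfm_le; lra.
have H3 : cdfm (- s) <= cdfm s by apply: cdfm_le; lra.
rewrite -!cdfmN [X in l * X]mulrC [leRHS]mulrC.
have /andP[? _] := lo (- s). have /andP[? _] := lo t. have /andP[? _] := lo s.
apply: prod; [exact: ltW|exact: ltW| |by []|exact: ltW].
by rewrite (le_trans (_ : _ <= l * cdfm (- (b / 2))))//; [rewrite ler_wpM2l//; lra|lra].
Qed.

Lemma explaw_PL1 : PL1 m (fun x y => kap (cdfm x) (cdfm y)).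
Proof. exact: PL1_density continuous_explaw g0 mE. Qed.

End explaw_theory.

Section ge0_integral_extra.
Context {R : realType} {d} {T : measurableType d}.
Implicit Type mu : {measure set T -> \bar R}.

(** The integral of a nonnegative function is a supremum over the simple functions below it, and
    this set grows with the function. *)
Lemma le_integral_ge0 mu (f g : T -> \bar R) : (forall x, 0 <= f x <= g x)%E ->
  (\int[mu]_x f x <= \int[mu]_x g x)%E.
Proof.
move=> fg; have f0 x : (0 <= f x)%E by case/andP: (fg x).
have g0 x : (0 <= g x)%E by apply: le_trans (f0 x) _; case/andP: (fg x).
rewrite !ge0_integralTE//; apply: le_ereal_sup => _ [h hf <-]; exists h => //= x.
by rewrite (le_trans (hf x))//; case/andP: (fg x).
Qed.

Lemma le_integral_fin mu (f g : T -> R) : (forall x, 0 <= f x <= g x) ->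
  (\int[mu]_x (f x)%:E <= \int[mu]_x (g x)%:E)%E.
Proof. by move=> fg; apply: le_integral_ge0 => x; rewrite !lee_fin. Qed.

Lemma ge0_integralZ_fin mu (c : R) (f : T -> R) : 0 <= c -> (forall x, 0 <= f x) ->
  measurable_fun setT f -> (\int[mu]_x (c * f x)%:E = c%:E * \int[mu]_x (f x)%:E)%E.
Proof.
move=> c0 f0 mf; under eq_integral do rewrite EFinM.
rewrite ge0_integralZl_EFin//; first by move=> x _; rewrite lee_fin.
exact/measurable_EFinP.
Qed.

Lemma ge0_integralD_fin mu (f g : T -> R) : (forall x, 0 <= f x) -> (forall x, 0 <= g x) ->
  measurable_fun setT f -> measurable_fun setT g ->
  (\int[mu]_x (f x + g x)%:E = \int[mu]_x (f x)%:E + \int[mu]_x (g x)%:E)%E.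
Proof.
move=> f0 g0 mf mg; under eq_integral do rewrite EFinD.
rewrite ge0_integralD//; try exact/measurable_EFinP.
- by move=> x _; rewrite lee_fin.
- by move=> x _; rewrite lee_fin.
Qed.

Lemma integral_probability_cst (P : probability T R) (c : \bar R) : (\int[P]_x c = c)%E.
Proof. by rewrite integral_cst// [X in (_ * X)%E](probability_setT P) mule1. Qed.

End ge0_integral_extra.

(** * The Laplace law, uniform moments, linear forms *)

Section laplace.
Context {R : realType}.
Notation leb := (@lebesgue_measure R).
Notation RR := (measurableTypeR R).

Lemma measurable_expN_norm (c : R) : measurable_fun setT (fun x : RR => expR (- (c * `|x|))).
Proof.
apply: continuous_measurable_fun => x.
apply: (cvg_comp (fun x : R => - (c * `|x|)) expR); last exact: continuous_expR.
by apply: cvgN; apply: cvgM; [exact: cvg_cst|apply: cvg_norm; exact: cvg_id].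
Qed.

Lemma integral_expN_norm (c : R) : 0 < c ->
  (\int[leb]_x (expR (- (c * `|x|)))%:E = (2 / c)%:E)%E.
Proof.
move=> c0; rewrite ge0_symfun_integralT; last 3 first.
- by move=> x; exact: expR_ge0.
- move=> x; apply: (cvg_comp (fun x : R => - (c * `|x|)) expR); last exact: continuous_expR.
  by apply: cvgN; apply: cvgM; [exact: cvg_cst|apply: cvg_norm; exact: cvg_id].
- by move=> x /=; rewrite normrN.
rewrite EFinM; congr (_ * _)%E.
have mp : measurable_fun setT (EFin \o @exponential_pdf R c).
  by apply/measurable_EFinP; exact: measurable_exponential_pdf.
rewrite (_ : [set x : R | _] = `[0, +oo[%classic); last first.
  by apply/seteqP; split=> x /=; rewrite in_itv/= andbT.
rewrite integral_mkcond -[RHS]mule1 -(integral_exponential_pdf c0).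
rewrite -[in RHS](@ge0_integralZl_EFin)//.
- apply: eq_integral => x _ /=; rewrite /exponential_pdf !patchE.
  case: ifPn; last by rewrite mule0.
  rewrite inE/= in_itv/= andbT => x0; rewrite -EFinM ger0_norm// mulNr mulrA mulVf ?mul1r//.
  by rewrite gt_eqF.
- by move=> x _; rewrite lee_fin exponential_pdf_ge0// ltW.
- by rewrite invr_ge0 ltW.
Qed.

(** The exponent 1 is kept as a power so that the Laplace law is literally the case [r = 1] of
    [explaw]. *)
Let lapd (x : R) := 2^-1 * expR (- (`|x| `^ 1)).

Let lapdE x : lapd x = 2^-1 * expR (- (1 * `|x|)).
Proof. by rewrite /lapd powRr1// mul1r. Qed.

Let mlap : measurable_fun setT lapd.
Proof.
rewrite (_ : lapd = fun x => 2^-1 * expR (- (1 * `|x|))); last exact/funext/lapdE.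
by apply: measurable_funM => //; exact: measurable_expN_norm.
Qed.

Let lap0 x : 0 <= lapd x. Proof. by rewrite mulr_ge0 ?expR_ge0. Qed.

Let lap1 : (\int[leb]_x (lapd x)%:E = 1)%E.
Proof.
under eq_integral do rewrite lapdE EFinM.
rewrite ge0_integralZl_EFin//; last first.
- by apply/measurable_EFinP; exact: measurable_expN_norm.
by rewrite integral_expN_norm// -EFinM divr1 mulVf// pnatr_eq0.
Qed.

Definition laplace : probability RR R := density_probability mlap lap0 lap1.

Lemma explaw_laplace : explaw laplace 1 2^-1.
Proof. by split=> // A mA. Qed.

End laplace.

Section explaw_moments.
Context {R : realType}.
Notation leb := (@lebesgue_measure R).
Notation RR := (measurableTypeR R).
Variables (m : probability RR R) (r cr : R).
Hypothesis law : explaw m r cr.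

Let r1 := law.1.
Let cr0 := explaw_cr_gt0 law.

Lemma explaw_cr_le : cr <= 2.
Proof.
have := cdfm_increment law (lexx 0) ler01; rewrite oppr0 add0r powR1 mul1r (cdfm0 law).
move=> /andP[H _]; have /andP[c0 _] := cdfm_lt01 law (-1).
have H2 : cr * expR (-1) <= 2^-1 by lra.
rewrite expRN ler_pdivrMr ?expR_gt0// in H2.
have := @expR1_le4 R; lra.
Qed.

Lemma ge0_integral_explaw (F : RR -> \bar R) : measurable_fun setT F -> (forall x, 0 <= F x)%E ->
  (\int[m]_x F x = \int[leb]_x (F x * (cr * expR (- (`|x| `^ r)))%:E))%E.
Proof.
move=> mF F0; apply: ge0_integral_density => //.
- by apply: continuous_measurable_fun; exact: continuous_explaw law.
- by move=> x; rewrite mulr_ge0 ?expR_ge0// ltW.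
- exact: law.2.
Qed.

(** [|x| <= 1 + |x|^r] gives [expR (- |x|^r) <= expR 1 * expR (- |x|)]; with [cr <= 2] and
    [expR 1 <= 4] the factor is 8. This domination is the source of moment bounds uniform in [r]. *)
Lemma explaw_le (F : RR -> \bar R) : measurable_fun setT F -> (forall x, 0 <= F x)%E ->
  (\int[m]_x F x <= \int[leb]_x (F x * (8 * expR (- (1 * `|x|)))%:E))%E.
Proof.
move=> mF F0; rewrite (ge0_integral_explaw mF F0); apply: le_integral_ge0 => x.
rewrite mule_ge0 ?lee_fin ?mulr_ge0 ?expR_ge0 ?(ltW cr0)//=.
apply: lee_wpmul2l => //; rewrite lee_fin mul1r.
apply: (@le_trans _ _ (2 * (expR 1 * expR (- `|x|)))).
  apply: ler_pM; [exact: ltW|exact: expR_ge0|exact: explaw_cr_le|].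
  rewrite -expRD ler_expR lerNl opprD opprK addrC lerBlDr.
  have [x1|x1] := leP `|x| 1; first by rewrite (le_trans x1)// lerDr powR_ge0.
  by rewrite -[leLHS]powRr1// (@le_trans _ _ (`|x| `^ r))// ?lerDl// ler_powR// ltW.
rewrite mulrA ler_wpM2r ?expR_ge0//; have := @expR1_le4 R; lra.
Qed.

Lemma explaw_sym (F : RR -> \bar R) : measurable_fun setT F -> (forall x, 0 <= F x)%E ->
  (\int[m]_x F (- x)%R = \int[m]_x F x)%E.
Proof.
move=> mF F0.
have mo : measurable_fun setT (fun x : RR => - x : RR).
  by apply: continuous_measurable_fun => x; apply: cvgN; exact: cvg_id.
have mg : measurable_fun setT (fun x : RR => (cr * expR (- (`|x| `^ r)))%:E).
  apply/measurable_EFinP.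
  by apply: continuous_measurable_fun; exact: continuous_explaw law.
rewrite !ge0_integral_explaw//; last exact: (measurableT_comp (f := F)).
rewrite -[RHS]ge0_integral_opp; last 2 first.
- exact: emeasurable_funM.
- by move=> x; rewrite mule_ge0// lee_fin mulr_ge0 ?expR_ge0// ltW.
by apply: eq_integral => x _; rewrite normrN.
Qed.

Lemma explaw_expmoment : (\int[m]_x (expR (`|x| / 2))%:E <= 32%:E)%E.
Proof.
have mE : measurable_fun setT (fun x : RR => (expR (`|x| / 2))%:E).
  apply/measurable_EFinP; apply: eq_measurable_fun (measurable_expN_norm (- 2^-1)) => x _.
  by rewrite mulNr opprK mulrC.
have e0 (x : RR) : (0 <= (expR (`|x| / 2))%:E)%E by rewrite lee_fin expR_ge0.
apply: (le_trans (explaw_le mE e0)).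
rewrite (eq_integral (fun x : RR => 8%:E * (expR (- (2^-1 * `|x|)))%:E)%E); last first.
  move=> x _; rewrite -!EFinM mulrCA -expRD; congr (_ * expR _)%:E; lra.
rewrite ge0_integralZl_EFin//; last first.
- by apply/measurable_EFinP; exact: measurable_expN_norm.
by rewrite integral_expN_norm// -EFinM lee_fin invrK; lra.
Qed.

Lemma explaw_moment (F : RR -> R) K : 0 <= K -> measurable_fun setT F ->
  (forall x, 0 <= F x <= K * expR (`|x| / 2)) ->
  (\int[m]_x (F x)%:E <= (K * 32)%:E)%E.
Proof.
move=> K0 mF FK.
have me : measurable_fun setT (fun x : RR => expR (`|x| / 2)).
  apply: eq_measurable_fun (measurable_expN_norm (- 2^-1)) => x _.
  by rewrite mulNr opprK mulrC.
rewrite (le_trans (le_integral_fin _ FK))// ge0_integralZ_fin// EFinM.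
by rewrite lee_wpmul2l ?lee_fin//; exact: explaw_expmoment.
Qed.

End explaw_moments.

Section prodP_moments.
Context {R : realType}.
Notation RR := (measurableTypeR R).

Lemma measurable_tnth_comp n (f : RR -> R) i : measurable_fun setT f ->
  measurable_fun setT (fun z : n.-tuple RR => f (tnth z i)).
Proof. by move=> mf; apply: (measurableT_comp (f := f)) => //; exact: measurable_tnth. Qed.

Lemma prodP_integral_prod (m : probability RR R) n (f : 'I_n -> RR -> R) (c : 'I_n -> R) :
  (forall i, measurable_fun setT (f i)) -> (forall i x, 0 <= f i x) ->
  (forall i, \int[m]_x (f i x)%:E = (c i)%:E)%E ->
  (\int[prodP m n]_z (\prod_(i < n) f i (tnth z i))%:E = (\prod_(i < n) c i)%:E)%E.
Proof.
elim: n f c => [|n IH] f c mf f0 fc; first by rewrite integral_prodP0 !big_ord0.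
rewrite integral_prodPS; last 2 first.
- apply/measurable_EFinP/measurable_prod => i _; exact: measurable_tnth_comp.
- by move=> x; rewrite lee_fin; apply: prodr_ge0.
pose c' := \prod_(i < n) c (lift ord0 i).
have c0 i : 0 <= c i.
  by rewrite -lee_fin -fc; apply: integral_ge0 => x _; rewrite lee_fin.
rewrite (eq_integral (fun t => (c' * f ord0 t)%:E)); last first.
  move=> t _; rewrite (eq_integral (fun z => (f ord0 t * \prod_(i < n) f (lift ord0 i) (tnth z i))%:E)); last first.
    by move=> z _; rewrite big_ord_recl; under eq_bigr do rewrite tnth_tconsS.
  rewrite ge0_integralZ_fin//.
  - by rewrite (IH (fun i => f (lift ord0 i)) (fun i => c (lift ord0 i)))// -EFinM mulrC.
  - by move=> x; apply: prodr_ge0.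
  - by apply: measurable_prod => i _; exact: measurable_tnth_comp.
rewrite ge0_integralZ_fin ?fc -?EFinM//; last exact: prodr_ge0.
by rewrite big_ord_recl mulrC.
Qed.

Lemma prodP_integral_prod_le (m : probability RR R) n (f : 'I_n -> RR -> R) (c : 'I_n -> R) :
  (forall i, measurable_fun setT (f i)) -> (forall i x, 0 <= f i x) ->
  (forall i, \int[m]_x (f i x)%:E <= (c i)%:E)%E ->
  (\int[prodP m n]_z (\prod_(i < n) f i (tnth z i))%:E <= (\prod_(i < n) c i)%:E)%E.
Proof.
move=> mf f0 fc.
have i0 i : (0 <= \int[m]_x (f i x)%:E)%E by apply: integral_ge0 => x _; rewrite lee_fin.
have fE i : (\int[m]_x (f i x)%:E = (fine (\int[m]_x (f i x)%:E))%:E)%E.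
  by rewrite fineK// ge0_fin_numE// (le_lt_trans (fc i))// ltry.
rewrite (prodP_integral_prod mf f0 fE) lee_fin; apply: ler_prod => i _.
by rewrite -!lee_fin -fE fc i0.
Qed.

Lemma prodP_integral_coord (m : probability RR R) n (f : RR -> R) (i : 'I_n) c :
  measurable_fun setT f -> (forall x, 0 <= f x) -> (\int[m]_x (f x)%:E <= c%:E)%E ->
  (\int[prodP m n]_z (f (tnth z i))%:E <= c%:E)%E.
Proof.
move=> mf f0 fc.
have /= := @prodP_integral_prod_le m n (fun j => if j == i then f else fun=> 1)
  (fun j => if j == i then c else 1).
rewrite (eq_integral (fun z => (f (tnth z i))%:E)); last first.
  move=> z _; rewrite (bigD1 i)//= eqxx big1 ?mulr1// => j /negPf ji.
  by rewrite ji.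
rewrite [X in (_ <= X%:E)%E](bigD1 i)//= eqxx big1 ?mulr1; last by move=> j /negPf ->.
apply.
- by move=> j; case: ifP.
- by move=> j x; case: ifP.
- by move=> j; case: ifP => // _; rewrite integral_probability_cst.
Qed.

End prodP_moments.

Lemma cosh_le {R : realType} (u : R) : expR u + expR (- u) <= 2 + u ^+ 2 * expR `|u|.
Proof.
wlog u0 : u / 0 <= u.
  move=> H; have [/H//|u0] := leP 0 u.
  by have := H (- u); rewrite oppr_ge0 (ltW u0) opprK sqrrN normrN addrC; exact.
rewrite (ger0_norm u0).
have h1 : 0 <= 1 - expR (- u) by rewrite subr_ge0 -expR0 ler_expR oppr_le0.
have h2 : 1 - expR (- u) <= u by have := expR_ge1Dx (- u); lra.
have h3 : (1 - expR (- u)) ^+ 2 <= u ^+ 2 by rewrite ler_sqr.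
have h4 : expR u * expR (- u) = 1 by rewrite expRxMexpNx_1.
have := ler_wpM2r (ltW (expR_gt0 u)) h3.
set a := expR u in h4 *; set b := expR (- u) in h4 *.
have -> : (1 - b) ^+ 2 * a = a + b - 2 by rewrite (_ : _ * a = a - 2 * (a * b) + (a * b) * b); [rewrite h4; ring|ring].
lra.
Qed.

Lemma sqr_le_expR {R : realType} (t : R) : t ^+ 2 * expR (`|t| / 4) <= 32 * expR (`|t| / 2).
Proof.
have -> : `|t| / 2 = `|t| / 4 + `|t| / 4 by lra.
rewrite expRD mulrA ler_wpM2r ?expR_ge0// -real_normK ?num_real//.
have /(expR_ge1Dxn 1) : 0 <= `|t| / 4 by rewrite divr_ge0.
rewrite (_ : 2`!%:R = 2 :> R)// => H.
have : `|t| ^+ 2 = 32 * ((`|t| / 4) ^+ 2 / 2) by field.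
by move=> ->; rewrite ler_pM2l//; apply: le_trans H; rewrite lerDr.
Qed.

Section prodP_linear_forms.
Context {R : realType}.
Notation RR := (measurableTypeR R).
Variables (m : probability RR R) (r cr : R).
Hypothesis law : explaw m r cr.

Let measurable_expRM (s : R) : measurable_fun setT (fun t : RR => expR (s * t)).
Proof.
apply: continuous_measurable_fun => x.
apply: (cvg_comp (fun x : R => s * x) expR); last exact: continuous_expR.
by apply: cvgM; [exact: cvg_cst|exact: cvg_id].
Qed.

Let measurable_absp (f : R -> R) : continuous f -> measurable_fun setT (fun t : RR => f t).
Proof. by move=> cf; exact: continuous_measurable_fun. Qed.

(** The odd part is removed under the integral sign, before any estimate, so that all the integrals
    stay nonnegative. *)
Lemma explaw_symE (F : R -> R) : measurable_fun setT (F : RR -> RR) -> (forall t, 0 <= F t) ->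
  (\int[m]_t (F t)%:E = \int[m]_t (2^-1 * (F t + F (- t)))%:E)%E.
Proof.
move=> mF F0.
have mo : measurable_fun setT (fun x : RR => - x : RR).
  by apply: continuous_measurable_fun => x; apply: cvgN; exact: cvg_id.
have mFo : measurable_fun setT (fun x : RR => F (- x)) by exact: (measurableT_comp (f := F)).
rewrite ge0_integralZ_fin//; last 2 first.
- by move=> t; rewrite addr_ge0.
- exact: measurable_funD.
rewrite ge0_integralD_fin// (explaw_sym law (F := fun t => (F t)%:E)); last 2 first.
- exact/measurable_EFinP.
- by move=> x; rewrite lee_fin.
have I0 : (0 <= \int[m]_x (F x)%:E)%E by apply: integral_ge0 => x _; rewrite lee_fin.
rewrite ge0_muleDr// -ge0_muleDl ?lee_fin// -EFinD.
by rewrite (_ : 2^-1 + 2^-1 = 1) ?mul1e//; lra.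
Qed.

(** After symmetrization only the hyperbolic cosine remains, and it is 1 plus a term of order [s^2];
    [|s| <= 4^-1] keeps the remaining exponential factor integrable. 512 is 16 times the exponential
    moment 32. *)
Lemma explaw_mgf (s : R) : `|s| <= 4^-1 ->
  (\int[m]_t (expR (s * t))%:E <= (expR (512 * s ^+ 2))%:E)%E.
Proof.
move=> s4.
rewrite explaw_symE; [|exact: measurable_expRM|by move=> t; exact: expR_ge0].
apply: (@le_trans _ _ (\int[m]_t (1 + s ^+ 2 * 16 * expR (`|t| / 2))%:E)%E).
  apply: le_integral_fin => t; rewrite mulr_ge0 ?addr_ge0 ?expR_ge0//= mulrN.
  have -> : 1 + s ^+ 2 * 16 * expR (`|t| / 2) = 2^-1 * (2 + s ^+ 2 * 32 * expR (`|t| / 2)) by lra.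
  rewrite ler_pM2l//.
  apply: le_trans (cosh_le _) _; rewrite lerD2l exprMn -[leRHS]mulrA -[leLHS]mulrA.
  apply: ler_wpM2l; first by rewrite sqr_ge0.
  apply: le_trans (sqr_le_expR _); rewrite ler_wpM2l ?sqr_ge0// ler_expR normrM mulrC.
  by rewrite ler_wpM2l.
have me : measurable_fun setT (fun t : RR => expR (`|t| / 2)).
  apply: eq_measurable_fun (measurable_expN_norm (- 2^-1)) => x _.
  by rewrite mulNr opprK mulrC.
have c0 : 0 <= s ^+ 2 * 16 by rewrite mulr_ge0 ?sqr_ge0.
rewrite ge0_integralD_fin//; last 2 first.
- by move=> t; rewrite mulr_ge0 ?expR_ge0.
- exact: measurable_funM.
rewrite integral_probability_cst ge0_integralZ_fin//.
apply: (@le_trans _ _ (1%:E + (s ^+ 2 * 16)%:E * 32%:E)%E).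
  by rewrite leeD2l// lee_wpmul2l ?lee_fin//; exact: explaw_expmoment law.
rewrite -!EFinM -EFinD lee_fin.
by have := expR_ge1Dx (512 * s ^+ 2); lra.
Qed.

Lemma measurable_linear_form n (a : 'I_n -> R) :
  measurable_fun setT (fun z : n.-tuple RR => \sum_(i < n) a i * tnth z i).
Proof.
apply: measurable_sum => i; apply: measurable_funM => //; exact: measurable_tnth.
Qed.

Lemma linear_mgf n (a : 'I_n -> R) (s : R) : (forall i, `|s * a i| <= 4^-1) ->
  (\int[prodP m n]_z (expR (s * \sum_(i < n) a i * tnth z i))%:E <=
   (expR (512 * s ^+ 2 * \sum_(i < n) a i ^+ 2))%:E)%E.
Proof.
move=> sa.
have := prodP_integral_prod_le (f := fun i t => expR (s * a i * t))
  (fun i => measurable_expRM _) (fun i t => expR_ge0 _) (fun i => explaw_mgf (sa i)).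
rewrite -expR_sum (eq_integral (fun z : n.-tuple RR => (expR (s * \sum_(i < n) a i * tnth z i))%:E)); last first.
  by move=> z _; rewrite -expR_sum mulr_sumr; under [in RHS]eq_bigr do rewrite mulrA.
rewrite (_ : \sum_(i < n) 512 * (s * a i) ^+ 2 = 512 * s ^+ 2 * \sum_(i < n) a i ^+ 2)//.
by rewrite mulr_sumr; apply: eq_bigr => i _; rewrite exprMn mulrA.
Qed.

(** With [s = 1 / (32 * sg)] and its opposite, the exponent [512 * s^2 * sg^2] is 1/2 and each
    [s * a i] is at most 1/32; the exponential of an absolute value is at most the sum of the two
    exponentials. *)
Lemma linear_expmoment n (a : 'I_n -> R) (sg : R) : 0 < sg -> \sum_(i < n) a i ^+ 2 <= sg ^+ 2 ->
  (\int[prodP m n]_z (expR (`|\sum_(i < n) a i * tnth z i| / (32 * sg)))%:E <= 8%:E)%E.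
Proof.
move=> sg0 asg.
have H (e : R) : `|e| = 1 ->
   (\int[prodP m n]_z (expR (e / (32 * sg) * \sum_(i < n) a i * tnth z i))%:E <= 4%:E)%E.
  move=> e1; apply: le_trans (linear_mgf _) _.
    move=> i; have ai : `|a i| <= sg.
      rewrite -(@ler_pXn2r _ 2)// ?nnegrE; last exact: ltW.
      apply: le_trans asg; rewrite (bigD1 i)//=.
      by rewrite real_normK ?num_real// lerDl sumr_ge0// => j _; rewrite sqr_ge0.
    rewrite normrM normf_div e1 (gtr0_norm (x := _ * sg)) ?mulr_gt0//.
    by rewrite mulrAC mul1r ler_pdivrMr ?mulr_gt0//; lra.
  rewrite lee_fin; apply: le_trans (@expR1_le4 R); rewrite ler_expR.
  have -> : 512 * (e / (32 * sg)) ^+ 2 = 2^-1 / sg ^+ 2.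
    by rewrite !exprMn -[e ^+ 2]real_normK ?num_real// e1 expr1n exprVn exprMn; field; rewrite gt_eqF.
  rewrite mulrAC ler_pdivrMr ?exprn_gt0// mul1r.
  by apply: le_trans asg; rewrite ler_piMl ?sumr_ge0// => [i _|]; [rewrite sqr_ge0|lra].
have mE (c : R) : measurable_fun setT (fun z : n.-tuple RR => expR (c * \sum_(i < n) a i * tnth z i)).
  apply: measurableT_comp => //; apply: measurable_funM => //; exact: measurable_linear_form.
apply: (@le_trans _ _ (\int[prodP m n]_z (expR (1 / (32 * sg) * \sum_(i < n) a i * tnth z i) + expR (- 1 / (32 * sg) * \sum_(i < n) a i * tnth z i))%:E)%E).
  apply: le_integral_fin => z; rewrite expR_ge0/=.
  case: (ler0P (\sum_(i < n) a i * tnth z i)) => _.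
    by rewrite [X in _ + expR X]mulrAC mulN1r lerDr expR_ge0.
  by rewrite mulrAC mul1r lerDl expR_ge0.
rewrite ge0_integralD_fin//; try by move=> z; exact: expR_ge0.
rewrite (_ : 8%:E = 4%:E + 4%:E)%E; last by rewrite -EFinD; congr EFin; lra.
by apply: leeD; apply: H; rewrite ?normrN normr1.
Qed.

Lemma powR_le_expR (q u : R) : 0 < q -> 0 <= u -> u `^ q <= q `^ q * expR u.
Proof.
move=> q0 u0.
have -> : u = q * (u / q) by rewrite mulrCA mulfV ?mulr1// gt_eqF.
rewrite powRM ?divr_ge0 ?(ltW q0)// ler_wpM2l ?powR_ge0//.
rewrite [q * _]mulrC expRM.
apply: ge0_ler_powR; rewrite ?nnegrE ?divr_ge0 ?expR_ge0 ?(ltW q0)//.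
by apply: le_trans (expR_ge1Dx _); rewrite lerDr.
Qed.

Lemma linear_moment n (a : 'I_n -> R) (sg q : R) : 0 < q -> 0 < sg ->
  \sum_(i < n) a i ^+ 2 <= sg ^+ 2 ->
  (\int[prodP m n]_z (`|\sum_(i < n) a i * tnth z i| `^ q)%:E <= (8 * (32 * q) `^ q * sg `^ q)%:E)%E.
Proof.
move=> q0 sg0 asg.
have c0 : 0 <= (32 * sg) `^ q * q `^ q by rewrite mulr_ge0 ?powR_ge0.
apply: (@le_trans _ _ (\int[prodP m n]_z ((32 * sg) `^ q * q `^ q * expR (`|\sum_(i < n) a i * tnth z i| / (32 * sg)))%:E)%E).
  apply: le_integral_fin => z; rewrite powR_ge0/= -mulrA.
  have s0 : 0 < 32 * sg by rewrite mulr_gt0.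
  apply: (@le_trans _ _ ((32 * sg) `^ q * (`|\sum_(i < n) a i * tnth z i| / (32 * sg)) `^ q)).
    rewrite -powRM ?divr_ge0 ?(ltW s0)// mulrCA mulfV ?mulr1// gt_eqF//.
  by rewrite ler_wpM2l ?powR_ge0// powR_le_expR// divr_ge0// ltW.
rewrite ge0_integralZ_fin//; last first.
  apply: measurableT_comp => //; apply: measurable_funM => //.
  apply: measurableT_comp => //; exact: measurable_linear_form.
rewrite (_ : 8 * _ * _ = (32 * sg) `^ q * q `^ q * 8); last first.
  by rewrite !powRM ?ltW//; ring.
by rewrite [X in (_ <= X)%E]EFinM lee_wpmul2l ?lee_fin//; exact: linear_expmoment.
Qed.

Definition explaw_var := fine (\int[m]_t (t ^+ 2)%:E)%E.

Let msq : measurable_fun setT (fun t : RR => t ^+ 2 : R).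
Proof. by apply: continuous_measurable_fun => x; apply: cvgM; exact: cvg_id. Qed.

Lemma explaw_varE : (\int[m]_t (t ^+ 2)%:E = explaw_var%:E)%E.
Proof.
rewrite fineK// ge0_fin_numE; last by apply: integral_ge0 => t _; rewrite lee_fin sqr_ge0.
apply: le_lt_trans (explaw_moment law (K := 32) _ msq _) _; rewrite ?ltry// => x.
rewrite sqr_ge0/=; apply: le_trans (sqr_le_expR x).
by rewrite ler_peMr ?sqr_ge0// -expR0 ler_expR divr_ge0.
Qed.

(** The density is at most 2, so each side keeps mass at least 1/4 beyond 1/8, and 2 * (1/4) *
    (1/64) = 1/128. *)
Lemma explaw_var_ge : 128^-1 <= explaw_var.
Proof.
rewrite -lee_fin -explaw_varE.
have H : 4^-1 <= cdfm m (- (8^-1)).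
  have h8 : 0 <= 8^-1 :> R by lra.
  have := cdfm_increment law (lexx 0) h8.
  rewrite add0r oppr0 (cdfm0 law) => /andP[_].
  have := explaw_cr_le law; lra.
have mI : measurable (`]8^-1, +oo[%classic : set RR) by exact: measurable_itv.
apply: (@le_trans _ _ (2%:E * \int[m]_t (64^-1 * \1_`]8^-1, +oo[ t)%:E)%E).
  rewrite ge0_integralZ_fin// integral_indic// setIT.
  rewrite [X in (_ <= _ * (_ * X))%E](explaw_tail law).
  by rewrite -!EFinM lee_fin; lra.
rewrite explaw_symE//; last by apply: measurable_funM => //; exact: measurable_indic.
rewrite -ge0_integralZ_fin//; last first.
- have mi : measurable_fun setT (fun t : RR => 64^-1 * \1_`]8^-1, +oo[ t : R).
    by apply: measurable_funM => //; exact: measurable_indic.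
  have mo : measurable_fun setT (fun x : RR => - x : RR).
    by apply: continuous_measurable_fun => x; apply: cvgN; exact: cvg_id.
  by apply: measurable_funM => //; apply: measurable_funD => //; exact: (measurableT_comp mi mo).
apply: le_integral_fin => t; rewrite mulr_ge0// ?mulr_ge0// ?addr_ge0 ?mulr_ge0//= !indicE !mem_setE !in_itv/= !andbT.
case: (ltP _ t) => t1; case: (ltP _ (- t)) => t2; rewrite ?mulr1 ?mulr0 ?addr0 ?add0r ?sqr_ge0//; nra.
Qed.

(** The offset [b] carries the coordinates already treated, which closes the induction. *)
Lemma linear_sqr n (a : 'I_n -> R) (b : R) :
  (\int[prodP m n]_z ((b + \sum_(i < n) a i * tnth z i) ^+ 2)%:E =
   (b ^+ 2 + explaw_var * \sum_(i < n) a i ^+ 2)%:E)%E.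
Proof.
elim: n a b => [|n IH] a b; first by rewrite integral_prodP0 !big_ord0 mulr0 !addr0.
rewrite integral_prodPS; last 2 first.
- apply/measurable_EFinP; apply: (measurableT_comp (f := fun t : RR => t ^+ 2 : R)) => //.
  by apply: measurable_funD => //; exact: measurable_linear_form.
- by move=> x; rewrite lee_fin sqr_ge0.
pose V := explaw_var * \sum_(i < n) a (lift ord0 i) ^+ 2.
have v0 : 0 <= explaw_var by apply: le_trans explaw_var_ge; rewrite invr_ge0.
have V0 : 0 <= V by rewrite mulr_ge0// sumr_ge0// => i _; rewrite sqr_ge0.
have mF : measurable_fun setT (fun t : RR => (b + a ord0 * t) ^+ 2 + V : R).
  apply: measurable_funD => //; apply: (measurableT_comp (f := fun t : RR => t ^+ 2 : R)) => //.
  by apply: measurable_funD => //; apply: measurable_funM.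
rewrite (eq_integral (fun t : RR => ((b + a ord0 * t) ^+ 2 + V)%:E)); last first.
  move=> t _; rewrite -IH; apply: eq_integral => z _; rewrite big_ord_recl/= addrA.
  by under eq_bigr do rewrite tnth_tconsS.
rewrite explaw_symE//; last by move=> t; rewrite addr_ge0 ?sqr_ge0.
rewrite (eq_integral (fun t : RR => ((b ^+ 2 + V) + a ord0 ^+ 2 * t ^+ 2)%:E)); last first.
  by move=> t _; congr EFin; field.
rewrite ge0_integralD_fin//; last 3 first.
- by move=> t; rewrite addr_ge0 ?sqr_ge0.
- by move=> t; apply: mulr_ge0; rewrite sqr_ge0.
- exact: measurable_funM.
rewrite integral_probability_cst ge0_integralZ_fin ?sqr_ge0//; last by move=> t; rewrite sqr_ge0.
rewrite explaw_varE -!EFinM -EFinD; congr EFin.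
by rewrite big_ord_recl /V; ring.
Qed.

(** Integrate [u^2 <= A * sg * u + u^4 / (A * sg)^2]. The fourth moment is at most [2^31 * sg^4], so
    [A = 2^20] makes the last term [sg^2 / 512]. The second moment is at least [sg^2 / 128], hence
    [sg^2 / 256] remains for the first term, and 28 = 20 + 8. *)
Lemma linear_abs_ge n (a : 'I_n -> R) (sg : R) : 0 <= sg -> \sum_(i < n) a i ^+ 2 = sg ^+ 2 ->
  ((sg / 2 ^+ 28)%:E <= \int[prodP m n]_z `|\sum_(i < n) a i * tnth z i|%:E)%E.
Proof.
move=> sg0 asg.
have I0 : (0 <= \int[prodP m n]_z `|\sum_(i < n) a i * tnth z i|%:E)%E.
  by apply: integral_ge0 => z _; rewrite lee_fin.
have [->|sgn0] := eqVneq sg 0; first by rewrite mul0r.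
have {}sg0 : 0 < sg by rewrite lt_neqAle eq_sym sgn0.
have := linear_sqr a 0; rewrite expr0n add0r asg => E2.
have mb : measurable_fun setT (fun z : n.-tuple RR => `|\sum_(i < n) a i * tnth z i|).
  by apply: measurableT_comp => //; exact: measurable_linear_form.
have mb4 : measurable_fun setT (fun z : n.-tuple RR => `|\sum_(i < n) a i * tnth z i| ^+ 4).
  exact: measurable_funX.
have E4 : (\int[prodP m n]_z (`|\sum_(i < n) a i * tnth z i| ^+ 4)%:E <= (2 ^+ 31 * sg ^+ 4)%:E)%E.
  have -> : 2 ^+ 31 * sg ^+ 4 = 8 * (32 * 4%:R) `^ 4%:R * sg `^ 4%:R.
    by rewrite !powR_mulrn ?(ltW sg0) ?mulr_ge0//; ring.
  have H4 : (0 : R) < 4%:R by rewrite ltr0n.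
  have := @linear_moment n a sg 4%:R H4 sg0; rewrite asg lexx => /(_ isT).
  by under eq_integral do rewrite powR_mulrn//.
set A : R := 2 ^+ 20.
have A0 : 0 < A by rewrite exprn_gt0.
have As0 : 0 < A * sg by rewrite mulr_gt0.
have : ((explaw_var * sg ^+ 2)%:E <= (A * sg)%:E * \int[prodP m n]_z `|\sum_(i < n) a i * tnth z i|%:E
    + ((A * sg) ^- 2)%:E * (2 ^+ 31 * sg ^+ 4)%:E)%E.
  rewrite -E2; apply: le_trans (leeD2l _ (lee_wpmul2l _ E4)); last by rewrite lee_fin invr_ge0 sqr_ge0.
  rewrite -!ge0_integralZ_fin// ?(ltW As0) ?invr_ge0 ?sqr_ge0//.
  rewrite -ge0_integralD_fin//; last 4 first.
  - by move=> z; rewrite mulr_ge0 ?(ltW As0).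
  - by move=> z; rewrite mulr_ge0 ?invr_ge0 ?sqr_ge0// exprn_ge0.
  - exact: measurable_funM.
  - exact: measurable_funM.
  apply: le_integral_fin => z; rewrite sqr_ge0/= add0r.
  rewrite -[leLHS]real_normK ?num_real//; set u := `| _ |.
  have u0 : 0 <= u by exact: normr_ge0.
  have [uA|/ltW Au] := leP u (A * sg).
    by rewrite expr2 (le_trans (ler_wpM2r u0 uA))// lerDl mulr_ge0 ?invr_ge0 ?sqr_ge0// exprn_ge0.
  apply: (@le_trans _ _ ((A * sg) ^- 2 * u ^+ 4)); last by rewrite lerDr mulr_ge0 ?(ltW As0).
  rewrite mulrC ler_pdivlMr ?exprn_gt0//.
  rewrite (_ : u ^+ 4 = u ^+ 2 * u ^+ 2); last by ring.
  by rewrite ler_wpM2l ?sqr_ge0// ler_sqr ?nnegrE ?(ltW As0).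
case: (integral _ _ _) I0 => [I I0| |]; rewrite ?leey ?leeNy_eq//.
rewrite -!EFinM -EFinD !lee_fin => H.
have v0 := explaw_var_ge.
have E : (A * sg) ^- 2 * (2 ^+ 31 * sg ^+ 4) = 512^-1 * sg ^+ 2.
  by rewrite /A; field; rewrite gt_eqF.
rewrite {}E in H.
have H2 : 128^-1 * sg ^+ 2 <= explaw_var * sg ^+ 2 by rewrite ler_wpM2r ?sqr_ge0.
have H3 : (256^-1 * sg) * sg <= (A * I) * sg.
  rewrite [leRHS]mulrAC -mulrA -expr2; move: H H2; set u := sg ^+ 2.
  have : 0 <= u by rewrite sqr_ge0.
  lra.
rewrite ler_pM2r// /A in H3.
by rewrite ler_pdivrMr ?exprn_gt0//; lra.
Qed.

End prodP_linear_forms.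

(** * Sublinear functions and their concentration *)

Section sublinear.
Context {R : realType}.
Notation RR := (measurableTypeR R).

Definition sublin n (h : ('I_n -> R) -> R) := [/\ forall x, 0 <= h x,
  forall x y, h (fun i => x i + y i) <= h x + h y &
  forall c x, 0 <= c -> h (fun i => c * x i) = c * h x].

Definition norm1 n (x : 'I_n -> R) : R := \sum_(i < n) `|x i|.

Lemma norm1_ge0 n (x : 'I_n -> R) : 0 <= norm1 x.
Proof. exact: sumr_ge0. Qed.

Definition unitv n (i j : 'I_n) : R := (i == j)%:R.

Section one.
Variables (n : nat) (h : ('I_n -> R) -> R).
Hypothesis hs : sublin h.

Lemma sublin_ge0 x : 0 <= h x. Proof. by case: hs. Qed.

Lemma sublinD x y : h (fun i => x i + y i) <= h x + h y. Proof. by case: hs. Qed.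

Lemma sublinZ c x : 0 <= c -> h (fun i => c * x i) = c * h x. Proof. by case: hs => _ _; exact. Qed.

Lemma sublin0 : h (fun=> 0) = 0.
Proof.
by have := @sublinZ 0 (fun=> 0) (lexx 0); under eq_fun do rewrite mul0r; rewrite mul0r.
Qed.

Lemma sublinB x y : h x - h y <= h (fun i => x i - y i).
Proof.
rewrite lerBlDl; apply: le_trans (sublinD _ _).
by under [in leRHS]eq_fun do rewrite addrC subrK.
Qed.

Lemma sublin_sum (I : Type) (s : seq I) (F : I -> 'I_n -> R) :
  h (fun j => \sum_(i <- s) F i j) <= \sum_(i <- s) h (F i).
Proof.
elim: s => [|i s IH].
  by rewrite big_nil; under eq_fun do rewrite big_nil; rewrite sublin0.
rewrite big_cons; under eq_fun do rewrite big_cons.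
by apply: le_trans (sublinD _ _) _; rewrite lerD2l.
Qed.

Lemma sublin_le_units x :
  h x <= \sum_(i < n) `|x i| * (h (unitv i) + h (fun j => - unitv i j)).
Proof.
have -> : x = fun j => \sum_(i < n) x i * unitv i j.
  apply/funext => j; rewrite (bigD1 j)//= big1 ?addr0; last first.
    by move=> i /negPf ij; rewrite /unitv ij mulr0.
  by rewrite /unitv eqxx mulr1.
apply: le_trans (sublin_sum _ _) _; apply: ler_sum => i _.
rewrite [in leRHS](bigD1 i)//= big1 ?addr0; last first.
  by move=> j /negPf ij; rewrite /unitv ij mulr0.
rewrite /unitv eqxx mulr1.
have := normr_ge0 (x i); case: (ler0P (x i)) => xi n0.
  have -> : (fun j => x i * (i == j)%:R) = (fun j => - x i * - (i == j)%:R).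
    by apply/funext => j; rewrite mulrNN.
  by rewrite sublinZ// ler_wpM2l// lerDr sublin_ge0.
by rewrite sublinZ// ler_wpM2l// lerDl sublin_ge0.
Qed.

Definition sublin_const := \sum_(i < n) (h (unitv i) + h (fun j => - unitv i j)).

Lemma sublin_const_ge0 : 0 <= sublin_const.
Proof. by apply: sumr_ge0 => i _; rewrite addr_ge0 ?sublin_ge0. Qed.

Lemma sublin_le_norm1 x : h x <= sublin_const * norm1 x.
Proof.
apply: le_trans (sublin_le_units x) _; rewrite mulrC /norm1 mulr_suml.
apply: ler_sum => i _; rewrite ler_wpM2l// /sublin_const (bigD1 i)//= lerDl sumr_ge0// => j _.
by rewrite addr_ge0 ?sublin_ge0.
Qed.

Lemma sublin_lip x y : `|h x - h y| <= sublin_const * norm1 (fun i => x i - y i).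
Proof.
rewrite ler_norml; apply/andP; split; last exact: le_trans (sublinB _ _) (sublin_le_norm1 _).
rewrite lerNl opprB; apply: le_trans (sublinB _ _) _; apply: le_trans (sublin_le_norm1 _) _.
by rewrite /norm1; under eq_bigr do rewrite distrC.
Qed.

Lemma norm1_fam_continuous (F : ('I_n -> R) -> R) (L : R) : 0 <= L ->
  (forall x y, `|F x - F y| <= L * norm1 (fun i => x i - y i)) -> fam_continuous F.
Proof.
move=> L0 HF x e e0.
have k0 : 0 < L * n%:R + 1 by rewrite ltr_wpDl// mulr_ge0.
exists (e / (L * n%:R + 1)); first exact: divr_gt0.
move=> y xy; apply: le_trans (HF _ _) _.
apply: (@le_trans _ _ (L * \sum_(i < n) (e / (L * n%:R + 1)))).
  by rewrite ler_wpM2l// ler_sum.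
rewrite sumr_const card_ord -[X in L * X]mulr_natl.
have -> : L * (n%:R * (e / (L * n%:R + 1))) = e * (L * n%:R) / (L * n%:R + 1) by ring.
by rewrite ler_pdivrMr// ler_wpM2l ?(ltW e0)// lerDl.
Qed.

Lemma sublin_continuous : fam_continuous h.
Proof. exact: norm1_fam_continuous sublin_const_ge0 sublin_lip. Qed.

Lemma measurable_sublin {d} {W : measurableType d} (X : 'I_n -> W -> R) :
  (forall i, measurable_fun setT (X i)) -> measurable_fun setT (fun w => h (X^~ w)).
Proof. by move=> mX; apply: measurable_fam_continuous => //; exact: sublin_continuous. Qed.

Lemma measurable_sublin_tnth : measurable_fun setT (fun z : n.-tuple RR => h (tnth z)).
Proof.
by apply: (@measurable_sublin _ _ (fun i (z : n.-tuple RR) => tnth z i)) => i; exact: measurable_tnth.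
Qed.

End one.

Definition mean n (m : probability RR R) (h : ('I_n -> R) -> R) : R :=
  fine (\int[prodP m n]_z (h (tnth z))%:E)%E.

Definition pball (r : R) n (p : R) : set ('I_n -> R) := [set x | \sum_(i < n) phi r (x i) <= p].

End sublinear.

Section sublinear_mean.
Context {R : realType}.
Notation RR := (measurableTypeR R).
Variables (m : probability RR R) (r cr : R).
Hypothesis law : explaw m r cr.

Lemma integral_norm1 n : (\int[prodP m n]_z (norm1 (tnth z))%:E <= (n%:R * 64)%:E)%E.
Proof.
rewrite /norm1; under eq_integral do rewrite -sumEFin.
have mn i : measurable_fun setT (fun z : n.-tuple RR => `|tnth z i| : R).
  by apply: measurableT_comp => //; exact: measurable_tnth.
rewrite ge0_integral_sum//; last by move=> i; exact/measurable_EFinP.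
apply: (@le_trans _ _ (\sum_(i < n) (64%:E : \bar R))%E).
  apply: lee_sum => i _; apply: (prodP_integral_coord (f := fun t : RR => `|t| : R)) => //.
    exact: measurableT_comp.
  rewrite (_ : 64 = 2 * 32); last by lra.
  have ma : measurable_fun setT (fun t : RR => `|t| : R) by exact: measurableT_comp.
  apply: (explaw_moment law) => //.
  by move=> x; rewrite normr_ge0/=; have := expR_ge1Dx (`|x| / 2); lra.
by rewrite sumEFin sumr_const card_ord mulr_natl.
Qed.

Lemma meanE n (h : ('I_n -> R) -> R) : sublin h ->
  (\int[prodP m n]_z (h (tnth z))%:E = (mean m h)%:E)%E.
Proof.
move=> hs; rewrite fineK// ge0_fin_numE; last first.
  by apply: integral_ge0 => z _; rewrite lee_fin sublin_ge0.
apply: (@le_lt_trans _ _ (\int[prodP m n]_z (sublin_const h * norm1 (tnth z))%:E)%E).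
  by apply: le_integral_fin => z; rewrite sublin_ge0//= sublin_le_norm1.
rewrite ge0_integralZ_fin ?sublin_const_ge0//; last 2 first.
- by move=> z; exact: norm1_ge0.
- apply: measurable_sum => i; apply: measurableT_comp => //; exact: measurable_tnth.
apply: (@le_lt_trans _ _ ((sublin_const h)%:E * (n%:R * 64)%:E)%E); last by rewrite -EFinM ltry.
by rewrite lee_wpmul2l ?lee_fin ?sublin_const_ge0//; exact: integral_norm1.
Qed.

Lemma mean_ge0 n (h : ('I_n -> R) -> R) : sublin h -> 0 <= mean m h.
Proof. by move=> hs; rewrite -lee_fin -meanE//; apply: integral_ge0 => z _; rewrite lee_fin sublin_ge0. Qed.

Lemma mean_le n (h g : ('I_n -> R) -> R) : sublin h -> sublin g -> (forall x, h x <= g x) ->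
  mean m h <= mean m g.
Proof.
move=> hs gs hg; rewrite -lee_fin -!meanE//; apply: le_integral_fin => z.
by rewrite sublin_ge0/=.
Qed.

(** Outside the ball, at cost [s > p], the point divided by [s / p] is in the ball by [phi_scale],
    and homogeneity gives [h x <= s]. A bound on the ball thus becomes a bound by the cost itself,
    the form needed in an exponent. *)
Lemma pball_le n (h : ('I_n -> R) -> R) p : sublin h -> 0 < p ->
  (forall x, pball r p x -> h x <= p) -> forall x, h x <= p + \sum_(i < n) phi r (x i).
Proof.
move=> hs p0 hp x; set s := \sum_(i < n) _.
have s0 : 0 <= s by apply: sumr_ge0 => i _; exact: phi_ge0.
have [sp|/ltW ps] := leP s p; first by apply: le_trans (hp _ sp) _; rewrite lerDl.
have K1 : 1 <= s / p by rewrite ler_pdivlMr// mul1r.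
have K0 : 0 < s / p by apply: lt_le_trans K1.
have H : h (fun i => (s / p)^-1 * x i) <= p.
  apply: hp; rewrite /pball/=.
  apply: (@le_trans _ _ (\sum_(i < n) phi r (x i) / (s / p))).
    by apply: ler_sum => i _; rewrite mulrC; apply: phi_scale => //; exact: law.1.
  by rewrite -mulr_suml -/s invf_div mulrCA mulfV ?mulr1// gt_eqF// (lt_le_trans p0).
rewrite sublinZ ?invr_ge0 ?(ltW K0)// mulrC ler_pdivrMr// mulrCA mulfV ?mulr1 ?gt_eqF// in H.
by apply: le_trans H _; rewrite lerDr ltW.
Qed.

(** The tangent inequality for [expR] at the mean, with the negative term moved to the other side so
    that all integrands are nonnegative. *)
Lemma jensen_expN n (h : ('I_n -> R) -> R) (c : R) : sublin h -> 0 <= c ->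
  ((expR (- (c * mean m h)))%:E <= \int[prodP m n]_z (expR (- (c * h (tnth z))))%:E)%E.
Proof.
move=> hs c0; set t := c * mean m h.
have t0 : 0 <= t by rewrite mulr_ge0 ?mean_ge0.
have mh := measurable_sublin_tnth hs.
have me : measurable_fun setT (fun z : n.-tuple RR => expR (- (c * h (tnth z)))).
  apply: measurableT_comp => //; apply: measurableT_comp => //; exact: measurable_funM.
have : (\int[prodP m n]_z (expR (- t) * (1 + t))%:E <= \int[prodP m n]_z (expR (- (c * h (tnth z))))%:E
   + \int[prodP m n]_z (expR (- t) * c * h (tnth z))%:E)%E.
  rewrite -ge0_integralD_fin//; last 2 first.
  - by move=> z; rewrite !mulr_ge0 ?expR_ge0 ?sublin_ge0.
  - exact: measurable_funM.
  apply: le_integral_fin => z; rewrite mulr_ge0 ?expR_ge0 ?addr_ge0//=.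
  rewrite -mulrA; set u := c * h _.
  have -> : expR (- u) = expR (- t) * expR (t - u) by rewrite -expRD; congr expR; ring.
  by rewrite -mulrDr ler_wpM2l ?expR_ge0//; have := expR_ge1Dx (t - u); lra.
rewrite integral_probability_cst ge0_integralZ_fin ?mulr_ge0 ?expR_ge0//; last first.
  by move=> z; exact: sublin_ge0.
rewrite meanE// -EFinM -mulrA -/t; case: (integral _ _ _) => [I| |]; rewrite ?leey//.
by rewrite -EFinD !lee_fin; lra.
Qed.

Lemma loglip_sublin n (h : ('I_n -> R) -> R) : sublin h ->
  loglip (fun z : n.-tuple RR => expR (- (h (tnth z)))).
Proof.
move=> hs; split.
- by do 2! apply: measurableT_comp => //; exact: measurable_sublin_tnth.
- exists 1 => x; rewrite expR_gt0/= -expR0 ler_expR oppr_le0; exact: sublin_ge0.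
exists (sublin_const h); first exact: sublin_const_ge0.
move=> x y; rewrite -expRD ler_expR -lerBlDr opprK addrC.
by apply: le_trans (sublin_lip hs _ _); rewrite distrC ler_norm.
Qed.

Lemma loglip_sublin_min n (h : ('I_n -> R) -> R) (k : R) : sublin h -> 0 <= k ->
  loglip (fun z : n.-tuple RR => expR (Num.min (h (tnth z)) k)).
Proof.
move=> hs k0; split.
- by apply: measurableT_comp => //; apply: measurable_minr => //; exact: measurable_sublin_tnth.
- by exists (expR k) => x; rewrite expR_gt0/= ler_expR ge_min lexx orbT.
exists (sublin_const h); first exact: sublin_const_ge0.
move=> x y; rewrite -expRD ler_expR.
have H : h (tnth x) <= sublin_const h * l1dist x y + h (tnth y).
  by rewrite -lerBlDr; apply: le_trans (sublin_lip hs _ _); rewrite ler_norm.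
have d0 : 0 <= sublin_const h * l1dist x y by rewrite mulr_ge0 ?sublin_const_ge0// sumr_ge0.
have [hk|hk] := leP (h (tnth y)) k; first by rewrite ge_min H.
by rewrite ge_min lerDr d0 orbT.
Qed.

Lemma sublin_scale n (h : ('I_n -> R) -> R) (c : R) : sublin h -> 0 <= c -> sublin (fun x => c * h x).
Proof.
move=> hs c0; split=> [x|x y|a x a0]; first by rewrite mulr_ge0 ?sublin_ge0.
- by rewrite -mulrDr ler_wpM2l// sublinD.
- by rewrite sublinZ// mulrCA.
Qed.

Lemma mean_scale n (h : ('I_n -> R) -> R) (c : R) : sublin h -> 0 <= c ->
  mean m (fun x => c * h x) = c * mean m h.
Proof.
move=> hs c0; apply: EFin_inj; rewrite -meanE; last exact: sublin_scale.
rewrite ge0_integralZ_fin//; last 2 first.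
- by move=> z; exact: sublin_ge0.
- exact: measurable_sublin_tnth.
by rewrite meanE.
Qed.

(** For [g = h / 128], the difference [g x - g y] is at most [h ((x - y) / 128)], hence at most [p]
    plus the costs, and [expR (g x) * expR (- g y)] is at most [expR p] times the product of the
    [kap]. The tensorized inequality bounds the product of the integrals, and Jensen replaces the
    second one by [expR (- mean)]. The truncation at [k] supplies the boundedness in [loglip] and is
    removed by monotone convergence. *)
Lemma sublin_concentration n (h : ('I_n -> R) -> R) (p : R) : sublin h -> 0 < p ->
  (forall x, pball r p x -> h x <= p) ->
  (\int[prodP m n]_z (expR (h (tnth z) / 128))%:E <= (expR (p + mean m h / 128))%:E)%E.
Proof.
move=> hs p0 hp.
pose g x := 128^-1 * h x.
have gs : sublin g by apply: sublin_scale => //; lra.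
have step (k : nat) : (\int[prodP m n]_z (expR (Num.min (g (tnth z)) k%:R))%:E <=
    (expR (p + mean m h / 128))%:E)%E.
  have := PL_tensor (explaw_PL1 law) (c := expR p) (loglip_sublin_min gs (ler0n _ k)) (loglip_sublin gs).
  have le0 : (0 <= \int[prodP m n]_z (expR (Num.min (g (tnth z)) k%:R))%:E)%E.
    by apply: integral_ge0 => z _; rewrite lee_fin expR_ge0.
  have Hp (x y : n.-tuple RR) : expR (Num.min (g (tnth x)) k%:R) * expR (- g (tnth y)) <=
      expR p * \prod_(i < n) kap (cdfm m (tnth x i)) (cdfm m (tnth y i)).
    apply: (@le_trans _ _ (expR (p + \sum_(i < n) phi r ((tnth x i - tnth y i) / 128)))).
      rewrite -expRD ler_expR; apply: (@le_trans _ _ (g (tnth x) - g (tnth y))).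
        by rewrite lerD2r ge_min lexx.
      apply: le_trans (sublinB gs _ _) _; rewrite /g -sublinZ//.
      apply: le_trans (pball_le hs p0 hp _) _.
      by under eq_bigr do rewrite mulrC.
    rewrite expRD expR_sum ler_wpM2l ?expR_ge0//; apply: ler_prod => i _.
    by rewrite expR_ge0/=; exact: explaw_kap law _ _.
  move=> /(_ Hp) H.
  have := jensen_expN hs (c := 128^-1) _; rewrite invr_ge0 => /(_ (ler0n _ _)) J.
  have := le_trans (lee_wpmul2l le0 J) H.
  rewrite expRN -lee_pdivlMr ?invr_gt0 ?expR_gt0// invrK -EFinM -expRD.
  by rewrite [128^-1 * mean m h]mulrC.
have mg := measurable_sublin_tnth gs.
have mc (k : nat) : measurable_fun setT (fun z : n.-tuple RR => (expR (Num.min (g (tnth z)) k%:R))%:E).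
  by apply/measurable_EFinP; apply: measurableT_comp => //; apply: measurable_minr.
have ec (k : nat) (z : n.-tuple RR) : (0 <= (expR (Num.min (g (tnth z)) k%:R))%:E)%E.
  by rewrite lee_fin expR_ge0.
have mono (z : n.-tuple RR) : {homo (fun k : nat => (expR (Num.min (g (tnth z)) k%:R))%:E) : a b / (a <= b)%N >-> (a <= b)%E}.
  by move=> a b ab; rewrite lee_fin ler_expR le_min ge_min lexx ge_min ler_nat ab orbT.
have := @monotone_convergence _ _ _ (prodP m n) setT measurableT _ mc (fun k z _ => ec k z) (fun z _ => mono z).
rewrite (_ : (fun z => _) = fun z : n.-tuple RR => (expR (h (tnth z) / 128))%:E); last first.
  apply/funext => z; apply/cvg_lim => //.
  apply: cvg_near_cst; near=> k.
  congr (expR _)%:E; rewrite mulrC -/(g (tnth z)); apply/min_idPl.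
  by near: k; exact: nbhs_infty_ger.
move=> ->; apply: lime_le; last by apply: nearW => k; exact: step.
apply: ereal_nondecreasing_is_cvgn => a b ab.
by apply: le_integral_ge0 => z; rewrite ec/= mono.
Unshelve. all: by end_near. Qed.

(** [h] is rescaled by [p / K] so as to be at most [p] on the ball; [u^p <= p^p * expR u] turns the
    exponential moment into a p-th moment. 2048 is 128 times 16, a bound for [expR 2]. *)
Lemma sublin_moment n (h : ('I_n -> R) -> R) (p K : R) : sublin h -> 1 <= p -> 0 < K ->
  mean m h <= K -> (forall x, pball r p x -> h x <= K) ->
  (\int[prodP m n]_z (h (tnth z) `^ p)%:E <= ((2048 * K) `^ p)%:E)%E.
Proof.
move=> hs p1 K0 mK hK; have p0 : 0 < p by apply: lt_le_trans p1.
have pK0 : 0 <= p / K by rewrite divr_ge0 ?ltW.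
have gs := sublin_scale hs pK0.
have gp x : pball r p x -> p / K * h x <= p.
  by move=> /hK H; rewrite mulrAC ler_pdivrMr// ler_wpM2l ?(ltW p0).
have := sublin_concentration gs p0 gp; rewrite mean_scale// => H.
apply: (@le_trans _ _ (\int[prodP m n]_z ((128 * K) `^ p * expR (p / K * h (tnth z) / 128))%:E)%E).
  apply: le_integral_fin => z; rewrite powR_ge0/=.
  have h0 := sublin_ge0 hs (tnth z).
  set u := p / K * h (tnth z) / 128.
  have hu : h (tnth z) = (128 * K / p) * u by rewrite /u; field; rewrite !gt_eqF.
  have u0 : 0 <= u by rewrite /u divr_ge0// mulr_ge0.
  have c0 : 0 <= 128 * K / p by rewrite divr_ge0 ?mulr_ge0 ?ltW.
  rewrite hu powRM//; apply: (@le_trans _ _ ((128 * K / p) `^ p * (p `^ p * expR u))).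
    by rewrite ler_wpM2l ?powR_ge0// powR_le_expR.
  by rewrite mulrA -powRM ?(ltW p0)// divfK ?gt_eqF.
rewrite ge0_integralZ_fin ?powR_ge0//; last first.
  apply: measurableT_comp => //; apply: measurable_funM => //; apply: measurable_funM => //.
  exact: measurable_sublin_tnth.
apply: (@le_trans _ _ (((128 * K) `^ p)%:E * (expR (p + p / K * mean m h / 128))%:E)%E).
  by rewrite lee_wpmul2l ?lee_fin ?powR_ge0.
have -> : 2048 * K = 128 * K * 16 by ring.
rewrite -EFinM lee_fin (@powRM _ _ 16) ?mulr_ge0 ?(ltW K0)//.
rewrite ler_wpM2l ?powR_ge0//.
apply: (@le_trans _ _ (expR ((1 + 1) * p))).
  rewrite ler_expR mulrDl mul1r lerD2l.
  have : p / K * mean m h <= p by rewrite mulrAC ler_pdivrMr// ler_wpM2l ?(ltW p0).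
  by lra.
rewrite expRM; apply: ge0_ler_powR; rewrite ?nnegrE ?expR_ge0 ?(ltW p0)//.
have e4 := @expR1_le4 R; rewrite expRD (_ : 16 = 4 * 4); last by lra.
by apply: ler_pM => //; exact: expR_ge0.
Qed.

End sublinear_mean.

Section bisublinear.
Context {R : realType}.
Notation RR := (measurableTypeR R).

Definition bisublin n k (M : ('I_n -> R) -> ('I_k -> R) -> R) :=
  (forall y, sublin (M ^~ y)) /\ (forall x, sublin (M x)).

Variables (n k : nat) (M : ('I_n -> R) -> ('I_k -> R) -> R).
Hypothesis Ms : bisublin M.

Lemma bisublin_le_norm1 : exists2 K, 0 <= K & forall x y, M x y <= K * norm1 x * norm1 y.
Proof.
pose c j := sublin_const (M ^~ (unitv j)) + sublin_const (M ^~ (fun i => - unitv j i)).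
have c0 j : 0 <= c j by rewrite addr_ge0// sublin_const_ge0//; apply: Ms.1.
exists (\sum_(j < k) c j); first exact: sumr_ge0.
move=> x y; apply: le_trans (sublin_le_units (Ms.2 x) y) _.
rewrite /norm1 [leRHS]mulr_sumr; apply: ler_sum => j _; rewrite [leRHS]mulrC ler_wpM2l//.
apply: (@le_trans _ _ (c j * norm1 x)).
  by rewrite mulrDl lerD// (sublin_le_norm1 (Ms.1 _)).
by rewrite ler_wpM2r ?norm1_ge0// (bigD1 j)//= lerDl sumr_ge0.
Qed.

Lemma bisublin_continuous : fam_continuous
  (fun u : 'I_n + 'I_k -> R => M (fun i => u (inl i)) (fun j => u (inr j))).
Proof.
move=> u e e0; have [K K0 MK] := bisublin_le_norm1.
set x := fun i => u (inl i); set y := fun j => u (inr j).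
pose B := K * n%:R * norm1 y + K * (norm1 x + n%:R) * k%:R + 1.
have B1 : 1 <= B by rewrite lerDr addr_ge0// ?mulr_ge0// ?addr_ge0// ?norm1_ge0.
have B0 : 0 < B by apply: lt_le_trans B1.
pose dl := Num.min 1 (e / B).
have dl0 : 0 < dl by rewrite lt_min ltr01 divr_gt0.
have dl1 : dl <= 1 by rewrite ge_min lexx.
have nle q (a b : 'I_q -> R) : (forall i, `|a i - b i| <= dl) -> norm1 (fun i => a i - b i) <= q%:R * dl.
  by move=> ab; apply: (@le_trans _ _ (\sum_(i < q) dl)); [exact: ler_sum|rewrite sumr_const card_ord mulr_natl].
exists dl => // v uv; set x' := fun i => v (inl i); set y' := fun j => v (inr j).
have H1 : `|M x y - M x' y| <= K * (n%:R * dl) * norm1 y.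
  have a1 : norm1 (fun i => x i - x' i) <= n%:R * dl by apply: nle => i; exact: uv.
  have a2 : norm1 (fun i => x' i - x i) <= n%:R * dl by apply: nle => i; rewrite distrC; exact: uv.
  rewrite ler_norml lerNl opprB; apply/andP; split.
    apply: le_trans (sublinB (Ms.1 y) _ _) _; apply: le_trans (MK _ _) _.
    by rewrite ler_wpM2r ?norm1_ge0// ler_wpM2l.
  apply: le_trans (sublinB (Ms.1 y) _ _) _; apply: le_trans (MK _ _) _.
  by rewrite ler_wpM2r ?norm1_ge0// ler_wpM2l.
have x'n : norm1 x' <= norm1 x + n%:R.
  rewrite /norm1 -[in n%:R](card_ord n) -sumr_const -big_split/=; apply: ler_sum => i _.
  have -> : x' i = x i - (x i - x' i) by ring.
  by apply: le_trans (ler_normB _ _) _; rewrite lerD2l; apply: le_trans (uv (inl i)) _.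
have H2 : `|M x' y - M x' y'| <= K * (norm1 x + n%:R) * (k%:R * dl).
  have a1 : norm1 (fun i => y i - y' i) <= k%:R * dl by apply: nle => i; exact: uv.
  have a2 : norm1 (fun i => y' i - y i) <= k%:R * dl by apply: nle => i; rewrite distrC; exact: uv.
  rewrite ler_norml lerNl opprB; apply/andP; split.
    apply: le_trans (sublinB (Ms.2 x') _ _) _; apply: le_trans (MK _ _) _.
    by apply: ler_pM; rewrite ?mulr_ge0 ?norm1_ge0// ler_wpM2l.
  apply: le_trans (sublinB (Ms.2 x') _ _) _; apply: le_trans (MK _ _) _.
  by apply: ler_pM; rewrite ?mulr_ge0 ?norm1_ge0// ler_wpM2l.
have -> : M x y - M x' y' = (M x y - M x' y) + (M x' y - M x' y') by ring.
apply: le_trans (ler_normD _ _) _; apply: le_trans (lerD H1 H2) _.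
apply: (@le_trans _ _ (B * dl)).
  have -> : K * (n%:R * dl) * norm1 y + K * (norm1 x + n%:R) * (k%:R * dl) =
    (B - 1) * dl by rewrite /B; ring.
  by rewrite ler_wpM2r ?(ltW dl0)// gerBl.
by rewrite mulrC -ler_pdivlMr// ge_min lexx orbT.
Qed.

Lemma measurable_bisublin {d} {W : measurableType d} (X : 'I_n -> W -> R) (Y : 'I_k -> W -> R) :
  (forall i, measurable_fun setT (X i)) -> (forall i, measurable_fun setT (Y i)) ->
  measurable_fun setT (fun w => M (X ^~ w) (Y ^~ w)).
Proof.
move=> mX mY.
by apply: (measurable_fam_continuous (Z := fun i => match i with inl i => X i | inr j => Y j end) _ bisublin_continuous) => -[].
Qed.

Lemma measurable_bisublin_tnth :
  measurable_fun setT (fun u : n.-tuple RR * k.-tuple RR => M (tnth u.1) (tnth u.2)).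
Proof.
apply: (@measurable_bisublin _ _ (fun i (u : n.-tuple RR * k.-tuple RR) => tnth u.1 i)
  (fun j (u : n.-tuple RR * k.-tuple RR) => tnth u.2 j)) => i.
  by apply: (measurableT_comp (f := (@tnth n RR)^~ i)) => //; exact: measurable_tnth.
by apply: (measurableT_comp (f := (@tnth k RR)^~ i)) => //; exact: measurable_tnth.
Qed.

Variables (m : probability RR R) (r cr : R).
Hypothesis law : explaw m r cr.

Lemma sublin_mean_r : sublin (fun x => mean m (M x)).
Proof.
split=> [x|x y|c x c0]; first by apply: (mean_ge0 law); exact: Ms.2.
- rewrite -lee_fin EFinD -!(meanE law); try exact: Ms.2.
  rewrite -ge0_integralD_fin; last 4 first.
  + by move=> z; apply: sublin_ge0; exact: Ms.2.
  + by move=> z; apply: sublin_ge0; exact: Ms.2.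
  + by apply: measurable_sublin_tnth; exact: Ms.2.
  + by apply: measurable_sublin_tnth; exact: Ms.2.
  apply: le_integral_fin => z; rewrite (sublin_ge0 (Ms.2 _))/=; exact: sublinD (Ms.1 _) _ _.
- rewrite -(mean_scale law (Ms.2 x) c0); congr (mean _ _); apply/funext => y.
  by rewrite (sublinZ (Ms.1 y)).
Qed.

End bisublinear.

(** * Supremum over the ball: smoothing by the Laplace law *)

Section tuple_maps.
Context {R : realType}.
Notation RR := (measurableTypeR R).
Notation leb := (@lebesgue_measure R).

Definition tneg n (z : n.-tuple RR) : n.-tuple RR := [tuple - tnth z i | i < n].

Definition tadd n (y : 'I_n -> R) (z : n.-tuple RR) : n.-tuple RR := [tuple y i + tnth z i | i < n].

Lemma tnth_tneg n (z : n.-tuple RR) : tnth (tneg z) = fun i => - tnth z i.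
Proof. by apply/funext => i; rewrite tnth_mktuple. Qed.

Lemma tnth_tadd n (y : 'I_n -> R) (z : n.-tuple RR) : tnth (tadd y z) = fun i => y i + tnth z i.
Proof. by apply/funext => i; rewrite tnth_mktuple. Qed.

Lemma tneg_tcons n t (z : n.-tuple RR) : tneg (tcons t z) = tcons (- t : RR) (tneg z).
Proof.
apply: eq_from_tnth => i; rewrite tnth_tneg; case: (unliftP ord0 i) => [j|] ->.
  by rewrite !tnth_tconsS tnth_tneg.
by rewrite !tnth_tcons0.
Qed.

Lemma tadd_tcons n (y : 'I_n.+1 -> R) t (z : n.-tuple RR) :
  tadd y (tcons t z) = tcons (t + y ord0 : RR) (tadd (fun i => y (lift ord0 i)) z).
Proof.
apply: eq_from_tnth => i; rewrite tnth_tadd; case: (unliftP ord0 i) => [j|] ->.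
  by rewrite !tnth_tconsS tnth_tadd.
by rewrite !tnth_tcons0 addrC.
Qed.

Let measurable_oppRR : measurable_fun setT (fun x : RR => - x : RR).
Proof. by apply: continuous_measurable_fun => x; apply: cvgN; exact: cvg_id. Qed.

Let measurable_addRR (b : R) : measurable_fun setT (fun x : RR => b + x : RR).
Proof. by apply: continuous_measurable_fun => x; apply: cvgD; [exact: cvg_cst|exact: cvg_id]. Qed.

Let measurable_addrRR (b : R) : measurable_fun setT (fun x : RR => x + b : RR).
Proof. by apply: continuous_measurable_fun => x; apply: cvgD; [exact: cvg_id|exact: cvg_cst]. Qed.

Lemma measurable_tneg n : measurable_fun setT (@tneg n).
Proof.
apply/measurable_fun_tnthP => i.
apply: (eq_measurable_fun (fun z : n.-tuple RR => - tnth z i : RR)).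
  by move=> z _ /=; rewrite tnth_mktuple.
by apply: (measurableT_comp measurable_oppRR); exact: measurable_tnth.
Qed.

Lemma measurable_tadd n (y : 'I_n -> R) : measurable_fun setT (tadd y).
Proof.
apply/measurable_fun_tnthP => i.
apply: (eq_measurable_fun (fun z : n.-tuple RR => y i + tnth z i : RR)).
  by move=> z _ /=; rewrite tnth_mktuple.
by apply: (measurableT_comp (measurable_addRR _)); exact: measurable_tnth.
Qed.

Lemma integral_prodP_tneg (m : probability RR R) (r cr : R) (law : explaw m r cr) n
  (F : n.-tuple RR -> \bar R) : measurable_fun setT F -> (forall z, 0 <= F z)%E ->
  (\int[prodP m n]_z F (tneg z) = \int[prodP m n]_z F z)%E.
Proof.
elim: n F => [|n IH] F mF F0; first by rewrite !integral_prodP0; congr F; exact: tuple0.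
have mFn : measurable_fun setT (fun z => F (tneg z)).
  exact: (measurableT_comp (f := F) mF (@measurable_tneg _)).
rewrite (integral_prodPS _ mFn (fun z => F0 (tneg z))) (integral_prodPS _ mF F0).
rewrite -(explaw_sym law (F := fun t => \int[prodP m n]_z F (tcons t z))%E); last 2 first.
- exact: measurable_integral_tcons.
- by move=> t; apply: integral_ge0.
apply: eq_integral => t _; under eq_integral do rewrite tneg_tcons.
by apply: (IH (fun z => F (tcons (- t : RR) z))) => //; exact: measurable_tcons_l.
Qed.

(** Quasi-invariance: the exponential factor is the ratio of the Laplace densities at [x + y] and at
    [x]. *)
Lemma laplace_shift1 (F : RR -> \bar R) (y : R) : measurable_fun setT F -> (forall x, 0 <= F x)%E ->
  (\int[@laplace R]_x F x = \int[@laplace R]_x (F (x + y)%R * (expR (`|x| - `|x + y|))%:E))%E.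
Proof.
move=> mF F0.
have cn (b : R) : continuous (fun x : R => expR (- (`|x + b| `^ 1))).
  move=> x; apply: (cvg_comp (fun x : R => - (`|x + b| `^ 1)) expR); last exact: continuous_expR.
  apply: cvgN; apply: (cvg_comp (fun x : R => x + b) (fun x : R => `|x| `^ 1)); last exact: continuous_absp.
  by apply: cvgD; [exact: cvg_id|exact: cvg_cst].
have mn (b : R) : measurable_fun setT (fun x : RR => expR (- (`|x + b| `^ 1))).
  by apply: continuous_measurable_fun; exact: cn.
have mF' : measurable_fun setT (fun x : RR => F (x + y)) by exact: (measurableT_comp mF (measurable_addrRR y)).
have law := @explaw_laplace R.
rewrite (ge0_integral_explaw law mF F0) (ge0_integral_explaw law); last 2 first.
- apply: emeasurable_funM => //; apply/measurable_EFinP; apply: measurableT_comp => //.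
  have m1 : measurable_fun setT (fun x : RR => `|x| : R) by exact: measurableT_comp.
  have m2 : measurable_fun setT (fun x : RR => `|x + y| : R).
    exact: (measurableT_comp m1 (measurable_addrRR y)).
  exact: measurable_funB m1 m2.
- by move=> x; rewrite mule_ge0// lee_fin expR_ge0.
rewrite -(ge0_integral_shift y); last 2 first.
- apply: emeasurable_funM => //; apply/measurable_EFinP; apply: measurable_funM => //.
  by have := mn 0; under eq_fun do rewrite addr0.
- by move=> x; rewrite mule_ge0// lee_fin mulr_ge0 ?expR_ge0.
apply: eq_integral => x _; rewrite -muleA -EFinM; congr (_ * _%:E)%E.
by rewrite !powRr1// mulrCA -expRD; congr (_ * expR _); ring.
Qed.

Lemma laplace_shift n (F : n.-tuple RR -> \bar R) (y : 'I_n -> R) :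
  measurable_fun setT F -> (forall z, 0 <= F z)%E ->
  (\int[prodP (@laplace R) n]_z F z =
   \int[prodP (@laplace R) n]_z (F (tadd y z) * (expR (\sum_(i < n) (`|tnth z i| - `|tnth z i + y i|)))%:E))%E.
Proof.
elim: n F y => [|n IH] F y mF F0.
  by rewrite !integral_prodP0 big_ord0 expR0 mule1; congr F; exact: esym (tuple0 _).
have me k (v : 'I_k -> R) : measurable_fun setT (fun z : k.-tuple RR =>
   (expR (\sum_(i < k) (`|tnth z i| - `|tnth z i + v i|)))%:E).
  apply/measurable_EFinP; apply: measurableT_comp => //; apply: measurable_sum => i.
  apply: measurable_funB; apply: measurableT_comp => //; first exact: measurable_tnth.
  by apply: (measurableT_comp (measurable_addrRR _)); exact: measurable_tnth.
have mFy : measurable_fun setT (fun z => F (tadd y z)).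
  exact: (measurableT_comp (f := F) mF (measurable_tadd _)).
rewrite (integral_prodPS _ mF F0) integral_prodPS; last 2 first.
- by apply: emeasurable_funM; [exact: mFy|exact: me].
- by move=> z; rewrite mule_ge0// lee_fin expR_ge0.
rewrite (laplace_shift1 (y ord0) (F := fun t => \int[prodP laplace n]_z F (tcons t z))%E); last 2 first.
- exact: measurable_integral_tcons.
- by move=> t; apply: integral_ge0.
apply: eq_integral => t _.
have mFt : measurable_fun setT (fun z => F (tcons (t + y ord0 : RR) z)) by exact: measurable_tcons_l.
have mFt' : measurable_fun setT (fun z => F (tcons (t + y ord0 : RR) (tadd (fun i => y (lift ord0 i)) z))).
  exact: (measurableT_comp mFt (measurable_tadd _)).
rewrite (IH _ (fun i => y (lift ord0 i)) mFt (fun z => F0 _)) -ge0_integralZr; last 4 first.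
- exact: measurableT.
- by apply: emeasurable_funM; [exact: mFt'|exact: me].
- by move=> z _; rewrite mule_ge0// lee_fin expR_ge0.
- by rewrite lee_fin expR_ge0.
apply: eq_integral => z _; rewrite tadd_tcons -muleA -EFinM; congr (_ * _%:E)%E.
rewrite -expRD big_ord_recl addrC; congr (expR (_ + _)).
by apply: eq_bigr => i _; rewrite tnth_tconsS.
Qed.

End tuple_maps.

Section sup_tools.
Context {R : realType}.

Lemma sublin_sup (T : Type) (A : set T) n (f : T -> ('I_n -> R) -> R) :
  (forall z, has_ubound [set f a z | a in A]) ->
  (forall a x y, A a -> f a (fun i => x i + y i) <= f a x + f a y) ->
  (forall a c x, A a -> 0 <= c -> f a (fun i => c * x i) = c * f a x) ->
  (forall z, exists2 a, A a & 0 <= f a z) ->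
  sublin (fun z => sup [set f a z | a in A]).
Proof.
move=> ub fD fZ f0.
have A0 : A !=set0 by have [a Aa _] := f0 (fun=> 0); exists a.
have ne z : [set f a z | a in A] !=set0 by case: A0 => a Aa; exists (f a z), a.
have le z a : A a -> f a z <= sup [set f a z | a in A].
  by move=> Aa; apply: ub_le_sup => //; exists a.
have s0 z : 0 <= sup [set f a z | a in A].
  by have [a Aa fa] := f0 z; exact: le_trans fa (le _ _ Aa).
split=> // [x y|c x c0].
  apply: ge_sup => // _ [a Aa <-]; apply: le_trans (fD _ _ _ Aa) _.
  by rewrite lerD// le.
have sZ k z : 0 <= k -> sup [set f a (fun i => k * z i) | a in A] <= k * sup [set f a z | a in A].
  by move=> k0; apply: ge_sup => // _ [a Aa <-]; rewrite fZ// ler_wpM2l// le.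
apply/eqP; rewrite eq_le sZ//=.
have [->|cn] := eqVneq c 0; first by rewrite mul0r.
have {cn}c0 : 0 < c by rewrite lt_neqAle eq_sym cn.
rewrite -ler_pdivlMl//; apply: le_trans (sZ _ _ _); last by rewrite invr_ge0 ltW.
suff -> : (fun i => c^-1 * (c * x i)) = x by [].
by apply/funext => i; rewrite mulrA mulVf ?gt_eqF// mul1r.
Qed.

End sup_tools.

Section excess.
Context {R : realType}.
Notation RR := (measurableTypeR R).
Notation leb := (@lebesgue_measure R).

(** The cost, at the point [z], of translating the Laplace law by [y], once averaged over [z] and
    [- z]. *)
Definition excess (y z : R) : R := Num.max 0 (`|y| - `|z|).

Lemma excess_ge0 y z : 0 <= excess y z. Proof. by rewrite le_max lexx. Qed.

Lemma excess_le y z : excess y z <= `|y|.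
Proof. by rewrite ge_max normr_ge0/= gerBl. Qed.

Lemma excessN y z : excess y (- z) = excess y z. Proof. by rewrite /excess normrN. Qed.

Lemma continuous_excess y : continuous (excess y).
Proof.
move=> z; apply: (@continuous_max R R^o (fun=> 0) (fun z : R => `|y| - `|z|)).
  exact: cvg_cst.
by apply: cvgB; [exact: cvg_cst|apply: cvg_norm; exact: cvg_id].
Qed.

Lemma measurable_excess y : measurable_fun setT (fun z : RR => excess y z).
Proof. by apply: continuous_measurable_fun; exact: continuous_excess. Qed.

(** [|z + y| + |z - y|] is twice the maximum of [|y|] and [|z|]. *)
Lemma excess_avg (y z : R) : (`|z| - `|z + y|) + (`|- z| - `|- z + y|) = - 2 * excess y z.
Proof.
rewrite /excess normrN (_ : - z + y = - (z - y)); last by ring.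
rewrite normrN.
case: (ger0P y) => y0; case: (ger0P z) => z0; case: (ger0P (z + y)) => zy; case: (ger0P (z - y)) => zz;
  case: leP => H; lra.
Qed.

(** For [|y| < 1] the excess is at most [|y|] and lives on [|z| <= |y|], a set of Laplace mass at
    most [|y|]: this is the quadratic regime of the cost. For [|y| >= 1] the trivial bound [|y|] is
    enough. *)
Lemma integral_excess (r y : R) : 1 <= r ->
  (\int[@laplace R]_z (excess y z)%:E <= (phi r y)%:E)%E.
Proof.
move=> r1; have [y1|y1] := leP 1 `|y|.
  apply: (@le_trans _ _ (\int[@laplace R]_z `|y|%:E)%E).
    by apply: le_integral_fin => z; rewrite excess_ge0 excess_le.
  by rewrite integral_probability_cst lee_fin phi_ge_lin.
have mI : measurable (`[- `|y|, `|y|]%classic : set RR) by exact: measurable_itv.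
rewrite (ge0_integral_explaw explaw_laplace); last 2 first.
- by apply/measurable_EFinP; exact: measurable_excess.
- by move=> z; rewrite lee_fin excess_ge0.
apply: (@le_trans _ _ (\int[leb]_z (`|y| / 2 * \1_`[- `|y|, `|y|] z)%:E)%E).
  apply: le_integral_ge0 => z; rewrite -EFinM !lee_fin !mulr_ge0 ?excess_ge0 ?expR_ge0//=.
  rewrite indicE mem_setE in_itv/= -ler_norml.
  case: (leP `|z| `|y|) => zy; last first.
    by rewrite /excess (_ : Num.max _ _ = 0) ?mul0r ?mulr0//; apply/max_idPl; lra.
  rewrite mulr1; apply: ler_pM; rewrite ?excess_ge0 ?excess_le ?mulr_ge0 ?expR_ge0//.
  by rewrite ler_piMr// -expR0 ler_expR oppr_le0 powR_ge0.
rewrite ge0_integralZ_fin//.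
rewrite integral_indic// setIT [X in (_ * X <= _)%E](_ : _ = (2 * `|y|)%:E); last first.
  transitivity (leb (`[- `|y|, `|y|]%classic : set R)); first by [].
  rewrite lebesgue_measure_itv/= lte_fin; case: ltP => H; first by rewrite -EFinB; congr EFin; ring.
  by congr EFin; have := normr_ge0 y; lra.
by rewrite -EFinM lee_fin /phi (ltW y1) -real_normK ?num_real//; lra.
Qed.

End excess.

Section attained_norm.
Context {R : realType}.
Notation RR := (measurableTypeR R).

Definition bil n (f : 'I_n -> 'I_n -> R) (x y : 'I_n -> R) : R :=
  \sum_(i < n) \sum_(j < n) f i j * x i * y j.

Section bil.
Variables (n : nat) (f : 'I_n -> 'I_n -> R).

Lemma bilDl x x' y : bil f (fun i => x i + x' i) y = bil f x y + bil f x' y.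
Proof.
rewrite /bil -big_split/=; apply: eq_bigr => i _; rewrite -big_split/=; apply: eq_bigr => j _; ring.
Qed.

Lemma bilDr x y y' : bil f x (fun i => y i + y' i) = bil f x y + bil f x y'.
Proof.
rewrite /bil -big_split/=; apply: eq_bigr => i _; rewrite -big_split/=; apply: eq_bigr => j _; ring.
Qed.

Lemma bilZl c x y : bil f (fun i => c * x i) y = c * bil f x y.
Proof.
rewrite /bil mulr_sumr; apply: eq_bigr => i _; rewrite mulr_sumr; apply: eq_bigr => j _; ring.
Qed.

Lemma bilZr c x y : bil f x (fun i => c * y i) = c * bil f x y.
Proof.
rewrite /bil mulr_sumr; apply: eq_bigr => i _; rewrite mulr_sumr; apply: eq_bigr => j _; ring.
Qed.

Lemma bilNl x y : bil f (fun i => - x i) y = - bil f x y.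
Proof. by rewrite -[RHS]mulN1r -bilZl; congr (bil _ _ _); apply/funext => i; rewrite mulN1r. Qed.

Lemma bilNr x y : bil f x (fun i => - y i) = - bil f x y.
Proof. by rewrite -[RHS]mulN1r -bilZr; congr (bil _ _ _); apply/funext => i; rewrite mulN1r. Qed.

Lemma bilN x y : bil (fun i j => - f i j) x y = - bil f x y.
Proof.
rewrite /bil -sumrN; apply: eq_bigr => i _; rewrite -sumrN; apply: eq_bigr => j _; ring.
Qed.

End bil.

(** The structure retained from L_q: a maximum of bilinear forms over a symmetric set of matrices.
    Since it is attained, each point has a single form that equals [M] there and stays below it
    elsewhere. *)
Definition attained_norm n (Phi : set ('I_n -> 'I_n -> R)) (M : ('I_n -> R) -> ('I_n -> R) -> R) :=
  [/\ forall f, Phi f -> Phi (fun i j => - f i j),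
      forall f x y, Phi f -> bil f x y <= M x y &
      forall x y, exists2 f, Phi f & M x y = bil f x y].

Variables (n : nat) (Phi : set ('I_n -> 'I_n -> R)) (M : ('I_n -> R) -> ('I_n -> R) -> R).
Hypothesis PM : attained_norm Phi M.

Let PhiN f : Phi f -> Phi (fun i j => - f i j). Proof. by case: PM => + _ _; apply. Qed.

Lemma bil_le f x y : Phi f -> bil f x y <= M x y. Proof. by case: PM => _ + _; apply. Qed.

Lemma bil_attained x y : exists2 f, Phi f & M x y = bil f x y.
Proof. by case: PM => _ _; apply. Qed.

Lemma attained_ge0 x y : 0 <= M x y.
Proof.
have [f Pf _] := bil_attained x y.
by have := lerD (bil_le x y Pf) (bil_le x y (PhiN Pf)); rewrite bilN subrr -mulr2n pmulrn_lge0.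
Qed.

Lemma bil_norm_le f x y : Phi f -> `|bil f x y| <= M x y.
Proof. by move=> Pf; rewrite ler_norml bil_le// andbT lerNl -bilN bil_le//; exact: PhiN. Qed.

Lemma bisublin_attained : bisublin M.
Proof.
have Z (c : R) (a b : R) : a <= b -> a = b \/ a < b by rewrite le_eqVlt => /orP[/eqP|]; [left|right].
split=> y; split.
- by move=> x; exact: attained_ge0.
- by move=> x x'; have [f Pf ->] := bil_attained (fun i => x i + x' i) y; rewrite bilDl lerD ?bil_le.
- move=> c x c0; apply/eqP; rewrite eq_le; apply/andP; split.
    by have [f Pf ->] := bil_attained (fun i => c * x i) y; rewrite bilZl ler_wpM2l ?bil_le.
  by have [f Pf ->] := bil_attained x y; rewrite -bilZl bil_le.
- by move=> x; exact: attained_ge0.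
- by move=> x x'; have [f Pf ->] := bil_attained y (fun i => x i + x' i); rewrite bilDr lerD ?bil_le.
- move=> c x c0; apply/eqP; rewrite eq_le; apply/andP; split.
    by have [f Pf ->] := bil_attained y (fun i => c * x i); rewrite bilZr ler_wpM2l ?bil_le.
  by have [f Pf ->] := bil_attained y x; rewrite -bilZr bil_le.
Qed.

Lemma attainedNr x y : M x (fun i => - y i) = M x y.
Proof.
apply/eqP; rewrite eq_le; apply/andP; split.
  by have [f Pf ->] := bil_attained x (fun i => - y i); rewrite bilNr -bilN bil_le//; exact: PhiN.
by have [f Pf ->] := bil_attained x y; rewrite -[bil _ _ _]opprK -bilNr -bilN bil_le//; exact: PhiN.
Qed.

End attained_norm.

Section ball_sup.
Context {R : realType}.
Notation RR := (measurableTypeR R).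
Variables (n : nat) (r p : R).
Hypotheses (r1 : 1 <= r) (p1 : 1 <= p).
Let p0 : 0 < p. Proof. exact: lt_le_trans p1. Qed.

Lemma pball0 : pball r p (fun _ : 'I_n => 0).
Proof. by rewrite /pball/= big1 ?(ltW p0)// => i _; rewrite /phi normr0 ler01 expr0n. Qed.

Lemma pballN (x : 'I_n -> R) : pball r p x -> pball r p (fun i => - x i).
Proof. by move=> xp; rewrite /pball/=; under eq_bigr do rewrite phiN. Qed.

Lemma pball_norm1 (x : 'I_n -> R) : pball r p x -> norm1 x <= n%:R * p.
Proof.
move=> xp; rewrite /norm1 -[in n%:R](card_ord n) -sum1_card natr_sum mulr_suml.
apply: ler_sum => i _; rewrite mul1r.
have [x1|/ltW x1] := leP `|x i| 1; first exact: le_trans x1 p1.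
apply: le_trans (phi_ge_lin r1 x1) _; apply: le_trans xp; rewrite (bigD1 i)//= lerDl.
by apply: sumr_ge0 => j _; exact: phi_ge0.
Qed.

Definition ballsup (h : ('I_n -> R) -> R) : R := sup [set h x | x in pball r p].

Lemma ballsup_le (h : ('I_n -> R) -> R) c : (forall x, pball r p x -> h x <= c) -> ballsup h <= c.
Proof.
move=> H; apply: ge_sup; last by move=> _ [x xp <-]; exact: H.
by exists (h (fun=> 0)), (fun=> 0) => //; exact: pball0.
Qed.

Lemma le_ballsup (h : ('I_n -> R) -> R) L x : (forall x, h x <= L * norm1 x) -> 0 <= L ->
  pball r p x -> h x <= ballsup h.
Proof.
move=> hL L0 xp; apply: ub_le_sup; last by exists x.
exists (L * (n%:R * p)) => _ [y yp <-]; apply: le_trans (hL _) _.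
by rewrite ler_wpM2l// pball_norm1.
Qed.

End ball_sup.

Lemma max1_lip {R : realType} (a b : R) : `|Num.max 1 a - Num.max 1 b| <= `|a - b|.
Proof.
have H c d : Num.max 1 c - Num.max 1 d <= `|c - d| :> R.
  rewrite lerBlDr ge_max; apply/andP; split.
    by apply: (@le_trans _ _ (Num.max 1 d)); [rewrite le_max lexx|rewrite lerDr].
  apply: (@le_trans _ _ (`|c - d| + d)); first by rewrite -lerBlDr ler_norm.
  by rewrite lerD2l le_max lexx orbT.
by rewrite ler_norml H andbT lerNl opprB distrC H.
Qed.

Lemma expR_midpoint {R : realType} (a b : R) : 2 * expR ((a + b) / 2) <= expR a + expR b.
Proof.
have -> : expR a = expR (a / 2) ^+ 2 by rewrite expr2 -expRD; congr expR; lra.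
have -> : expR b = expR (b / 2) ^+ 2 by rewrite expr2 -expRD; congr expR; lra.
rewrite [(a + b) / 2]mulrDl expRD -subr_ge0; set c := expR _; set d := expR _.
have -> : c ^+ 2 + d ^+ 2 - 2 * (c * d) = (c - d) ^+ 2 by ring.
exact: sqr_ge0.
Qed.

(** Markov's inequality with a continuous weight instead of an indicator: [1 - k / 12] has mean at
    least 3/4, and the weight vanishes where [k >= 12]. *)
Lemma markov_weight {R : realType} d (T : measurableType d) (P : probability T R) (k : T -> R) :
  measurable_fun setT k -> (forall x, 0 <= k x) -> (\int[P]_x (k x)%:E <= 3%:E)%E ->
  ((3 / 4)%:E <= \int[P]_x (Num.max 0 (1 - k x / 12))%:E)%E.
Proof.
move=> mk k0 Ek.
have w0 x : 0 <= Num.max 0 (1 - k x / 12) by rewrite le_max lexx.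
have mw : measurable_fun setT (fun x => Num.max 0 (1 - k x / 12)).
  by apply: measurable_maxr => //; apply: measurable_funB => //; exact: measurable_funM.
have : (1%:E <= \int[P]_x (Num.max 0 (1 - k x / 12))%:E + (12^-1)%:E * (3%:E : \bar R))%E.
  apply: (@le_trans _ _ (\int[P]_x (Num.max 0 (1 - k x / 12))%:E + \int[P]_x (12^-1 * k x)%:E)%E).
    rewrite -ge0_integralD_fin//; last 2 first.
    - by move=> z; rewrite mulr_ge0.
    - exact: measurable_funM.
    rewrite -[leLHS](integral_probability_cst P).
    apply: le_integral_fin => z; rewrite ler01/= -lerBlDr.
    by rewrite [12^-1 * _]mulrC le_max lexx orbT.
  by rewrite leeD2l// ge0_integralZ_fin// lee_wpmul2l.
case: (integral _ _ _) => [W'| |]; rewrite ?leey// -EFinM -EFinD !lee_fin; lra.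
Qed.

Lemma le_of_double {R : realType} (I : \bar R) (a : R) :
  ((2 * a)%:E * (3 / 4)%:E <= I + I)%E -> ((3 / 4 * a)%:E <= I)%E.
Proof. by case: I => [I'| |]; rewrite ?leey// -EFinM -EFinD !lee_fin; lra. Qed.

Lemma powR_le_scaled_exp {R : realType} (w p c : R) : 0 <= w -> 0 < p -> 0 < c ->
  w `^ p <= c `^ p * expR (p * w / c).
Proof.
move=> w0 p0 c0.
have u0 : 0 <= p * w / c by rewrite divr_ge0 ?mulr_ge0// ltW.
have wE : w = (c / p) * (p * w / c) by field; rewrite !gt_eqF.
have q0 : 0 <= c / p by rewrite divr_ge0 ?ltW.
rewrite [in leLHS]wE powRM//.
apply: (@le_trans _ _ ((c / p) `^ p * (p `^ p * expR (p * w / c)))).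
  by rewrite ler_wpM2l ?powR_ge0// powR_le_expR.
by rewrite mulrA -powRM ?(ltW p0)// divfK ?gt_eqF.
Qed.

(** 15 = 1 + 13 + 1, where the first unit absorbs the factor 2. *)
Lemma double_exp_le {R : realType} (p : R) : 1 <= p -> 2 * expR (13 * p) * expR p <= (4 ^+ 15) `^ p.
Proof.
move=> p1; have p0 : 0 < p by exact: lt_le_trans p1.
have e2 : 2 <= expR p by have := expR_ge1Dx p; lra.
apply: (@le_trans _ _ (expR p * expR (13 * p) * expR p)).
  by rewrite ler_wpM2r ?expR_ge0// ler_wpM2r ?expR_ge0.
rewrite -!expRD (_ : p + 13 * p + p = (15%:R * 1) * p); last by ring.
rewrite expRM; apply: ge0_ler_powR; rewrite ?nnegrE ?expR_ge0 ?exprn_ge0 ?(ltW p0)//.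
by rewrite expRM_natl; apply: lerXn2r; rewrite ?nnegrE ?expR_ge0// expR1_le4.
Qed.

(** * Moment of the supremum over the ball *)

Section shifted_bound.
Context {R : realType}.
Notation RR := (measurableTypeR R).
Notation lap := (@laplace R).
Variables (m : probability RR R) (r cr p : R).
Hypotheses (law : explaw m r cr) (p1 : 1 <= p).
Variables (n : nat) (Phi : set ('I_n -> 'I_n -> R)) (M : ('I_n -> R) -> ('I_n -> R) -> R).
Hypothesis PM : attained_norm Phi M.

Let r1 : 1 <= r := law.1.
Let p0 : 0 < p. Proof. exact: lt_le_trans p1. Qed.
Let Ms := bisublin_attained PM.

Definition rowsup (f : 'I_n -> 'I_n -> R) (z : 'I_n -> R) := ballsup r p (fun x => bil f x z).

Let exK := bisublin_le_norm1 Ms.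
Let K : R := s2val (cid2 exK).
Let K0 : 0 <= K. Proof. exact: s2valP (cid2 exK). Qed.
Let MK x y : M x y <= K * norm1 x * norm1 y. Proof. exact: (s2valP' (cid2 exK)). Qed.

Let bK f x z : Phi f -> bil f x z <= K * norm1 z * norm1 x.
Proof. by move=> Pf; rewrite mulrAC; apply: le_trans (bil_le PM _ _ Pf) (MK _ _). Qed.

Lemma bil_rowsup f x z : Phi f -> pball r p x -> bil f x z <= rowsup f z.
Proof.
move=> Pf xp; apply: (le_ballsup r1 p1 (L := K * norm1 z) (h := fun x => bil f x z)) => //.
  by move=> x'; exact: bK.
by rewrite mulr_ge0 ?norm1_ge0.
Qed.

Lemma sublin_rowsup f : Phi f -> sublin (rowsup f).
Proof.
move=> Pf; apply: (sublin_sup (A := pball r p) (f := fun x z => bil f x z)).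
- move=> z; exists (K * norm1 z * (n%:R * p)) => _ [x xp <-]; apply: le_trans (bK _ _ Pf) _.
  by rewrite ler_wpM2l ?mulr_ge0 ?norm1_ge0// (pball_norm1 r1).
- by move=> x y y' _; rewrite bilDr.
- by move=> x c y _ _; rewrite bilZr.
- move=> z; exists (fun=> 0); first exact: pball0.
  by rewrite /bil big1// => i _; rewrite big1// => j _; rewrite mulr0 mul0r.
Qed.

(** The Lipschitz constant is the same for all [f]; this uniformity is what [damped_continuous]
    needs. *)
Lemma rowsup_lip f z z' : Phi f ->
  `|rowsup f z - rowsup f z'| <= K * (n%:R * p) * norm1 (fun i => z i - z' i).
Proof.
move=> Pf; have cl w : rowsup f w <= K * (n%:R * p) * norm1 w.
  apply: ballsup_le => // x xp; apply: le_trans (bK _ _ Pf) _; rewrite mulrAC.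
  by rewrite ler_wpM2r ?norm1_ge0// ler_wpM2l// (pball_norm1 r1).
have H a b : rowsup f a - rowsup f b <= K * (n%:R * p) * norm1 (fun i => a i - b i).
  exact: le_trans (sublinB (sublin_rowsup Pf) _ _) (cl _).
rewrite ler_norml H lerNl opprB andbT; apply: le_trans (H _ _) _.
by rewrite /norm1; under eq_bigr do rewrite distrC.
Qed.

Variable lam : R.
Hypothesis lam0 : 0 <= lam.

Definition damp f z : R := Num.max 1 (lam / p * rowsup f z).

Let damp1 f z : 1 <= damp f z. Proof. by rewrite le_max lexx. Qed.
Let damp0 f z : 0 < damp f z. Proof. exact: lt_le_trans (damp1 f z). Qed.

(* The quotient by damp keeps the exponent bounded on the ball whatever z is,
   and equals 1 for the typical z. *)
Definition damped (x z : 'I_n -> R) : R := sup [set lam * bil f x z / damp f z | f in Phi].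

Let damped_elt f x z : Phi f -> lam * bil f x z / damp f z <= lam * M x z.
Proof.
move=> Pf; rewrite ler_pdivrMr//; apply: (@le_trans _ _ (lam * M x z)).
  by rewrite ler_wpM2l// (bil_le PM).
by rewrite ler_peMr// mulr_ge0// (attained_ge0 PM).
Qed.

Let damped_ub x z : has_ubound [set lam * bil f x z / damp f z | f in Phi].
Proof. by exists (lam * M x z) => _ [f Pf <-]; exact: damped_elt. Qed.

Let damped_ne x z : [set lam * bil f x z / damp f z | f in Phi] !=set0.
Proof. by have [f Pf _] := bil_attained PM x z; exists (lam * bil f x z / damp f z), f. Qed.

Lemma damped_le x z : damped x z <= lam * M x z.
Proof. by apply: ge_sup => // _ [f Pf <-]; exact: damped_elt. Qed.

Lemma le_damped f x z : Phi f -> lam * bil f x z / damp f z <= damped x z.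
Proof. by move=> Pf; apply: ub_le_sup => //; exists f. Qed.

Lemma sublin_damped z : sublin (damped ^~ z).
Proof.
apply: (sublin_sup (A := Phi) (f := fun f x => lam * bil f x z / damp f z)) => //.
- by move=> f x y Pf; rewrite bilDl mulrDr mulrDl.
- by move=> f c x Pf c0; rewrite bilZl; ring.
- move=> x; have [f Pf MfE] := bil_attained PM x z; exists f => //.
  by rewrite divr_ge0 ?(ltW (damp0 _ _))// mulr_ge0// -MfE (attained_ge0 PM).
Qed.

Lemma damped_ball x z : pball r p x -> damped x z <= p.
Proof.
move=> xp; apply: ge_sup => // _ [f Pf <-]; rewrite ler_pdivrMr//.
apply: (@le_trans _ _ (p * (lam / p * rowsup f z))).
  have -> : p * (lam / p * rowsup f z) = lam * rowsup f z by field; rewrite gt_eqF.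
  by rewrite ler_wpM2l// bil_rowsup.
by rewrite ler_pM2l// le_max lexx orbT.
Qed.

(** [Phi] may be uncountable, so the measurability of the supremum rests on a modulus of continuity
    common to all quotients: the numerators vary by bilinearity, the denominators are at least 1 and
    vary by [rowsup_lip]. *)
Lemma damped_continuous : fam_continuous
  (fun u : 'I_n + 'I_n -> R => damped (fun i => u (inl i)) (fun j => u (inr j))).
Proof.
move=> u e e0.
set x := fun i => u (inl i); set z := fun j => u (inr j).
pose B := lam * (K * n%:R * norm1 z) + lam * (K * (norm1 x + n%:R) * n%:R)
  + lam * M x z * (lam / p * (K * (n%:R * p) * n%:R)) + 1.
have Mxz0 := attained_ge0 PM x z.
have B1 : 1 <= B.
  by rewrite lerDr !addr_ge0// !mulr_ge0// ?addr_ge0// ?norm1_ge0// ?invr_ge0 ltW.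
have B0 : 0 < B by apply: lt_le_trans B1.
pose dl := Num.min 1 (e / B).
have dl0 : 0 < dl by rewrite lt_min ltr01 divr_gt0.
have dl1 : dl <= 1 by rewrite ge_min lexx.
have nle (a b : 'I_n -> R) : (forall i, `|a i - b i| <= dl) -> norm1 (fun i => a i - b i) <= n%:R * dl.
  by move=> ab; apply: (@le_trans _ _ (\sum_(i < n) dl)); [exact: ler_sum|rewrite sumr_const card_ord mulr_natl].
exists dl => // v uv; set x' := fun i => v (inl i); set z' := fun j => v (inr j).
have a1 : norm1 (fun i => x i - x' i) <= n%:R * dl by apply: nle => i; exact: uv.
have a2 : norm1 (fun i => z i - z' i) <= n%:R * dl by apply: nle => i; exact: uv.
have x'n : norm1 x' <= norm1 x + n%:R.
  rewrite /norm1 -[in n%:R](card_ord n) -sumr_const -big_split/=; apply: ler_sum => i _.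
  have -> : x' i = x i - (x i - x' i) by ring.
  by apply: le_trans (ler_normB _ _) _; rewrite lerD2l; apply: le_trans (uv (inl i)) _.
have key f : Phi f -> `|lam * bil f x z / damp f z - lam * bil f x' z' / damp f z'| <= e.
  move=> Pf; set a := lam * bil f x z; set a' := lam * bil f x' z'.
  set b := damp f z; set b' := damp f z'.
  have [b1 b'1] : 1 <= b /\ 1 <= b' by split; exact: damp1.
  have [b0 b'0] : 0 < b /\ 0 < b' by split; exact: damp0.
  have aa' : `|a - a'| <= lam * (K * (n%:R * dl) * norm1 z) + lam * (K * (norm1 x + n%:R) * (n%:R * dl)).
    have -> : a - a' = lam * bil f (fun i => x i - x' i) z + lam * bil f x' (fun i => z i - z' i).
      by rewrite /a /a' bilDl bilDr bilNl bilNr; ring.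
    apply: le_trans (ler_normD _ _) _; rewrite !normrM (ger0_norm lam0); apply: lerD.
      rewrite ler_wpM2l//; apply: le_trans (bil_norm_le PM _ _ Pf) _; apply: le_trans (MK _ _) _.
      by rewrite ler_wpM2r ?norm1_ge0// ler_wpM2l.
    rewrite ler_wpM2l//; apply: le_trans (bil_norm_le PM _ _ Pf) _; apply: le_trans (MK _ _) _.
    by apply: ler_pM; rewrite ?mulr_ge0 ?norm1_ge0// ler_wpM2l.
  have ale : `|a| <= lam * M x z.
    by rewrite normrM (ger0_norm lam0) ler_wpM2l// (bil_norm_le PM).
  have bb' : `|b' - b| <= lam / p * (K * (n%:R * p) * (n%:R * dl)).
    have lp0 : 0 <= lam / p by rewrite divr_ge0// ltW.
    apply: (@le_trans _ _ `|lam / p * rowsup f z' - lam / p * rowsup f z|).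
      exact: max1_lip.
    rewrite -mulrBr normrM (ger0_norm lp0) ler_wpM2l//.
    rewrite distrC; apply: le_trans (rowsup_lip _ _ Pf) _.
    by rewrite ler_wpM2l ?mulr_ge0// ltW.
  have -> : a / b - a' / b' = (a - a') / b' + a * (b' - b) / (b * b').
    by field; rewrite !gt_eqF.
  apply: le_trans (ler_normD _ _) _.
  apply: (@le_trans _ _ (`|a - a'| + `|a| * `|b' - b|)).
    rewrite lerD// ?normf_div ?normrM (gtr0_norm b'0) ?(gtr0_norm b0) ler_pdivrMr ?mulr_gt0//.
      by rewrite ler_peMr.
    by rewrite ler_peMr ?mulr_ge0// -[1]mulr1 ler_pM.
  apply: (@le_trans _ _ ((B - 1) * dl)).
    have -> : (B - 1) * dl = (lam * (K * (n%:R * dl) * norm1 z) + lam * (K * (norm1 x + n%:R) * (n%:R * dl)))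
      + lam * M x z * (lam / p * (K * (n%:R * p) * (n%:R * dl))) by rewrite /B; ring.
    by rewrite lerD// ler_pM.
  apply: (@le_trans _ _ (B * dl)); first by rewrite ler_wpM2r ?(ltW dl0)// gerBl.
  by rewrite mulrC -ler_pdivlMr// ge_min lexx orbT.
rewrite ler_norml lerNl opprB !lerBlDl; apply/andP; split; apply: ge_sup => // _ [f Pf <-].
  rewrite -lerBlDr; apply: le_trans (le_damped _ _ Pf).
  by have := key _ Pf; rewrite ler_norml => /andP[]; lra.
rewrite -lerBlDr; apply: le_trans (le_damped _ _ Pf).
by have := key _ Pf; rewrite ler_norml => /andP[]; lra.
Qed.

Lemma measurable_damped : measurable_fun setT
  (fun u : n.-tuple RR * n.-tuple RR => damped (tnth u.1) (tnth u.2)).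
Proof.
apply: (measurable_fam_continuous (Z := fun i (u : n.-tuple RR * n.-tuple RR) =>
  match i with inl i => tnth u.1 i | inr j => tnth u.2 j end) _ damped_continuous) => -[i|j].
  by apply: (measurableT_comp (f := (@tnth n RR)^~ i)) => //; exact: measurable_tnth.
by apply: (measurableT_comp (f := (@tnth n RR)^~ j)) => //; exact: measurable_tnth.
Qed.

Let alpha (z : 'I_n -> R) := mean m (M ^~ z).

Let Ms' : bisublin (fun z x => M x z).
Proof. by case: Ms. Qed.

Lemma sublin_alpha : sublin alpha.
Proof. exact: (sublin_mean_r Ms' law). Qed.

Definition shifted (x : 'I_n -> R) : \bar R :=
  (\int[prodP lap n]_z (expR ((damped x (tnth z) - lam * alpha (tnth z)) / 128))%:E)%E.

Let measurable_shifted_integrand : measurable_fun setT (fun u : n.-tuple RR * n.-tuple RR =>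
  (expR ((damped (tnth u.1) (tnth u.2) - lam * alpha (tnth u.2)) / 128))%:E).
Proof.
apply/measurable_EFinP; apply: measurableT_comp => //; apply: measurable_funM => //.
apply: measurable_funB; first exact: measurable_damped.
apply: measurable_funM => //.
apply: (measurableT_comp (f := fun z : n.-tuple RR => alpha (tnth z))) => //.
exact: measurable_sublin_tnth sublin_alpha.
Qed.

(** By Tonelli [x] is integrated first. For fixed [z] the function [damped ^~ z] is at most [p] on
    the ball and has mean at most [lam * alpha z], precisely what the exponent subtracts;
    concentration leaves [expR p]. *)
Lemma integral_shifted : (\int[prodP m n]_x shifted (tnth x) <= (expR p)%:E)%E.
Proof.
have g0 (u : n.-tuple RR * n.-tuple RR) :
    (0 <= (expR ((damped (tnth u.1) (tnth u.2) - lam * alpha (tnth u.2)) / 128))%:E)%E.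
  by rewrite lee_fin expR_ge0.
rewrite /shifted [leLHS](fubini_tonelli (m1 := prodP m n) (m2 := prodP lap n) _ measurable_shifted_integrand g0)/=.
rewrite -[leRHS](integral_probability_cst (prodP lap n)); apply: le_integral_ge0 => z.
apply/andP; split; first by apply: integral_ge0 => x _; rewrite lee_fin expR_ge0.
rewrite (eq_integral (fun x : n.-tuple RR => (expR (- (lam * alpha (tnth z) / 128)) *
  expR (damped (tnth x) (tnth z) / 128))%:E)); last first.
  by move=> x _; rewrite -expRD; congr (expR _)%:E; ring.
rewrite ge0_integralZ_fin ?expR_ge0//; last first.
  apply: measurableT_comp => //; apply: measurable_funM => //.
  exact: measurable_sublin_tnth (sublin_damped _).
have H := sublin_concentration law (sublin_damped (tnth z)) p0 (fun x => @damped_ball x (tnth z)).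
apply: le_trans (lee_wpmul2l _ H) _; first by rewrite lee_fin expR_ge0.
rewrite -EFinM lee_fin -expRD ler_expR.
have : mean m (damped ^~ (tnth z)) <= lam * alpha (tnth z).
  rewrite -(mean_scale law (Ms.1 _) lam0); apply: (mean_le law).
  - exact: sublin_damped.
  - by apply: sublin_scale => //; exact: Ms.1.
  - by move=> x; exact: damped_le.
by lra.
Qed.

Variable rho : R.
Hypotheses (rho0 : 0 < rho) (lamE : lam = p / (13 * rho)).
Hypotheses (alpha_mean : mean lap alpha <= rho)
  (alpha_ball : forall y, pball r p y -> alpha y <= rho)
  (row_mean : forall f, Phi f -> mean lap (rowsup f) <= rho)
  (row_ball : forall f y, Phi f -> pball r p y -> rowsup f y <= rho).

Let lamp_le f (z : 'I_n -> R) c : rowsup f z <= 13 * rho * c -> lam / p * rowsup f z <= c.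
Proof.
move=> H; have -> : lam / p * rowsup f z = rowsup f z / (13 * rho).
  by rewrite lamE; field; rewrite !gt_eqF.
by rewrite ler_pdivrMr ?mulr_gt0// mulrC.
Qed.

Let alphaN z : alpha (fun i => - z i) = alpha z.
Proof. by congr (mean _ _); apply/funext => x; rewrite (attainedNr PM). Qed.

Let rowsupN f z : Phi f -> rowsup f (fun i => - z i) = rowsup f z.
Proof.
move=> Pf; have H w : rowsup f (fun i => - w i) <= rowsup f w.
  apply: ballsup_le => // x xp; rewrite bilNr -bilNl; apply: bil_rowsup => //.
  exact: pballN.
apply/eqP; rewrite eq_le H/= -[leLHS](_ : rowsup f (fun i => - - z i) = _) ?H//.
by congr (rowsup _ _); apply/funext => i; rewrite opprK.
Qed.

(* Shift the Laplace integral by y.  The weight w is symmetric, has integral at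
   least 3/4, and vanishes unless all the quantities entering the exponent are at
   most a constant times p; averaging over z and - z removes the odd terms. *)
Lemma shifted_ge x y : pball r p y ->
  ((expR (lam * M x y / 128))%:E <= (2 * expR (13 * p))%:E * shifted x)%E.
Proof.
move=> yp; have [f Pf MfE] := bil_attained PM x y.
have rs := sublin_rowsup Pf; have als := sublin_alpha.
pose sk (z : 'I_n -> R) := rho^-1 * (rowsup f z + alpha z).
have ir0 : 0 <= rho^-1 by rewrite invr_ge0 ltW.
have sks : sublin sk.
  split=> [z|z z'|c z c0]; first by rewrite mulr_ge0// addr_ge0 ?sublin_ge0.
    by rewrite -mulrDr ler_wpM2l// addrACA lerD// sublinD.
  by rewrite /sk (sublinZ rs)// (sublinZ als)//; ring.
pose ex (z : 'I_n -> R) := \sum_(i < n) excess (y i) (z i).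
have ex0 z : 0 <= ex z by apply: sumr_ge0 => i _; exact: excess_ge0.
have mex : measurable_fun setT (fun z : n.-tuple RR => ex (tnth z)).
  apply: measurable_sum => i; apply: (measurable_tnth_comp (f := excess (y i))).
  exact: measurable_excess.
have Eex : (\int[prodP lap n]_z (ex (tnth z))%:E <= p%:E)%E.
  rewrite /ex; under eq_integral do rewrite -sumEFin.
  rewrite ge0_integral_sum//; last 2 first.
  - move=> i; apply/measurable_EFinP; apply: (measurable_tnth_comp (f := excess (y i))).
    exact: measurable_excess.
  - by move=> i z _; rewrite lee_fin excess_ge0.
  apply: (@le_trans _ _ (\sum_(i < n) (phi r (y i))%:E)%E); last by rewrite sumEFin lee_fin.
  apply: lee_sum => i _; apply: (prodP_integral_coord (f := excess (y i))).
  - exact: measurable_excess.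
  - by move=> z; exact: excess_ge0.
  - exact: integral_excess.
have msk := measurable_sublin_tnth sks.
have Esk : mean lap sk <= 2.
  rewrite -lee_fin -(meanE explaw_laplace sks) ge0_integralZ_fin//; last 2 first.
  - by move=> z; rewrite addr_ge0 ?sublin_ge0.
  - by apply: measurable_funD; exact: measurable_sublin_tnth.
  rewrite ge0_integralD_fin; last 4 first.
  - by move=> z; rewrite sublin_ge0.
  - by move=> z; rewrite sublin_ge0.
  - exact: measurable_sublin_tnth.
  - exact: measurable_sublin_tnth.
  rewrite !(meanE explaw_laplace)// -EFinD -EFinM lee_fin mulrC ler_pdivrMr//.
  by apply: le_trans (lerD (row_mean Pf) alpha_mean) _; lra.
(* [k] controls three quantities at once: [rowsup] and [alpha] in units of [rho], the excess in
   units of [p]. Each has mean at most 1, whence the 3 of [markov_weight]. *)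
pose k (z : 'I_n -> R) := sk z + p^-1 * ex z.
pose w (z : 'I_n -> R) := Num.max 0 (1 - k z / 12).
have k0 z : 0 <= k z by rewrite addr_ge0 ?sublin_ge0// mulr_ge0// invr_ge0 ltW.
have w0 z : 0 <= w z by rewrite le_max lexx.
have wN z : w (fun i => - z i) = w z.
  rewrite /w /k /sk rowsupN// alphaN /ex; congr (Num.max _ (1 - (_ + _ * _) / 12)).
  by apply: eq_bigr => i _; rewrite excessN.
have mk : measurable_fun setT (fun z : n.-tuple RR => k (tnth z)).
  by apply: measurable_funD => //; exact: measurable_funM.
have mw : measurable_fun setT (fun z : n.-tuple RR => w (tnth z)).
  apply: measurable_maxr => //; apply: measurable_funB => //; exact: measurable_funM.
pose U (z : 'I_n -> R) := lam * bil f x z / 128 + \sum_(i < n) (`|z i| - `|z i + y i|).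
have UU z : U z + U (fun i => - z i) = - 2 * ex z.
  rewrite /U bilNr /ex [RHS]mulr_sumr; under [RHS]eq_bigr do rewrite -excess_avg.
  by rewrite [RHS]big_split/= mulrN mulNr addrACA subrr add0r.
(* What remains of the exponent besides [U]: the value at [y], minus the bound [p] for
   [lam * alpha (y + z)]. The form at [z] and the density ratio are in [U]. *)
pose c0 := (lam * bil f x y - p) / 128.
pose g (z : 'I_n -> R) := w z * expR (c0 + U z).
have g0 z : 0 <= g z by rewrite mulr_ge0 ?expR_ge0.
have mU : measurable_fun setT (fun z : n.-tuple RR => U (tnth z)).
  apply: measurable_funD.
    apply: measurable_funM => //; apply: measurable_funM => //.
    apply: measurable_sum => i; apply: measurable_sum => j; apply: measurable_funM => //.
    exact: measurable_tnth.
  apply: measurable_sum => i; apply: measurable_funB.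
    by apply: (measurable_tnth_comp (f := fun t : RR => `|t| : R)); exact: measurableT_comp.
  apply: (measurable_tnth_comp (f := fun t : RR => `|t + y i| : R)); apply: measurableT_comp => //.
  by apply: measurable_funD.
have mg : measurable_fun setT (fun z : n.-tuple RR => g (tnth z)).
  apply: measurable_funM => //; apply: measurableT_comp => //; exact: measurable_funD.
have wk z : w z != 0 -> k z < 12.
  by move=> wn; rewrite ltNge; apply: contraNN wn => H; apply/eqP/max_idPl; lra.
have w1 z : w z <= 1 by rewrite ge_max ler01/=; have := k0 z; lra.
have sk_le z : w z != 0 -> rowsup f z <= 12 * rho /\ alpha z <= 12 * rho.
  move=> /wk H; have : sk z < 12 by apply: le_lt_trans H; rewrite lerDl mulr_ge0// invr_ge0 ltW.
  rewrite /sk mulrC ltr_pdivrMr//; have := sublin_ge0 rs z; have := sublin_ge0 als z; lra.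
have ex_le z : w z != 0 -> ex z <= 12 * p.
  move=> /wk H; have : p^-1 * ex z < 12 by apply: le_lt_trans H; rewrite lerDr sublin_ge0.
  by rewrite mulrC ltr_pdivrMr// => /ltW.
have step1 : (\int[prodP lap n]_z (g (tnth z))%:E <= shifted x)%E.
  have mF : measurable_fun setT (fun z : n.-tuple RR =>
      (expR ((damped x (tnth z) - lam * alpha (tnth z)) / 128))%:E).
    pose xt : n.-tuple RR := [tuple x i | i < n].
    have -> : x = tnth xt by apply/funext => i; rewrite tnth_mktuple.
    exact: (measurableT_comp measurable_shifted_integrand (measurable_pair1 xt)).
  have F0 (z : n.-tuple RR) : (0 <= (expR ((damped x (tnth z) - lam * alpha (tnth z)) / 128))%:E)%E.
    by rewrite lee_fin expR_ge0.
  rewrite /shifted (laplace_shift y mF F0); apply: le_integral_ge0 => z.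
  rewrite -EFinM !lee_fin g0/= /g.
  have [->|wn0] := eqVneq (w (tnth z)) 0; first by rewrite mul0r mulr_ge0 ?expR_ge0.
  apply: (@le_trans _ _ (1 * expR (c0 + U (tnth z)))).
    by rewrite ler_wpM2r ?expR_ge0.
  rewrite mul1r -expRD ler_expR tnth_tadd /U addrA lerD2r /c0 -mulrDl ler_pM2r//.
  have [rz az] := sk_le _ wn0.
  (* 12 from the weight and 1 from [y] in the ball: this is the 13 in [lam]. *)
  have H1 : damp f (fun i => y i + tnth z i) = 1.
    apply/max_idPl; apply: lamp_le; rewrite mulr1; apply: le_trans (sublinD rs _ _) _.
    by have := row_ball Pf yp; lra.
  have H2 : lam * alpha (fun i => y i + tnth z i) <= p.
    apply: (@le_trans _ _ (lam * (13 * rho))).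
      rewrite ler_wpM2l//; apply: le_trans (sublinD als _ _) _.
      by have := alpha_ball yp; lra.
    by rewrite lamE divfK// gt_eqF// mulr_gt0.
  have := le_damped x (fun i => y i + tnth z i) Pf; rewrite H1 divr1 bilDr mulrDr; lra.
set I := (\int[prodP lap n]_z (g (tnth z))%:E)%E in step1.
have IN : I = (\int[prodP lap n]_z (g (fun i => - tnth z i))%:E)%E.
  rewrite /I -(integral_prodP_tneg explaw_laplace); last 2 first.
  - exact/measurable_EFinP.
  - by move=> z; rewrite lee_fin.
  by apply: eq_integral => z _; rewrite tnth_tneg.
have mgN : measurable_fun setT (fun z : n.-tuple RR => g (fun i => - tnth z i)).
  have := measurableT_comp mg (@measurable_tneg R n).
  by apply: eq_measurable_fun => z _ /=; rewrite tnth_tneg.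
pose W := (\int[prodP lap n]_z (w (tnth z))%:E)%E.
(* [I] is written once with [z] and once with [- z]; midpoint convexity of [expR] replaces [U] by
   its even part, minus the excess, and the excess is at most [12 * p] where [w] is nonzero. *)
have H2I : ((2 * expR (c0 - 12 * p))%:E * W <= I + I)%E.
  have a0 : 0 <= 2 * expR (c0 - 12 * p) by rewrite mulr_ge0 ?expR_ge0.
  rewrite {2}IN -(ge0_integralD_fin _ (fun z => g0 _) (fun z => g0 _) mg mgN).
  rewrite /W -(ge0_integralZ_fin _ a0 (fun z => w0 _) mw).
  apply: le_integral_fin => z; rewrite (mulr_ge0 a0 (w0 _)) andTb /g wN -mulrDr mulrC.
  have [->|wn0] := eqVneq (w (tnth z)) 0; first by rewrite !mul0r.
  apply: ler_wpM2l; first exact: w0.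
  apply: (@le_trans _ _ (2 * expR (c0 - ex (tnth z)))).
    by rewrite ler_pM2l; [rewrite ler_expR lerD2l lerN2; exact: ex_le|exact: ltr0n].
  have UUz := UU (tnth z).
  have -> : c0 - ex (tnth z) = ((c0 + U (tnth z)) + (c0 + U (fun i => - tnth z i))) / 2.
    by move: UUz; lra.
  exact: expR_midpoint.
have Ek : (\int[prodP lap n]_z (k (tnth z))%:E <= 3%:E)%E.
  have pi0 : 0 <= p^-1 by rewrite invr_ge0 ltW.
  have pex0 (z : n.-tuple RR) : 0 <= p^-1 * ex (tnth z) by exact: mulr_ge0 pi0 (ex0 _).
  rewrite (ge0_integralD_fin _ (fun z => sublin_ge0 sks _) pex0 msk); last exact: measurable_funM.
  rewrite (meanE explaw_laplace sks) (ge0_integralZ_fin _ pi0 (fun z => ex0 _) mex).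
  rewrite (_ : 3%:E = 2%:E + 1%:E)%E; last by rewrite -EFinD; congr EFin; lra.
  apply: leeD; first by rewrite lee_fin.
  apply: le_trans (lee_wpmul2l _ Eex) _; first by rewrite lee_fin.
  by rewrite -EFinM mulVf; [exact: lexx|rewrite gt_eqF].
have HW : ((3 / 4)%:E <= W)%E by exact: (markov_weight mk (fun z => k0 _) Ek).
have HI : ((3 / 4 * expR (c0 - 12 * p))%:E <= I)%E.
  have : ((2 * expR (c0 - 12 * p))%:E * (3 / 4)%:E <= I + I)%E.
    by apply: le_trans H2I; rewrite lee_wpmul2l// lee_fin mulr_ge0 ?expR_ge0.
  exact: le_of_double.
apply: (@le_trans _ _ ((2 * expR (13 * p))%:E * I)%E); last first.
  by rewrite lee_wpmul2l// lee_fin mulr_ge0 ?expR_ge0.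
apply: (@le_trans _ _ ((2 * expR (13 * p))%:E * (3 / 4 * expR (c0 - 12 * p))%:E)%E); last first.
  by rewrite lee_wpmul2l// lee_fin mulr_ge0 ?expR_ge0.
rewrite -EFinM lee_fin MfE.
(* 13 is 12, to undo the excess, plus 1, to undo the [p / 128] subtracted in [c0]; the numerical
   factor 3/2 is at least 1. *)
have -> : 2 * expR (13 * p) * (3 / 4 * expR (c0 - 12 * p)) = 3 / 2 * expR (c0 + p).
  have -> : c0 + p = 13 * p + (c0 - 12 * p) by ring.
  by rewrite [expR (13 * p + _)]expRD; field.
apply: (@le_trans _ _ (expR (c0 + p))); last by have := expR_ge0 (c0 + p); lra.
by rewrite ler_expR /c0; have := p0; lra.
Qed.

(** The right-hand side of [shifted_ge] does not involve [y], so the supremum passes through; it is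
    taken after [ln], once the infinite values of [shifted x] are set aside. *)
Lemma ballsup_exp x :
  ((expR (lam * ballsup r p (M x) / 128))%:E <= (2 * expR (13 * p))%:E * shifted x)%E.
Proof.
have c0 : 0 < 2 * expR (13 * p) by rewrite mulr_gt0 ?expR_gt0.
have lam_gt0 : 0 < lam by rewrite lamE divr_gt0 ?mulr_gt0.
have H y : pball r p y -> ((expR (lam * M x y / 128))%:E <= (2 * expR (13 * p))%:E * shifted x)%E.
  by move=> yp; exact: shifted_ge.
case: (((2 * expR (13 * p))%:E * shifted x)%E) H => [h| |] H; rewrite ?leey//; last first.
  by have := H _ (pball0 n r p1); rewrite leeNy_eq.
have h0 : 0 < h.
  by have := H _ (pball0 n r p1); rewrite lee_fin; apply: lt_le_trans; exact: expR_gt0.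
rewrite lee_fin -[h]lnK ?posrE// ler_expR ler_pdivrMr// mulrC -ler_pdivlMr//.
apply: ballsup_le => // y yp; rewrite ler_pdivlMr// mulrC -ler_pdivrMr// -ler_expR lnK ?posrE//.
by rewrite -lee_fin; exact: H.
Qed.

Lemma sublin_ballsup : sublin (fun x => ballsup r p (M x)).
Proof.
apply: (sublin_sup (A := pball r p) (f := fun y x => M x y)).
- move=> x; exists (K * norm1 x * (n%:R * p)) => _ [y yp <-]; apply: le_trans (MK _ _) _.
  by rewrite ler_wpM2l ?mulr_ge0 ?norm1_ge0// (pball_norm1 r1).
- by move=> y x x' _; exact: sublinD (Ms.1 y) _ _.
- by move=> y c x _ c0; exact: (sublinZ (Ms.1 y)).
- by move=> x; exists (fun=> 0); [exact: pball0|exact: attained_ge0 PM _ _].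
Qed.

Lemma le_ballsup_attained x y : pball r p y -> M x y <= ballsup r p (M x).
Proof.
move=> yp; apply: (le_ballsup r1 p1 (L := K * norm1 x)) => //.
by rewrite mulr_ge0 ?norm1_ge0.
Qed.

(** [w^p <= c^p * expR (p * w / c)] with [c = 13 * 128 * rho], for which [p / c] is [lam / 128].
    Then [ballsup_exp] turns the supremum into an integral in [z], and [integral_shifted] bounds its
    mean. *)
Lemma ballsup_moment :
  (\int[prodP m n]_x (ballsup r p (M (tnth x)) `^ p)%:E <= ((13 * 128 * 4 ^+ 15 * rho) `^ p)%:E)%E.
Proof.
have lam_gt0 : 0 < lam by rewrite lamE divr_gt0 ?mulr_gt0.
have ws := sublin_ballsup.
have ms : measurable_fun setT (fun x : n.-tuple RR => shifted (tnth x)).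
  apply: (measurable_fun_fubini_tonelli_F (m2 := prodP lap n) _ measurable_shifted_integrand).
  by move=> u; rewrite lee_fin expR_ge0.
have s0 x : (0 <= shifted x)%E by apply: integral_ge0 => z _; rewrite lee_fin expR_ge0.
have c0 : 0 <= 2 * expR (13 * p) by rewrite mulr_ge0 ?expR_ge0.
have c1 : (0 <= ((13 * 128 * rho) `^ p * (2 * expR (13 * p)))%:E)%E.
  by rewrite lee_fin mulr_ge0 ?powR_ge0.
apply: (@le_trans _ _ (\int[prodP m n]_x (((13 * 128 * rho) `^ p * (2 * expR (13 * p)))%:E * shifted (tnth x)))%E).
  apply: le_integral_ge0 => z; rewrite lee_fin powR_ge0 andTb.
  rewrite EFinM -muleA.
  apply: (@le_trans _ _ (((13 * 128 * rho) `^ p)%:E * (expR (lam * ballsup r p (M (tnth z)) / 128))%:E)%E); last first.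
    by apply: lee_wpmul2l; [rewrite lee_fin powR_ge0|exact: ballsup_exp].
  rewrite -EFinM lee_fin; set w := ballsup r p _.
  have -> : lam * w / 128 = p * w / (13 * 128 * rho) by rewrite lamE; field; rewrite gt_eqF.
  apply: powR_le_scaled_exp; [exact: sublin_ge0 ws _|exact: p0|].
  by apply: mulr_gt0; [apply: mulr_gt0; exact: ltr0n|exact: rho0].
rewrite ge0_integralZl//.
apply: le_trans (lee_wpmul2l c1 integral_shifted) _.
rewrite -EFinM lee_fin (_ : 13 * 128 * 4 ^+ 15 * rho = 13 * 128 * rho * 4 ^+ 15); last by ring.
rewrite (@powRM _ _ (4 ^+ 15)) ?mulr_ge0 ?exprn_ge0 ?(ltW rho0)//.
rewrite -[leLHS]mulrA; apply: ler_wpM2l; first exact: powR_ge0.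
exact: double_exp_le.
Qed.

End shifted_bound.

(** * Laplace mean of the row suprema *)

Section row_bounds.
Context {R : realType}.
Notation RR := (measurableTypeR R).
Notation lap := (@laplace R).

Lemma linear_moment_nat (m : probability RR R) (r cr : R) (law : explaw m r cr) n (a : 'I_n -> R)
    (sg : R) (k : nat) : (0 < k)%N -> 0 <= sg -> \sum_(i < n) a i ^+ 2 <= sg ^+ 2 ->
  (\int[prodP m n]_z (`|\sum_(i < n) a i * tnth z i| ^+ k)%:E <= (8 * (32 * k%:R) ^+ k * sg ^+ k)%:E)%E.
Proof.
move=> k0 sg0 asg; have [sgE|sgn] := eqVneq sg 0.
  have a0 i : a i = 0.
    apply/eqP; rewrite -sqrf_eq0 eq_le sqr_ge0 andbT; apply: le_trans (_ : _ <= sg ^+ 2) _.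
      by apply: le_trans asg; rewrite (bigD1 i)//= lerDl sumr_ge0// => j _; rewrite sqr_ge0.
    by rewrite sgE expr0n.
  rewrite (eq_integral (fun=> 0)); first by rewrite integral0 lee_fin !mulr_ge0 ?exprn_ge0.
  move=> z _; rewrite big1; first by rewrite normr0 expr0n gtn_eqF.
  by move=> i _; rewrite a0 mul0r.
have {}sg0 : 0 < sg by rewrite lt_neqAle eq_sym sgn.
have k0' : (0 : R) < k%:R by rewrite ltr0n.
have := linear_moment law k0' sg0 asg.
rewrite !powR_mulrn ?(ltW sg0) ?mulr_ge0//.
by under eq_integral do rewrite powR_mulrn//.
Qed.

Lemma integral_sum_le {d} {T : measurableType d} (P : probability T R) n (f : 'I_n -> T -> R)
    (c : 'I_n -> R) : (forall i, measurable_fun setT (f i)) -> (forall i x, 0 <= f i x) ->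
  (forall i, \int[P]_x (f i x)%:E <= (c i)%:E)%E ->
  (\int[P]_x (\sum_(i < n) f i x)%:E <= (\sum_(i < n) c i)%:E)%E.
Proof.
move=> mf f0 fc; under eq_integral do rewrite -sumEFin.
rewrite ge0_integral_sum//.
- by rewrite -sumEFin; exact: lee_sum.
- by move=> i; exact/measurable_EFinP.
- by move=> i x _; rewrite lee_fin.
Qed.

Definition rownorm n (a : 'I_n -> 'I_n -> R) (i : 'I_n) : R := Num.sqrt (\sum_(j < n) a i j ^+ 2).

Definition rowform n (a : 'I_n -> 'I_n -> R) (z : 'I_n -> R) (i : 'I_n) : R := \sum_(j < n) a i j * z j.

Lemma rownorm_ge0 n (a : 'I_n -> 'I_n -> R) i : 0 <= rownorm a i.
Proof. exact: sqrtr_ge0. Qed.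

Lemma rownorm_sqr n (a : 'I_n -> 'I_n -> R) i : rownorm a i ^+ 2 = \sum_(j < n) a i j ^+ 2.
Proof. by rewrite sqr_sqrtr// sumr_ge0// => j _; rewrite sqr_ge0. Qed.

Lemma bil_rowform n (a : 'I_n -> 'I_n -> R) x z : bil a x z = \sum_(i < n) x i * rowform a z i.
Proof.
apply: eq_bigr => i _; rewrite mulr_sumr; apply: eq_bigr => j _; ring.
Qed.

(** [(t^3)^r >= t^4] means [3 * r >= 4]: this is the origin of the threshold 4/3. In the mixed case,
    [w] small and [t^3 * w] large, the exponents 2 and [r] are compared in either order. *)
Lemma phi_dilate (r t w : R) : 4 / 3 <= r -> 1 <= t -> t ^+ 4 * phi r w <= phi r (t ^+ 3 * w).
Proof.
move=> r43 t1; have t0 : 0 < t by apply: lt_le_trans t1.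
have t3 : 1 <= t ^+ 3 by rewrite exprn_ege1.
have r1 : 1 <= r by lra.
rewrite /phi normrM (ger0_norm (ltW (lt_le_trans ltr01 t3))).
have t4 : t ^+ 4 <= (t ^+ 3) `^ r.
  rewrite -!powR_mulrn ?(ltW t0)// -powRrM ler_powR//; lra.
have w0 := normr_ge0 w.
have [w1|w1] := leP `|w| 1; last first.
  have tw1 : 1 < t ^+ 3 * `|w| by rewrite (lt_le_trans w1)// ler_peMl.
  by rewrite [t ^+ 3 * _ <= 1]leNgt tw1/= powRM// ?(ltW (lt_le_trans ltr01 t3))// ler_wpM2r// powR_ge0.
have [tw1|tw1] := leP (t ^+ 3 * `|w|) 1.
  by rewrite exprMn ler_wpM2r ?sqr_ge0// -exprM ler_weXn2l.
rewrite -[w ^+ 2]real_normK ?num_real//.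
have [r2|r2] := leP r 2.
  rewrite powRM ?(ltW (lt_le_trans ltr01 t3))// ler_pM ?exprn_ge0 ?(ltW t0)//.
  have [->|wn] := eqVneq `|w| 0; first by rewrite expr0n/= powR_ge0.
  by rewrite -powR_mulrn// ger_powR// lt_neqAle eq_sym wn w0.
apply: (@le_trans _ _ ((t ^+ 3 * `|w|) `^ 2)); last by rewrite ler_powR ?(ltW tw1)// ltW.
rewrite (powR_mulrn 2) ?mulr_ge0 ?exprn_ge0 ?(ltW t0)// exprMn ler_wpM2r ?sqr_ge0//.
by rewrite -exprM ler_weXn2l.
Qed.

(** A separable function is maximized coordinate by coordinate: near-maximizers with error
    [e / n.+1] are put together in one vector. It is applied to [s * u - phi u], whose supremum is
    the Legendre transform of the cost at [s]. *)
Lemma sumr_sup_le n (g : 'I_n -> R -> R) (b : 'I_n -> R) (p : R) :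
  (forall i, g i 0 = 0) ->
  (forall i, b i = sup (range (g i))) -> (forall x : 'I_n -> R, \sum_(i < n) g i (x i) <= p) ->
  (forall i u, g i u <= b i) /\ \sum_(i < n) b i <= p.
Proof.
move=> g0 bE gp.
have ub i : has_ubound (range (g i)).
  exists p => _ [u _ <-]; apply: le_trans (gp (fun j => if j == i then u else 0)).
  by rewrite (bigD1 i)//= eqxx big1 ?addr0// => j /negPf ->.
split=> [i u|]; first by rewrite bE; apply: ub_le_sup => //; exists u.
apply/ler_addgt0Pr => e e0.
have d0 : 0 < e / n.+1%:R by rewrite divr_gt0.
have ex i : exists u, b i - e / n.+1%:R < g i u.
  have hs : has_sup (range (g i)) by split=> //; exists (g i 0), 0.
  by have [_ [u _ <-] H] := sup_adherent d0 hs; exists u; rewrite bE.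
pose x i := projT1 (cid (ex i)).
have xP i : b i <= g i (x i) + e / n.+1%:R by rewrite -lerBlDr ltW// /x; case: cid.
apply: le_trans (ler_sum _ (fun i _ => xP i)) _; rewrite big_split/= lerD//.
rewrite sumr_const card_ord -[leLHS]mulr_natl mulrCA ler_piMr ?(ltW e0)//.
by rewrite ler_pdivrMr// mul1r ler_nat.
Qed.

Section scaled.
Variables (r p : R) (n : nat) (a : 'I_n -> 'I_n -> R).
Hypotheses (r1 : 1 <= r) (p1 : 1 <= p).
Let p0 : 0 < p. Proof. exact: lt_le_trans p1. Qed.
Hypothesis rowsP : forall x, \sum_(i < n) rownorm a i * x i <= p + \sum_(i < n) phi r (x i).
Hypothesis ballP : forall x y, pball r p x -> pball r p y -> bil a x y <= p.

Let law := @explaw_laplace R.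

Let mrow i : measurable_fun setT (fun z : n.-tuple RR => `|rowform a (tnth z) i|).
Proof. by apply: measurableT_comp => //; exact: measurable_linear_form. Qed.

(* An integrable upper bound, linear in the scale p, of z |-> sup of a(x, z) over x
   in the ball. *)
Definition row_bound C := exists2 B : n.-tuple RR -> R, measurable_fun setT B /\ (forall z, 0 <= B z) &
  (forall z x, pball r p x -> bil a x (tnth z) <= B z) /\
  (\int[prodP lap n]_z (B z)%:E <= (C * p)%:E)%E.

(* For r >= 4/3, the Legendre transform of phi at t s is at most max(1, t^4) times
   its value at s. *)
Lemma row_bound_large : 4 / 3 <= r -> row_bound (2 + 8 * 128 ^+ 4).
Proof.
move=> r43.
pose g i u := rownorm a i * u - phi r u.
have g0 i : g i 0 = 0 by rewrite /g mulr0 /phi normr0 ler01 expr0n subrr.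
pose b i := sup (range (g i)).
have [gb sb] : (forall i u, g i u <= b i) /\ \sum_(i < n) b i <= p.
  apply: sumr_sup_le => // x; rewrite /g sumrB lerBlDr; exact: rowsP.
have b0 i : 0 <= b i by rewrite -(g0 i).
(* The row form in units of its row norm; a zero row gives 0, by the convention on division. *)
pose t z i := `|rowform a z i| / rownorm a i.
have key z i u : u * rowform a z i <= phi r u + (1 + t z i ^+ 4) * b i.
  have t0 : 0 <= t z i by rewrite divr_ge0 ?rownorm_ge0.
  have [s0|sn] := eqVneq (rownorm a i) 0.
    have a0 j : a i j = 0.
      apply/eqP; rewrite -sqrf_eq0 eq_le sqr_ge0 andbT.
      have := rownorm_sqr a i; rewrite s0 expr0n/= (bigD1 j)//= => H.
      by rewrite [leRHS]H lerDl sumr_ge0// => k _; rewrite sqr_ge0.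
    rewrite /rowform big1 ?mulr0; last by move=> j _; rewrite a0 mul0r.
    by rewrite addr_ge0 ?phi_ge0// mulr_ge0// addr_ge0// exprn_ge0.
  have s0 : 0 < rownorm a i by rewrite lt_neqAle eq_sym sn rownorm_ge0.
  have rE : `|rowform a z i| = t z i * rownorm a i by rewrite /t divfK.
  apply: (@le_trans _ _ (`|u| * (t z i * rownorm a i))).
    by rewrite -rE -normrM ler_norm.
  have phin : phi r `|u| = phi r u by rewrite /phi normr_id real_normK ?num_real.
  rewrite -phin; set v : R := `|u|; have v0 : 0 <= v by exact: normr_ge0.
  have [t1|t1] := leP (t z i) 1.
    apply: (@le_trans _ _ (rownorm a i * v)).
      by rewrite mulrC ler_wpM2r// ler_piMl// rownorm_ge0.
    rewrite -lerBlDl; apply: le_trans (gb i v) _.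
    by rewrite ler_peMl// lerDl exprn_ge0.
  (* The Legendre bound at [v / t^3], multiplied by [t^4], bounds [v * (t * s)] by
     [t^4 * phi (v / t^3) + t^4 * b], and the dilation inequality absorbs the first term into
     [phi v]. *)
  have H := @phi_dilate r (t z i) (v / t z i ^+ 3) r43 (ltW t1).
  have tn : t z i != 0 by rewrite gt_eqF// (lt_trans ltr01).
  have := gb i (v / t z i ^+ 3); rewrite /g => H2.
  have t40 : 0 <= t z i ^+ 4 by rewrite exprn_ge0.
  have H3 := ler_wpM2l t40 H2.
  rewrite (_ : t z i ^+ 3 * (v / t z i ^+ 3) = v) in H; last by rewrite mulrC divfK// expf_neq0.
  have -> : v * (t z i * rownorm a i) = t z i ^+ 4 * (rownorm a i * (v / t z i ^+ 3)) by field.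
  have := b0 i; move: H H3; rewrite mulrBr mulrDl mul1r; lra.
have t0 z i : 0 <= t z i by rewrite divr_ge0 ?rownorm_ge0.
have f0 (i : 'I_n) (z : n.-tuple RR) : 0 <= (1 + t (tnth z) i ^+ 4) * b i.
  by rewrite mulr_ge0// addr_ge0// exprn_ge0.
have mt i : measurable_fun setT (fun z : n.-tuple RR => t (tnth z) i ^+ 4).
  by apply: measurable_funX; exact: measurable_funM.
have mf i : measurable_fun setT (fun z : n.-tuple RR => (1 + t (tnth z) i ^+ 4) * b i).
  by apply: measurable_funM => //; exact: measurable_funD.
have fsum0 (z : n.-tuple RR) : 0 <= \sum_(i < n) (1 + t (tnth z) i ^+ 4) * b i by exact: sumr_ge0.
have mS : measurable_fun setT (fun z : n.-tuple RR => \sum_(i < n) (1 + t (tnth z) i ^+ 4) * b i).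
  exact: measurable_sum.
exists (fun z => p + \sum_(i < n) (1 + t (tnth z) i ^+ 4) * b i).
  split; first exact: measurable_funD.
  by move=> z; rewrite addr_ge0// ltW.
split.
  move=> z x xp; rewrite bil_rowform.
  apply: (@le_trans _ _ (\sum_(i < n) (phi r (x i) + (1 + t (tnth z) i ^+ 4) * b i))).
    exact: ler_sum.
  by rewrite big_split/= lerD2r.
have Et i : (\int[prodP lap n]_z (t (tnth z) i ^+ 4)%:E <= (8 * 128 ^+ 4)%:E)%E.
  have := linear_moment_nat law (a := a i) (sg := rownorm a i) (k := 4) isT (rownorm_ge0 _ _) _.
  rewrite rownorm_sqr lexx => /(_ isT) H.
  rewrite (eq_integral (fun z : n.-tuple RR => ((rownorm a i) ^- 4 * `|rowform a (tnth z) i| ^+ 4)%:E)); last first.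
    by move=> z _; rewrite /t expr_div_n mulrC.
  have ri : 0 <= rownorm a i ^- 4 by rewrite invr_ge0 exprn_ge0// rownorm_ge0.
  rewrite ge0_integralZ_fin//; last 1 first.
    exact: measurable_funX.
  apply: (@le_trans _ _ ((rownorm a i ^- 4)%:E * (8 * (32 * 4%:R) ^+ 4 * rownorm a i ^+ 4)%:E)%E).
    by rewrite lee_wpmul2l// lee_fin.
  rewrite -EFinM lee_fin.
  rewrite mulrCA (_ : (32 * 4%:R) = 128); last by rewrite -natrM.
  rewrite ler_piMr ?mulr_ge0 ?exprn_ge0//.
  have [->|sn] := eqVneq (rownorm a i) 0; first by rewrite expr0n mulr0.
  by rewrite mulVf// expf_neq0.
rewrite (ge0_integralD_fin _ (fun _ => ltW p0) fsum0)// integral_probability_cst.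
apply: (@le_trans _ _ (p%:E + (\sum_(i < n) (1 + 8 * 128 ^+ 4) * b i)%:E)%E); last first.
  by rewrite -mulr_sumr -EFinD lee_fin mulrDl [leRHS]mulrDl; nra.
rewrite leeD2l//; apply: integral_sum_le => // i.
under eq_integral do rewrite mulrC.
rewrite (ge0_integralZ_fin _ (b0 i) (f := fun z : n.-tuple RR => 1 + t (tnth z) i ^+ 4)); last 2 first.
- by move=> z; rewrite addr_ge0// exprn_ge0.
- exact: measurable_funD.
rewrite mulrC [X in (_ <= X)%E]EFinM; apply: lee_wpmul2l; first by rewrite lee_fin.
rewrite ge0_integralD_fin//; last by move=> z; rewrite exprn_ge0.
by rewrite integral_probability_cst EFinD leeD2l.
Qed.

Let phi_le_sqr t : r <= 2 -> phi r t <= t ^+ 2.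
Proof.
move=> r2; rewrite /phi; case: (leP `|t| 1) => // t1.
by rewrite -[leRHS]real_normK ?num_real// -powR_mulrn// ler_powR// ltW.
Qed.

Let pball_coord (x : 'I_n -> R) i : pball r p x -> `|x i| <= p.
Proof.
move=> xp; have [x1|/ltW x1] := leP `|x i| 1; first exact: le_trans x1 p1.
apply: le_trans (phi_ge_lin r1 x1) _; apply: le_trans xp; rewrite (bigD1 i)//= lerDl.
by apply: sumr_ge0 => j _; exact: phi_ge0.
Qed.

(** The form is tested on [x] equal to [p^(1/r)] at [i] and 0 elsewhere, and on [y] the normalized
    row times [sqrt p]. Both are in the ball, so [p^(1/r) * sqrt p * s <= p]. For [r <= 4/3] one has
    [p^(4/r) >= p^3], and the fourth power of the inequality gives the claim. *)
Let row_small i : r <= 4 / 3 -> p * rownorm a i ^+ 4 <= 1.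
Proof.
move=> r43; have r0 : 0 < r by exact: lt_le_trans r1.
have [->|sn] := eqVneq (rownorm a i) 0; first by rewrite expr0n mulr0.
pose P := p `^ r^-1.
have P1 : 1 <= P by rewrite -[leLHS](powRr0 p) ler_powR// invr_ge0 ltW.
have P0 : 0 < P by exact: lt_le_trans P1.
have Pr : P `^ r = p by rewrite -powRrM mulVf ?gt_eqF// powRr1// ltW.
have P4 : p ^+ 3 <= P ^+ 4.
  rewrite -!powR_mulrn ?(ltW P0) ?(ltW p0)// /P -powRrM ler_powR//.
  by rewrite mulrC ler_pdivlMr//; lra.
pose x j := if j == i then P else 0.
pose y j := Num.sqrt p * a i j / rownorm a i.
have xp : pball r p x.
  rewrite /pball/= (bigD1 i)//= big1 ?addr0; last first.
    by move=> j /negPf ji; rewrite /x ji /phi normr0 ler01 expr0n.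
  rewrite /x eqxx /phi (gtr0_norm P0); case: (leP P 1) => PP; last by rewrite Pr.
  by rewrite (@le_anti _ _ P 1) ?PP ?P1// expr1n.
have yp : pball r p y.
  apply: (@le_trans _ _ (\sum_(j < n) y j ^+ 2)).
    by apply: ler_sum => j _; apply: phi_le_sqr; lra.
  rewrite (eq_bigr (fun j => p / rownorm a i ^+ 2 * a i j ^+ 2)).
    by rewrite -mulr_sumr -rownorm_sqr divfK// expf_neq0.
  by move=> j _; rewrite /y exprMn exprVn exprMn sqr_sqrtr ?(ltW p0)//; ring.
have := ballP xp yp; rewrite bil_rowform (bigD1 i)//= big1 ?addr0; last first.
  by move=> j /negPf ji; rewrite /x ji mul0r.
have -> : rowform a y i = Num.sqrt p * rownorm a i.
  rewrite /rowform (eq_bigr (fun j => Num.sqrt p / rownorm a i * a i j ^+ 2)).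
    by rewrite -mulr_sumr -rownorm_sqr; field.
  by move=> j _; rewrite /y; ring.
rewrite /x eqxx => H.
have s0 := rownorm_ge0 a i; set s := rownorm a i in s0 H *.
have sp0 := sqrtr_ge0 p; have sp2 : Num.sqrt p ^+ 2 = p by rewrite sqr_sqrtr// ltW.
have : (P * (Num.sqrt p * s)) ^+ 4 <= p ^+ 4.
  by apply: lerXn2r => //; rewrite nnegrE ?(ltW p0)// !mulr_ge0// ltW.
have -> : (P * (Num.sqrt p * s)) ^+ 4 = P ^+ 4 * ((Num.sqrt p ^+ 2) ^+ 2 * s ^+ 4) by ring.
rewrite sp2 => H4.
have H5 : p ^+ 3 * (p ^+ 2 * s ^+ 4) <= p ^+ 4.
  by apply: le_trans H4; rewrite ler_wpM2r// mulr_ge0// exprn_ge0// ltW.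
rewrite -(@ler_pM2l _ (p ^+ 4)) ?exprn_gt0// mulr1.
by apply: le_trans H5; rewrite le_eqVlt; apply/orP; left; apply/eqP; ring.
Qed.

(* For r <= 4/3, all the row norms are at most p^(-1/4). *)
Lemma row_bound_small : r <= 4 / 3 -> row_bound (1 + (8 * 64 ^+ 2 + 8 * 192 ^+ 6) * 4).
Proof.
move=> r43.
pose s i := rownorm a i.
have s0 i : 0 <= s i by exact: rownorm_ge0.
have si4 i : p * s i ^+ 4 <= 1 by exact: row_small.
have si1 i : s i <= 1.
  rewrite -(@ler_pXn2r _ 4)// ?nnegrE// expr1n; apply: le_trans (si4 i).
  by rewrite ler_peMl// exprn_ge0.
(* Half the row norms, all at most 1, are a test vector of quadratic cost: the sum of squares over 2
   is at most [p] plus the sum of squares over 4. *)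
have ssum : \sum_(i < n) s i ^+ 2 <= 4 * p.
  have := rowsP (fun i => s i / 2).
  rewrite (eq_bigr (fun i => s i ^+ 2 / 2)); last by move=> i _; rewrite -/(s i); ring.
  rewrite [X in _ <= p + X](eq_bigr (fun i => s i ^+ 2 / 4)); last first.
    move=> i _; rewrite /phi ger0_norm ?divr_ge0// ifT; first by field.
    by have := si1 i; lra.
  by rewrite -!mulr_suml; lra.
(* If [b > 1], [|u| <= p] gives [p * b^6]; if [b <= 1 < |u|], the cost [phi] alone suffices; if both
   are at most 1, the product is split into squares. The sixth power is chosen because
   [p * s^6 <= s^2] by [row_small], so its mean is again summable. *)
have key z i u : `|u| <= p -> u * rowform a z i <= phi r u + (`|rowform a z i| ^+ 2 + p * `|rowform a z i| ^+ 6).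
  move=> up; apply: (@le_trans _ _ (`|u| * `|rowform a z i|)); first by rewrite -normrM ler_norm.
  set b : R := `|rowform a z i|; have b0 : 0 <= b by exact: normr_ge0.
  have pb6 : 0 <= p * b ^+ 6 by rewrite mulr_ge0 ?exprn_ge0// ltW.
  have b2 : 0 <= b ^+ 2 by rewrite exprn_ge0.
  have [b1|b1] := leP b 1; last first.
    apply: (@le_trans _ _ (p * b ^+ 6)); last by have := phi_ge0 r u; lra.
    by rewrite ler_pM// ler_eXnr// ltW.
  have [u1|u1] := leP `|u| 1; last first.
    have := phi_ge_lin r1 (ltW u1); have : `|u| * b <= `|u| by rewrite ler_piMr.
    lra.
  rewrite /phi u1 -real_normK ?num_real//; have := sqr_ge0 (`|u| - b).
  by have := sqr_ge0 `|u|; nra.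
have f0 (i : 'I_n) (z : n.-tuple RR) : 0 <= `|rowform a (tnth z) i| ^+ 2 + p * `|rowform a (tnth z) i| ^+ 6.
  by rewrite addr_ge0 ?mulr_ge0 ?exprn_ge0// ltW.
have m6 (i : 'I_n) : measurable_fun setT (fun z : n.-tuple RR => p * `|rowform a (tnth z) i| ^+ 6).
  by apply: measurable_funM => //; exact: measurable_funX.
have mf (i : 'I_n) : measurable_fun setT (fun z : n.-tuple RR => `|rowform a (tnth z) i| ^+ 2 + p * `|rowform a (tnth z) i| ^+ 6).
  by apply: measurable_funD => //; exact: measurable_funX.
have mS : measurable_fun setT (fun z : n.-tuple RR =>
    \sum_(i < n) (`|rowform a (tnth z) i| ^+ 2 + p * `|rowform a (tnth z) i| ^+ 6)).
  exact: measurable_sum.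
have S0 (z : n.-tuple RR) : 0 <= \sum_(i < n) (`|rowform a (tnth z) i| ^+ 2 + p * `|rowform a (tnth z) i| ^+ 6).
  exact: sumr_ge0.
exists (fun z => p + \sum_(i < n) (`|rowform a (tnth z) i| ^+ 2 + p * `|rowform a (tnth z) i| ^+ 6)).
  split; first exact: measurable_funD.
  by move=> z; rewrite addr_ge0// ltW.
split.
  move=> z x xp; rewrite bil_rowform.
  apply: (@le_trans _ _ (\sum_(i < n) (phi r (x i) + (`|rowform a (tnth z) i| ^+ 2 + p * `|rowform a (tnth z) i| ^+ 6)))).
    by apply: ler_sum => i _; apply: key; exact: pball_coord.
  by rewrite big_split/= lerD2r.
have Ek k i : (0 < k)%N ->
    (\int[prodP lap n]_z (`|rowform a (tnth z) i| ^+ k)%:E <= (8 * (32 * k%:R) ^+ k * s i ^+ k)%:E)%E.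
  by move=> k0; apply: (linear_moment_nat law (a := a i)) => //; rewrite -rownorm_sqr.
rewrite (ge0_integralD_fin _ (fun _ => ltW p0) S0)// integral_probability_cst.
set c := 8 * 64 ^+ 2 + 8 * 192 ^+ 6.
have c0 : 0 <= c by rewrite addr_ge0// mulr_ge0// exprn_ge0.
apply: (@le_trans _ _ (p%:E + (\sum_(i < n) c * s i ^+ 2)%:E)%E); last first.
  by have := ler_wpM2l c0 ssum; rewrite -mulr_sumr -EFinD lee_fin; lra.
rewrite leeD2l//; apply: integral_sum_le => // i.
rewrite ge0_integralD_fin//; last 2 first.
- by move=> z; rewrite mulr_ge0 ?exprn_ge0// ltW.
- exact: measurable_funX.
rewrite ge0_integralZ_fin ?(ltW p0)//; last exact: measurable_funX.
apply: (@le_trans _ _ ((8 * 64 ^+ 2 * s i ^+ 2)%:E + p%:E * (8 * 192 ^+ 6 * s i ^+ 6)%:E)%E).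
  have := @Ek 2 i isT; have := @Ek 6 i isT.
  rewrite (_ : 32 * 2%:R = 64); last by rewrite -natrM.
  rewrite (_ : 32 * 6%:R = 192); last by rewrite -natrM.
  by move=> h6 h2; apply: leeD => //; rewrite lee_wpmul2l// lee_fin ltW.
rewrite -EFinM -EFinD lee_fin /c [leRHS]mulrDl lerD2l.
have -> : p * (8 * 192 ^+ 6 * s i ^+ 6) = 8 * 192 ^+ 6 * ((p * s i ^+ 4) * s i ^+ 2) by ring.
apply: ler_wpM2l; first by apply: mulr_ge0 => //; exact: exprn_ge0.
by apply: ler_piMl; [exact: exprn_ge0|exact: si4].
Qed.

End scaled.

(** The sum of the constants of the two regimes of [r], so that it serves for both. *)
Definition row_const : R := 2 + 8 * 128 ^+ 4 + (1 + (8 * 64 ^+ 2 + 8 * 192 ^+ 6) * 4).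

Lemma row_const_ge1 : 1 <= row_const.
Proof.
have h1 : 0 <= 128 ^+ 4 :> R by exact: exprn_ge0.
have h2 : 0 <= 64 ^+ 2 :> R by exact: exprn_ge0.
have h3 : 0 <= 192 ^+ 6 :> R by exact: exprn_ge0.
rewrite /row_const; move: h1 h2 h3.
set x := 128 ^+ 4; set y := 64 ^+ 2; set z := 192 ^+ 6; lra.
Qed.

Lemma row_bound_le r p n (a : 'I_n -> 'I_n -> R) C C' : 0 < p -> C <= C' ->
  row_bound r p a C -> row_bound r p a C'.
Proof.
move=> p0 CC [B B1 [B2 B3]]; exists B => //; split=> //.
by apply: le_trans B3 _; rewrite lee_fin ler_wpM2r// ltW.
Qed.

(** Scaling the matrix by [p / rho] turns both bounds into [p]. The row bound is put in additive
    form by [pball_le], applied to the sum with absolute values of the coordinates, which is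
    nonnegative and sublinear. *)
Lemma mean_rowsup (m : probability RR R) (r cr p : R) (law : explaw m r cr) (p1 : 1 <= p) n
    (Phi : set ('I_n -> 'I_n -> R)) M (PM : attained_norm Phi M) f rho : Phi f -> 0 < rho ->
  (forall x, pball r p x -> \sum_(i < n) rownorm f i * x i <= rho) ->
  (forall x y, pball r p x -> pball r p y -> bil f x y <= rho) ->
  mean lap (rowsup r p f) <= row_const * rho.
Proof.
move=> Pf rho0 Hrow Hball; have p0 : 0 < p by exact: lt_le_trans p1.
have r1 := law.1.
pose k := p / rho; have k0 : 0 < k by rewrite divr_gt0.
pose a i j := k * f i j.
have arow i : rownorm a i = k * rownorm f i.
  rewrite /rownorm -[X in _ = X * _](ger0_norm (ltW k0)) -sqrtr_sqr -sqrtrM ?sqr_ge0//.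
  by rewrite mulr_sumr; congr Num.sqrt; apply: eq_bigr => j _; rewrite exprMn.
have abil x y : bil a x y = k * bil f x y.
  rewrite /bil mulr_sumr; apply: eq_bigr => i _; rewrite mulr_sumr; apply: eq_bigr => j _.
  by rewrite /a; ring.
pose h (x : 'I_n -> R) := \sum_(i < n) rownorm a i * `|x i|.
have hs : sublin h.
  split=> [x|x y|c x c0]; first by rewrite sumr_ge0// => i _; rewrite mulr_ge0 ?rownorm_ge0.
    by rewrite -big_split/=; apply: ler_sum => i _; rewrite -mulrDr ler_wpM2l ?rownorm_ge0// ler_normD.
  by rewrite mulr_sumr; apply: eq_bigr => i _; rewrite normrM (ger0_norm c0) mulrCA.
have kr : k * rho = p by rewrite /k divfK// gt_eqF.
have hp x : pball r p x -> h x <= p.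
  move=> xp; have xp' : pball r p (fun i => `|x i|).
    rewrite /pball/= (eq_bigr (fun i => phi r (x i)))// => i _.
    by rewrite /phi normr_id real_normK ?num_real.
  rewrite -kr; apply: le_trans (ler_wpM2l (ltW k0) (Hrow _ xp')).
  by rewrite mulr_sumr; apply: ler_sum => i _; rewrite arow mulrA.
have rowsP x : \sum_(i < n) rownorm a i * x i <= p + \sum_(i < n) phi r (x i).
  apply: le_trans (pball_le law hs p0 hp x); apply: ler_sum => i _.
  by rewrite ler_wpM2l ?rownorm_ge0// ler_norm.
have ballP x y : pball r p x -> pball r p y -> bil a x y <= p.
  by move=> xp yp; rewrite abil -kr ler_wpM2l ?(ltW k0)// Hball.
have [B [mB B0] [Bx EB]] : row_bound r p a row_const.
  have [r43|/ltW r43] := leP r (4 / 3).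
    apply: row_bound_le (row_bound_small r1 p1 rowsP ballP r43) => //.
    by rewrite lerDr addr_ge0// mulr_ge0// exprn_ge0.
  apply: row_bound_le (row_bound_large p1 rowsP r43) => //.
  by rewrite lerDl addr_ge0// mulr_ge0// addr_ge0// mulr_ge0// exprn_ge0.
have ki0 : 0 <= k^-1 by rewrite invr_ge0 ltW.
rewrite -lee_fin -(meanE explaw_laplace); last exact: (sublin_rowsup law p1 PM Pf).
apply: (@le_trans _ _ (\int[prodP lap n]_z (k^-1 * B z)%:E)%E).
  apply: le_integral_fin => z; rewrite (sublin_ge0 (sublin_rowsup law p1 PM Pf))/=.
  apply: ballsup_le => // x xp; rewrite mulrC ler_pdivlMr// mulrC -abil; exact: Bx.
rewrite ge0_integralZ_fin//.
apply: (@le_trans _ _ ((k^-1)%:E * (row_const * p)%:E)%E); first by rewrite lee_wpmul2l.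
by rewrite -EFinM lee_fin /k invf_div mulrCA mulrC divfK ?gt_eqF// mulrC.
Qed.

End row_bounds.

(** * Lower bounds by tilting *)

Section gadget.
Context {R : realType}.
Notation RR := (measurableTypeR R).
Variables (m : probability RR R) (r cr : R).
Hypothesis law : explaw m r cr.
Let r1 := law.1.

Definition abstail (t : R) : R := fine (m [set x : RR | t <= `|x|]).

Let measurable_abstail (t : R) : measurable ([set x : RR | t <= `|x|] : set RR).
Proof.
have -> : [set x : RR | t <= `|x|] = (fun x : RR => `|x| : RR) @^-1` `[t, +oo[.
  by apply/seteqP; split=> x /=; rewrite in_itv/= andbT.
have mabs : measurable_fun setT (fun x : RR => `|x| : RR) by exact: measurableT_comp.
by have := mabs measurableT _ (measurable_itv `[t, +oo[); rewrite setTI.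
Qed.

Lemma abstail_fin t : m [set x : RR | t <= `|x|] = (abstail t)%:E.
Proof. by rewrite fineK//; exact: fin_num_measure. Qed.

Lemma abs_indic (t x : R) : \1_[set x : RR | t <= `|x|] x = (t <= `|x|)%R%:R :> R.
Proof. by rewrite indicE; congr (_%:R); congr nat_of_bool; apply/idP/idP; rewrite inE. Qed.

Lemma abstailE (t : R) : 0 < t -> abstail t = 2 * cdfm m (- t).
Proof.
move=> t0; apply: EFin_inj; rewrite -abstail_fin.
have mA := measurable_abstail t.
have mI : measurable (`]-oo, (- t)%R]%classic : set RR) by exact: measurable_itv.
have -> : m [set x : RR | t <= `|x|] = (\int[m]_x (\1_[set x : RR | t <= `|x|] x)%:E)%E.
  by rewrite integral_indic// setIT.
rewrite (explaw_symE law (F := fun x => \1_[set x : R | t <= `|x|] x))//; last exact: measurable_indic.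
rewrite (eq_integral (fun x : RR => (2 * (2^-1 * (\1_`]-oo, (- t)%R] x + \1_`]-oo, (- t)%R] (- x))))%:E)); last first.
  move=> x _; congr EFin; rewrite !abs_indic !indicE !mem_setE !in_itv/= normrN.
  case: (ger0P x) => x0.
    have -> : (x <= - t) = false by apply/negP => H; lra.
    by rewrite lerNl opprK; case: (t <= x) => /=; rewrite ?mulr0 ?addr0 ?add0r//; field.
  have -> : (- x <= - t) = false by apply/negP => H; lra.
  by rewrite lerNr; case: (t <= - x) => /=; rewrite ?mulr0 ?addr0 ?add0r//; field.
have mi : measurable_fun setT (\1_`]-oo, (- t)%R] : RR -> R) by exact: measurable_indic.
have mo : measurable_fun setT (fun x : RR => - x : RR).
  by apply: continuous_measurable_fun => x; apply: cvgN; exact: cvg_id.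
rewrite ge0_integralZ_fin//; last first.
- by apply: measurable_funM => //; apply: measurable_funD => //; exact: (measurableT_comp mi mo).
rewrite -(explaw_symE law)// integral_indic// setIT EFinM; congr (_ * _)%E.
by rewrite /cdfm fineK//; exact: fin_num_measure.
Qed.

Definition hatm (t : R) : R := if `|t| <= 1 then t ^+ 2 else - ln (abstail `|t|).

Lemma abstail_gt0 t : 0 < t -> 0 < abstail t.
Proof. by move=> t0; rewrite abstailE// mulr_gt0//; case/andP: (cdfm_lt01 law (- t)). Qed.

Lemma abstail_le t : 0 < t -> abstail t <= expR (- (t `^ r)).
Proof.
by move=> t0; rewrite abstailE//; have := cdfm_tail_le law (ltW t0); lra.
Qed.

(** The interval []t, 3 * t]] has length at least 2 and density at least
    [4^-1 * expR (- (3 * t)^r)]; the two signs double this. *)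
Lemma abstail_ge t : 1 <= t -> expR (- ((3 * t) `^ r)) <= abstail t.
Proof.
move=> t1; have t0 : 0 < t by exact: lt_le_trans t1.
rewrite abstailE//.
have b0 : 0 <= 2 * t by lra.
have := cdfm_increment law (ltW t0) b0 => /andP[H _].
have -> : 3 * t = t + 2 * t by ring.
have /andP[c0 _] := cdfm_lt01 law (- (t + 2 * t)).
have cr4 := explaw_cr_ge law; set e := expR _ in H *.
have e0 : 0 <= e by exact: expR_ge0.
have : 4^-1 * e <= cr * e by rewrite ler_wpM2r.
have : 1 * (cr * e) <= t * (cr * e) by rewrite ler_wpM2r// mulr_ge0// (le_trans _ cr4).
lra.
Qed.

Lemma hatm_le t : hatm t <= phi r (3 * t).
Proof.
rewrite /hatm /phi normrM ger0_norm//; have [t1|t1] := leP `|t| 1.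
  case: (leP (3 * `|t|) 1) => t3; first by have := sqr_ge0 t; nra.
  rewrite -real_normK ?num_real// (@le_trans _ _ (3 * `|t|))//.
    by have := normr_ge0 t; nra.
  by rewrite -[leLHS]powRr1 ?mulr_ge0// ler_powR// ltW.
rewrite ifF; last by apply/negbTE; rewrite -ltNge; lra.
rewrite lerNl -ler_expR lnK ?posrE ?abstail_gt0 ?(lt_trans ltr01)//.
exact: abstail_ge (ltW t1).
Qed.

Lemma hatm_ge0 t : 0 <= hatm t.
Proof.
rewrite /hatm; case: (leP `|t| 1) => t1; first exact: sqr_ge0.
rewrite lerNr oppr0 ln_le0//; apply: le_trans (abstail_le (lt_trans ltr01 t1)) _.
by rewrite -[leRHS]expR0 ler_expR oppr_le0 powR_ge0.
Qed.

Lemma hatm_ge t : 1 < `|t| -> `|t| <= hatm t.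
Proof.
move=> t1; have t0 : 0 < `|t| by exact: lt_trans t1.
rewrite /hatm; case: (leP `|t| 1) => [t1'|_]; first by have := le_lt_trans t1' t1; rewrite ltxx.
rewrite lerNr -ler_expR lnK ?posrE ?abstail_gt0//.
apply: le_trans (abstail_le t0) _; rewrite ler_expR lerN2 -[leLHS]powRr1 ?(ltW t0)//.
by rewrite ler_powR// ltW.
Qed.

Definition absmean : R := fine (\int[m]_t `|t|%:E)%E.

Let mabs : measurable_fun setT (fun t : RR => `|t| : R). Proof. exact: measurableT_comp. Qed.

Lemma absmeanE : (\int[m]_t `|t|%:E = absmean%:E)%E.
Proof.
rewrite fineK// ge0_fin_numE; last by apply: integral_ge0 => x _; rewrite lee_fin.
apply: (@le_lt_trans _ _ (2 * 32)%:E); last exact: ltry.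
apply: (explaw_moment law) => // x.
by rewrite normr_ge0/=; have := expR_ge1Dx (`|x| / 2); lra.
Qed.

Lemma absmean_ge : 16^-1 <= absmean.
Proof.
have H : 2^-1 <= abstail (8^-1).
  rewrite abstailE ?invr_gt0//.
  have h8 : 0 <= 8^-1 :> R by lra.
  have := cdfm_increment law (lexx 0) h8.
  rewrite add0r oppr0 (cdfm0 law) => /andP[_].
  have := explaw_cr_le law; lra.
have mI := measurable_abstail (8^-1).
rewrite -lee_fin -absmeanE; apply: (@le_trans _ _ (\int[m]_t (8^-1 * \1_[set x : RR | 8^-1 <= `|x|] t)%:E)%E).
  rewrite ge0_integralZ_fin// integral_indic// setIT [X in (_ <= _ * X)%E](abstail_fin _).
  by rewrite -EFinM lee_fin; lra.
apply: le_integral_fin => t; rewrite mulr_ge0//= abs_indic.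
by case: (leP (8^-1) `|t|) => H8; rewrite ?mulr1 ?mulr0.
Qed.

(* The tilt is 1 plus a small multiple of the sign, multiplied for |y| > 1 by the
   conditioning on |t| >= |y|.  The tilted law has mean y / 16. *)
Definition tilt_weight (y t : R) : R :=
  if `|y| <= 1 then 1 else if `|y| <= `|t| then (abstail `|y|)^-1 else 0.

Lemma tilt_weight_small y t : `|y| <= 1 -> tilt_weight y t = 1.
Proof. by rewrite /tilt_weight => ->. Qed.

Lemma tilt_weight_large y t : 1 < `|y| ->
  tilt_weight y t = if `|y| <= `|t| then (abstail `|y|)^-1 else 0.
Proof. by rewrite /tilt_weight ltNge => /negbTE ->. Qed.

Lemma tilt_weight_indic y : 1 < `|y| ->
  tilt_weight y = fun t => (abstail `|y|)^-1 * \1_[set x : RR | `|y| <= `|x|] t.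
Proof.
move=> y1; apply/funext => t; rewrite tilt_weight_large// abs_indic.
by case: (_ <= _) => /=; rewrite ?mulr1 ?mulr0.
Qed.

Lemma tilt_weightN y t : tilt_weight y (- t) = tilt_weight y t.
Proof. by rewrite /tilt_weight normrN. Qed.

Lemma tilt_weight_ge0 y t : 0 <= tilt_weight y t.
Proof.
have [y1|y1] := leP `|y| 1; first by rewrite tilt_weight_small.
rewrite tilt_weight_large//; case: ifP => // _.
by rewrite invr_ge0 ltW// abstail_gt0// (lt_trans ltr01).
Qed.

Lemma measurable_tilt_weight y : measurable_fun setT (tilt_weight y : RR -> R).
Proof.
have [y1|y1] := leP `|y| 1.
  by rewrite (_ : tilt_weight y = fun=> 1)//; apply/funext => t; exact: tilt_weight_small.
rewrite tilt_weight_indic//; by apply: measurable_funM => //; apply: measurable_indic.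
Qed.

Lemma integral_tilt_weight y : (\int[m]_t (tilt_weight y t)%:E = 1)%E.
Proof.
have [y1|y1] := leP `|y| 1.
  under eq_integral do rewrite tilt_weight_small//.
  by rewrite integral_probability_cst.
rewrite tilt_weight_indic//.
have y0 : 0 < `|y| by exact: lt_trans y1.
have mA := measurable_abstail `|y|.
rewrite ge0_integralZ_fin//; last by rewrite invr_ge0 ltW// abstail_gt0.
rewrite integral_indic// setIT [X in (_ * X)%E](abstail_fin _) -EFinM mulVf//.
by rewrite gt_eqF// abstail_gt0.
Qed.

(** For [|y| > 1] the weight has a single nonzero value, the inverse of the tail. Its second moment
    is that value, which is [expR (hatm y)]. *)
Lemma integral_tilt_weight_sqr y : (\int[m]_t (tilt_weight y t ^+ 2)%:E <= (expR (hatm y))%:E)%E.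
Proof.
rewrite /hatm; case: (leP `|y| 1) => y1.
  under eq_integral do rewrite tilt_weight_small// expr1n.
  rewrite integral_probability_cst lee_fin -[leLHS]expR0 ler_expR.
  exact: sqr_ge0.
have y0 : 0 < `|y| by exact: lt_trans y1.
have T0 := abstail_gt0 y0.
rewrite expRN lnK ?posrE//.
rewrite (eq_integral (fun t : RR => ((abstail `|y|)^-1 * tilt_weight y t)%:E)); last first.
  by move=> t _; rewrite tilt_weight_large//; case: ifP => _; rewrite ?mulr0 ?expr0n.
rewrite ge0_integralZ_fin ?integral_tilt_weight ?mule1//.
- by rewrite invr_ge0 ltW.
- exact: tilt_weight_ge0.
- exact: measurable_tilt_weight.
Qed.

Definition tilt_absmean (y : R) : R := fine (\int[m]_t (`|t| * tilt_weight y t)%:E)%E.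

Let tilt_weight_le y : exists2 C, 0 <= C & forall t, tilt_weight y t <= C.
Proof.
have [y1|y1] := leP `|y| 1; first by exists 1 => // t; rewrite tilt_weight_small.
have y0 : 0 < `|y| by exact: lt_trans y1.
have T0 : 0 <= (abstail `|y|)^-1 by rewrite invr_ge0 ltW// abstail_gt0.
by exists (abstail `|y|)^-1 => // t; rewrite tilt_weight_large//; case: ifP.
Qed.

Lemma tilt_absmeanE y : (\int[m]_t (`|t| * tilt_weight y t)%:E = (tilt_absmean y)%:E)%E.
Proof.
rewrite fineK// ge0_fin_numE; last first.
  by apply: integral_ge0 => x _; rewrite lee_fin mulr_ge0// tilt_weight_ge0.
have [C C0 HC] := tilt_weight_le y.
apply: (@le_lt_trans _ _ (\int[m]_t (C * `|t|)%:E)%E).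
  apply: le_integral_fin => t; rewrite mulr_ge0 ?tilt_weight_ge0//= mulrC.
  by rewrite ler_wpM2r.
by rewrite ge0_integralZ_fin// absmeanE -EFinM ltry.
Qed.

(** Conditioning on [|t| >= |y|] raises the absolute mean to at least [|y|]. The first bound keeps
    the coefficient of the sign at most 1, the second keeps it at most [|y|]. *)
Lemma tilt_absmean_ge y : `|y| / 16 <= tilt_absmean y /\ 16^-1 <= tilt_absmean y.
Proof.
have am := absmean_ge.
have [y1|y1] := leP `|y| 1.
  have -> : tilt_absmean y = absmean.
    rewrite /tilt_absmean /absmean; congr fine; apply: eq_integral => t _.
    by rewrite tilt_weight_small// mulr1.
  by split=> //; have := normr_ge0 y; lra.
suff : `|y| <= tilt_absmean y by move=> H; split; lra.
rewrite -lee_fin -tilt_absmeanE -[leLHS]mule1 -(integral_tilt_weight y) -ge0_integralZ_fin//.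
- apply: le_integral_fin => t; rewrite mulr_ge0 ?tilt_weight_ge0//=.
  rewrite tilt_weight_large//; case: ifP => yt; last by rewrite !mulr0.
  by rewrite ler_wpM2r// invr_ge0 ltW// abstail_gt0// (lt_trans ltr01).
- exact: tilt_weight_ge0.
- exact: measurable_tilt_weight.
Qed.

(** The tilted law has mean [tilt_coef y * tilt_absmean y]; this choice makes it [y / 16]. *)
Definition tilt_coef (y : R) : R := y / (16 * tilt_absmean y).

Definition tilt (y t : R) : R := (1 + tilt_coef y * Num.sg t) * tilt_weight y t.

Lemma tilt_coef_le y : `|tilt_coef y| <= 1.
Proof.
have [H1 H2] := tilt_absmean_ge y; rewrite /tilt_coef normf_div.
have I0 : 0 < tilt_absmean y by lra.
by rewrite (gtr0_norm (x := 16 * _)) ?mulr_gt0// ler_pdivrMr ?mulr_gt0//; lra.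
Qed.

Let sg_le (t : R) : `|Num.sg t| <= 1.
Proof. by case: sgrP; rewrite ?normr0 ?normrN ?normr1. Qed.

Lemma tilt_ge0 y t : 0 <= tilt y t.
Proof.
rewrite mulr_ge0 ?tilt_weight_ge0//.
have : `|tilt_coef y * Num.sg t| <= 1 by rewrite normrM mulr_ile1 ?tilt_coef_le.
by rewrite ler_norml; lra.
Qed.

Lemma measurable_tilt y : measurable_fun setT (tilt y : RR -> R).
Proof.
apply: measurable_funM; last exact: measurable_tilt_weight.
apply: measurable_funD => //; apply: measurable_funM => //.
have -> : (Num.sg : R -> R) = (fun t => \1_`]0, +oo[ t - \1_`]-oo, 0[ t).
  apply/funext => t; rewrite !indicE !mem_setE !in_itv/= andbT.
  by case: sgrP => _ /=; rewrite ?subrr ?subr0 ?sub0r.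
by apply: measurable_funB; apply: measurable_indic.
Qed.

(** Symmetrization removes the cross term and leaves at most [1 + tilt_coef y ^+ 2] times the second
    moment of the weight; and [1 + tilt_coef y ^+ 2 <= 1 + hatm y <= expR (hatm y)]. *)
Lemma tilt_sqr_le y : (\int[m]_t (tilt y t ^+ 2)%:E <= (expR (2 * hatm y))%:E)%E.
Proof.
have c1 := tilt_coef_le y.
rewrite (explaw_symE law); last 2 first.
- by apply: measurable_funX; exact: measurable_tilt.
- by move=> t; exact: sqr_ge0.
apply: (@le_trans _ _ (\int[m]_t ((1 + tilt_coef y ^+ 2) * tilt_weight y t ^+ 2)%:E)%E).
  apply: le_integral_fin => t; rewrite mulr_ge0 ?addr_ge0 ?sqr_ge0//= /tilt tilt_weightN sgrN.
  have : Num.sg t ^+ 2 <= 1 by rewrite -real_normK ?num_real// expr_le1.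
  set c := tilt_coef y; set w := tilt_weight y t; set s := Num.sg t => sg2.
  have -> : 2^-1 * (((1 + c * s) * w) ^+ 2 + ((1 + c * - s) * w) ^+ 2) =
    (1 + c ^+ 2 * s ^+ 2) * w ^+ 2 by field.
  by rewrite ler_wpM2r ?sqr_ge0// lerD2l ler_piMr ?sqr_ge0.
rewrite ge0_integralZ_fin ?addr_ge0 ?sqr_ge0//; last 2 first.
- by move=> t; exact: sqr_ge0.
- by apply: measurable_funX; exact: measurable_tilt_weight.
apply: le_trans (lee_wpmul2l _ (integral_tilt_weight_sqr y)) _.
  by rewrite lee_fin addr_ge0 ?sqr_ge0.
have -> : 2 * hatm y = hatm y + hatm y by ring.
rewrite -EFinM lee_fin expRD ler_wpM2r ?expR_ge0//.
apply: (@le_trans _ _ (1 + hatm y)); last exact: expR_ge1Dx.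
rewrite lerD2l -real_normK ?num_real//.
rewrite /hatm; case: (leP `|y| 1) => y1; last first.
  have := hatm_ge y1; rewrite /hatm; case: (leP `|y| 1) => [H|_ H]; first by move: (le_lt_trans H y1); rewrite ltxx.
  apply: (@le_trans _ _ 1); first by rewrite expr_le1.
  by apply: le_trans H; exact: ltW.
rewrite -(real_normK (num_real y)) lerXn2r ?nnegrE//.
have [H1 H2] := tilt_absmean_ge y; rewrite /tilt_coef normf_div.
have I0 : 0 < tilt_absmean y by lra.
rewrite (gtr0_norm (x := 16 * _)) ?mulr_gt0// ler_pdivrMr ?mulr_gt0//.
by rewrite ler_peMr//; lra.
Qed.

(** The affine minorant is integrated against the tilted law, of mean [y / 16]. It may be negative,
    so multiples of the weight by [|al|] and [|be * c|] are added on both sides before integrating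
    and subtracted afterwards as real numbers. *)
Lemma tilt_affine_le y (F : RR -> R) (al be : R) : measurable_fun setT F -> (forall t, 0 <= F t) ->
  (forall t, al + be * t <= F t) -> ((al + be * (y / 16))%:E <= \int[m]_t (F t * tilt y t)%:E)%E.
Proof.
move=> mF F0 HF.
have mFt : measurable_fun setT (fun t : RR => F t * tilt y t).
  by apply: measurable_funM => //; exact: measurable_tilt.
have mw := measurable_tilt_weight y.
have maw : measurable_fun setT (fun t : RR => `|t| * tilt_weight y t) by exact: measurable_funM.
pose c := tilt_coef y; pose I := tilt_absmean y.
have [H1 H2] := tilt_absmean_ge y.
have cI : c * I = y / 16 by rewrite /c /tilt_coef /I; field; rewrite gt_eqF//; lra.
have F0' t : 0 <= F t * tilt y t by rewrite mulr_ge0 ?tilt_ge0.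
pose G t := (al + `|al|) * tilt_weight y t + (be * c + `|be * c|) * (`|t| * tilt_weight y t).
pose H t := `|al| * tilt_weight y t + `|be * c| * (`|t| * tilt_weight y t).
have pp (u : R) : 0 <= u + `|u| by rewrite -lerBlDl sub0r -normrN ler_norm.
have lin (u v : R) : 0 <= u -> 0 <= v ->
    (\int[m]_t (u * tilt_weight y t + v * (`|t| * tilt_weight y t))%:E = (u + v * I)%:E)%E.
  move=> u0 v0; have w0 := tilt_weight_ge0 y.
  have aw0 t : 0 <= `|t| * tilt_weight y t by rewrite mulr_ge0.
  rewrite ge0_integralD_fin; last 4 first.
  - by move=> t; rewrite mulr_ge0.
  - by move=> t; rewrite mulr_ge0.
  - exact: measurable_funM.
  - exact: measurable_funM.
  rewrite ge0_integralZ_fin// ge0_integralZ_fin//.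
  by rewrite integral_tilt_weight tilt_absmeanE mule1 -EFinM -EFinD.
have key : (\int[m]_t (G t)%:E <= \int[m]_t (F t * tilt y t)%:E + \int[m]_t (H t)%:E)%E.
  have w0 := tilt_weight_ge0 y.
  have mo : measurable_fun setT (fun x : RR => - x : RR).
    by apply: continuous_measurable_fun => x; apply: cvgN; exact: cvg_id.
  have mH : measurable_fun setT (H : RR -> R).
    by apply: measurable_funD; exact: measurable_funM.
  rewrite (explaw_symE law mFt F0') -ge0_integralD_fin//; last 3 first.
  - by move=> t; rewrite mulr_ge0 ?addr_ge0.
  - by move=> t; rewrite addr_ge0 ?mulr_ge0.
  - apply: measurable_funM => //; apply: measurable_funD => //.
    exact: (measurableT_comp (f := fun t : RR => F t * tilt y t) mFt mo).
  apply: le_integral_fin => t; rewrite addr_ge0 ?mulr_ge0//=.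
  have h1 : 0 <= 1 + c * Num.sg t.
    have : `|c * Num.sg t| <= 1 by rewrite normrM mulr_ile1 ?tilt_coef_le.
    by rewrite ler_norml; lra.
  have h2 : 0 <= 1 - c * Num.sg t.
    have : `|c * Num.sg t| <= 1 by rewrite normrM mulr_ile1 ?tilt_coef_le.
    by rewrite ler_norml; lra.
  have k1 := ler_wpM2r (mulr_ge0 h1 (w0 t)) (HF t).
  have k2 := ler_wpM2r (mulr_ge0 h2 (w0 t)) (HF (- t)).
  rewrite /tilt tilt_weightN sgrN mulrN -/c /G /H.
  have tE : `|t| = Num.sg t * t by exact: normrEsg.
  rewrite tE; move: k1 k2; set s := Num.sg t; set w := tilt_weight y t.
  set f := F t; set f' := F (- t); lra.
move: key; rewrite /G /H !lin//.
rewrite (_ : al + `|al| + (be * c + `|be * c|) * I = (al + be * (y / 16)) + (`|al| + `|be * c| * I)).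
  by rewrite [X in (X <= _)%E]EFinD leeD2rE.
by rewrite -cI; ring.
Qed.

Lemma integral_tilt y : (\int[m]_t (tilt y t)%:E = 1)%E.
Proof.
rewrite (explaw_symE law); [|exact: measurable_tilt|exact: tilt_ge0].
rewrite -(integral_tilt_weight y); apply: eq_integral => t _; congr EFin.
by rewrite /tilt tilt_weightN sgrN; field.
Qed.

Definition ptilt n (x : 'I_n -> R) (z : n.-tuple RR) : R := \prod_(i < n) tilt (x i) (tnth z i).

Lemma ptilt_ge0 n (x : 'I_n -> R) z : 0 <= ptilt x z.
Proof. by apply: prodr_ge0 => i _; exact: tilt_ge0. Qed.

Lemma measurable_ptilt n (x : 'I_n -> R) : measurable_fun setT (ptilt x).
Proof.
apply: measurable_prod => i _; apply: (measurable_tnth_comp (f := tilt (x i))).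
exact: measurable_tilt.
Qed.

Lemma integral_ptilt n (x : 'I_n -> R) : (\int[prodP m n]_z (ptilt x z)%:E = 1)%E.
Proof.
rewrite (prodP_integral_prod (f := fun i => tilt (x i)) (c := fun=> 1)).
- by rewrite big1.
- by move=> i; exact: measurable_tilt.
- by move=> i t; exact: tilt_ge0.
- by move=> i; exact: integral_tilt.
Qed.

Lemma integral_ptilt_sqr n (x : 'I_n -> R) :
  (\int[prodP m n]_z (ptilt x z ^+ 2)%:E <= (expR (2 * \sum_(i < n) hatm (x i)))%:E)%E.
Proof.
rewrite (eq_integral (fun z : n.-tuple RR => (\prod_(i < n) (tilt (x i) (tnth z i) ^+ 2))%:E)); last first.
  by move=> z _; rewrite prodrXl.
rewrite mulr_sumr expR_sum.
apply: (prodP_integral_prod_le (f := fun i t => tilt (x i) t ^+ 2)).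
- by move=> i; apply: measurable_funX; exact: measurable_tilt.
- by move=> i t; exact: sqr_ge0.
- by move=> i; exact: tilt_sqr_le.
Qed.

(** Induction on the number of coordinates. Once all but the first are integrated, the affine
    function of the first may be negative; its positive part [G] is still below the partial
    integral, which is nonnegative, and the one-dimensional inequality applies to [G]. *)
Lemma ptilt_affine_le n (x : 'I_n -> R) (F : n.-tuple RR -> R) (al : R) (b : 'I_n -> R) :
  measurable_fun setT F -> (forall z, 0 <= F z) ->
  (forall z, al + \sum_(i < n) b i * tnth z i <= F z) ->
  ((al + \sum_(i < n) b i * (x i / 16))%:E <= \int[prodP m n]_z (F z * ptilt x z)%:E)%E.
Proof.
elim: n x F al b => [|n IH] x F al b mF F0 HF.
  rewrite integral_prodP0 lee_fin /ptilt big_ord0 mulr1.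
  by have := HF [tuple]; rewrite !big_ord0.
have mFD : measurable_fun setT (fun z => (F z * ptilt x z)%:E).
  by apply/measurable_EFinP; apply: measurable_funM => //; exact: measurable_ptilt.
have FD0 z : (0 <= (F z * ptilt x z)%:E)%E by rewrite lee_fin mulr_ge0 ?ptilt_ge0.
rewrite (integral_prodPS _ mFD FD0) big_ord_recl.
pose be := al + \sum_(i < n) b (lift ord0 i) * (x (lift ord0 i) / 16).
pose G (t : RR) : R := Num.max 0 (be + b ord0 * t).
have mG : measurable_fun setT (G : RR -> R).
  by apply: measurable_maxr => //; apply: measurable_funD => //; exact: measurable_funM.
have G0 t : 0 <= G t by rewrite le_max lexx.
have HG t : be + b ord0 * t <= G t by rewrite le_max lexx orbT.
have -> : al + (b ord0 * (x ord0 / 16) + \sum_(i < n) b (lift ord0 i) * (x (lift ord0 i) / 16)) =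
  be + b ord0 * (x ord0 / 16) by rewrite /be; ring.
apply: le_trans (tilt_affine_le (x ord0) mG G0 HG) _; apply: le_integral_ge0 => t.
rewrite lee_fin mulr_ge0 ?tilt_ge0//=.
rewrite (eq_integral (fun z => (tilt (x ord0) t * (F (tcons t z) * ptilt (fun i => x (lift ord0 i)) z))%:E)); last first.
  move=> z _; congr EFin; rewrite /ptilt big_ord_recl tnth_tcons0.
  by under eq_bigr do rewrite tnth_tconsS; rewrite mulrCA.
have mFt : measurable_fun setT (fun z => F (tcons t z)) by exact: measurable_tcons_r.
rewrite ge0_integralZ_fin ?tilt_ge0//; last 2 first.
- by move=> z; rewrite mulr_ge0 ?ptilt_ge0.
- by apply: measurable_funM => //; exact: measurable_ptilt.
rewrite mulrC EFinM lee_wpmul2l ?lee_fin ?tilt_ge0//.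
have [H|H] := leP 0 (be + b ord0 * t); last first.
  rewrite (_ : G t = 0); last by apply/max_idPl; exact: ltW.
  by apply: integral_ge0 => z _; rewrite lee_fin mulr_ge0 ?ptilt_ge0.
rewrite (_ : G t = be + b ord0 * t); last exact/max_idPr.
have := IH (fun i => x (lift ord0 i)) (fun z => F (tcons t z)) (al + b ord0 * t)
  (fun i => b (lift ord0 i)) mFt (fun z => F0 _).
rewrite (_ : al + b ord0 * t + _ = be + b ord0 * t); last by rewrite /be; ring.
apply=> z; apply: le_trans (HF (tcons t z)); rewrite big_ord_recl tnth_tcons0 addrA lerD2l.
by apply: ler_sum => i _; rewrite tnth_tconsS.
Qed.

End gadget.

Section moment_comparison.
Context {R : realType} {d} {T : measurableType d}.
Variable P : probability T R.

Lemma measurable_powRr_comp (f : T -> R) (p : R) : measurable_fun setT f ->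
  measurable_fun setT (fun x => f x `^ p).
Proof. by move=> mf; apply: (measurableT_comp (measurable_powR p)). Qed.

(** [f <= K + K * (f / K)^p] for [p >= 1]; the two terms account for the factor 2. *)
Lemma integral_le_moment (f : T -> R) (p K : R) : measurable_fun setT f -> (forall x, 0 <= f x) ->
  1 <= p -> 0 < K -> (\int[P]_x (f x `^ p)%:E <= (K `^ p)%:E)%E ->
  (\int[P]_x (f x)%:E <= (2 * K)%:E)%E.
Proof.
move=> mf f0 p1 K0 HK; have Kp : 0 < K `^ p by exact: powR_gt0.
have c0 : 0 <= K / K `^ p by rewrite divr_ge0 ?ltW.
have mfp := measurable_powRr_comp p mf.
apply: (@le_trans _ _ (\int[P]_x (K + K / K `^ p * f x `^ p)%:E)%E).
  apply: le_integral_fin => x; rewrite f0/=.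
  have [fK|/ltW Kf] := leP (f x) K; first by apply: le_trans fK _; rewrite lerDl mulr_ge0 ?powR_ge0.
  apply: (@le_trans _ _ (K / K `^ p * f x `^ p)); last by rewrite lerDr ltW.
  have u1 : 1 <= f x / K by rewrite ler_pdivlMr// mul1r.
  set u := f x / K in u1; have fE : f x = u * K by rewrite divfK// gt_eqF.
  have u0 : 0 <= u by exact: le_trans u1.
  rewrite fE powRM ?(ltW K0)//.
  have -> : K / K `^ p * (u `^ p * K `^ p) = K * u `^ p by field; rewrite gt_eqF.
  rewrite mulrC.
  by rewrite ler_pM2l// le1r_powR.
rewrite ge0_integralD_fin//; last 3 first.
- by move=> x; exact: ltW.
- by move=> x; rewrite mulr_ge0 ?powR_ge0.
- exact: measurable_funM.
rewrite integral_probability_cst ge0_integralZ_fin//; last by move=> x; exact: powR_ge0.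
apply: (@le_trans _ _ (K%:E + (K / K `^ p)%:E * (K `^ p)%:E)%E).
  by rewrite leeD2l// lee_wpmul2l// lee_fin.
by rewrite -EFinM -EFinD lee_fin divfK ?gt_eqF//; lra.
Qed.

End moment_comparison.

Lemma powR_split2 {R : realType} (u p : R) : 0 < u -> u `^ p = u ^+ 2 * u `^ (p - 2).
Proof.
move=> u0; rewrite -(powR_mulrn 2 (ltW u0)) -powRD.
  by congr (_ `^ _); ring.
by apply/implyP => _; rewrite gt_eqF.
Qed.

(** For [u > expR 2], [u^(p - 2) >= expR (2 * (p - 2))] gives [u^2 * expR (2 * p) <= expR 4 * u^p],
    and the product is split with the weights [expR p] and [expR (- p)]. The weight on [D ^+ 2] is
    tuned to the bound [expR (2 * p)] for the second moment of the tilt. *)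
Lemma weighted_product_le {R : realType} (u D p : R) : 0 <= u -> 0 <= D -> 2 <= p ->
  u * D <= expR 2 * D + (expR 4 / 2 * u `^ p + expR (- (2 * p)) / 2 * D ^+ 2).
Proof.
move=> u0 D0 p2.
have up0 : 0 <= expR 4 / 2 * u `^ p by rewrite mulr_ge0 ?powR_ge0// divr_ge0 ?expR_ge0.
have d0 : 0 <= expR (- (2 * p)) / 2 * D ^+ 2 by rewrite mulr_ge0 ?sqr_ge0// divr_ge0 ?expR_ge0.
have [ue|/ltW eu] := leP u (expR 2).
  by apply: (@le_trans _ _ (expR 2 * D)); [rewrite ler_wpM2r|rewrite lerDl addr_ge0].
apply: (@le_trans _ _ (expR 4 / 2 * u `^ p + expR (- (2 * p)) / 2 * D ^+ 2)); last first.
  by rewrite lerDr mulr_ge0 ?expR_ge0.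
have un0 : 0 < u by apply: lt_le_trans eu; exact: expR_gt0.
have H : u ^+ 2 * expR (2 * p) <= expR 4 * u `^ p.
  rewrite (powR_split2 _ un0).
  have : expR 2 `^ (p - 2) <= u `^ (p - 2).
    by apply: ge0_ler_powR; rewrite ?nnegrE ?expR_ge0// subr_ge0.
  rewrite -expRM => H1.
  rewrite mulrCA ler_wpM2l ?sqr_ge0//; apply: le_trans (ler_wpM2l (expR_ge0 4) H1).
  by rewrite -expRD ler_expR; lra.
have a2 : expR (2 * p) = expR p ^+ 2 by rewrite expr2 -expRD; congr expR; ring.
have b2 : expR (- (2 * p)) = expR (- p) ^+ 2 by rewrite expr2 -expRD; congr expR; ring.
have ab : expR p * expR (- p) = 1 by exact: expRxMexpNx_1.
have : 0 <= (u * expR p - D * expR (- p)) ^+ 2 by exact: sqr_ge0.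
have -> : (u * expR p - D * expR (- p)) ^+ 2 =
  u ^+ 2 * expR p ^+ 2 + expR (- p) ^+ 2 * D ^+ 2 - 2 * (u * D) * (expR p * expR (- p)) by ring.
by rewrite ab -a2 -b2; lra.
Qed.

Section lower_bound.
Context {R : realType}.
Notation RR := (measurableTypeR R).
Variables (m : probability RR R) (r cr : R).
Hypothesis law : explaw m r cr.
Let r1 := law.1.

Definition hball n (p : R) : set ('I_n -> R) := [set x | \sum_(i < n) hatm m (x i) <= p].

Lemma hball_pball n p (x : 'I_n -> R) : pball r p x -> hball p (fun i => x i / 3).
Proof.
move=> xp; rewrite /hball/=; apply: le_trans xp; apply: ler_sum => i _.
apply: le_trans (hatm_le law _) _.
by have -> : 3 * (x i / 3) = x i by field.
Qed.

Lemma hball_coord n p (x : 'I_n -> R) i : 1 <= p -> hball p x -> `|x i| <= p.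
Proof.
move=> p1 xp; have [x1|x1] := leP `|x i| 1; first exact: le_trans x1 p1.
apply: le_trans (hatm_ge law x1) _; apply: le_trans xp; rewrite (bigD1 i)//= lerDl.
by apply: sumr_ge0 => j _; exact: hatm_ge0 law _.
Qed.

Lemma hballS n p p' (x : 'I_n -> R) : p <= p' -> hball p x -> hball p' x.
Proof. by move=> pp' H; exact: le_trans pp'. Qed.

(* Satisfied by the norms used below, because the tilted law has mean x / 16. *)
Definition tilt_dom n (N : ('I_n -> R) -> R) := forall x,
  ((N x / 16)%:E <= \int[prodP m n]_z (N (tnth z) * ptilt m x z)%:E)%E.

(** The linear form that touches [N] at [x] is a minorant of [N], and its mean under the tilted law
    is [N x / 16]. *)
Lemma tilt_dom_linear n (N : ('I_n -> R) -> R) : sublin N ->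
  (forall x, exists2 b : 'I_n -> R, N x = \sum_(i < n) b i * x i &
    forall z, \sum_(i < n) b i * z i <= N z) -> tilt_dom N.
Proof.
move=> Ns HN x; have [b Nx bN] := HN x.
have := ptilt_affine_le law (n := n) x (F := fun z => N (tnth z)) (al := 0) (b := b).
rewrite add0r (_ : \sum_(i < n) b i * (x i / 16) = N x / 16); last first.
  by rewrite Nx mulr_suml; apply: eq_bigr => i _; rewrite mulrA.
apply; first exact: measurable_sublin_tnth.
- by move=> z; exact: sublin_ge0.
- by move=> z; rewrite add0r.
Qed.

(** [weighted_product_le] at [u = N / K], integrated: in units of [K] the three terms are at most
    16, 128 and 1/2. *)
Lemma ptilt_moment n (N : n.-tuple RR -> R) (p K : R) (x : 'I_n -> R) :
  measurable_fun setT N -> (forall z, 0 <= N z) -> 2 <= p -> 0 < K ->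
  (\int[prodP m n]_z (N z `^ p)%:E <= (K `^ p)%:E)%E -> hball p x ->
  (\int[prodP m n]_z (N z * ptilt m x z)%:E <= (145 * K)%:E)%E.
Proof.
move=> mN N0 p2 K0 HN xp; have p0 : 0 < p by apply: lt_le_trans p2.
have Kp : 0 < K `^ p by exact: powR_gt0.
have D0 z : 0 <= ptilt m x z by exact: (ptilt_ge0 law).
have mD := measurable_ptilt m x.
set e2 := expR (2 : R); set e4 := expR (4 : R).
have pw z : N z * ptilt m x z <= K * e2 * ptilt m x z +
    (K * e4 / 2 / K `^ p * N z `^ p + K * expR (- (2 * p)) / 2 * ptilt m x z ^+ 2).
  set u := N z / K; have u0 : 0 <= u by rewrite divr_ge0// ltW.
  have NE : N z = K * u by rewrite mulrC divfK// gt_eqF.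
  set D := ptilt m x z; have {}D0 : 0 <= D by exact: D0.
  have -> : K * e4 / 2 / K `^ p * N z `^ p = K * (e4 / 2 * u `^ p).
    by rewrite NE powRM ?(ltW K0)//; field; rewrite gt_eqF.
  rewrite NE.
  have -> : K * e2 * D + (K * (e4 / 2 * u `^ p) + K * expR (- (2 * p)) / 2 * D ^+ 2) =
    K * (e2 * D + (e4 / 2 * u `^ p + expR (- (2 * p)) / 2 * D ^+ 2)) by ring.
  by rewrite -mulrA ler_pM2l//; exact: weighted_product_le.
have c1 : 0 <= K * e2 by rewrite mulr_ge0 ?expR_ge0// ltW.
have c2 : 0 <= K * e4 / 2 / K `^ p by rewrite !divr_ge0 ?mulr_ge0 ?expR_ge0// ltW.
have c3 : 0 <= K * expR (- (2 * p)) / 2 by rewrite divr_ge0 ?mulr_ge0 ?expR_ge0// ltW.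
have mNp := measurable_powRr_comp p mN.
have mD2 : measurable_fun setT (fun z => ptilt m x z ^+ 2) by exact: measurable_funX.
have pw' z := introT andP (conj (mulr_ge0 (N0 z) (D0 z)) (pw z)).
apply: le_trans (le_integral_fin _ pw') _.
have q2 z : 0 <= K * e4 / 2 / K `^ p * N z `^ p by rewrite mulr_ge0 ?powR_ge0.
have q3 z : 0 <= K * expR (- (2 * p)) / 2 * ptilt m x z ^+ 2 by rewrite mulr_ge0 ?sqr_ge0.
have q1 z : 0 <= K * e2 * ptilt m x z by rewrite mulr_ge0.
have m2 : measurable_fun setT (fun z => K * e4 / 2 / K `^ p * N z `^ p) by exact: measurable_funM.
have m3 : measurable_fun setT (fun z => K * expR (- (2 * p)) / 2 * ptilt m x z ^+ 2) by exact: measurable_funM.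
have m1 : measurable_fun setT (fun z => K * e2 * ptilt m x z) by exact: measurable_funM.
rewrite (ge0_integralD_fin _ q1 (fun z => addr_ge0 (q2 z) (q3 z)) m1 (measurable_funD m2 m3)).
rewrite (ge0_integralD_fin _ q2 q3 m2 m3).
rewrite (ge0_integralZ_fin _ c1 D0 mD) (ge0_integralZ_fin _ c2 (fun z => powR_ge0 _ _) mNp).
rewrite (ge0_integralZ_fin _ c3 (fun z => sqr_ge0 _) mD2).
rewrite (integral_ptilt law) mule1.
apply: (@le_trans _ _ ((K * e2)%:E + ((K * e4 / 2 / K `^ p)%:E * (K `^ p)%:E +
   (K * expR (- (2 * p)) / 2)%:E * (expR (2 * p))%:E))%E).
  rewrite leeD2l//; apply: leeD; first by rewrite lee_wpmul2l// lee_fin.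
  apply: lee_wpmul2l; first by rewrite lee_fin.
  apply: le_trans (integral_ptilt_sqr law x) _; rewrite lee_fin ler_expR ler_pM2l//.
rewrite -!EFinM -!EFinD lee_fin divfK ?gt_eqF//.
have -> : K * expR (- (2 * p)) / 2 * expR (2 * p) = K / 2.
  have E : expR (2 * p) * expR (- (2 * p)) = 1 by exact: expRxMexpNx_1.
  have -> : K * expR (- (2 * p)) / 2 * expR (2 * p) = K / 2 * (expR (2 * p) * expR (- (2 * p))) by field.
  by rewrite E mulr1.
have e1 := @expR1_le4 R.
have e2le : e2 <= 16.
  rewrite /e2 (_ : 2 = 1 + 1)// expRD (_ : 16 = 4 * 4); last by ring.
  by apply: ler_pM; rewrite ?expR_ge0.
have e4le : e4 <= 256.
  rewrite /e4 (_ : 4 = 2 + 2); last by ring.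
  rewrite expRD (_ : 256 = 16 * 16); last by ring.
  by apply: ler_pM; rewrite ?expR_ge0.
have h1 := ler_wpM2l (ltW K0) e2le; have h2 := ler_wpM2l (ltW K0) e4le.
by lra.
Qed.

Lemma tilt_dom_le2 n (N : ('I_n -> R) -> R) (p K : R) (x : 'I_n -> R) : sublin N -> tilt_dom N ->
  2 <= p -> 0 < K -> (\int[prodP m n]_z (N (tnth z) `^ p)%:E <= (K `^ p)%:E)%E -> hball p x ->
  N x <= 16 * (145 * K).
Proof.
move=> Ns Nd p2 K0 HN xp.
have := ptilt_moment (measurable_sublin_tnth Ns) (fun z => sublin_ge0 Ns _) p2 K0 HN xp.
by move=> /(le_trans (Nd x)); rewrite lee_fin ler_pdivrMr// mulrC.
Qed.

Definition kahane_const : R := 2048 * (96 * 145).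

Lemma kahane_const_gt0 : 0 < kahane_const.
Proof. by apply: mulr_gt0; last apply: mulr_gt0; exact: ltr0n. Qed.

(* Khinchine-Kahane: the fourth moment is controlled by the second one. *)
Lemma tilt_dom_kahane n (N : ('I_n -> R) -> R) : sublin N -> tilt_dom N ->
  exists2 s, 0 <= s <= 3 * kahane_const ^+ 2 * mean m N &
   (\int[prodP m n]_z (N (tnth z) `^ 2)%:E <= (s `^ 2)%:E)%E.
Proof.
move=> Ns Nd.
have mN := measurable_sublin_tnth Ns.
have N0 z : 0 <= N z by exact: sublin_ge0.
have mean0 := mean_ge0 law Ns.
have mN2 := measurable_powRr_comp 2 mN.
have fin : (\int[prodP m n]_z (N (tnth z) `^ 2)%:E < +oo)%E.
  pose K := mean m N + sublin_const N * (n%:R * 2) + 1.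
  have c0 := sublin_const_ge0 Ns.
  have K0 : 0 < K by rewrite ltr_wpDl// addr_ge0// mulr_ge0// mulr_ge0.
  have h12 : 1 <= 2 :> R by rewrite ler1n.
  apply: le_lt_trans (sublin_moment law Ns h12 K0 _ _) (ltry _).
    by rewrite /K -addrA lerDl addr_ge0// mulr_ge0// mulr_ge0.
  move=> x xp; apply: le_trans (sublin_le_norm1 Ns x) _.
  apply: (@le_trans _ _ (sublin_const N * (n%:R * 2))).
    by rewrite ler_wpM2l// (pball_norm1 r1 h12).
  by rewrite /K; lra.
pose V := fine (\int[prodP m n]_z (N (tnth z) `^ 2)%:E)%E.
have V0 : 0 <= V by apply: fine_ge0; apply: integral_ge0 => z _; rewrite lee_fin powR_ge0.
have VE : (\int[prodP m n]_z (N (tnth z) `^ 2)%:E = V%:E)%E.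
  by rewrite fineK// ge0_fin_numE//; apply: integral_ge0 => z _; rewrite lee_fin powR_ge0.
pose s := Num.sqrt V; have s0 : 0 <= s by exact: sqrtr_ge0.
have s2 : s `^ 2 = V by rewrite (powR_mulrn 2 s0) sqr_sqrtr.
exists s; last by rewrite VE s2.
rewrite s0/=; have [->|sn] := eqVneq s 0; first by rewrite mulr_ge0// mulr_ge0// sqr_ge0.
have {sn}s0' : 0 < s by rewrite lt_neqAle eq_sym sn.
have H2 : (\int[prodP m n]_z (N (tnth z) `^ 2)%:E <= (s `^ 2)%:E)%E by rewrite VE s2.
have mean_s : mean m N <= 2 * s.
  rewrite -lee_fin -(meanE law Ns); apply: (integral_le_moment mN _ _ s0' H2) => //.
  by rewrite ler1n.
(* Dividing by 2 goes from level 4 to level 2, dividing by 3 goes into [hball]; with the 16 of the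
   tilt, 96 = 16 * 6. *)
have ball4 x : pball r 4 x -> N x <= 96 * 145 * s.
  move=> x4; have x2 : pball r 2 (fun i => x i / 2).
    rewrite /pball/=; apply: (@le_trans _ _ (\sum_(i < n) phi r (x i) / 2)).
      by apply: ler_sum => i _; apply: phi_scale => //; rewrite ler1n.
    by rewrite -mulr_suml ler_pdivrMr//; apply: le_trans x4 _; lra.
  have := tilt_dom_le2 Ns Nd (lexx 2) s0' H2 (hball_pball x2).
  have -> : (fun i => x i / 2 / 3) = (fun i => 6^-1 * x i) by apply/funext => i; field.
  by rewrite sublinZ//; set c := N x; lra.
have [k [k0 kE]] : exists k : R, 0 < k /\ k = kahane_const.
  by exists kahane_const; split; first exact: kahane_const_gt0.
have k1 : 2 <= 96 * 145 :> R by rewrite -natrM ler_nat.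
have H4 : (\int[prodP m n]_z (N (tnth z) `^ 4)%:E <= ((k * s) `^ 4)%:E)%E.
  have := @sublin_moment _ m r cr law n N 4 (96 * 145 * s) Ns.
  rewrite mulrA -/kahane_const -kE; apply; first by rewrite ler1n.
  - by apply: mulr_gt0 => //; apply: lt_le_trans k1.
  - by apply: le_trans mean_s _; rewrite ler_wpM2r.
  - exact: ball4.
(* [A = 2 * k^2] makes the fourth-moment term [s^2 / 4]; the other three quarters of the second
   moment are carried by the mean. *)
set A := 2 * k ^+ 2; have A0 : 0 < A by rewrite mulr_gt0 ?exprn_gt0.
have As0 : 0 < A * s by rewrite mulr_gt0.
have mN4 := measurable_powRr_comp 4 mN.
have i0 : 0 <= (A * s) ^- 2 by rewrite invr_ge0 sqr_ge0.
have : ((s ^+ 2)%:E <= (A * s)%:E * (mean m N)%:E + ((A * s) ^- 2)%:E * ((k * s) ^+ 4)%:E)%E.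
  have -> : (s ^+ 2)%:E = (\int[prodP m n]_z (N (tnth z) `^ 2)%:E)%E.
    by rewrite VE -s2 (powR_mulrn 2 s0).
  apply: (@le_trans _ _ ((A * s)%:E * \int[prodP m n]_z (N (tnth z))%:E +
     ((A * s) ^- 2)%:E * \int[prodP m n]_z (N (tnth z) `^ 4)%:E)%E); last first.
    rewrite (meanE law Ns) leeD2l// lee_wpmul2l ?lee_fin//.
    by apply: le_trans H4 _; rewrite lee_fin (powR_mulrn 4 (mulr_ge0 (ltW k0) s0)).
  rewrite -(ge0_integralZ_fin _ (ltW As0) (fun z => N0 _) mN) -(ge0_integralZ_fin _ i0 (fun z => powR_ge0 _ _) mN4).
  rewrite -ge0_integralD_fin//; last 4 first.
  - by move=> z; rewrite mulr_ge0// ltW.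
  - by move=> z; rewrite mulr_ge0// powR_ge0.
  - exact: measurable_funM.
  - exact: measurable_funM.
  apply: le_integral_fin => z; rewrite powR_ge0/= (powR_mulrn 2 (N0 _)) (powR_mulrn 4 (N0 _)).
  set u := N _; have u0 : 0 <= u by exact: N0.
  have [uA|/ltW Au] := leP u (A * s).
    by rewrite expr2 (le_trans (ler_wpM2r u0 uA))// lerDl mulr_ge0// exprn_ge0.
  apply: (@le_trans _ _ ((A * s) ^- 2 * u ^+ 4)); last by rewrite lerDr mulr_ge0// ltW.
  rewrite mulrC ler_pdivlMr ?exprn_gt0// (_ : u ^+ 4 = u ^+ 2 * u ^+ 2); last by ring.
  by rewrite ler_wpM2l ?sqr_ge0// ler_sqr ?nnegrE ?(ltW As0).
rewrite -!EFinM -EFinD lee_fin.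
have -> : (A * s) ^- 2 * (k * s) ^+ 4 = s ^+ 2 / 4 by rewrite /A; field; rewrite !gt_eqF.
move=> H; have : (3 / 4 * s) * s <= (A * mean m N) * s by move: H; rewrite expr2; lra.
rewrite ler_pM2r// /A -kE => H'.
have km0 : 0 <= k ^+ 2 * mean m N by rewrite mulr_ge0// exprn_ge0// ltW.
move: H' km0; rewrite -!mulrA; set w := k ^+ 2 * mean m N; lra.
Qed.

Definition low_const : R := 16 * 145 * (1 + 6 * kahane_const ^+ 2).

Lemma low_const_gt0 : 0 < low_const.
Proof.
by rewrite mulr_gt0 ?mulr_gt0 ?ltr0n// addr_gt0// mulr_gt0// exprn_gt0// kahane_const_gt0.
Qed.

(** For [p < 2], where [weighted_product_le] does not apply, the second moment is bounded by the
    mean through [tilt_dom_kahane], the mean by the p-th moment, and the case of the exponent 2 is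
    used on the larger ball of level 2. *)
Lemma tilt_dom_le n (N : ('I_n -> R) -> R) (p K : R) (x : 'I_n -> R) : sublin N -> tilt_dom N ->
  1 <= p -> 0 < K -> (\int[prodP m n]_z (N (tnth z) `^ p)%:E <= (K `^ p)%:E)%E -> hball p x ->
  N x <= low_const * K.
Proof.
move=> Ns Nd p1 K0 HN xp.
set k : R := kahane_const ^+ 2; have k0 : 0 <= k by rewrite sqr_ge0.
have kK : 0 <= k * K by rewrite mulr_ge0// ltW.
have cE : low_const * K = 16 * (145 * K) + 16 * (145 * (6 * (k * K))).
  by rewrite /low_const -/k; ring.
have [p2|/ltW p2] := leP 2 p.
  by have := tilt_dom_le2 Ns Nd p2 K0 HN xp; rewrite cE; lra.
have [s /andP[s0 sle] Hs] := tilt_dom_kahane Ns Nd.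
have mle : mean m N <= 2 * K.
  rewrite -lee_fin -(meanE law Ns).
  exact: (integral_le_moment (measurable_sublin_tnth Ns) (fun z => sublin_ge0 Ns _) p1 K0 HN).
have x2 := hballS p2 xp.
have sK : s <= 6 * (k * K).
  apply: le_trans sle _; rewrite -/k -mulrA.
  by have := ler_wpM2l k0 mle; lra.
have t0 : 0 < s + K by lra.
have H2 : (\int[prodP m n]_z (N (tnth z) `^ 2)%:E <= ((s + K) `^ 2)%:E)%E.
  apply: le_trans Hs _; rewrite lee_fin; apply: ge0_ler_powR; rewrite ?nnegrE ?(ltW t0)//.
  by rewrite lerDl ltW.
have := tilt_dom_le2 Ns Nd (lexx 2) t0 H2 x2; rewrite cE; lra.
Qed.

End lower_bound.

(** * Decoupled moments *)

Lemma powR_sum3_le {R : realType} (a b c p : R) : 0 <= a -> 0 <= b -> 0 <= c -> 1 <= p ->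
  (a + b + c) `^ p <= 3 `^ p * (a `^ p + b `^ p + c `^ p).
Proof.
move=> a0 b0 c0 p1; have p0 : 0 <= p by exact: le_trans p1.
have H (u : R) : 0 <= u -> a <= u -> b <= u -> c <= u -> (a + b + c) `^ p <= 3 `^ p * u `^ p.
  move=> u0 au bu cu; rewrite -powRM//; apply: ge0_ler_powR; rewrite ?nnegrE ?addr_ge0 ?mulr_ge0//; lra.
have Ha := powR_ge0 a p; have Hb := powR_ge0 b p; have Hc := powR_ge0 c p.
have t0 := powR_ge0 3 p.
have [ab|/ltW ba] := leP a b; [have [bc|/ltW cb] := leP b c|have [ac|/ltW ca] := leP a c].
- by apply: le_trans (H c c0 (le_trans ab bc) bc (lexx c)) _; rewrite ler_wpM2l// lerDr addr_ge0.
- by apply: le_trans (H b b0 ab (lexx b) cb) _; rewrite ler_wpM2l// -addrA addrCA lerDl addr_ge0.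
- by apply: le_trans (H c c0 ac (le_trans ba ac) (lexx c)) _; rewrite ler_wpM2l// lerDr addr_ge0.
- by apply: le_trans (H a a0 (lexx a) ba ca) _; rewrite ler_wpM2l// -addrA lerDl addr_ge0.
Qed.

Lemma powR_scaled_sum3_le {R : realType} (k a b c p : R) : 0 <= k -> 0 <= a -> 0 <= b -> 0 <= c ->
  1 <= p -> (k * (a + b + c)) `^ p <= (k * 3) `^ p * (a `^ p + b `^ p + c `^ p).
Proof.
move=> k0 a0 b0 c0 p1; rewrite powRM ?addr_ge0// (powRM _ k0)// -mulrA ler_wpM2l ?powR_ge0//.
exact: powR_sum3_le.
Qed.

Lemma powR_superadd_scaled3 {R : realType} (k a b c p : R) : 0 <= k -> 0 <= a -> 0 <= b -> 0 <= c ->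
  1 <= p -> k `^ p * (a `^ p + b `^ p + c `^ p) <= (k * (a + b + c)) `^ p.
Proof.
move=> k0 a0 b0 c0 p1; rewrite (powRM _ k0) ?addr_ge0// ler_wpM2l ?powR_ge0//.
apply: le_trans (powR_superadd p1 (addr_ge0 a0 b0) c0).
by rewrite lerD2r; exact: powR_superadd.
Qed.

Lemma scale_absorb {R : realType} (a c rho : R) : 0 <= a -> 0 <= rho ->
  c * (9 * rho) <= (a + 9 * c) * rho.
Proof.
move=> a0 rho0; have -> : (a + 9 * c) * rho = a * rho + c * (9 * rho) by ring.
by rewrite lerDr mulr_ge0.
Qed.

Section decoupled_moment.
Context {R : realType}.
Notation RR := (measurableTypeR R).
Notation lap := (@laplace R).

Lemma bisublin_swap n k (M : ('I_n -> R) -> ('I_k -> R) -> R) : bisublin M ->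
  bisublin (fun y x => M x y).
Proof. by case. Qed.

Section mean_swap.
Variables (m1 m2 : probability RR R) (r1 r2 c1 c2 : R).
Hypotheses (law1 : explaw m1 r1 c1) (law2 : explaw m2 r2 c2).

Lemma integral_mean n k (M : ('I_n -> R) -> ('I_k -> R) -> R) : bisublin M ->
  (\int[prodP m1 n]_x \int[prodP m2 k]_y (M (tnth x) (tnth y))%:E =
   (mean m1 (fun x => mean m2 (M x)))%:E)%E.
Proof.
move=> Ms; rewrite -(meanE law1 (sublin_mean_r Ms law2)); apply: eq_integral => x _.
by rewrite (meanE law2 (Ms.2 _)).
Qed.

End mean_swap.

Lemma mean_swap (m1 m2 : probability RR R) (r1 r2 c1 c2 : R) (law1 : explaw m1 r1 c1)
    (law2 : explaw m2 r2 c2) n k (M : ('I_n -> R) -> ('I_k -> R) -> R) : bisublin M ->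
  mean m1 (fun x => mean m2 (M x)) = mean m2 (fun y => mean m1 (M ^~ y)).
Proof.
move=> Ms; apply: EFin_inj.
rewrite -(integral_mean law1 law2 Ms) -(integral_mean law2 law1 (bisublin_swap Ms)).
have mM : measurable_fun setT (fun u : n.-tuple RR * k.-tuple RR => (M (tnth u.1) (tnth u.2))%:E).
  by apply/measurable_EFinP; exact: measurable_bisublin_tnth.
apply: (fubini_tonelli (m1 := prodP m1 n) (m2 := prodP m2 k) _ mM) => u.
by rewrite lee_fin (sublin_ge0 (Ms.2 _)).
Qed.

Variables (m : probability RR R) (r cr p : R).
Hypotheses (law : explaw m r cr) (p1 : 1 <= p).
Let r1 : 1 <= r := law.1.
Let p0 : 0 < p. Proof. exact: lt_le_trans p1. Qed.

Lemma sublin_moment_lty n (h : ('I_n -> R) -> R) : sublin h ->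
  (\int[prodP m n]_z (h (tnth z) `^ p)%:E < +oo)%E.
Proof.
move=> hs; have c0 := sublin_const_ge0 hs; have m0 := mean_ge0 law hs.
pose K := mean m h + sublin_const h * (n%:R * p) + 1.
have K0 : 0 < K by rewrite ltr_wpDl// addr_ge0// mulr_ge0// mulr_ge0// ltW.
apply: le_lt_trans (sublin_moment law hs p1 K0 _ _) (ltry _).
  by rewrite /K -addrA lerDl addr_ge0// mulr_ge0// mulr_ge0// ltW.
move=> x xp; apply: le_trans (sublin_le_norm1 hs x) _.
apply: (@le_trans _ _ (sublin_const h * (n%:R * p))).
  by rewrite ler_wpM2l// (pball_norm1 r1 p1).
by rewrite /K; lra.
Qed.

Definition ball_const : R := 13 * 128 * 4 ^+ 15.

Lemma ball_const_gt0 : 0 < ball_const.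
Proof. by apply: mulr_gt0; [apply: mulr_gt0; exact: ltr0n|apply: exprn_gt0; exact: ltr0n]. Qed.

(** The outer factor is 2048 from [sublin_moment] times 3 from splitting the p-th power of a sum.
    Inside are the contributions of the mean over [Y], of the supremum over the ball, and of the
    additive [rho]. *)
Definition upper_const (Cq : R) : R :=
  2048 * 3 * (2048 * 3 + ball_const * (Cq + 9 * @row_const R) + 1).

Lemma upper_constE Cq rho :
  2048 * 3 * (2048 * (3 * rho) + ball_const * ((Cq + 9 * @row_const R) * rho) + rho) =
  upper_const Cq * rho.
Proof. by rewrite /upper_const; ring. Qed.

Lemma upper_const_gt0 Cq : 0 <= Cq -> 0 < upper_const Cq.
Proof.
move=> Cq0; have c0 : 0 <= Cq + 9 * @row_const R.
  exact: addr_ge0 Cq0 (mulr_ge0 (ler0n _ _) (le_trans ler01 (@row_const_ge1 R))).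
have bc0 := mulr_ge0 (ltW ball_const_gt0) c0.
apply: mulr_gt0; first by apply: mulr_gt0; exact: ltr0n.
apply: ltr_wpDl ltr01; apply: addr_ge0 bc0.
by apply: mulr_ge0; exact: ler0n.
Qed.

Section upper.
Variables (n : nat) (Phi : set ('I_n -> 'I_n -> R)) (M : ('I_n -> R) -> ('I_n -> R) -> R).
Hypothesis PM : attained_norm Phi M.
Let Ms := bisublin_attained PM.
Variables (Cq rho : R).
Hypotheses (Cq0 : 0 <= Cq) (comparison : forall x, mean lap (M x) <= Cq * mean m (M x)) (rho0 : 0 < rho).
Hypotheses (T1 : mean m (fun x => mean m (M x)) <= rho)
  (T2 : forall x, hball m p x -> mean m (M x) <= rho)
  (T3 : forall y, hball m p y -> mean m (M ^~ y) <= rho)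
  (T4 : forall f x, Phi f -> hball m p x -> \sum_(i < n) rownorm f i * x i <= rho)
  (T5 : forall f x y, Phi f -> hball m p x -> hball m p y -> bil f x y <= rho).

Let third (x : 'I_n -> R) : (fun i => x i / 3) = (fun i => 3^-1 * x i).
Proof. by apply/funext => i; rewrite mulrC. Qed.

Let i3 : 0 <= 3^-1 :> R. Proof. by rewrite invr_ge0. Qed.

Let A := fun x => mean m (M x).
Let As : sublin A. Proof. by have H := sublin_mean_r Ms law; exact: H. Qed.

Let A_ball x : pball r p x -> A x <= 3 * rho.
Proof.
move=> /(hball_pball law)/T2; rewrite -/(A _) third (sublinZ As)//.
by rewrite ler_pdivrMl.
Qed.

Let B_ball y : pball r p y -> mean m (M ^~ y) <= 3 * rho.
Proof.
have Bs := sublin_mean_r (bisublin_swap Ms) law.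
move=> /(hball_pball law)/T3; rewrite third (sublinZ Bs)//.
by rewrite ler_pdivrMl.
Qed.

Let row_ball f x : Phi f -> pball r p x -> \sum_(i < n) rownorm f i * x i <= 9 * rho.
Proof.
move=> Pf /(hball_pball law)/(T4 Pf).
rewrite (eq_bigr (fun i => rownorm f i * x i / 3)); last by move=> i _; rewrite mulrA.
by rewrite -mulr_suml; set s := \sum_(i < n) _; have := rho0; lra.
Qed.

Let bil_ball f x y : Phi f -> pball r p x -> pball r p y -> bil f x y <= 9 * rho.
Proof.
move=> Pf /(hball_pball law) xp /(hball_pball law) yp.
by have := T5 Pf xp yp; rewrite !third bilZl bilZr; set s := bil _ _ _; have := rho0; lra.
Qed.

Let cc : R := Cq + 9 * @row_const R.
Let rc1 := @row_const_ge1 R.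
Let cc9 : 9 <= cc. Proof. by rewrite /cc; have := rc1; have := Cq0; lra. Qed.

Let W := fun x => ballsup r p (M x).
Let Ws : sublin W. Proof. exact: sublin_ballsup law p1 _ _ _ PM. Qed.

(** [ballsup_moment] at the level [cc * rho]. The comparison of means enters here, for the Laplace
    mean of z -> E M(X,z), after exchanging the two means; the Laplace mean of the row suprema costs
    [row_const]. *)
Let W_moment : (\int[prodP m n]_x (W (tnth x) `^ p)%:E <= ((ball_const * (cc * rho)) `^ p)%:E)%E.
Proof.
have cc0 : 0 < cc by apply: lt_le_trans cc9.
have rho'0 : 0 < cc * rho by rewrite mulr_gt0.
have le9 : 9 * rho <= cc * rho by rewrite ler_pM2r.
have lam0 : 0 <= p / (13 * (cc * rho)) by rewrite divr_ge0 ?(ltW p0)// mulr_ge0// ltW.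
apply: (ballsup_moment law p1 PM lam0 rho'0 erefl).
- rewrite -(mean_swap law (@explaw_laplace R) Ms).
  have sl := sublin_mean_r Ms (@explaw_laplace R).
  apply: (le_trans (mean_le law sl (sublin_scale As Cq0) comparison)).
  rewrite (mean_scale law As Cq0); apply: (le_trans (ler_wpM2l Cq0 T1)).
  by rewrite ler_pM2r// /cc lerDl mulr_ge0// (le_trans ler01 rc1).
- by move=> y /B_ball H; apply: (le_trans H); have := le9; have := rho0; lra.
- move=> f Pf.
  have rho9 : 0 < 9 * rho by rewrite mulr_gt0.
  apply: (le_trans (mean_rowsup law p1 PM Pf rho9 _ _)).
  + by move=> x; exact: row_ball.
  + by move=> x y; exact: bil_ball.
  + exact: (scale_absorb _ Cq0 (ltW rho0)).
- move=> f y Pf yp; apply: ballsup_le => // x xp.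
  exact: le_trans (bil_ball Pf xp yp) le9.
Qed.

(** Given [x], [M x] has mean [A x] and is at most [W x] on the ball, so its p-th moment is at most
    the p-th power of [2048 * (A x + W x + rho)], where [rho] keeps the level positive. Then [A] is
    sublinear with mean and ball bounds from the first two terms, and [W] is covered by
    [W_moment]. *)
Lemma decoupled_upper :
  (\int[prodP m n]_x \int[prodP m n]_y (M (tnth x) (tnth y) `^ p)%:E <=
   ((upper_const Cq * rho) `^ p)%:E)%E.
Proof.
have A_moment : (\int[prodP m n]_x (A (tnth x) `^ p)%:E <= ((2048 * (3 * rho)) `^ p)%:E)%E.
  apply: (sublin_moment law As p1); first by rewrite mulr_gt0.
    by apply: (le_trans T1); have := rho0; lra.
  exact: A_ball.
have A0 x : 0 <= A x by exact: sublin_ge0 As _.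
have W0 x : 0 <= W x by exact: sublin_ge0 Ws _.
have pw x : (\int[prodP m n]_y (M x (tnth y) `^ p)%:E <=
    ((2048 * 3) `^ p * (A x `^ p + W x `^ p + rho `^ p))%:E)%E.
  have K0 : 0 < A x + W x + rho by rewrite ltr_wpDl// addr_ge0.
  apply: (@le_trans _ _ ((2048 * (A x + W x + rho)) `^ p)%:E).
    apply: (sublin_moment law (Ms.2 x) p1 K0).
      by rewrite -/(A x) -addrA lerDl addr_ge0// ltW.
    move=> y yp; apply: (@le_trans _ _ (W x)); first exact: (le_ballsup_attained law p1 PM).
    by rewrite -addrA addrCA lerDl addr_ge0// ltW.
  by rewrite lee_fin; exact: (powR_scaled_sum3_le (ler0n _ _) (A0 x) (W0 x) (ltW rho0) p1).
have mA := measurable_powRr_comp p (measurable_sublin_tnth As).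
have mW := measurable_powRr_comp p (measurable_sublin_tnth Ws).
have nA z : 0 <= A (tnth z) `^ p by exact: powR_ge0.
have nW z : 0 <= W (tnth z) `^ p by exact: powR_ge0.
apply: (@le_trans _ _ (\int[prodP m n]_x
    ((2048 * 3) `^ p * (A (tnth x) `^ p + W (tnth x) `^ p + rho `^ p))%:E)%E).
  apply: le_integral_ge0 => x; rewrite pw andbT.
  by apply: integral_ge0 => y _; rewrite lee_fin powR_ge0.
have nr (z : n.-tuple RR) : 0 <= rho `^ p by exact: powR_ge0.
have mr : measurable_fun setT (fun z : n.-tuple RR => rho `^ p) by exact: measurable_cst.
rewrite ge0_integralZ_fin; last 3 first.
- exact: powR_ge0.
- by move=> z; exact: addr_ge0 (addr_ge0 (nA z) (nW z)) (nr z).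
- exact: measurable_funD (measurable_funD mA mW) mr.
rewrite ge0_integralD_fin; last 4 first.
- by move=> z; exact: addr_ge0 (nA z) (nW z).
- exact: nr.
- exact: measurable_funD mA mW.
- exact: mr.
rewrite ge0_integralD_fin//; rewrite integral_probability_cst.
have b0 : 0 < ball_const := ball_const_gt0.
have c0 : 0 < cc by exact: lt_le_trans cc9.
have s1 : 0 <= 2048 * (3 * rho) := mulr_ge0 (ler0n _ _) (mulr_ge0 (ler0n _ _) (ltW rho0)).
have s2 : 0 <= ball_const * (cc * rho) := mulr_ge0 (ltW b0) (mulr_ge0 (ltW c0) (ltW rho0)).
have k0 : 0 <= 2048 * 3 :> R := mulr_ge0 (ler0n _ _) (ler0n _ _).
have H := powR_superadd_scaled3 k0 s1 s2 (ltW rho0) p1.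
rewrite -upper_constE -/cc; move: H; rewrite -lee_fin; apply: le_trans; rewrite EFinM !EFinD.
apply: lee_wpmul2l; first by rewrite lee_fin; exact: powR_ge0.
apply: leeD; last exact: lexx.
by apply: leeD; [exact: A_moment|exact: W_moment].
Qed.

End upper.

(** * Lower bounds for the decoupled moment *)

Section lower.
Variables (n : nat) (M : ('I_n -> R) -> ('I_n -> R) -> R).
Hypotheses (Ms : bisublin M) (tdr : forall x, tilt_dom m (M x)) (tdl : forall y, tilt_dom m (M ^~ y)).
Variable K : R.
Hypotheses (K0 : 0 < K)
  (HM : (\int[prodP m n]_x \int[prodP m n]_y (M (tnth x) (tnth y) `^ p)%:E <= (K `^ p)%:E)%E).

Let G x : R := fine (\int[prodP m n]_y (M x (tnth y) `^ p)%:E)%E.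

Let GE x : (\int[prodP m n]_y (M x (tnth y) `^ p)%:E = (G x)%:E)%E.
Proof.
rewrite fineK// ge0_fin_numE; first exact: (sublin_moment_lty (Ms.2 x)).
by apply: integral_ge0 => z _; rewrite lee_fin powR_ge0.
Qed.

Let G0 x : 0 <= G x.
Proof. by rewrite -lee_fin -GE; apply: integral_ge0 => z _; rewrite lee_fin powR_ge0. Qed.

Let mMp : measurable_fun setT (fun u : n.-tuple RR * n.-tuple RR => (M (tnth u.1) (tnth u.2) `^ p)%:E).
Proof.
by apply/measurable_EFinP; apply: measurable_powRr_comp; exact: measurable_bisublin_tnth.
Qed.

Let mG : measurable_fun setT (fun x : n.-tuple RR => G (tnth x)).
Proof.
apply/measurable_EFinP.
have := measurable_fun_fubini_tonelli_F (m2 := prodP m n) _ mMp.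
rewrite (_ : fubini_F _ _ = (fun x : n.-tuple RR => (G (tnth x))%:E)); last first.
  by apply/funext => x; rewrite /fubini_F -GE.
by apply => u; rewrite lee_fin powR_ge0.
Qed.

(* The L_p norm of y |-> M x y, kept positive by the additive constant. *)
Let kap x : R := (G x + K `^ p) `^ p^-1.

Let GK x : 0 < G x + K `^ p. Proof. by rewrite ltr_wpDl// powR_gt0. Qed.

Let kap0 x : 0 < kap x. Proof. exact: powR_gt0. Qed.

Let kapE x : kap x `^ p = G x + K `^ p.
Proof. by rewrite -powRrM mulVf ?gt_eqF// powRr1// ltW. Qed.

Let kap_ge x : (\int[prodP m n]_y (M x (tnth y) `^ p)%:E <= (kap x `^ p)%:E)%E.
Proof. by rewrite GE kapE lee_fin lerDl powR_ge0. Qed.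

Let mkap : measurable_fun setT (fun x : n.-tuple RR => kap (tnth x)).
Proof. by apply: measurable_powRr_comp; exact: measurable_funD. Qed.

Let kap_moment : (\int[prodP m n]_x (kap (tnth x) `^ p)%:E <= ((2 * K) `^ p)%:E)%E.
Proof.
under eq_integral do rewrite kapE.
rewrite ge0_integralD_fin//; last by move=> z; exact: powR_ge0.
rewrite integral_probability_cst.
apply: (@le_trans _ _ ((K `^ p)%:E + (K `^ p)%:E)%E).
  by rewrite leeD2r//; under eq_integral do rewrite -GE.
rewrite -EFinD lee_fin; apply: le_trans (powR_superadd p1 (ltW K0) (ltW K0)) _.
by rewrite (_ : K + K = 2 * K)//; ring.
Qed.

(** A function below [c * kap] has p-th moment at most that of the constant [c * (2 * K)], so
    tilting bounds it on the ball and [integral_le_moment] bounds its mean. It is used for the mean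
    in y, [N1], and for the supremum over the ball in y, [N2]. *)
Let kap_bound (N : ('I_n -> R) -> R) c : sublin N -> tilt_dom m N -> 0 < c ->
  (forall x, N x <= c * kap x) ->
  mean m N <= 2 * (c * (2 * K)) /\ forall x, hball m p x -> N x <= low_const * (c * (2 * K)).
Proof.
move=> Ns Nd c0 Nk.
have cK0 : 0 < c * (2 * K) by rewrite mulr_gt0// mulr_gt0.
have HN : (\int[prodP m n]_x (N (tnth x) `^ p)%:E <= ((c * (2 * K)) `^ p)%:E)%E.
  apply: (@le_trans _ _ (\int[prodP m n]_x (c `^ p * kap (tnth x) `^ p)%:E)%E).
    apply: le_integral_fin => x; rewrite powR_ge0/= -powRM ?(ltW c0) ?(ltW (kap0 _))//.
    apply: ge0_ler_powR; rewrite ?nnegrE ?(ltW p0) ?mulr_ge0 ?(ltW c0) ?(ltW (kap0 _)) ?(sublin_ge0 Ns)//.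
  rewrite ge0_integralZ_fin ?powR_ge0//; last 2 first.
  - by move=> z; exact: powR_ge0.
  - exact: measurable_powRr_comp.
  rewrite (powRM _ (ltW c0)); last by rewrite mulr_ge0// ltW.
  by rewrite EFinM lee_wpmul2l// lee_fin powR_ge0.
split; last by move=> x xp; exact: (tilt_dom_le law Ns Nd p1 cK0 HN xp).
rewrite -lee_fin -(meanE law Ns).
exact: (integral_le_moment (measurable_sublin_tnth Ns) (fun z => sublin_ge0 Ns _) p1 cK0 HN).
Qed.

Let N1 := fun x => mean m (M x).
Let N1s : sublin N1. Proof. by have H := sublin_mean_r Ms law; exact: H. Qed.

Let N1k x : N1 x <= 2 * kap x.
Proof.
rewrite -lee_fin -(meanE law (Ms.2 x)).
exact: (integral_le_moment (measurable_sublin_tnth (Ms.2 x)) (fun z => sublin_ge0 (Ms.2 x) _) p1 (kap0 x) (kap_ge x)).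
Qed.

Let mMt x : measurable_fun setT (fun u : n.-tuple RR * n.-tuple RR =>
  (M (tnth u.1) (tnth u.2) * ptilt m x u.1)%:E).
Proof.
apply/measurable_EFinP; apply: measurable_funM; first exact: measurable_bisublin_tnth.
by apply: measurableT_comp => //; exact: measurable_ptilt.
Qed.

(** Tilt domination holds for each [M ^~ y] and survives integration in [y], by Tonelli. *)
Let N1d : tilt_dom m N1.
Proof.
move=> x.
have Mt0 (u : n.-tuple RR * n.-tuple RR) : (0 <= (M (tnth u.1) (tnth u.2) * ptilt m x u.1)%:E)%E.
  by rewrite lee_fin mulr_ge0 ?(sublin_ge0 (Ms.2 _))// (ptilt_ge0 law).
apply: (@le_trans _ _ (\int[prodP m n]_y \int[prodP m n]_z (M (tnth z) (tnth y) * ptilt m x z)%:E)%E).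
  rewrite /N1 mulrC -(mean_scale law (Ms.2 x)) ?invr_ge0// -(meanE law); last first.
    by apply: sublin_scale; [exact: Ms.2|rewrite invr_ge0].
  apply: le_integral_ge0 => y; rewrite lee_fin mulr_ge0 ?(sublin_ge0 (Ms.2 _)) ?invr_ge0//=.
  by rewrite mulrC; exact: tdl.
rewrite -(fubini_tonelli (m1 := prodP m n) (m2 := prodP m n) _ (mMt x) Mt0)/=.
apply: le_integral_ge0 => z; apply/andP; split.
  by apply: integral_ge0 => y _; exact: Mt0 (z, y).
under eq_integral do rewrite mulrC.
rewrite ge0_integralZ_fin ?(ptilt_ge0 law)//; last 2 first.
- by move=> y; exact: sublin_ge0 (Ms.2 _) _.
- exact: measurable_sublin_tnth (Ms.2 _).
by rewrite (meanE law (Ms.2 _)) -EFinM mulrC.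
Qed.

Definition hballsup x : R := sup [set M x y | y in hball m p].
Let N2 := hballsup.

Let hball0 : hball m p (fun _ : 'I_n => 0).
Proof.
by rewrite /hball/= big1 ?(ltW p0)// => i _; rewrite /hatm normr0 ler01 expr0n.
Qed.

Let N2_ub x : has_ubound [set M x y | y in hball m p].
Proof.
have Mxs := Ms.2 x; have c0 := sublin_const_ge0 Mxs.
exists (sublin_const (M x) * (n%:R * p)) => _ [y yp <-].
apply: le_trans (sublin_le_norm1 Mxs y) _; rewrite ler_wpM2l//.
rewrite /norm1 -[in n%:R](card_ord n) -sum1_card natr_sum mulr_suml.
by apply: ler_sum => i _; rewrite mul1r; exact: (hball_coord law).
Qed.

Lemma le_hballsup x y : hball m p y -> M x y <= hballsup x.
Proof. by move=> yp; apply: ub_le_sup => //; exists y. Qed.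

Let N2_le x c : (forall y, hball m p y -> M x y <= c) -> N2 x <= c.
Proof.
move=> H; apply: ge_sup; first by exists (M x (fun=> 0)), (fun=> 0).
by move=> _ [y yp <-]; exact: H.
Qed.

Let N2s : sublin N2.
Proof.
apply: (sublin_sup (A := hball m p) (f := fun y x => M x y)) => //.
- by move=> y x x' _; exact: sublinD (Ms.1 y) _ _.
- by move=> y c x _ c0; exact: (sublinZ (Ms.1 y)).
- by move=> x; exists (fun=> 0); [exact: hball0|exact: sublin_ge0 (Ms.1 _) _].
Qed.

Let N2k x : N2 x <= low_const * kap x.
Proof.
apply: N2_le => y yp.
exact: (tilt_dom_le law (Ms.2 x) (tdr x) p1 (kap0 x) (kap_ge x) yp).
Qed.

(** Each [M ^~ y] is tilt dominated and lies below [N2], and the tilt is nonnegative; the resulting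
    bound is the same for all [y] in the ball. *)
Let N2d : tilt_dom m N2.
Proof.
move=> x; set I := integral _ _ _.
have H y : hball m p y -> ((M x y / 16)%:E <= I)%E.
  move=> yp; apply: le_trans (tdl y x) _; apply: le_integral_fin => z.
  rewrite mulr_ge0 ?(sublin_ge0 (Ms.1 _)) ?(ptilt_ge0 law)//=.
  by rewrite ler_wpM2r ?(ptilt_ge0 law)//; exact: le_hballsup.
case: I H => [I| |] H; rewrite ?leey//; last by have := H _ hball0; rewrite leeNy_eq.
rewrite lee_fin ler_pdivrMr//; apply: N2_le => y yp.
by have := H y yp; rewrite lee_fin ler_pdivrMr.
Qed.

Lemma decoupled_mean_le : mean m (fun x => mean m (M x)) <= 8 * K.
Proof.
have h2 : 0 < 2 :> R by [].
by have [H _] := kap_bound N1s N1d h2 N1k; apply: (le_trans H); have := K0; lra.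
Qed.

Lemma decoupled_ball_mean_le x : hball m p x -> mean m (M x) <= 4 * low_const * K.
Proof.
have h2 : 0 < 2 :> R by [].
have [_ H] := kap_bound N1s N1d h2 N1k; move=> xp; apply: (le_trans (H x xp)).
by rewrite le_eqVlt; apply/orP; left; apply/eqP; ring.
Qed.

Lemma decoupled_ball_ball_le x y : hball m p x -> hball m p y -> M x y <= 2 * low_const ^+ 2 * K.
Proof.
have [_ H] := kap_bound N2s N2d (@low_const_gt0 R) N2k.
move=> xp yp; apply: (le_trans (le_hballsup x yp)); apply: (le_trans (H x xp)).
by rewrite le_eqVlt; apply/orP; left; apply/eqP; ring.
Qed.

Lemma mean_hballsup_le : mean m hballsup <= 4 * low_const * K.
Proof.
have [H _] := kap_bound N2s N2d (@low_const_gt0 R) N2k.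
by apply: (le_trans H); rewrite le_eqVlt; apply/orP; left; apply/eqP; ring.
Qed.

Lemma sublin_hballsup : sublin hballsup. Proof. exact: N2s. Qed.

End lower.

Section lower_attained.
Variables (n : nat) (Phi : set ('I_n -> 'I_n -> R)) (M : ('I_n -> R) -> ('I_n -> R) -> R).
Hypothesis PM : attained_norm Phi M.
Let Ms := bisublin_attained PM.

Lemma tilt_dom_attained_r x : tilt_dom m (M x).
Proof.
apply: (tilt_dom_linear law (Ms.2 x)) => y; have [f Pf ME] := bil_attained PM x y.
have bilE z : bil f x z = \sum_(j < n) (\sum_(i < n) f i j * x i) * z j.
  by rewrite /bil exchange_big/=; apply: eq_bigr => j _; rewrite mulr_suml.
exists (fun j => \sum_(i < n) f i j * x i); first by rewrite ME bilE.
by move=> z; rewrite -bilE; exact: (bil_le PM).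
Qed.

Lemma tilt_dom_attained_l y : tilt_dom m (M ^~ y).
Proof.
apply: (tilt_dom_linear law (Ms.1 y)) => x; have [f Pf ME] := bil_attained PM x y.
have bilE z : bil f z y = \sum_(i < n) rowform f y i * z i.
  by rewrite bil_rowform; apply: eq_bigr => i _; rewrite mulrC.
exists (rowform f y); first by rewrite ME bilE.
by move=> z; rewrite -bilE; exact: (bil_le PM).
Qed.

Variable K : R.
Hypotheses (K0 : 0 < K)
  (HM : (\int[prodP m n]_x \int[prodP m n]_y (M (tnth x) (tnth y) `^ p)%:E <= (K `^ p)%:E)%E).

Lemma moment_swap :
  (\int[prodP m n]_y \int[prodP m n]_x (M (tnth x) (tnth y) `^ p)%:E <= (K `^ p)%:E)%E.
Proof.
have mMp : measurable_fun setT (fun u : n.-tuple RR * n.-tuple RR => (M (tnth u.1) (tnth u.2) `^ p)%:E).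
  by apply/measurable_EFinP; apply: measurable_powRr_comp; exact: measurable_bisublin_tnth.
rewrite -(fubini_tonelli (m1 := prodP m n) (m2 := prodP m n) _ mMp)// => u.
by rewrite lee_fin powR_ge0.
Qed.

(** Up to the factor [2^28], each row norm is at most the mean of the absolute value of the row
    form. Choosing the signs of the coordinates of [x] according to the row forms, which does not
    leave the ball, the weighted sum of these absolute values is a value of the form, hence at most
    the supremum over the ball, whose mean is already bounded. *)
Lemma rownorm_sum_le f x : Phi f -> hball m p x ->
  \sum_(i < n) rownorm f i * x i <= 2 ^+ 28 * (4 * low_const * K).
Proof.
move=> Pf xp.
pose N := hballsup (fun y x => M x y).
have Nms := bisublin_swap Ms.
have Ns : sublin N by exact: sublin_hballsup.
have NK : mean m N <= 4 * low_const * K.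
  exact: (mean_hballsup_le Nms tilt_dom_attained_l tilt_dom_attained_r K0 moment_swap).
have k0 : 0 < 2 ^+ 28 :> R by exact: exprn_gt0.
move: k0 (@linear_abs_ge _ _ _ _ law n); set k := 2 ^+ 28 => k0 lin.
rewrite -ler_pdivrMl//; apply: le_trans NK; rewrite -lee_fin -(meanE law Ns).
have mrow i : measurable_fun setT (fun z : n.-tuple RR => `|rowform f (tnth z) i|).
  by apply: measurableT_comp => //; exact: measurable_linear_form.
apply: (@le_trans _ _ (\int[prodP m n]_z (\sum_(i < n) `|x i| * `|rowform f (tnth z) i|)%:E)%E).
  under eq_integral do rewrite -sumEFin.
  rewrite ge0_integral_sum; last 3 first.
  - exact: measurableT.
  - by move=> i; apply/measurable_EFinP; exact: measurable_funM.
  - by move=> i z _; rewrite lee_fin mulr_ge0.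
  rewrite mulr_sumr -sumEFin; apply: lee_sum => i _.
  rewrite ge0_integralZ_fin//.
  apply: (@le_trans _ _ (`|x i|%:E * (rownorm f i / k)%:E)%E).
    rewrite -EFinM lee_fin (_ : `|x i| * (rownorm f i / k) = k^-1 * (rownorm f i * `|x i|)); last by ring.
    rewrite ler_wpM2l ?invr_ge0 ?(ltW k0)// ler_wpM2l ?rownorm_ge0//; exact: ler_norm.
  apply: lee_wpmul2l => //; apply: lin; first exact: rownorm_ge0.
  by rewrite sqr_sqrtr// sumr_ge0// => j _; exact: sqr_ge0.
apply: le_integral_fin => z; rewrite sumr_ge0 /=; last by move=> i _; rewrite mulr_ge0.
pose x' i := `|x i| * Num.sg (rowform f (tnth z) i).
have x'p : hball m p x'.
  apply: le_trans xp; apply: ler_sum => i _; rewrite /x'.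
  have [->|rn] := eqVneq (rowform f (tnth z) i) 0.
    rewrite sgr0 mulr0; apply: le_trans (hatm_ge0 law _).
    by rewrite /hatm normr0 ler01 expr0n.
  rewrite /hatm normrM normr_sg rn mulr1 normr_id.
  by rewrite exprMn sqr_sg rn mulr1 real_normK ?num_real.
apply: (@le_trans _ _ (M x' (tnth z))).
  apply: le_trans (bil_le PM x' (tnth z) Pf); rewrite bil_rowform; apply: ler_sum => i _.
  by rewrite /x' -mulrA -normrEsg.
exact: (le_hballsup Nms).
Qed.

End lower_attained.

End decoupled_moment.

(** * The space L_q and its dual ball *)

Section sigma_finite_support.
Context {R : realType} {d} {T : measurableType d}.
Variables (mu : {measure set T -> \bar R}) (h : T -> R).
Hypotheses (mh : measurable_fun setT h) (h0 : forall t, 0 <= h t)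
  (hlty : (\int[mu]_t (h t)%:E < +oo)%E).

Let m_gt (e : R) : measurable [set t | e < h t].
Proof.
rewrite (_ : mkset _ = h @^-1` `]e, +oo[).
  by rewrite -[X in measurable X]setTI; exact: (mh measurableT (measurable_itv _)).
by apply/seteqP; split=> t /=; rewrite in_itv/= andbT.
Qed.

Let mA := m_gt 0.

Let mu_gt (e : R) : 0 < e -> (mu [set t | (e < h t)%R] < +oo)%E.
Proof.
move=> e0; rewrite -[X in mu X]setIT -(integral_indic mu measurableT (m_gt e)).
apply: (@le_lt_trans _ _ (\int[mu]_t (e^-1 * h t)%:E)%E).
  apply: le_integral_fin => t; rewrite indicE; apply/andP; split; first by case: (_ \in _).
  have [|_] := boolP (t \in _); last by rewrite mulr_ge0// invr_ge0 ltW.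
  by rewrite inE/= => et; rewrite ler_pdivlMl// mulr1 ltW.
by rewrite ge0_integralZ_fin ?invr_ge0 ?(ltW e0)// lte_mul_pinfty ?lee_fin ?invr_ge0 ?(ltW e0).
Qed.

Let sigma_finite_mrestr : sigma_finite setT (mrestr mu mA).
Proof.
(* The set where [h] vanishes is added to each piece: the pieces must cover the space, and this set
   is null for the restriction. *)
exists (fun k => [set t | h t <= 0] `|` [set t | k.+1%:R^-1 < h t]).
  apply/esym/seteqP; split=> // t _; have [ht|ht] := leP (h t) 0; first by exists 0%N => //; left.
  exists (Num.truncn (h t)^-1) => //; right => /=.
  rewrite invf_plt ?posrE//; apply: truncnS_gt.
move=> k; split.
  apply: measurableU => //; rewrite (_ : mkset _ = ~` [set t | 0 < h t]); first exact: measurableC.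
  by apply/seteqP; split=> t /=; rewrite leNgt => /negP.
rewrite /mrestr setIUl (_ : _ `&` _ = set0) ?set0U; last first.
  by apply/seteqP; split=> // t [] /=; rewrite leNgt => /negP.
apply: le_lt_trans (mu_gt (e := k.+1%:R^-1) _); last by rewrite invr_gt0.
by apply: le_measure; rewrite ?inE//; exact: measurableI.
Qed.

Let restrE (f : T -> \bar R) : measurable_fun setT f -> (forall t, 0 <= f t)%E ->
  (forall t, h t = 0 -> f t = 0%E) -> (\int[mrestr mu mA]_t f t = \int[mu]_t f t)%E.
Proof.
move=> mf f0 fh; have mAc := measurableC mA.
have -> : (\int[mu]_t f t = \int[measure_add (mrestr mu mA) (mrestr mu mAc)]_t f t)%E.
  apply: eq_measure_integral => B mB _; transitivity (mrestr mu mA B + mrestr mu mAc B)%E; last exact/esym/measure_addE.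
  rewrite /mrestr.
  rewrite -measureU -?setIUr ?setUv ?setIT//; try exact: measurableI.
  by rewrite setIACA setICr setI0.
rewrite ge0_integral_measure_add// [X in (_ + X)%E](_ : _ = 0)%E ?adde0//.
rewrite [LHS](_ : _ = \int[mrestr mu mAc]_(t in [set t | (0 < h t)%R]) f t)%E; last first.
  rewrite [RHS]integral_mkcond; apply: eq_integral => t _; rewrite patchE.
  by case: ifPn => //; rewrite notin_setE/= => /negP; rewrite -leNgt => ht; apply: fh; apply/eqP; rewrite eq_le ht h0.
apply: null_set_integral => //; first exact: measurable_funTS.
by rewrite /= /mrestr setICr measure0.
Qed.

(** [mu] is arbitrary while Tonelli's theorem needs sigma-finiteness. The restriction of [mu] to the
    set where the integrable [h] is positive is sigma-finite, through the sets [h > 1 / k], and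
    functions that vanish wherever [h] does keep their integrals. *)
Lemma sigma_finite_support : exists nu : {sigma_finite_measure set T -> \bar R},
  forall f : T -> \bar R, measurable_fun setT f -> (forall t, 0 <= f t)%E ->
  (forall t, h t = 0 -> f t = 0%E) -> (\int[nu]_t f t = \int[mu]_t f t)%E.
Proof.
pose I := Measure_isSigmaFinite.Build _ _ _ (mrestr mu mA) sigma_finite_mrestr.
pose nu : {sigma_finite_measure set T -> \bar R} := HB.pack (mrestr mu mA) I.
by exists nu => f mf f0 fh; exact: restrE.
Qed.

End sigma_finite_support.

Lemma tonelli_support {R : realType} d1 d2 (T : measurableType d1) (U : measurableType d2)
  (mu : {measure set T -> \bar R}) (nu : {sigma_finite_measure set U -> \bar R})
  (h : T -> R) (f : T * U -> \bar R) :
  measurable_fun setT h -> (forall t, 0 <= h t) -> (\int[mu]_t (h t)%:E < +oo)%E ->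
  measurable_fun setT f -> (forall u, 0 <= f u)%E -> (forall t u, h t = 0 -> f (t, u) = 0%E) ->
  (\int[mu]_t \int[nu]_u f (t, u) = \int[nu]_u \int[mu]_t f (t, u))%E.
Proof.
move=> mh h0 hlty mf f0 fh; have [mu' mu'E] := sigma_finite_support mh h0 hlty.
transitivity (\int[mu']_t \int[nu]_u f (t, u))%E.
  apply/esym/mu'E.
  - exact: (measurable_fun_fubini_tonelli_F (m2 := nu) f mf f0).
  - by move=> t; exact: integral_ge0.
  - by move=> t ht; rewrite integral0_eq// => u _; exact: fh.
rewrite (fubini_tonelli (m1 := mu') (m2 := nu) f mf f0).
apply: eq_integral => u _; apply: mu'E => [|//|t ht]; last exact: fh.
by apply: measurableT_comp => //; exact: measurable_pair2.
Qed.

Section Lq_norm.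
Context {R : realType} {d} {T : measurableType d}.
Variables (mu : {measure set T -> \bar R}) (q : R).
Hypothesis q1 : 1 <= q.
Let q0 : 0 < q. Proof. exact: lt_le_trans q1. Qed.

Definition Lqnorm (g : T -> R) : R := fine (Lnorm mu q%:E (fun t => (g t)%:E)).

Lemma Lqnorm_ge0 g : 0 <= Lqnorm g.
Proof. by apply: fine_ge0; exact: Lnorm_ge0. Qed.

Let LnormE g : (Lnorm mu q%:E (fun t => (g t)%:E) `^ q = \int[mu]_t (`|g t| `^ q)%:E)%E.
Proof. by rewrite poweR_Lnorm ?gt_eqF//; apply: eq_integral => t _; rewrite abse_EFin poweR_EFin. Qed.

Lemma inLqP (g : T -> R) : measurable_fun setT g -> (\int[mu]_t (`|g t| `^ q)%:E < +oo)%E -> inLq mu q g.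
Proof.
move=> mg; rewrite -LnormE => H; split=> //; move: H.
by case: (Lnorm _ _ _) (Lnorm_ge0 mu q%:E (fun t => (g t)%:E)) => [x||]//=; rewrite ?ltry ?poweRyr// gt_eqF.
Qed.

Lemma Lqnorm_EFin g : inLq mu q g -> Lnorm mu q%:E (fun t => (g t)%:E) = (Lqnorm g)%:E.
Proof. by case=> _ glt; rewrite fineK// ge0_fin_numE// Lnorm_ge0. Qed.

Lemma integral_Lqnorm g : inLq mu q g -> (\int[mu]_t (`|g t| `^ q)%:E = (Lqnorm g `^ q)%:E)%E.
Proof. by move=> gq; rewrite -LnormE Lqnorm_EFin// poweR_EFin. Qed.

Lemma inLqZ c g : inLq mu q g -> inLq mu q (fun t => c * g t).
Proof.
move=> gq; have mg := gq.1; apply: inLqP; first exact: measurable_funM.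
under eq_integral do rewrite normrM powRM//.
rewrite ge0_integralZ_fin ?powR_ge0//; first by rewrite integral_Lqnorm// -EFinM ltry.
by apply: measurable_powRr_comp; exact: measurableT_comp.
Qed.

Lemma inLqD f g : inLq mu q f -> inLq mu q g -> inLq mu q (f \+ g).
Proof.
move=> [mf lf] [mg lg]; split; first exact: measurable_funD.
exact: le_lt_trans (minkowski_EFin mu mf mg q1) (lte_add_pinfty lf lg).
Qed.

Lemma inLq0 : inLq mu q (fun=> 0).
Proof.
apply: inLqP => //; under eq_integral do rewrite normr0 powR0 ?gt_eqF//.
by rewrite integral0.
Qed.

Lemma inLq_sum (I : Type) (s : seq I) (F : I -> T -> R) :
  (forall i, inLq mu q (F i)) -> inLq mu q (fun t => \sum_(i <- s) F i t).
Proof.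
move=> Fq; elim: s => [|i s IH]; first by under eq_fun do rewrite big_nil; exact: inLq0.
by under eq_fun do rewrite big_cons; exact: inLqD.
Qed.

Lemma inLq_norm g : inLq mu q g -> inLq mu q (fun t => `|g t|).
Proof.
move=> gq; have mg := gq.1; apply: inLqP; first exact: measurableT_comp.
by under eq_integral do rewrite normr_id; rewrite integral_Lqnorm// ltry.
Qed.

Lemma inLq_le (f g : T -> R) : measurable_fun setT f -> inLq mu q g -> (forall t, `|f t| <= `|g t|) ->
  inLq mu q f.
Proof.
move=> mf gq fg; apply: inLqP => //.
apply: (@le_lt_trans _ _ (\int[mu]_t (`|g t| `^ q)%:E)%E); last by rewrite integral_Lqnorm// ltry.
by apply: le_integral_fin => t; rewrite powR_ge0 ge0_ler_powR ?nnegrE// ltW.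
Qed.

Lemma Lqnorm_le g K : inLq mu q g -> 0 <= K -> (\int[mu]_t (`|g t| `^ q)%:E <= (K `^ q)%:E)%E ->
  Lqnorm g <= K.
Proof.
move=> gq K0; rewrite integral_Lqnorm// lee_fin => H.
rewrite leNgt; apply/negP => KN; move: H; rewrite leNgt => /negP; apply.
by apply: gt0_ltr_powR; rewrite ?nnegrE ?Lqnorm_ge0.
Qed.

(** Young's inequality for the exponents [q] and [q / (q - 1)]. At [q = 1] it reads [u <= u], the
    power 0 being 1 by convention. *)
Lemma young_powR (u s : R) : 0 <= u -> 0 <= s ->
  u * s `^ (q - 1) <= u `^ q / q + (1 - q^-1) * s `^ q.
Proof.
move=> u0 s0; have [qE|qn] := eqVneq q 1.
  by rewrite qE !subrr powRr0 !invr1 !mulr1 subrr mul0r addr0 powRr1.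
have q1' : 0 < q - 1 by rewrite subr_gt0 lt_neqAle eq_sym qn.
have c0 : 0 < q / (q - 1) by rewrite divr_gt0.
have := conjugate_powR u0 (powR_ge0 s (q - 1)) q0 c0.
rewrite -powRrM (_ : (q - 1) * (q / (q - 1)) = q); last by field; rewrite gt_eqF.
rewrite invf_div (_ : (q - 1) / q = 1 - q^-1); last by field; rewrite gt_eqF.
by rewrite [_ * s `^ q]mulrC; apply; ring.
Qed.

(* Hoelder for the exponents q and q / (q - 1), q = 1 included, with upper
   bounds a and b of the norms instead of the norms. *)
Lemma dual_pairing_le (g S : T -> R) (a b : R) : measurable_fun setT g -> measurable_fun setT S ->
  (forall t, 0 <= S t) -> 0 < a -> 0 < b ->
  (\int[mu]_t (`|g t| `^ q)%:E <= (a `^ q)%:E)%E -> (\int[mu]_t (S t `^ q)%:E <= (b `^ q)%:E)%E ->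
  (\int[mu]_t (`|g t| * S t `^ (q - 1))%:E <= (a * b `^ (q - 1))%:E)%E.
Proof.
move=> mg mS S0 a0 b0 Hg HS.
have aq0 : 0 < a `^ q by exact: powR_gt0.
have bq0 : 0 < b `^ q by exact: powR_gt0.
have b10 : 0 < b `^ (q - 1) by exact: powR_gt0.
pose k := a * b `^ (q - 1); have k0 : 0 < k by rewrite mulr_gt0.
pose c := k / q / a `^ q; pose e := k * (1 - q^-1) / b `^ q.
have c0 : 0 <= c by rewrite !divr_ge0// ltW.
have i0 : 0 <= 1 - q^-1 by rewrite subr_ge0 invf_le1.
have e0 : 0 <= e by rewrite divr_ge0 ?(ltW bq0)// mulr_ge0// ltW.
have mgq : measurable_fun setT (fun t => `|g t| `^ q).
  by apply: measurable_powRr_comp; exact: measurableT_comp.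
have mSq := measurable_powRr_comp q mS.
apply: (@le_trans _ _ (\int[mu]_t (c * `|g t| `^ q + e * S t `^ q)%:E)%E).
  apply: le_integral_fin => t; rewrite mulr_ge0 ?powR_ge0//=.
  have u0 : 0 <= `|g t| / a by rewrite divr_ge0// ltW.
  have s0 : 0 <= S t / b by rewrite divr_ge0// ltW.
  have := ler_wpM2l (ltW k0) (young_powR u0 s0).
  rewrite (powRM _ (normr_ge0 _)) ?invr_ge0 ?(ltW a0)// !(powRM _ (S0 t)) ?invr_ge0 ?(ltW b0)//.
  have iV (x y : R) : 0 < x -> x^-1 `^ y = (x `^ y)^-1.
    by move=> x0; rewrite -powR_inv1 ?(ltW x0)// -powRrM mulN1r powRN.
  rewrite !iV// => H; apply: le_trans (le_trans _ H) _.
    by rewrite /k le_eqVlt; apply/orP; left; apply/eqP; field; rewrite !gt_eqF.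
  by rewrite /c /e le_eqVlt; apply/orP; left; apply/eqP; field; rewrite !gt_eqF.
rewrite ge0_integralD_fin; last 4 first.
- by move=> t; rewrite mulr_ge0 ?powR_ge0.
- by move=> t; rewrite mulr_ge0 ?powR_ge0.
- exact: measurable_funM.
- exact: measurable_funM.
rewrite (ge0_integralZ_fin _ c0 (fun t => powR_ge0 _ _) mgq) (ge0_integralZ_fin _ e0 (fun t => powR_ge0 _ _) mSq).
apply: (@le_trans _ _ (c%:E * (a `^ q)%:E + e%:E * (b `^ q)%:E)%E).
  by apply: leeD; apply: lee_wpmul2l; rewrite ?lee_fin.
rewrite -!EFinM -EFinD lee_fin /c /e !divfK ?gt_eqF// le_eqVlt; apply/orP; left; apply/eqP.
by rewrite -/k; field; rewrite gt_eqF.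
Qed.

Lemma dual_ball_sum (f : (T -> R) -> R) (I : Type) (s : seq I) (F : I -> T -> R) :
  dual_ball mu q f -> (forall i, inLq mu q (F i)) ->
  f (fun t => \sum_(i <- s) F i t) = \sum_(i <- s) f (F i).
Proof.
move=> [fD [fZ _]] Fq; elim: s => [|i s IH].
  rewrite big_nil; under eq_fun do rewrite big_nil.
  by have := fZ 0 (fun=> 0) inLq0; under eq_fun do rewrite mul0r; rewrite mul0r.
rewrite big_cons -IH; under eq_fun do rewrite big_cons.
by apply: fD => //; exact: inLq_sum.
Qed.

Lemma dual_ball_le f g : dual_ball mu q f -> inLq mu q g -> f g <= Lqnorm g.
Proof.
move=> [_ [_ fb]] gq; apply: le_trans (ler_norm _) _.
by rewrite -lee_fin -Lqnorm_EFin//; exact: fb.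
Qed.

Lemma dual_ballN f : dual_ball mu q f -> dual_ball mu q (fun g => - f g).
Proof.
move=> [fD [fZ fb]]; split; first by move=> g h gq hq; rewrite fD// opprD.
by split=> [c g gq|g gq]; [rewrite fZ// mulrN|rewrite normrN; exact: fb].
Qed.

(** The pairing with the sign of [F] times [|F|^(q - 1)], written as [F * |F|^(q - 2)]; where [F]
    vanishes, so does the product. *)
Let norming (F g : T -> R) : R := \int[mu]_t (g t * (F t * `|F t| `^ (q - 2))).

(** Equality fails only for [q = 1] at the zeros of [F], where the right-hand side is 1. *)
Let norming_weight (F : T -> R) t : `|F t * `|F t| `^ (q - 2)| <= `|F t| `^ (q - 1).
Proof.
have [->|Fn] := eqVneq (F t) 0; first by rewrite mul0r normr0 powR_ge0.
rewrite normrM [`|_ `^ _|]ger0_norm ?powR_ge0// (_ : q - 2 = q - 1 - 1); last by ring.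
have [qE|qn] := eqVneq q 1.
  by rewrite qE subrr powRr0 sub0r powR_inv1// mulfV// normr_eq0.
by rewrite mulr_powRB1// subr_gt0 lt_neqAle eq_sym qn.
Qed.

Let norming_self (F : T -> R) t : F t * (F t * `|F t| `^ (q - 2)) = `|F t| `^ q.
Proof.
have [->|Fn] := eqVneq (F t) 0; first by rewrite mul0r normr0 powR0// gt_eqF.
rewrite mulrA -expr2 -real_normK ?num_real// -powR_split2// normr_gt0//.
Qed.

(** The explicit pairing [norming F], divided by [N^(q - 1)], is in the dual ball by
    [dual_pairing_le] and takes the value [N] at [F]. When the norm is 0 the zero functional
    serves. *)
Lemma dual_ball_attained F : inLq mu q F -> exists2 f, dual_ball mu q f & f F = Lqnorm F.
Proof.
move=> Fq; set N := Lqnorm F; have mF := Fq.1.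
have [N0|Nn] := eqVneq N 0.
  exists (fun=> 0) => //; split; first by move=> *; rewrite addr0.
  by split=> [c g _|g _]; [rewrite mulr0|rewrite normr0 Lnorm_ge0].
have N0 : 0 < N by rewrite lt_neqAle eq_sym Nn Lqnorm_ge0.
have NN : 0 < N `^ (q - 1) by exact: powR_gt0.
have mD : measurable_fun setT (fun t => F t * `|F t| `^ (q - 2)).
  by apply: measurable_funM => //; apply: measurable_powRr_comp; exact: measurableT_comp.
have mF1 : measurable_fun setT (fun t => `|F t|) by exact: measurableT_comp.
have HF : (\int[mu]_t (`|F t| `^ q)%:E <= (N `^ q)%:E)%E by rewrite integral_Lqnorm.
have bnd g a : inLq mu q g -> 0 < a -> Lqnorm g <= a ->
    (\int[mu]_t `|g t * (F t * `|F t| `^ (q - 2))|%:E <= (a * N `^ (q - 1))%:E)%E.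
  move=> gq a0 ga; have mg := gq.1.
  apply: le_trans (dual_pairing_le mg mF1 (fun t => normr_ge0 _) a0 N0 _ HF).
    by apply: le_integral_fin => t; rewrite normr_ge0/= normrM ler_wpM2l// norming_weight.
  by rewrite integral_Lqnorm// lee_fin ge0_ler_powR ?nnegrE ?Lqnorm_ge0 ?(ltW a0) ?(ltW q0).
have int g : inLq mu q g -> mu.-integrable setT (EFin \o (fun t => g t * (F t * `|F t| `^ (q - 2)))).
  move=> gq; apply/integrableP; split; first by apply/measurable_EFinP; apply: measurable_funM => //; exact: gq.1.
  have a0 : 0 < Lqnorm g + 1 by rewrite ltr_wpDl ?Lqnorm_ge0.
  by apply: le_lt_trans (bnd g _ gq a0 _) (ltry _); rewrite lerDl.
exists (fun g => norming F g / N `^ (q - 1)); last first.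
  rewrite /norming /Rintegral; under eq_integral do rewrite norming_self.
  by rewrite integral_Lqnorm//= -/N -[in LHS](mulr_powRB1 (ltW N0) q0) mulfK// gt_eqF.
split.
  move=> g h gq hq; rewrite -mulrDl; congr (_ / _).
  rewrite /norming -RintegralD//; [|exact: int..].
  by apply: eq_Rintegral => t _; rewrite /= mulrDl.
split.
  move=> c g gq; rewrite mulrA; congr (_ / _).
  rewrite /norming -RintegralZl//; last exact: int.
  by apply: eq_Rintegral => t _; rewrite /= -mulrA.
move=> g gq; rewrite Lqnorm_EFin// lee_fin; apply/ler_addgt0Pr => e e0.
have a0 : 0 < Lqnorm g + e by rewrite ltr_wpDl ?Lqnorm_ge0.
rewrite normrM [`|_^-1|]ger0_norm ?invr_ge0 ?(ltW NN)// ler_pdivrMr//.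
rewrite -lee_fin; apply: le_trans (bnd g _ gq a0 _); last by rewrite lerDl ltW.
rewrite /norming /Rintegral; apply: le_trans (le_abse_integral mu measurableT (measurable_int mu (int g gq))).
rewrite -[X in (_ <= `|X|)%E]fineK ?abse_EFin//.
exact: integrable_fin_num (int g gq).
Qed.

End Lq_norm.

(** * Comparison of means through the square function *)

Section Lq_forms.
Context {R : realType} {d} {T : measurableType d}.
Notation RR := (measurableTypeR R).
Notation lap := (@laplace R).
Variables (mu : {measure set T -> \bar R}) (q : R).
Hypothesis q1 : 1 <= q.
Let q0 : 0 < q. Proof. exact: lt_le_trans q1. Qed.

Section comparison.
Variables (n : nat) (v : 'I_n -> T -> R).
Hypothesis vq : forall j, inLq mu q (v j).

Let F (z : 'I_n -> R) t := \sum_(j < n) v j t * z j.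
Let S t := Num.sqrt (\sum_(j < n) v j t ^+ 2).
Let s := Lqnorm mu q S.

Let mv j : measurable_fun setT (v j). Proof. by case: (vq j). Qed.

Let sum0 t : 0 <= \sum_(j < n) v j t ^+ 2.
Proof. by apply: sumr_ge0 => j _; exact: sqr_ge0. Qed.

Let S0 t : 0 <= S t. Proof. exact: sqrtr_ge0. Qed.

Let S2 t : \sum_(j < n) v j t ^+ 2 = S t ^+ 2. Proof. by rewrite sqr_sqrtr. Qed.

Let Fq z : inLq mu q (F z).
Proof.
apply: (inLq_sum q1) => j.
by under eq_fun do rewrite mulrC; exact: inLqZ.
Qed.

Let mS : measurable_fun setT S.
Proof.
have -> : S = fun t => (\sum_(j < n) v j t ^+ 2) `^ 2^-1 by apply/funext => t; rewrite powR12_sqrt.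
by apply: measurable_powRr_comp; apply: measurable_sum => j; exact: measurable_funX.
Qed.

Let Sq : inLq mu q S.
Proof.
apply: (inLq_le q1 mS (inLq_sum q1 (index_enum 'I_n) (fun j => inLq_norm q1 (vq j)))) => t.
rewrite !ger0_norm ?S0//; last by rewrite sumr_ge0.
rewrite -(ger0_norm (S0 t)) -ler_sqr ?nnegrE ?normr_ge0//; last by rewrite sumr_ge0.
rewrite real_normK ?num_real// -S2.
elim: (index_enum 'I_n) => [|j r IH]; first by rewrite !big_nil expr0n.
rewrite !big_cons sqrrD real_normK ?num_real// -addrA lerD2l.
by apply: le_trans IH _; rewrite lerDr mulrn_wge0// mulr_ge0// sumr_ge0.
Qed.

Let SqE : (\int[mu]_t (S t `^ q)%:E = (s `^ q)%:E)%E.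
Proof. by rewrite -(integral_Lqnorm q1 Sq); apply: eq_integral => t _; rewrite ger0_norm. Qed.

Let s0 : 0 <= s. Proof. exact: Lqnorm_ge0. Qed.

Let mF2 : measurable_fun setT (fun u : T * n.-tuple RR => F (tnth u.2) u.1).
Proof.
apply: measurable_sum => j; apply: measurable_funM.
  by apply: (measurableT_comp (f := v j)).
by apply: (measurableT_comp (f := (@tnth n RR)^~ j)) => //; exact: measurable_tnth.
Qed.

(** The square function vanishes only where all the [v j] do; this is the support condition of
    [tonelli_support]. *)
Let F_support t z : S t `^ q = 0 -> F z t = 0.
Proof.
move=> /powR_eq0_eq0 St; rewrite /F big1// => j _.
suff -> : v j t = 0 by rewrite mul0r.
have : \sum_(j < n) v j t ^+ 2 == 0 by rewrite S2 St expr0n.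
rewrite psumr_eq0; last by move=> i _; exact: sqr_ge0.
by move=> /allP/(_ j (mem_index_enum _))/=; rewrite sqrf_eq0 => /eqP.
Qed.

Let tonelli (m : probability RR R) (g : T * n.-tuple RR -> R) :
  measurable_fun setT g -> (forall u, 0 <= g u) -> (forall t z, S t `^ q = 0 -> g (t, z) = 0) ->
  (\int[mu]_t \int[prodP m n]_z (g (t, z))%:E = \int[prodP m n]_z \int[mu]_t (g (t, z))%:E)%E.
Proof.
move=> mg g0 gS.
have g0' u : (0 <= (g u)%:E)%E by rewrite lee_fin.
have gS' t z : S t `^ q = 0 -> (g (t, z))%:E = 0%E by move=> St; rewrite gS.
have fin : (\int[mu]_t (S t `^ q)%:E < +oo)%E by rewrite SqE ltry.
have mg' : measurable_fun setT (fun u => (g u)%:E) by exact/measurable_EFinP.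
exact: (tonelli_support (prodP m n) (measurable_powRr_comp q mS) (fun t => powR_ge0 _ _) fin mg' g0' gS').
Qed.

Let N (z : 'I_n -> R) := Lqnorm mu q (F z).
Hypothesis Ns : sublin N.

(** The mean is controlled by the q-th moment; Tonelli moves the Laplace integral inside the
    integral in [t], where the scalar form has a q-th moment of order [S t ^ q]. The additional [e]
    makes the level positive when [s = 0]. *)
Let mean_laplace_le : mean lap N <= 2 * (8 * (32 * q)) * s.
Proof.
have k0 : 0 < 2 * (8 * (32 * q)) by rewrite !mulr_gt0.
apply/ler_addgt0Pr => e e0.
pose e' := e / (2 * (8 * (32 * q))); have e'0 : 0 < e' by rewrite divr_gt0.
have -> : 2 * (8 * (32 * q)) * s + e = 2 * (8 * (32 * q) * (s + e')).
  by rewrite /e'; field; rewrite gt_eqF.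
have se0 : 0 < s + e' by rewrite ltr_wpDl.
have K0 : 0 < 8 * (32 * q) * (s + e') by rewrite !mulr_gt0.
rewrite -lee_fin -(meanE (@explaw_laplace R) Ns).
apply: (integral_le_moment (measurable_sublin_tnth Ns) (fun z => sublin_ge0 Ns _) q1 K0).
have -> : (\int[prodP lap n]_z (N (tnth z) `^ q)%:E =
    \int[prodP lap n]_z \int[mu]_t (`|F (tnth z) t| `^ q)%:E)%E.
  by apply: eq_integral => z _; rewrite (integral_Lqnorm q1).
rewrite -(tonelli _ (g := fun u => `|F (tnth u.2) u.1| `^ q)); last 3 first.
- by apply: measurable_powRr_comp; exact: measurableT_comp.
- by move=> u; exact: powR_ge0.
- by move=> t z /F_support ->; rewrite normr0 powR0 ?gt_eqF.
apply: (@le_trans _ _ (\int[mu]_t (8 * (32 * q) `^ q * S t `^ q)%:E)%E).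
  apply: le_integral_ge0 => t; rewrite integral_ge0/=; last by move=> z _; rewrite lee_fin powR_ge0.
  have [St|Sn] := eqVneq (S t) 0.
    rewrite integral0_eq ?lee_fin ?mulr_ge0 ?powR_ge0//.
    by move=> z _; rewrite F_support ?normr0 ?powR0 ?St ?powR0 ?gt_eqF.
  apply: (linear_moment (@explaw_laplace R) q0); first by rewrite lt_neqAle eq_sym Sn S0.
  by rewrite S2.
have c0 : 0 <= 8 * (32 * q) `^ q by rewrite mulr_ge0 ?powR_ge0.
rewrite (ge0_integralZ_fin _ c0 (fun t => powR_ge0 _ _) (measurable_powRr_comp q mS)) SqE.
have q32 : 0 <= 32 * q by rewrite mulr_ge0// ltW.
rewrite -EFinM lee_fin (powRM _ _ (ltW se0)); last by rewrite mulr_ge0.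
apply: ler_pM; rewrite ?powR_ge0//.
  by rewrite (powRM _ _ q32)// ler_wpM2r ?powR_ge0// le1r_powR// ler1n.
by apply: ge0_ler_powR; rewrite ?nnegrE ?(ltW q0) ?(ltW se0)// lerDl ltW.
Qed.

Variables (m : probability RR R) (r cr : R).
Hypothesis law : explaw m r cr.

(** [|F|] is integrated against [S^(q - 1)] in both variables. From below, the first moment of a
    scalar form is at least [S t / 2^28], which yields [s^q / 2^28]; from above, Hoelder's
    inequality yields [N z * s^(q - 1)], up to [e'], for each [z]. Dividing by [s^(q - 1)] compares
    [s] with the mean. *)
Let le_mean : s <= 2 ^+ 28 * mean m N.
Proof.
have mean0 := mean_ge0 law Ns.
have k0 : 0 < 2 ^+ 28 :> R by exact: exprn_gt0.
move: k0 (@linear_abs_ge _ _ _ _ law n); set k := 2 ^+ 28 => k0 lin.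
have [->|sn] := eqVneq s 0; first by rewrite mulr_ge0// ltW.
have sp : 0 < s by rewrite lt_neqAle eq_sym sn.
have sq0 : 0 < s `^ (q - 1) by exact: powR_gt0.
have mS1 := measurable_powRr_comp (q - 1) mS.
have maF : measurable_fun setT (fun u : T * n.-tuple RR => `|F (tnth u.2) u.1| * S u.1 `^ (q - 1)).
  apply: measurable_funM; first exact: measurableT_comp.
  by apply: (measurableT_comp (f := fun t => S t `^ (q - 1))).
apply/ler_addgt0Pr => e e0.
pose e' := e / k; have e'0 : 0 < e' by rewrite divr_gt0.
have pw z : (\int[mu]_t (`|F z t| * S t `^ (q - 1))%:E <= ((N z + e') * s `^ (q - 1))%:E)%E.
  have Ne0 : 0 < N z + e' by rewrite ltr_wpDl ?(sublin_ge0 Ns).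
  apply: (dual_pairing_le q1 (Fq z).1 mS S0 Ne0 sp).
    rewrite (integral_Lqnorm q1 (Fq z)) lee_fin.
    by apply: ge0_ler_powR; rewrite ?nnegrE ?(ltW q0) ?(ltW Ne0) ?Lqnorm_ge0// lerDl ltW.
  by rewrite SqE.
have : ((s `^ q / k)%:E <= ((mean m N + e') * s `^ (q - 1))%:E)%E.
  apply: (@le_trans _ _ (\int[prodP m n]_z ((N (tnth z) + e') * s `^ (q - 1))%:E)%E).
    apply: (@le_trans _ _ (\int[prodP m n]_z \int[mu]_t (`|F (tnth z) t| * S t `^ (q - 1))%:E)%E).
      rewrite -(tonelli _ (g := fun u => `|F (tnth u.2) u.1| * S u.1 `^ (q - 1)))//; last 2 first.
      - by move=> u; rewrite mulr_ge0 ?powR_ge0.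
      - by move=> t z /F_support ->; rewrite normr0 mul0r.
      have -> : ((s `^ q / k)%:E = \int[mu]_t (k^-1 * S t `^ q)%:E)%E.
        rewrite ge0_integralZ_fin ?invr_ge0 ?(ltW k0)//; last 2 first.
        - by move=> t; exact: powR_ge0.
        - exact: measurable_powRr_comp.
        by rewrite SqE -EFinM mulrC.
      apply: le_integral_ge0 => t; rewrite lee_fin mulr_ge0 ?powR_ge0 ?invr_ge0 ?(ltW k0)//=.
      under eq_integral do rewrite mulrC.
      rewrite (ge0_integralZ_fin _ (powR_ge0 _ _) (fun z => normr_ge0 _)); last first.
        by apply: measurableT_comp => //; exact: measurable_linear_form.
      apply: (@le_trans _ _ ((S t `^ (q - 1))%:E * (S t / k)%:E)%E).
        rewrite -EFinM lee_fin -(mulr_powRB1 (S0 t) q0) le_eqVlt; apply/orP; left; apply/eqP; ring.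
      by apply: lee_wpmul2l; rewrite ?lee_fin ?powR_ge0//; apply: lin.
    by apply: le_integral_ge0 => z; rewrite pw andbT integral_ge0// => t _; rewrite lee_fin mulr_ge0 ?powR_ge0.
  under eq_integral do rewrite mulrC.
  rewrite ge0_integralZ_fin ?powR_ge0//; last 2 first.
  - by move=> z; rewrite addr_ge0 ?(sublin_ge0 Ns)// ltW.
  - by apply: measurable_funD => //; exact: measurable_sublin_tnth.
  rewrite ge0_integralD_fin//; last 3 first.
  - by move=> z; exact: sublin_ge0 Ns _.
  - by move=> z; exact: ltW.
  - exact: measurable_sublin_tnth.
  by rewrite (meanE law Ns) integral_probability_cst -EFinD -EFinM mulrC.
rewrite lee_fin -(mulr_powRB1 s0 q0) mulrAC ler_pM2r// ler_pdivrMr// => H.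
by apply: le_trans H _; rewrite mulrDl /e' divfK ?gt_eqF// mulrC.
Qed.

Definition comparison_const : R := 2 * (8 * (32 * q)) * 2 ^+ 28.

Lemma Lq_comparison : mean lap N <= comparison_const * mean m N.
Proof.
have c0 : 0 <= 2 * (8 * (32 * q)) by rewrite !mulr_ge0// ltW.
by rewrite /comparison_const -(mulrA _ (2 ^+ 28)); exact: le_trans mean_laplace_le (ler_wpM2l c0 le_mean).
Qed.

End comparison.

Variables (n : nat) (a : 'I_n -> 'I_n -> T -> R).
Hypothesis aq : forall i j, inLq mu q (a i j).

Definition Lqbil (x y : 'I_n -> R) : R :=
  Lqnorm mu q (fun t => \sum_(i < n) \sum_(j < n) a i j t * x i * y j).

Definition dual_images : set ('I_n -> 'I_n -> R) := [set (fun i j => f (a i j)) | f in dual_ball mu q].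

Let termq x y i j : inLq mu q (fun t => a i j t * x i * y j).
Proof.
have -> : (fun t => a i j t * x i * y j) = (fun t => (x i * y j) * a i j t) by apply/funext => t; ring.
exact: inLqZ.
Qed.

Lemma inLq_bil x y : inLq mu q (fun t => \sum_(i < n) \sum_(j < n) a i j t * x i * y j).
Proof. by apply: (inLq_sum q1) => i; exact: inLq_sum. Qed.

Lemma dual_ball_bil f x y : dual_ball mu q f ->
  f (fun t => \sum_(i < n) \sum_(j < n) a i j t * x i * y j) = bil (fun i j => f (a i j)) x y.
Proof.
move=> fd; rewrite (dual_ball_sum q1 _ fd); last by move=> i; exact: inLq_sum.
apply: eq_bigr => i _; rewrite (dual_ball_sum q1 _ fd)//; apply: eq_bigr => j _.
have -> : (fun t => a i j t * x i * y j) = (fun t => (x i * y j) * a i j t) by apply/funext => t; ring.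
by have [_ [-> // _]] := fd; ring.
Qed.

Lemma attained_norm_Lqbil : attained_norm dual_images Lqbil.
Proof.
split.
- by move=> _ [f fd <-]; exists (fun g => - f g) => //; exact: dual_ballN.
- by move=> _ x y [f fd <-]; rewrite -dual_ball_bil//; apply: (dual_ball_le fd); exact: inLq_bil.
- move=> x y; have [f fd fE] := dual_ball_attained q1 (inLq_bil x y).
  by exists (fun i j => f (a i j)); [exists f|rewrite -dual_ball_bil// fE].
Qed.

Lemma Lqbil_comparison (m : probability RR R) (r cr : R) (law : explaw m r cr) x :
  mean lap (Lqbil x) <= comparison_const * mean m (Lqbil x).
Proof.
pose v j t := \sum_(i < n) a i j t * x i.
have vq j : inLq mu q (v j).
  by apply: (inLq_sum q1) => i; under eq_fun do rewrite mulrC; exact: inLqZ.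
have E : Lqbil x = fun z => Lqnorm mu q (fun t => \sum_(j < n) v j t * z j).
  apply/funext => z; congr (Lqnorm _ _ _); apply/funext => t.
  by rewrite exchange_big/=; apply: eq_bigr => j _; rewrite mulr_suml.
have Ms := (bisublin_attained attained_norm_Lqbil).2 x; rewrite E in Ms *.
exact: (Lq_comparison vq Ms law).
Qed.

End Lq_forms.

(** * The five terms *)

Section five_terms.
Context {R : realType}.
Notation RR := (measurableTypeR R).
Notation lap := (@laplace R).
Variables (m : probability RR R) (r cr p : R).
Hypotheses (law : explaw m r cr) (p1 : 1 <= p).
Let p0 : 0 < p. Proof. exact: lt_le_trans p1. Qed.
Variables (n : nat) (Phi : set ('I_n -> 'I_n -> R)) (M : ('I_n -> R) -> ('I_n -> R) -> R).
Hypothesis PM : attained_norm Phi M.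
Let Ms := bisublin_attained PM.

Definition five_terms : \bar R :=
  ((mean m (fun x => mean m (M x)))%:E
   + ereal_sup [set (mean m (M x))%:E | x in hball m p]
   + ereal_sup [set (mean m (M ^~ y))%:E | y in hball m p]
   + ereal_sup [set ereal_sup [set (\sum_(i < n) rownorm f i * x i)%:E | x in hball m p] | f in Phi]
   + ereal_sup [set ereal_sup [set (bil f xy.1 xy.2)%:E
       | xy in [set xy : ('I_n -> R) * ('I_n -> R) | hball m p xy.1 /\ hball m p xy.2]] | f in Phi])%E.

Let h0 : hball m p (fun _ : 'I_n => 0).
Proof. by rewrite /hball/= big1 ?(ltW p0)// => i _; rewrite /hatm normr0 ler01 expr0n. Qed.

Let ge0_ereal_sup (A : set (\bar R)) x : A x -> (0 <= x)%E -> (0 <= ereal_sup A)%E.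
Proof. by move=> Ax x0; apply: le_trans x0 _; exact: ereal_sup_ubound. Qed.

Let Phi_ne : exists f, Phi f.
Proof. by have [f Pf _] := bil_attained PM (fun=> 0) (fun=> 0); exists f. Qed.

Let row_ge0 f : (0 <= ereal_sup [set (\sum_(i < n) rownorm f i * x i)%:E | x in hball m p])%E.
Proof.
apply: (@ge0_ereal_sup _ 0%E) => //; exists (fun=> 0) => //.
by rewrite big1// => i _; rewrite mulr0.
Qed.

Let bil_ge0 f : (0 <= ereal_sup [set (bil f xy.1 xy.2)%:E
  | xy in [set xy : ('I_n -> R) * ('I_n -> R) | hball m p xy.1 /\ hball m p xy.2]])%E.
Proof.
apply: (@ge0_ereal_sup _ 0%E) => //; exists (fun=> 0, fun=> 0) => //=.
by rewrite /bil big1// => i _; rewrite big1// => j _; rewrite mulr0.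
Qed.

Let term_le (a b c d e : \bar R) (rho : R) : (0 <= a)%E -> (0 <= b)%E -> (0 <= c)%E -> (0 <= d)%E ->
  (0 <= e)%E -> (a + b + c + d + e <= rho%:E)%E ->
  [/\ (a <= rho%:E)%E, (b <= rho%:E)%E, (c <= rho%:E)%E, (d <= rho%:E)%E & (e <= rho%:E)%E].
Proof.
move=> a0 b0 c0 d0 e0 H.
have ab0 : (0 <= a + b)%E by exact: adde_ge0.
have abc0 : (0 <= a + b + c)%E by exact: adde_ge0.
have abcd0 : (0 <= a + b + c + d)%E by exact: adde_ge0.
split; apply: le_trans H.
- apply: le_trans (leeDl _ e0); apply: le_trans (leeDl _ d0); apply: le_trans (leeDl _ c0).
  exact: leeDl.
- apply: le_trans (leeDl _ e0); apply: le_trans (leeDl _ d0); apply: le_trans (leeDl _ c0).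
  exact: leeDr.
- apply: le_trans (leeDl _ e0); apply: le_trans (leeDl _ d0); exact: leeDr.
- apply: le_trans (leeDl _ e0); exact: leeDr.
- exact: leeDr.
Qed.

Let terms_ge0 : [/\ (0 <= (mean m (fun x => mean m (M x)))%:E)%E,
  (0 <= ereal_sup [set (mean m (M x))%:E | x in hball m p])%E,
  (0 <= ereal_sup [set (mean m (M ^~ y))%:E | y in hball m p])%E,
  (0 <= ereal_sup [set ereal_sup [set (\sum_(i < n) rownorm f i * x i)%:E | x in hball m p] | f in Phi])%E &
  (0 <= ereal_sup [set ereal_sup [set (bil f xy.1 xy.2)%:E
     | xy in [set xy : ('I_n -> R) * ('I_n -> R) | hball m p xy.1 /\ hball m p xy.2]] | f in Phi])%E].
Proof.
have [f Pf] := Phi_ne; split.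
- by have H := sublin_mean_r Ms law; rewrite lee_fin (mean_ge0 law H).
- apply: (@ge0_ereal_sup _ (mean m (M (fun=> 0)))%:E); first by exists (fun=> 0).
  by rewrite lee_fin (mean_ge0 law)//; exact: Ms.2.
- apply: (@ge0_ereal_sup _ (mean m (M ^~ (fun=> 0)))%:E); first by exists (fun=> 0).
  by rewrite lee_fin (mean_ge0 law)//; exact: Ms.1.
- by apply: ge0_ereal_sup (row_ge0 f); exists f.
- by apply: ge0_ereal_sup (bil_ge0 f); exists f.
Qed.

Lemma five_terms_ge0 : (0 <= five_terms)%E.
Proof. by have [H1 H2 H3 H4 H5] := terms_ge0; rewrite /five_terms !adde_ge0. Qed.

Lemma moment_le_five_terms (Cq rho : R) : 0 <= Cq ->
  (forall x, mean lap (M x) <= Cq * mean m (M x)) -> 0 < rho -> (five_terms <= rho%:E)%E ->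
  (\int[prodP m n]_x \int[prodP m n]_y (M (tnth x) (tnth y) `^ p)%:E <=
   ((upper_const Cq * rho) `^ p)%:E)%E.
Proof.
move=> Cq0 comp rho0; have [H1 H2 H3 H4 H5] := terms_ge0.
move=> /(term_le H1 H2 H3 H4 H5)[T1 T2 T3 T4 T5].
apply: (decoupled_upper law p1 PM Cq0 comp rho0).
- by rewrite -lee_fin.
- by move=> x xp; rewrite -lee_fin; apply: le_trans T2; apply: ereal_sup_ubound; exists x.
- by move=> y yp; rewrite -lee_fin; apply: le_trans T3; apply: ereal_sup_ubound; exists y.
- move=> f x Pf xp; rewrite -lee_fin; apply: le_trans T4.
  apply: le_trans (ereal_sup_ubound _); last by exists f.
  by apply: ereal_sup_ubound; exists x.
- move=> f x y Pf xp yp; rewrite -lee_fin; apply: le_trans T5.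
  apply: le_trans (ereal_sup_ubound _); last by exists f.
  by apply: ereal_sup_ubound; exists (x, y).
Qed.

Definition lower_const : R :=
  8 + 4 * low_const + 4 * low_const + 2 ^+ 28 * (4 * low_const) + 2 * low_const ^+ 2.

Lemma lower_const_gt0 : 0 < lower_const.
Proof.
rewrite /lower_const; move: (@low_const R) (@low_const_gt0 R) => l l0.
have l4 : 0 < 4 * l by rewrite mulr_gt0.
apply: addr_gt0; last by rewrite mulr_gt0// exprn_gt0.
apply: addr_gt0; last by rewrite mulr_gt0// exprn_gt0.
by rewrite !addr_gt0.
Qed.

Lemma five_terms_le_moment (K : R) : 0 < K ->
  (\int[prodP m n]_x \int[prodP m n]_y (M (tnth x) (tnth y) `^ p)%:E <= (K `^ p)%:E)%E ->
  (five_terms <= (lower_const * K)%:E)%E.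
Proof.
move=> K0 HM.
have tr := tilt_dom_attained_r law PM; have tl := tilt_dom_attained_l law PM.
have -> : lower_const * K = 8 * K + 4 * low_const * K + 4 * low_const * K +
    2 ^+ 28 * (4 * low_const * K) + 2 * low_const ^+ 2 * K.
  by rewrite /lower_const; ring.
rewrite !EFinD /five_terms; apply: leeD; first (apply: leeD; first (apply: leeD; first apply: leeD)).
- by rewrite lee_fin (decoupled_mean_le law p1 Ms).
- apply: ge_ereal_sup => _ [x xp <-]; rewrite lee_fin.
  exact: (decoupled_ball_mean_le law p1 Ms tl K0 HM).
- apply: ge_ereal_sup => _ [y yp <-]; rewrite lee_fin.
  exact: (decoupled_ball_mean_le law p1 (bisublin_swap Ms) tr K0 (moment_swap PM HM) yp).
- apply: ge_ereal_sup => _ [f Pf <-]; apply: ge_ereal_sup => _ [x xp <-]; rewrite lee_fin.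
  exact: (rownorm_sum_le law p1 PM K0 HM).
- apply: ge_ereal_sup => _ [f Pf <-]; apply: ge_ereal_sup => _ [[x y] [/= xp yp] <-]; rewrite lee_fin.
  apply: le_trans (bil_le PM x y Pf) _.
  exact: (decoupled_ball_ball_le law p1 Ms tr tl K0 HM xp yp).
Qed.

End five_terms.

(** * Transfer to the given random variables *)

Section theorem_terms.
Context {R : realType}.
Notation RR := (measurableTypeR R).
Variables (q r : R).
Hypotheses (q1 : 1 <= q) (r1 : 1 <= r).
Context {d : measure_display} {T : measurableType d}.
Variables (mu : {measure set T -> \bar R}) (n : nat).
Context {d' : measure_display} {W : measurableType d'}.
Variables (P : probability W R) (X Y : 'I_n -> W -> R) (cr : R) (m : probability RR R).
Hypotheses (mX : forall i, measurable_fun setT (X i)) (mY : forall j, measurable_fun setT (Y j))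
  (ind : mutually_independent P
      (fun k : 'I_n + 'I_n => match k with inl i => X i | inr j => Y j end))
  (lawX : forall i (A : set R), measurable A ->
       P (X i @^-1` A) = (\int[lebesgue_measure]_(x in A) (cr * expR (- (`|x| `^ r)))%:E)%E)
  (lawY : forall j (A : set R), measurable A ->
       P (Y j @^-1` A) = (\int[lebesgue_measure]_(x in A) (cr * expR (- (`|x| `^ r)))%:E)%E)
  (law : explaw m r cr).

Let PX i (A : set RR) : measurable A -> P (X i @^-1` A) = m A.
Proof. by move=> mA; rewrite law.2//; exact: lawX. Qed.

Let PY i (A : set RR) : measurable A -> P (Y i @^-1` A) = m A.
Proof. by move=> mA; rewrite law.2//; exact: lawY. Qed.

Let hatN_hatm (Z : W -> R) : (forall A : set RR, measurable A -> P (Z @^-1` A) = m A) ->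
  forall t, hatN P Z t = hatm m t.
Proof.
move=> PZ t; rewrite /hatN /hatm /tailN /abstail.
have mA : measurable ([set x : RR | `|t| <= `|x|] : set RR).
  have -> : [set x : RR | `|t| <= `|x|] = (fun x : RR => `|x| : RR) @^-1` `[`|t|, +oo[.
    by apply/seteqP; split=> x /=; rewrite in_itv/= andbT.
  have mabs : measurable_fun setT (fun x : RR => `|x| : RR) by exact: measurableT_comp.
  by have := mabs measurableT _ (measurable_itv `[`|t|, +oo[); rewrite setTI.
by rewrite -(PZ _ mA).
Qed.

Lemma Bp_hballX p : Bp P X p = hball m p.
Proof.
have E (x : 'I_n -> R) : \sum_(i < n) hatN P (X i) (x i) = \sum_(i < n) hatm m (x i).
  by apply: eq_bigr => i _; exact: hatN_hatm (@PX i) _.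
by apply/seteqP; split=> x; rewrite /Bp/hball/= E.
Qed.

Lemma Bp_hballY p : Bp P Y p = hball m p.
Proof.
have E (x : 'I_n -> R) : \sum_(i < n) hatN P (Y i) (x i) = \sum_(i < n) hatm m (x i).
  by apply: eq_bigr => i _; exact: hatN_hatm (@PY i) _.
by apply/seteqP; split=> x; rewrite /Bp/hball/= E.
Qed.

Let joint (F : n.-tuple RR * n.-tuple RR -> R) : measurable_fun setT F -> (forall u, 0 <= F u) ->
  (\int[P]_w (F (rvtuple X w, rvtuple Y w))%:E = \int[prodP m n]_x \int[prodP m n]_y (F (x, y))%:E)%E.
Proof.
move=> mF F0; apply: (integral_joint_law mX mY ind PX PY (F := fun u => (F u)%:E)).
  exact/measurable_EFinP.
by move=> u; rewrite lee_fin.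
Qed.

Let rvE (Z : 'I_n -> W -> R) w : tnth (rvtuple Z w) = Z^~ w.
Proof. by apply/funext => i; rewrite tnth_mktuple. Qed.

Lemma joint_bisublin (G : ('I_n -> R) -> ('I_n -> R) -> R) p : bisublin G ->
  (\int[P]_w (G (X^~ w) (Y^~ w) `^ p)%:E =
   \int[prodP m n]_x \int[prodP m n]_y (G (tnth x) (tnth y) `^ p)%:E)%E.
Proof.
move=> Gs; rewrite -(joint (F := fun u => G (tnth u.1) (tnth u.2) `^ p)).
- by apply: eq_integral => w _; rewrite /= !rvE.
- by apply: measurable_powRr_comp; exact: measurable_bisublin_tnth.
- by move=> u; exact: powR_ge0.
Qed.

Lemma joint_bisublin_mean (G : ('I_n -> R) -> ('I_n -> R) -> R) : bisublin G ->
  (\int[P]_w (G (X^~ w) (Y^~ w))%:E = (mean m (fun x => mean m (G x)))%:E)%E.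
Proof.
move=> Gs; rewrite -(integral_mean law law Gs) -(joint (F := fun u => G (tnth u.1) (tnth u.2))).
- by apply: eq_integral => w _; rewrite /= !rvE.
- exact: measurable_bisublin_tnth.
- by move=> u; exact: sublin_ge0 (Gs.2 _) _.
Qed.

Lemma sublin_meanX (h : ('I_n -> R) -> R) : sublin h -> (\int[P]_w (h (X^~ w))%:E = (mean m h)%:E)%E.
Proof.
move=> hs; transitivity (\int[P]_w (h (tnth (rvtuple X w)))%:E)%E.
  by apply: eq_integral => w _; rewrite rvE.
rewrite (joint (F := fun u => h (tnth u.1)))/=.
- by rewrite -(meanE law hs); apply: eq_integral => x _; rewrite integral_probability_cst.
- by apply: (measurableT_comp (f := fun x : n.-tuple RR => h (tnth x))) => //; exact: measurable_sublin_tnth.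
- by move=> u; exact: sublin_ge0 hs _.
Qed.

Lemma sublin_meanY (h : ('I_n -> R) -> R) : sublin h -> (\int[P]_w (h (Y^~ w))%:E = (mean m h)%:E)%E.
Proof.
move=> hs; transitivity (\int[P]_w (h (tnth (rvtuple Y w)))%:E)%E.
  by apply: eq_integral => w _; rewrite rvE.
rewrite (joint (F := fun u => h (tnth u.2)))/=.
- by rewrite integral_probability_cst (meanE law hs).
- by apply: (measurableT_comp (f := fun x : n.-tuple RR => h (tnth x))) => //; exact: measurable_sublin_tnth.
- by move=> u; exact: sublin_ge0 hs _.
Qed.

Variables (a : 'I_n -> 'I_n -> T -> R) (p : R).
Hypotheses (aq : forall i j, inLq mu q (a i j)) (p1 : 1 <= p).
Let p0 : 0 < p. Proof. exact: lt_le_trans p1. Qed.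

Let M := Lqbil mu q a.
Let PM : attained_norm (dual_images mu q a) M := attained_norm_Lqbil q1 aq.
Let Ms := bisublin_attained PM.

Let LqE x y : Lnorm mu q%:E (fun t => (\sum_(i < n) \sum_(j < n) a i j t * x i * y j)%:E) = (M x y)%:E.
Proof. exact: Lqnorm_EFin (inLq_bil q1 aq x y). Qed.

Definition chaos_norm : \bar R := Lnorm P p%:E (fun w =>
  Lnorm mu q%:E (fun t => (\sum_(i < n) \sum_(j < n) a i j t * X i w * Y j w)%:E)).

Let chaos_normE : chaos_norm = Lnorm P p%:E (fun w => (M (X^~ w) (Y^~ w))%:E).
Proof. by congr (Lnorm _ _ _); apply/funext => w; exact: LqE. Qed.

Lemma five_termsE :
  (\int[P]_w Lnorm mu q%:E (fun t => (\sum_(i < n) \sum_(j < n) a i j t * X i w * Y j w)%:E)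
   + ereal_sup [set \int[P]_w Lnorm mu q%:E (fun t => (\sum_(i < n) \sum_(j < n) a i j t * x i * Y j w)%:E)
               | x in Bp P X p]
   + ereal_sup [set \int[P]_w Lnorm mu q%:E (fun t => (\sum_(i < n) \sum_(j < n) a i j t * X i w * y j)%:E)
               | y in Bp P Y p]
   + ereal_sup [set vnorm P X p (fun i => Num.sqrt (\sum_(j < n) (f (a i j)) ^+ 2))
               | f in dual_ball mu q]
   + ereal_sup [set mnorm P X Y p (fun i j => f (a i j)) | f in dual_ball mu q])%E =
  five_terms m p (dual_images mu q a) M.
Proof.
have im (F : ('I_n -> 'I_n -> R) -> \bar R) :
    [set F f | f in dual_images mu q a] = [set F (fun i j => f (a i j)) | f in dual_ball mu q].
  by rewrite -[RHS](image_comp _ F).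
rewrite /five_terms !im; congr (_ + _ + _ + _ + _)%E.
- rewrite -(joint_bisublin_mean Ms); apply: eq_integral => w _; exact: LqE.
- rewrite Bp_hballX; congr (ereal_sup _); apply: eq_imagel => x _.
  by rewrite -(sublin_meanY (Ms.2 x)); apply: eq_integral => w _; exact: LqE.
- rewrite Bp_hballY; congr (ereal_sup _); apply: eq_imagel => y _.
  by rewrite -(sublin_meanX (Ms.1 y)); apply: eq_integral => w _; exact: LqE.
- by congr (ereal_sup _); apply: eq_imagel => f _; rewrite /vnorm Bp_hballX.
- by congr (ereal_sup _); apply: eq_imagel => f _; rewrite /mnorm Bp_hballX Bp_hballY.
Qed.

Let mM : measurable_fun setT (fun w => M (X^~ w) (Y^~ w)).
Proof. exact: measurable_bisublin. Qed.

Let absM : (fun w => (`|M (X^~ w) (Y^~ w)| `^ p)%:E) = (fun w => (M (X^~ w) (Y^~ w) `^ p)%:E).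
Proof. by apply/funext => w; rewrite ger0_norm// (attained_ge0 PM). Qed.

Let inLpP (K : R) : 0 < K ->
  (\int[prodP m n]_x \int[prodP m n]_y (M (tnth x) (tnth y) `^ p)%:E <= (K `^ p)%:E)%E ->
  (chaos_norm <= K%:E)%E.
Proof.
move=> K0; rewrite -(joint_bisublin _ Ms) -absM => H.
have inM : inLq P p (fun w => M (X^~ w) (Y^~ w)).
  by apply: (inLqP p1 mM); exact: le_lt_trans H (ltry _).
by rewrite chaos_normE (Lqnorm_EFin inM) lee_fin; apply: (Lqnorm_le p1 inM (ltW K0) H).
Qed.

Let five := five_terms m p (dual_images mu q a) M.

(** [moment_le_five_terms] works at a positive level while the sum of the five terms may be 0; an
    arbitrarily small [e'] is added to it. *)
Lemma chaos_norm_le :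
  (chaos_norm <= (upper_const (comparison_const q))%:E * five)%E.
Proof.
have F0 := five_terms_ge0 law p1 PM.
have c0 : 0 <= comparison_const q.
  by rewrite /comparison_const mulr_ge0 ?exprn_ge0// !mulr_ge0// (le_trans ler01 q1).
have u0 := upper_const_gt0 c0; set cu := upper_const _ in u0 *.
rewrite -/five in F0; case E : five F0 => [f| |]// f0; last by rewrite gt0_muley ?lte_fin// leey.
rewrite -EFinM; apply/lee_addgt0Pr => e e0.
pose e' := e / cu; have e'0 : 0 < e' by rewrite divr_gt0.
have fe0 : 0 < f + e' by rewrite ltr_wpDl.
have -> : (cu * f)%:E + e%:E = (cu * (f + e'))%:E :> \bar R.
  by rewrite -EFinD mulrDr /e' mulrCA mulfV ?mulr1// gt_eqF.
apply: inLpP; first exact: mulr_gt0.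
apply: (moment_le_five_terms law p1 PM c0 _ fe0).
  by move=> x; exact: (Lqbil_comparison q1 aq law).
by rewrite -/five E lee_fin lerDl ltW.
Qed.

Lemma five_terms_le : (five <= (@lower_const R)%:E * chaos_norm)%E.
Proof.
have l0 := @lower_const_gt0 R; set cl := lower_const in l0 *.
have := Lnorm_ge0 P p%:E (fun w => (M (X^~ w) (Y^~ w))%:E).
rewrite -chaos_normE; case E : chaos_norm => [L| |]// L0; last by rewrite gt0_muley ?lte_fin// leey.
have inM : inLq P p (fun w => M (X^~ w) (Y^~ w)).
  by split=> //; rewrite -chaos_normE E ltry.
have := integral_Lqnorm p1 inM; rewrite absM (joint_bisublin _ Ms) => HI.
have LE : Lqnorm P p (fun w => M (X^~ w) (Y^~ w)) = L.
  by apply: EFin_inj; rewrite -(Lqnorm_EFin inM) -chaos_normE.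
rewrite LE in HI; rewrite -EFinM; apply/lee_addgt0Pr => e e0.
pose e' := e / cl; have e'0 : 0 < e' by rewrite divr_gt0.
have Le0 : 0 < L + e' by rewrite ltr_wpDl.
have -> : (cl * L)%:E + e%:E = (cl * (L + e'))%:E :> \bar R.
  by rewrite -EFinD mulrDr /e' mulrCA mulfV ?mulr1// gt_eqF.
apply: (five_terms_le_moment law p1 PM Le0); rewrite HI lee_fin.
by apply: ge0_ler_powR; rewrite ?nnegrE ?(ltW p0) ?(ltW Le0)// lerDl ltW.
Qed.

End theorem_terms.

Theorem theorem2p4 (R : realType) (q : R) (hq : 1 <= q) :
  exists C : R, 0 < C /\
  forall (r : R), 1 <= r ->
  forall (d : measure_display) (T : measurableType d) (mu : {measure set T -> \bar R})
         (n : nat), (0 < n)%N ->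
  forall (d' : measure_display) (W : measurableType d') (P : probability W R)
         (X Y : 'I_n -> W -> R) (cr : R),
    (forall i, measurable_fun setT (X i)) ->
    (forall j, measurable_fun setT (Y j)) ->
    mutually_independent P
      (fun k : 'I_n + 'I_n => match k with inl i => X i | inr j => Y j end) ->
    (* each X_i, Y_j has density g(x) = C(r) exp(-|x|^r) (cr is the normalizing constant) *)
    (forall i (A : set R), measurable A ->
       P (X i @^-1` A) = (\int[lebesgue_measure]_(x in A) (cr * expR (- (`|x| `^ r)))%:E)%E) ->
    (forall j (A : set R), measurable A ->
       P (Y j @^-1` A) = (\int[lebesgue_measure]_(x in A) (cr * expR (- (`|x| `^ r)))%:E)%E) ->
  forall a : 'I_n -> 'I_n -> T -> R,
    (forall i j, inLq mu q (a i j)) ->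
  forall p : R, 1 <= p ->
  let LqN (F : T -> R) := Lnorm mu q%:E (fun t => (F t)%:E) in
  let LHS := Lnorm P p%:E (fun w =>
               LqN (fun t => (\sum_(i < n) \sum_(j < n) a i j t * X i w * Y j w)%R)) in
  let RHS :=
    ((\int[P]_w LqN (fun t => (\sum_(i < n) \sum_(j < n) a i j t * X i w * Y j w)%R))
   + ereal_sup [set (\int[P]_w LqN (fun t => (\sum_(i < n) \sum_(j < n) a i j t * x i * Y j w)%R))
               | x in Bp P X p]
   + ereal_sup [set (\int[P]_w LqN (fun t => (\sum_(i < n) \sum_(j < n) a i j t * X i w * y j)%R))
               | y in Bp P Y p]
   + ereal_sup [set vnorm P X p (fun i => Num.sqrt (\sum_(j < n) (f (a i j)) ^+ 2)%R)
               | f in dual_ball mu q]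
   + ereal_sup [set mnorm P X Y p (fun i j => f (a i j)) | f in dual_ball mu q])%E in
  ((C^-1)%:E * LHS <= RHS)%E /\ (RHS <= C%:E * LHS)%E.

Proof.
have c0 : 0 <= comparison_const q.
  by rewrite /comparison_const mulr_ge0 ?exprn_ge0// !mulr_ge0// (le_trans ler01 hq).
have u0 := upper_const_gt0 c0; have l0 := @lower_const_gt0 R.
exists (upper_const (comparison_const q) + lower_const); split; first exact: addr_gt0.
move=> r r1 d T mu n n0 d' W P X Y cr mX mY ind lawX lawY a aq p p1 LqN LHS RHS.
(* The common law is realized as the distribution of the first variable, which exists because [n] is
   positive. *)
have mX0 : measurable_fun setT (X (Ordinal n0) : W -> measurableTypeR R) by exact: mX.
pose X0 : {mfun W >-> measurableTypeR R} := HB.pack (X (Ordinal n0) : W -> measurableTypeR R)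
  (isMeasurableFun.Build _ _ W (measurableTypeR R) (X (Ordinal n0)) mX0).
pose m : probability (measurableTypeR R) R := distribution P X0.
have law : explaw m r cr by split=> // A mA; exact: lawX.
have RHSE : RHS = five_terms m p (dual_images mu q a) (Lqbil mu q a).
  exact (five_termsE hq mX mY ind lawX lawY law p aq).
have Hu : (LHS <= (upper_const (comparison_const q))%:E * RHS)%E.
  by rewrite RHSE; exact (chaos_norm_le hq mX mY ind lawX lawY law aq p1).
have Hl : (RHS <= (@lower_const R)%:E * LHS)%E.
  by rewrite RHSE; exact (five_terms_le hq mX mY ind lawX lawY law aq p1).
have F0 : (0 <= RHS)%E by rewrite RHSE; exact: (five_terms_ge0 law p1 (attained_norm_Lqbil hq aq)).
have L0 : (0 <= LHS)%E by exact: Lnorm_ge0.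
split.
  rewrite (lee_pdivrMl _ _ (addr_gt0 u0 l0)); apply: le_trans Hu _.
  by apply: lee_wpmul2r => //; rewrite lee_fin lerDl ltW.
by apply: le_trans Hl _; apply: lee_wpmul2r => //; rewrite lee_fin lerDr ltW.
Qed.
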